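(* Let $n=2$. Let $\Omega'$ be an open subset of $\Omega$ such that $0\notin\overline{\Omega'}$. Then there are $\varepsilon'\in\,]0,\varepsilon^{\rm ad}[$ such that $\overline{\omega_\varepsilon}\cap\overline{\Omega'}=\emptyset$ for all $\varepsilon\in\,]-\varepsilon',\varepsilon'[$, and a real analytic map $\mathfrak U_{\Omega'}$ from $]-\varepsilon',\varepsilon'[$ to $C^{1,\alpha}(\overline{\Omega'})$ satisfying $$u_{\varepsilon|\overline{\Omega'}}=\mathfrak U_{\Omega'}[\varepsilon]\qquad\forall\,\varepsilon\in\,]0,\varepsilon'[\,.$$ Furthermore, $\mathfrak U_{\Omega'}[0]=u_{0|\overline{\Omega'}}$.
   Context: Here $n=2$, $\alpha\in\,]0,1[$ (open intervals are written $]a,b[$), $\mathbb R^2_+=\{x\in\mathbb R^2: x_2>0\}$, $B(0,r)$ the open ball, $B^+(0,r)=B(0,r)\cap\mathbb R^2_+$. $C^{k,\alpha}$ denotes the usual Schauder classes. Domain: $\Omega$ is an open bounded connected subset of $\mathbb R^2_+$ of class $C^{1,\alpha}$. Set $\partial_0\Omega=\partial\Omega\cap\partial\mathbb R^2_+$, $\partial_+\Omega=\partial\Omega\cap\mathbb R^2_+$. Assume $\partial_0\Omega$ is a neighbourhood of $0$ in $\partial\mathbb R^2_+$ and that $\overline{\partial_+\Omega}$ is a compact submanifold with boundary of $\mathbb R^2$ of class $C^{1,\alpha}$ (in dimension two this takes the form: $\overline{\partial_0\Omega}$ is a finite union of closed disjoint intervals in $\partial\mathbb R^2_+$). Hole: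 $\omega$ is a bounded open connected subset of $\mathbb R^2$ of class $C^{1,\alpha}$ with $0\in\omega$; $p=(p_1,p_2)\in\mathbb R^2_+$ is fixed. For $\varepsilon\in\mathbb R$ let $\omega_\varepsilon=\varepsilon p+\varepsilon\omega$ (size and distance to the boundary are comparable). Fix $\varepsilon^{\rm ad}\in\,]0,1[$ such that $\overline{\omega_\varepsilon}\subseteq\Omega$ for all $\varepsilon\in\,]0,\varepsilon^{\rm ad}[$; set $\Omega_\varepsilon=\Omega\setminus\overline{\omega_\varepsilon}$. Data: $g^{\mathrm o}\in C^{1,\alpha}(\partial\Omega)$, $g^{\mathrm i}\in C^{1,\alpha}(\partial\omega)$, and there is $r_0>0$ such that the restriction of $g^{\mathrm o}$ to $B(0,r_0)\cap\partial_0\Omega$ is real analytic. For $\varepsilon\in\,]0,\varepsilon^{\rm ad}[$, $u_\varepsilon\in C^{1,\alpha}(\overline{\Omega_\varepsilon})$ is the unique solution of $\Delta u=0$ in $\Omega_\varepsilon$, $u=g^{\mathrm o}$ on $\partial\Omega$, $u(x)=g^{\mathrm i}\big(\frac{x-\varepsilon p}{\varepsilon}\big)$ for $x\in\partial\omega_\varepsilon$. $u_0\in C^{1,\alpha}(\overline\Omega)$ is the unique solution of $\Delta u_0=0$ in $\Omega$, $u_0=g^{\mathrm o}$ on $\partial\Omega$. There are $r_1\in\,]0,r_0]$ with $B^+(0,r_1)\subseteq\Omega$ and a function $U_0$ on $\overline{B(0,r_1)}$, harmonic in $B(0,r_1)$, with $U_0=u_0$ on $\overline{B^+(0,r_1)}$;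 these are fixed and $\varepsilon^{\rm ad}$ is taken so small that $\varepsilon p+\varepsilon\overline\omega\subseteq B(0,r_1)$ for all $\varepsilon\in\,]-\varepsilon^{\rm ad},\varepsilon^{\rm ad}[$. Real analytic maps between (open subsets of) Banach spaces are those locally given by convergent power series. *)

(* Defs.v *)
From HB Require Import structures.
From mathcomp Require Import all_boot all_order all_algebra.
From mathcomp Require Import all_classical all_reals all_analysis.
Set Implicit Arguments.
Unset Strict Implicit.
Unset Printing Implicit Defensive.
Import Order.TTheory GRing.Theory Num.Theory.
Import numFieldNormedType.Exports.
Local Open Scope classical_set_scope.
Local Open Scope ring_scope.

(* The canonical norm of 'rV[R]_n is the max norm. *)

Definition enorm (R : realType) (n : nat) (x : 'rV[R]_n) : R :=
  Num.sqrt (\sum_i x 0 i ^+ 2).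

Definition eball (R : realType) (n : nat) (r : R) : set 'rV[R]_n :=
  [set x | enorm x < r].

Definition bdry (T : topologicalType) (A : set T) : set T :=
  closure A `\` interior A.

Definition half_plane (R : realType) : set 'rV[R]_2 := [set x | 0 < x 0 1].

Definition half_plane_bdry (R : realType) : set 'rV[R]_2 :=
  [set x | x 0 1 = 0].

Definition half_ball (R : realType) (r : R) : set 'rV[R]_2 :=
  @eball R 2 r `&` @half_plane R.

Definition pt (R : realType) (a b : R) : 'rV[R]_2 :=
  \row_j (if j == 0 then a else b).

Definition partial (R : realType) (n : nat) (i : 'I_n) (f : 'rV[R]_n -> R)
  : 'rV[R]_n -> R := fun x => 'D_(delta_mx 0 i) f x.

(* 0 is added so that suprema over the empty set are 0 and not -oo. *)
Definition sup_norm (R : realType) (n : nat) (A : set 'rV[R]_n)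
    (f : 'rV[R]_n -> R) : \bar R :=
  ereal_sup (0%E |` [set `|f x|%:E | x in A]).

Definition holder_seminorm (R : realType) (n : nat) (alpha : R)
    (A : set 'rV[R]_n) (f : 'rV[R]_n -> R) : \bar R :=
  ereal_sup (0%E |` [set (`|f z.1 - f z.2| / (enorm (z.1 - z.2) `^ alpha))%:E
                    | z in [set z | A z.1 /\ A z.2 /\ z.1 <> z.2]]).

(* C^{1,alpha}(closure O) for O open and bounded. Functions are total, and only
   the values on closure O matter. The partial derivatives are taken in O and
   are required to extend continuously to closure O. *)
Definition C1a (R : realType) (n : nat) (alpha : R) (O : set 'rV[R]_n)
    (f : 'rV[R]_n -> R) : Prop :=
  {within closure O, continuous f} /\
  forall i : 'I_n,
    [/\ forall x, O x -> derivable f x (delta_mx 0 i),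
        exists2 h : 'rV[R]_n -> R, {within closure O, continuous h} &
          forall x, O x -> h x = partial i f x
      & (holder_seminorm alpha O (partial i f) < +oo)%E].

Definition C1a_norm (R : realType) (n : nat) (alpha : R) (O : set 'rV[R]_n)
    (f : 'rV[R]_n -> R) : \bar R :=
  (sup_norm (closure O) f
   + \sum_(i < n) sup_norm O (partial i f)
   + \sum_(i < n) holder_seminorm alpha O (partial i f))%E.

(* psi is a C^{1,alpha} diffeomorphism of the open neighbourhood V of x0 onto
   the open set W, with inverse phi. *)
Definition C1a_chart (R : realType) (alpha : R) (x0 : 'rV[R]_2)
    (V W : set 'rV[R]_2) (psi phi : 'rV[R]_2 -> 'rV[R]_2) : Prop :=
  [/\ open V, V x0 & open W] /\
  [/\ forall x, V x -> W (psi x) /\ phi (psi x) = x,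
      forall y, W y -> V (phi y) /\ psi (phi y) = y,
      forall i, C1a alpha V (fun x => psi x 0 i)
    & forall i, C1a alpha W (fun y => phi y 0 i)].

Definition flattens (R : realType) (Om V : set 'rV[R]_2)
    (psi : 'rV[R]_2 -> 'rV[R]_2) : Prop :=
  forall x, V x -> (Om x <-> half_plane (psi x)) /\
                   (bdry Om x <-> half_plane_bdry (psi x)).

(* Gilbarg and Trudinger, Elliptic Partial Differential Equations of Second
   Order, Sect. 6.2. *)
Definition C1a_set (R : realType) (alpha : R) (Om : set 'rV[R]_2) : Prop :=
  forall x0, bdry Om x0 -> exists V W psi phi,
    C1a_chart alpha x0 V W psi phi /\ flattens Om V psi.

(* C^{1,alpha}(bdry Om), for Om of class C^{1,alpha}: g is of class C^{1,alpha}
   when read in local charts, as a function on the open subset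
   { s | (s, 0) \in W } of the real line. *)
Definition C1a_bdry (R : realType) (alpha : R) (Om : set 'rV[R]_2)
    (g : 'rV[R]_2 -> R) : Prop :=
  forall x0, bdry Om x0 -> exists V W psi phi,
    [/\ C1a_chart alpha x0 V W psi phi, flattens Om V psi
      & C1a alpha [set s : 'rV[R]_1 | W (pt (s 0 0) 0)]
          (fun s => g (phi (pt (s 0 0) 0)))].

(* One-dimensional compact submanifold with boundary of R^2. The half-line
   model covers interior points too, after shrinking the chart. *)
Definition compact_C1a_curve (R : realType) (alpha : R) (M : set 'rV[R]_2)
  : Prop :=
  compact M /\
  forall x0, M x0 -> exists V W psi phi,
    C1a_chart alpha x0 V W psi phi /\
    forall x, V x -> (M x <-> half_plane_bdry (psi x) /\ 0 <= psi x 0 0).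

Definition bdry0 (R : realType) (Om : set 'rV[R]_2) : set 'rV[R]_2 :=
  bdry Om `&` @half_plane_bdry R.

Definition bdry_plus (R : realType) (Om : set 'rV[R]_2) : set 'rV[R]_2 :=
  bdry Om `&` @half_plane R.

Definition finite_union_of_segments (R : realType) (A : set 'rV[R]_2) : Prop :=
  exists (m : nat) (a b : 'I_m -> R),
    [/\ forall i, a i <= b i,
        trivIset setT (fun i => `[a i, b i]%classic)
      & A = [set x | half_plane_bdry x /\ exists i, a i <= x 0 0 <= b i]].

Definition admissible_domain (R : realType) (alpha : R) (Om : set 'rV[R]_2)
  : Prop :=
  [/\ open Om, bounded_set Om, connected Om & Om `<=` @half_plane R] /\
  [/\ C1a_set alpha Om,
      within (@half_plane_bdry R) (nbhs (0 : 'rV[R]_2)) (bdry0 Om),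
      compact_C1a_curve alpha (closure (bdry_plus Om))
    & finite_union_of_segments (closure (bdry0 Om))].

Definition admissible_hole (R : realType) (alpha : R) (om : set 'rV[R]_2)
  : Prop :=
  [/\ open om, bounded_set om, connected om, C1a_set alpha om & om 0].

Definition hole (R : realType) (p : 'rV[R]_2) (om : set 'rV[R]_2) (e : R)
  : set 'rV[R]_2 := [set e *: p + e *: y | y in om].

Definition perforated (R : realType) (Om : set 'rV[R]_2) (p : 'rV[R]_2)
    (om : set 'rV[R]_2) (e : R) : set 'rV[R]_2 :=
  Om `\` closure (hole p om e).

Definition harmonic_on (R : realType) (O : set 'rV[R]_2) (u : 'rV[R]_2 -> R)
  : Prop :=
  forall x, O x ->
    (forall i : 'I_2, derivable u x (delta_mx 0 i)) /\
    (forall i j : 'I_2, derivable (partial i u) x (delta_mx 0 j) /\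
                        {for x, continuous (partial j (partial i u))}) /\
    \sum_(i < 2) partial i (partial i u) x = 0.

Definition real_analytic_on (R : realType) (A : set R) (f : R -> R) : Prop :=
  forall t0, A t0 -> exists2 d : R, 0 < d & exists a : nat -> R,
    forall t, A t -> `|t - t0| < d ->
      series (fun k => a k * (t - t0) ^+ k) @ \oo --> f t.

(* Real analytic maps from A to the Banach space C^{1,alpha}(closure O): the
   power series has coefficients in this space and converges in its norm. *)
Definition real_analytic_C1a (R : realType) (n : nat) (alpha : R)
    (O : set 'rV[R]_n) (A : set R) (F : R -> 'rV[R]_n -> R) : Prop :=
  (forall t, A t -> C1a alpha O (F t)) /\
  forall t0, A t0 -> exists2 d : R, 0 < d & exists a : nat -> 'rV[R]_n -> R,
    (forall k, C1a alpha O (a k)) /\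
    forall t, A t -> `|t - t0| < d ->
      (fun N : nat => C1a_norm alpha O
         (fun x => F t x - \sum_(0 <= k < N) (t - t0) ^+ k * a k x))
        @ \oo --> 0%E.

(* Main.v *)
(** Work in the complex plane and put [v e = u e - u0].  Near the hole, in the
    variable [X = x / e], the datum of [v e] on the fixed set
    [K = p + closure om] expands in powers of [e], because [U0 (e X)] does.  The
    Dirichlet problem in the half plane minus [K] has a solution that, outside a
    half disk, is a series of the multipoles [s_k X = - Im (X ^ - k)], by Kelvin
    transform and reflection.  Since [s_k (x / e) = e ^ k s_k x] contains no
    logarithm, the flat boundary removing the term in [log |X|] of the plane, the
    far field of the inner solution is again a power series in [e]; adding
    [h_k], harmonic in [Om] and equal to [- s_k] on its boundary, restores the
    outer boundary condition at the price of a smaller datum [h_k (e X)] on [K],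
    which is expanded by reflection at [0].  The resulting recursion has geometric
    bounds, and the maximum principle compares its partial sums with [v e]: away
    from [0], [v e] is a convergent series [\sum_N e ^ N A_N] of harmonic functions
    vanishing on the boundary of [Om].

    For such functions the [C^{1,alpha}] norm away from [0] is controlled by the
    supremum.  At the scale [r] the boundary is within [r ^ (1 + alpha)] of a line,
    so an improvement-of-flatness iteration gives a first-order expansion at every
    boundary point, which together with interior estimates is the Hoelder bound on
    the gradient.  Hence all power series converge in [C^{1,alpha}], and the series
    may be re-expanded at any point of a smaller interval.

    Harmonicity is used through the second difference of the four neighbours
    [c + s], [c - s], [c + i s], [c - i s]; solutions on a disk come from Fejer
    sums on roots of unity and solutions on a domain from Perron's method, so that
    no integral is needed. *)

Require Import Defs.
From HB Require Import structures.
From mathcomp Require Import all_boot all_order all_algebra.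
From mathcomp Require Import all_classical all_reals all_analysis.
From mathcomp Require Import complex ring lra.
Set Implicit Arguments.
Unset Strict Implicit.
Unset Printing Implicit Defensive.
Import Order.TTheory GRing.Theory Num.Theory.
Import numFieldNormedType.Exports.
Local Open Scope classical_set_scope.
Local Open Scope ring_scope.

(** The second-difference condition serves the maximum principle, but it is transported neither by
    rotations nor, directly, by uniform limits. A harmonic function is therefore compared on small
    disks with the solution having the same boundary values, and changes of variable, limits and
    gradient bounds are read off the resulting power series.

    Subtracting [u0] removes the outer datum. The hole then sees only the rescaled inner datum,
    which does not depend on [e], and the Taylor series of [U0] at 0.

    The obstacle in the recursion is that each order reacts to all earlier ones. A response delayed
    by [i] orders costs [(2 * lam) ^ i]; with the growth rate [mu = 20 * lam] the sum of the
    responses is a fixed fraction of [mu ^ n], so a single bound [4 * G * mu ^ n] propagates.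
    Numbers of terms are absorbed by doubling a ratio, as [n <= 2 ^ n].

    Re-expansion at another point needs one estimate uniform over coefficient sequences: the new
    coefficients and the remainders are sums of the same functions [A j] with other weights. *)

Local Notation Re := (@complex.Re _).
Local Notation Im := (@complex.Im _).

(** * Topology of the plane *)
Section Modulus.
Context {R : realType}.
Implicit Types (z w : R[i]) (x y : R).

(** The norm of [R[i]] is itself complex-valued; a real modulus keeps all estimates within real
    arithmetic. *)
Definition cn z : R := Num.sqrt (Re z ^+ 2 + Im z ^+ 2).

Lemma cnE z : `|z| = (cn z)%:C%C.
Proof. by case: z. Qed.

Lemma cn_ge0 z : 0 <= cn z. Proof. exact: sqrtr_ge0. Qed.

Lemma cn0 : cn (0 : R[i]) = 0.
Proof. by apply: (@complexI R); rewrite -cnE normr0. Qed.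

Lemma cn1 : cn (1 : R[i]) = 1.
Proof. by apply: (@complexI R); rewrite -cnE normr1. Qed.

Lemma cn0_eq z : cn z = 0 -> z = 0.
Proof. by move=> h; apply/eqP; rewrite -normr_eq0 cnE h. Qed.

Lemma cn_eq0 z : (cn z == 0) = (z == 0).
Proof. by apply/eqP/eqP => [/cn0_eq//|->]; rewrite cn0. Qed.

Lemma cn_gt0 z : (0 < cn z) = (z != 0).
Proof. by rewrite lt_def cn_ge0 andbT cn_eq0. Qed.

Lemma cnM z w : cn (z * w) = cn z * cn w.
Proof. by apply: (@complexI R); rewrite rmorphM /= -!cnE normrM. Qed.

Lemma cnN z : cn (- z) = cn z.
Proof. by apply: (@complexI R); rewrite -!cnE normrN. Qed.

Lemma cnB z w : cn (z - w) = cn (w - z).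
Proof. by rewrite -cnN opprB. Qed.

Lemma cnV z : cn z^-1 = (cn z)^-1.
Proof. by apply: (@complexI R); rewrite fmorphV /= -!cnE normfV. Qed.

Lemma cnX z n : cn (z ^+ n) = cn z ^+ n.
Proof. by apply: (@complexI R); rewrite rmorphXn /= -!cnE normrX. Qed.

Lemma cnD z w : cn (z + w) <= cn z + cn w.
Proof. by rewrite -lecR rmorphD /= -!cnE ler_normD. Qed.

Lemma cnD_le z w a b : cn z <= a -> cn w <= b -> cn (z + w) <= a + b.
Proof. by move=> h1 h2; apply: le_trans (cnD _ _) _; apply: lerD. Qed.

Lemma cn_tri u z w : cn (z - w) <= cn (z - u) + cn (u - w).
Proof. by rewrite (_ : z - w = (z - u) + (u - w)) ?cnD //; ring. Qed.

Lemma cnBD z w : cn z - cn w <= cn (z - w).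
Proof. by have := cn_tri w z 0; rewrite !subr0; lra. Qed.

Lemma cnR x : cn x%:C%C = `|x|.
Proof. by rewrite /cn /= expr0n addr0 sqrtr_sqr. Qed.

Lemma cni : cn ('i%C : R[i]) = 1.
Proof. by rewrite /cn /= expr0n add0r expr1n sqrtr1. Qed.

Lemma cn2 z : cn z ^+ 2 = Re z ^+ 2 + Im z ^+ 2.
Proof. by rewrite sqr_sqrtr // addr_ge0 ?sqr_ge0. Qed.

Lemma cnC z : cn (conjc z) = cn z.
Proof. by case: z => a b; rewrite /cn /= sqrrN. Qed.

Lemma ler_sqrt_bound x y : 0 <= y -> x ^+ 2 <= y ^+ 2 -> x <= y.
Proof. by move=> y0 h; nra. Qed.

Lemma Re_le z : `|Re z| <= cn z.
Proof.
by apply: ler_sqrt_bound (cn_ge0 z) _; rewrite cn2 real_normK ?num_real // lerDl sqr_ge0.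
Qed.

Lemma Im_le z : `|Im z| <= cn z.
Proof.
by apply: ler_sqrt_bound (cn_ge0 z) _; rewrite cn2 real_normK ?num_real // lerDr sqr_ge0.
Qed.

Lemma cn_ReIm z : cn z <= `|Re z| + `|Im z|.
Proof.
apply: ler_sqrt_bound; first by rewrite addr_ge0.
have h1 : `|Re z| ^+ 2 = Re z ^+ 2 by rewrite real_normK ?num_real.
have h2 : `|Im z| ^+ 2 = Im z ^+ 2 by rewrite real_normK ?num_real.
have := mulr_ge0 (normr_ge0 (Re z)) (normr_ge0 (Im z)).
by rewrite cn2 -h1 -h2; nra.
Qed.

Lemma ReD z w : Re (z + w) = Re z + Re w. Proof. by case: z; case: w. Qed.
Lemma ImD z w : Im (z + w) = Im z + Im w. Proof. by case: z; case: w. Qed.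
Lemma ReN z : Re (- z) = - Re z. Proof. by case: z. Qed.
Lemma ImN z : Im (- z) = - Im z. Proof. by case: z. Qed.
Lemma ReB z w : Re (z - w) = Re z - Re w. Proof. by rewrite ReD ReN. Qed.
Lemma ImB z w : Im (z - w) = Im z - Im w. Proof. by rewrite ImD ImN. Qed.
Lemma ReM z w : Re (z * w) = Re z * Re w - Im z * Im w.
Proof. by case: z; case: w. Qed.
Lemma ImM z w : Im (z * w) = Re z * Im w + Im z * Re w.
Proof. by case: z; case: w. Qed.
Lemma ReZ x z : Re (x%:C%C * z) = x * Re z.
Proof. by rewrite ReM /= mul0r subr0. Qed.
Lemma ImZ x z : Im (x%:C%C * z) = x * Im z.
Proof. by rewrite ImM /= mul0r addr0. Qed.
Lemma Re_sum (I : Type) (r : seq I) (P : pred I) (F : I -> R[i]) :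
  Re (\sum_(i <- r | P i) F i) = \sum_(i <- r | P i) Re (F i).
Proof. by rewrite (big_morph _ ReD (erefl : Re 0 = 0)). Qed.
Lemma cn_sum (I : Type) (r : seq I) (P : pred I) (F : I -> R[i]) :
  cn (\sum_(i <- r | P i) F i) <= \sum_(i <- r | P i) cn (F i).
Proof.
elim/big_rec2 : _ => [|i y1 y2 _ h]; first by rewrite cn0.
by apply: le_trans (cnD _ _) _; rewrite lerD2l.
Qed.

Lemma complex_eq z w : Re z = Re w -> Im z = Im w -> z = w.
Proof. by case: z => a b; case: w => c d /= -> ->. Qed.

Lemma conjc_mul z w : conjc (z * w) = conjc z * conjc w.
Proof. exact: rmorphM. Qed.
Lemma conjc_X z n : conjc (z ^+ n) = conjc z ^+ n.
Proof. exact: rmorphXn. Qed.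
Lemma conjc_add z w : conjc (z + w) = conjc z + conjc w.
Proof. exact: rmorphD. Qed.
Lemma conjc_sub z w : conjc (z - w) = conjc z - conjc w.
Proof. exact: rmorphB. Qed.
Lemma ReC z : Re (conjc z) = Re z. Proof. by case: z. Qed.
Lemma ImC z : Im (conjc z) = - Im z. Proof. by case: z. Qed.
Lemma mul_conjc z : z * conjc z = ((cn z) ^+ 2)%:C%C.
Proof. by apply: complex_eq; rewrite ?ReM ?ImM ReC ImC /= ?cn2; ring. Qed.

End Modulus.

(** * Limits and geometric series of real numbers *)

Section Sequences.
Context {R : realType}.
Implicit Types (x y b : nat -> R) (l A s : R).

Lemma divr2_gt0 (e : R) : 0 < e -> 0 < e / 2.
Proof. by move=> ?; rewrite divr_gt0. Qed.

Definition tends x l := forall e, 0 < e -> exists N, forall n, (N <= n)%N -> `|x n - l| <= e.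

Lemma eps_le (a b : R) : (forall e, 0 < e -> a <= b + e) -> a <= b.
Proof. by move=> h; apply/ler_addgt0Pr. Qed.

Lemma tends_le x l a : tends x l -> (exists N, forall n, (N <= n)%N -> x n <= a) -> l <= a.
Proof.
move=> h [N hN]; apply: eps_le => e e0; have [N' hN'] := h e e0.
have := hN' (maxn N N') (leq_maxr _ _); have := hN (maxn N N') (leq_maxl _ _).
by rewrite ler_norml => h1 /andP[h2 h3]; lra.
Qed.

Lemma tends_unique x l l' : tends x l -> tends x l' -> l = l'.
Proof.
move=> h h'; apply/eqP; rewrite -subr_eq0 -normr_le0; apply: eps_le => e e0.
have e2 : 0 < e / 2 by rewrite divr_gt0.
have [N hN] := h _ e2; have [N' hN'] := h' _ e2.
have := hN' (maxn N N') (leq_maxr _ _); have := hN (maxn N N') (leq_maxl _ _).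
by rewrite !ler_norml => /andP[? ?] /andP[? ?]; apply/andP; lra.
Qed.

Lemma tends_cst l : tends (fun=> l) l.
Proof. by move=> e e0; exists 0%N => n _; rewrite subrr normr0 ltW. Qed.

Lemma tendsD x y l l' : tends x l -> tends y l' -> tends (fun n => x n + y n) (l + l').
Proof.
move=> h h' e e0.
have e2 : 0 < e / 2 by rewrite divr_gt0.
have [N hN] := h _ e2; have [N' hN'] := h' _ e2.
exists (maxn N N') => n; rewrite geq_max => /andP[/hN + /hN'].
by rewrite !ler_norml => /andP[? ?] /andP[? ?]; apply/andP; lra.
Qed.

Lemma tendsZ (c : R) x l : tends x l -> tends (fun n => c * x n) (c * l).
Proof.
move=> h e e0; have c1 : 0 < `|c| + 1 by have := normr_ge0 c; lra.
have [N hN] := h (e / (`|c| + 1)) (divr_gt0 e0 c1); exists N => n /hN hn.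
rewrite -mulrBr normrM; apply: le_trans (_ : (`|c| + 1) * (e / (`|c| + 1)) <= _).
  by apply: ler_pM => //; lra.
by rewrite mulrCA divff ?mulr1 // gt_eqF.
Qed.

Lemma tendsN x l : tends x l -> tends (fun n => - x n) (- l).
Proof. by move=> h; have := tendsZ (-1) h; rewrite mulN1r; under eq_fun do rewrite mulN1r. Qed.

Lemma tendsB x y l l' : tends x l -> tends y l' -> tends (fun n => x n - y n) (l - l').
Proof. by move=> h h'; apply: tendsD => //; apply: tendsN. Qed.

Lemma tends_eq x y l : (forall n, x n = y n) -> tends x l -> tends y l.
Proof. by move=> /funext ->. Qed.

Lemma tends_cvg x l : tends x l <-> x @ \oo --> l.
Proof.
split=> [h|h].
  apply/cvgrPdist_le => e e0; have [N hN] := h e e0.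
  by exists N => // n /= /hN; rewrite distrC.
move/cvgrPdist_le : h => h e e0; have [N _ hN] := h e e0.
by exists N => n Nn; rewrite distrC; apply: hN.
Qed.

Lemma cauchy_tends x :
  (forall e, 0 < e -> exists N, forall m n, (N <= m)%N -> (N <= n)%N -> `|x m - x n| <= e) ->
  exists l, tends x l.
Proof.
move=> h; suff : cvgn x by move=> /cvg_ex[/= l /tends_cvg hl]; exists l.
apply/cauchy_cvgP/cauchy_ballP => e e0.
have [N hN] := h (e / 2) (divr2_gt0 e0).
exists (x @` [set n | (N <= n)%N], x @` [set n | (N <= n)%N]) => /=.
  by split; exists N => // n /= hn; exists n.
move=> [_ _] /= [[m hm <-] [n hn <-]].
by rewrite /ball /=; apply: le_lt_trans (hN _ _ hm hn) _; lra.
Qed.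

Lemma expr_small s e : 0 <= s < 1 -> 0 < e -> exists N, forall n, (N <= n)%N -> s ^+ n <= e.
Proof.
move=> /andP[s0 s1] e0; have : (fun n => s ^+ n) @ \oo --> 0.
  by apply: cvg_expr; rewrite ger0_norm.
move/tends_cvg => /(_ e e0)[N hN]; exists N => n /hN.
by rewrite subr0 ger0_norm // exprn_ge0.
Qed.

(** For a divergent series [lim] returns an arbitrary value, so each use goes through a majorant
    [geo] or through a limit known beforehand. *)
Definition ser b : R := lim ((fun n => \sum_(k < n) b k) @ \oo).

Definition geo A s b := forall k, `|b k| <= A * s ^+ k.

Lemma geo_tail A s b m n : 0 <= s < 1 -> geo A s b -> (m <= n)%N ->
  `|\sum_(k < n) b k - \sum_(k < m) b k| <= A * s ^+ m / (1 - s).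
Proof.
move=> /andP[s0 s1] hb mn.
have A0 : 0 <= A by have := hb 0%N; rewrite expr0 mulr1; apply: le_trans.
rewrite -(subnKC mn); elim: (n - m)%N => [|d IH].
  by rewrite addn0 subrr normr0 !mulr_ge0 ?exprn_ge0 ?invr_ge0 //; lra.
(* The bound is sharpened to the exact finite geometric sum, since the infinite one leaves no room
   for the next term of the induction. *)
suff : `|\sum_(k < m + d.+1) b k - \sum_(k < m) b k|
    <= A * s ^+ m * (1 - s ^+ d.+1) / (1 - s).
  move=> h; apply: le_trans h _; rewrite ler_wpM2r ?invr_ge0; try lra.
  rewrite ler_piMr ?mulr_ge0 ?exprn_ge0 //.
  by have := exprn_ge0 d.+1 s0; lra.
clear IH; elim: d.+1 => {d} [|d IH].
  by rewrite addn0 subrr normr0 expr0 subrr mulr0 mul0r.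
rewrite addnS big_ord_recr /= addrAC.
apply: le_trans (ler_normD _ _) _.
apply: le_trans (lerD IH (hb _)) _.
rewrite le_eqVlt; apply/orP; left; apply/eqP.
have : 1 - s != 0 by rewrite gt_eqF //; lra.
by rewrite exprD exprS => ?; field.
Qed.

Lemma geo_A0 A s b : geo A s b -> 0 <= A.
Proof. by move=> /(_ 0%N); rewrite expr0 mulr1; apply: le_trans. Qed.

Lemma ser_tends A s b : 0 <= s < 1 -> geo A s b ->
  tends (fun n => \sum_(k < n) b k) (ser b).
Proof.
move=> hs hb; have A0 := geo_A0 hb; move: (hs) => /andP[s0 s1].
suff /cauchy_tends[l /tends_cvg hl] : forall e, 0 < e -> exists N, forall m n,
  (N <= m)%N -> (N <= n)%N -> `|\sum_(k < m) b k - \sum_(k < n) b k| <= e.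
  by apply/tends_cvg; apply/cvg_ex; exists l.
move=> e e0.
have d0 : 0 < e * (1 - s) / (A + 1) by rewrite !(divr_gt0, mulr_gt0) //; lra.
have [N hN] := expr_small hs d0; exists N.
have key m n : (N <= m)%N -> (m <= n)%N -> `|\sum_(k < n) b k - \sum_(k < m) b k| <= e.
  move=> Nm mn; apply: le_trans (geo_tail hs hb mn) _.
  rewrite ler_pdivrMr; last by lra.
  apply: le_trans (_ : (A + 1) * (e * (1 - s) / (A + 1)) <= _).
    by apply: ler_pM => //; rewrite ?exprn_ge0 ?hN //; lra.
  by rewrite mulrCA divff ?mulr1 // gt_eqF //; lra.
move=> m n Nm Nn; case: (leqP m n) => mn; last by apply: key => //; apply: ltnW.
by rewrite distrC; apply: key.
Qed.

Lemma ser_tail A s b n : 0 <= s < 1 -> geo A s b ->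
  `|ser b - \sum_(k < n) b k| <= A * s ^+ n / (1 - s).
Proof.
move=> hs hb.
have h := tendsB (ser_tends hs hb) (tends_cst (\sum_(k < n) b k)).
rewrite ler_norml; apply/andP; split.
  rewrite lerNl; apply: (tends_le (tendsN h)); exists n => m nm.
  by have := geo_tail hs hb nm; rewrite ler_norml => /andP[]; lra.
apply: (tends_le h); exists n => m nm.
by have := geo_tail hs hb nm; rewrite ler_norml => /andP[]; lra.
Qed.

Lemma ser_le A s b : 0 <= s < 1 -> geo A s b -> `|ser b| <= A / (1 - s).
Proof. by move=> hs /(ser_tail 0 hs); rewrite big_ord0 subr0 expr0 mulr1. Qed.

Lemma tends_ser b l : tends (fun n => \sum_(k < n) b k) l -> ser b = l.
Proof. by move=> /tends_cvg; exact: cvg_lim. Qed.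

End Sequences.

(** * Compactness and continuity in the complex plane *)

Section Plane.
Context {R : realType}.
Local Notation C := R[i].
Implicit Types (A D K : set C) (u v : C -> R) (z w c : C).

Definition opn A := forall z, A z -> exists2 r, 0 < r & forall w, cn (w - z) < r -> A w.
Definition cl A : set C := fun z => forall r, 0 < r -> exists2 w, A w & cn (w - z) < r.
(** Closure minus the set itself: for open [A] this is the topological boundary. For the complement
    of a closed [K] it consists of the points of [K] reached from outside. *)
Definition bd A : set C := fun z => cl A z /\ ~ A z.
Definition bdd A := exists B : R, forall z, A z -> cn z <= B.
Definition cont A u := forall z, A z -> forall e, 0 < e ->
  exists2 d, 0 < d & forall w, A w -> cn (w - z) < d -> `|u w - u z| <= e.

Definition toC (x : 'rV[R]_2) : C := Complex (x 0 0) (x 0 1).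
Definition toV z : 'rV[R]_2 := pt (Re z) (Im z).

Lemma toVK : cancel toV toC.
Proof. by case=> a b; rewrite /toC /toV !mxE. Qed.

Lemma toCK : cancel toC toV.
Proof.
move=> x; apply/rowP => i; rewrite mxE; case: i => [[|[|//]] hi] /=.
  by congr (x 0 _); apply: val_inj.
by congr (x 0 _); apply: val_inj.
Qed.

Lemma toCB x y : toC (x - y) = toC x - toC y.
Proof. by rewrite /toC !mxE. Qed.
Lemma toCD x y : toC (x + y) = toC x + toC y.
Proof. by rewrite /toC !mxE. Qed.
Lemma toCZ a x : toC (a *: x) = a%:C%C * toC x.
Proof. by apply: complex_eq; rewrite ?ReZ ?ImZ /toC /= mxE. Qed.

Lemma toC_enorm x : cn (toC x) = enorm x.
Proof.
rewrite /cn /enorm /= !big_ord_recl big_ord0 addr0; congr (Num.sqrt (_ + _ ^+ 2)).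
by congr (x 0 _); apply: val_inj.
Qed.

Lemma norm_rV2 (x : 'rV[R]_2) e : `|x| < e <-> 0 < e /\ `|x 0 0| < e /\ `|x 0 1| < e.
Proof.
rewrite /Num.norm /= mx_normrE; split=> [/bigmax_ltP[e0 h]|[e0 [h0 h1]]].
  by split => //; split; [exact: (h (0, 0)) | exact: (h (0, 1))].
apply/bigmax_ltP; split => // -[i j] _ /=; rewrite (ord1 i).
case: j => [[|[|//]] hj].
  by rewrite (_ : Ordinal hj = 0) //; apply: val_inj.
by rewrite (_ : Ordinal hj = 1) //; apply: val_inj.
Qed.

Lemma nbhs_cn (x : 'rV[R]_2) (P : set 'rV[R]_2) :
  nbhs x P <-> exists2 r : R, 0 < r & forall y, cn (toC y - toC x) < r -> P y.
Proof.
split=> [/nbhs_normP[e /= e0 h]|[r r0 h]].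
  exists e => // y yx; apply: h; rewrite /= norm_rV2; split => //.
  move: yx; rewrite -toCB -cnN; set z := toC _ => zr.
  have := Re_le (- z); have := Im_le (- z).
  by rewrite /z /= !mxE !opprB => h1 h2; split; apply: le_lt_trans zr.
apply: (nbhs_normP x P).2; exists (r / 2); first by rewrite /= divr_gt0.
move=> y /=; rewrite norm_rV2 => -[_ []]; rewrite !mxE => h1 h2; apply: h.
rewrite cnB -toCB; apply: le_lt_trans (cn_ReIm _) _.
by rewrite /= !mxE; lra.
Qed.

Lemma clE A : cl A = toC @` closure (toV @` A).
Proof.
apply/seteqP; split=> [z hz|z [x hx <-] r r0].
  exists (toV z); last exact: toVK.
  move=> P /nbhs_cn[r r0 h]; have [w Aw wz] := hz r r0.
  by exists (toV w); split; [exists w | apply: h; rewrite !toVK].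
have [|_ [[w Aw <-] h]] := hx [set y | cn (toC y - toC x) < r].
  by apply/nbhs_cn; exists r.
by exists w => //; move: h; rewrite /= toVK.
Qed.

Lemma sub_cl A : A `<=` cl A.
Proof. by move=> z Az r r0; exists z => //; rewrite subrr cn0. Qed.

Lemma cl_cl A : cl (cl A) `<=` cl A.
Proof.
move=> z hz r r0; have r2 : 0 < r / 2 by rewrite divr_gt0.
have [w /(_ _ r2)[y Ay yw] wz] := hz _ r2; exists y => //.
by apply: le_lt_trans (cn_tri w _ _) _; lra.
Qed.

Lemma cl_sub A K : A `<=` K -> cl A `<=` cl K.
Proof. by move=> AK z hz r r0; have [w Aw wz] := hz r r0; exists w => //; apply: AK. Qed.

Lemma clU A D : opn D -> D `&` cl A `<=` cl (D `&` A).
Proof.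
move=> oD z [Dz Az] r r0; have [s s0 hs] := oD z Dz.
have m0 : 0 < Num.min r s by rewrite lt_min r0 s0.
have [w Aw] := Az _ m0; rewrite lt_min => /andP[h1 h2].
by exists w => //; split => //; apply: hs.
Qed.

Lemma bdd_cl A : bdd A -> bdd (cl A).
Proof.
move=> [B hB]; exists (B + 1) => z /(_ 1 ltr01)[w /hB h1 h2].
by have := cn_tri w z 0; rewrite !subr0 (cnB z); lra.
Qed.

Lemma bd_closed D : opn D -> cl (bd D) `<=` bd D.
Proof.
move=> oD z hz; split.
  by apply: cl_cl; apply: cl_sub hz => w [].
move=> Dz; have [r r0 h] := oD z Dz; have [w [_ nDw] wz] := hz r r0.
by apply: nDw; apply: h.
Qed.

(** Finite subcovers with a radius depending on the centre. Compactness is imported once, from row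
    vectors; the later compactness arguments go through this form. *)
Lemma cover K (d : C -> R) : cl K `<=` K -> bdd K -> (forall z, K z -> 0 < d z) ->
  exists s : seq C, (forall z, z \in s -> K z) /\
    forall w, K w -> exists2 z, z \in s & cn (w - z) < d z.
Proof.
move=> cK [B hB] hd.
have : compact (toV @` K).
  apply: bounded_closed_compact.
    exists B; split; first exact: num_real.
    move=> M BM _ [z Kz <-] /=; rewrite leNgt; apply/negP => h.
    have h0 : cn (toC (toV z)) < `|toV z|.
      by rewrite toVK; apply: le_lt_trans (hB _ Kz) _; apply: lt_trans h.
    have : `|toV z| < `|toV z|.
      have h1 := Re_le (toC (toV z)); have h2 := Im_le (toC (toV z)).
      apply/norm_rV2; split; first exact: le_lt_trans (cn_ge0 _) h0.
      by split; [apply: le_lt_trans h1 h0 | apply: le_lt_trans h2 h0].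
    by rewrite ltxx.
  move=> x hx; exists (toC x); last exact: toCK.
  by apply: cK; rewrite clE; exists x.
rewrite compact_cover => /(_ C K (fun z => [set y | cn (toC y - z) < d z])).
case.
- move=> z Kz; rewrite openE => y /= hy; apply/nbhs_cn.
  exists (d z - cn (toC y - z)); first by rewrite subr_gt0.
  by move=> x hx /=; have := cn_tri (toC y) (toC x) z; lra.
- by move=> _ [z Kz <-]; exists z => //=; rewrite toVK subrr cn0 hd.
move=> s sK hs; exists (finmap.enum_fset s); split=> [z zs|w Kw].
  by have := sK z zs; rewrite inE.
have [|z zs] := hs (toV w); first by exists w.
by rewrite /= toVK => h; exists z.
Qed.

Lemma seq_argmax (T : eqType) (s : seq T) (f : T -> R) : s != [::] ->
  exists2 x, x \in s & forall y, y \in s -> f y <= f x.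
Proof.
elim: s => // a s IH _; case: (eqVneq s [::]) => [->|/IH[x xs hx]].
  by exists a; rewrite ?mem_head // => y; rewrite inE => /eqP->.
case: (leP (f a) (f x)) => h.
  by exists x; rewrite ?inE ?xs ?orbT // => y; rewrite inE => /orP[/eqP->|/hx].
exists a; rewrite ?mem_head // => y; rewrite inE => /orP[/eqP->//|/hx h'].
exact: le_trans h' (ltW h).
Qed.

(** If no point is maximal, each point has a competitor that beats all values in a neighbourhood of
    it; the best of the finitely many competitors of a subcover would then beat itself. *)
Lemma evt K u : cl K `<=` K -> bdd K -> cont K u -> K !=set0 ->
  exists2 z, K z & forall w, K w -> u w <= u z.
Proof.
move=> cK bK cu [z0 Kz0]; apply: contrapT => hn.
have h z : exists p : C * R, K z -> [/\ K p.1, 0 < p.2 &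
    forall w, K w -> cn (w - z) < p.2 -> u w < u p.1].
  case: (pselect (K z)) => Kz; last by exists (0, 0).
  have [w Kw zw] : exists2 w, K w & u z < u w.
    apply: contrapT => hc; apply: hn; exists z => // w Kw.
    by rewrite leNgt; apply/negP => zw; apply: hc; exists w.
  have [d d0 hd] := cu z Kz ((u w - u z) / 2) ltac:(lra).
  exists (w, d) => _; split => // y Ky /(hd y Ky) /=.
  by rewrite ler_norml => /andP[]; lra.
have [p hp] := choice h.
have [s [sK hs]] := @cover K (fun z => (p z).2) cK bK (fun z Kz => let: And3 _ h _ := hp z Kz in h).
have s0 : s != [::] by have [z zs _] := hs z0 Kz0; apply/eqP => s0; rewrite s0 in zs.
have [x xs hx] := seq_argmax (fun z => u (p z).1) s0.
have [Kx _ _] := hp x (sK x xs).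
have [y ys hy] := hs _ Kx; have [Ky _ h'] := hp y (sK y ys).
by have := h' _ Kx hy; rewrite ltNge hx.
Qed.

Lemma evt_bound K u : cl K `<=` K -> bdd K -> cont K u ->
  exists2 M, 0 <= M & forall z, K z -> `|u z| <= M.
Proof.
move=> cK bK cu; case: (pselect (K !=set0)) => [K0|hn]; last first.
  by exists 0 => // z Kz; case: hn; exists z.
have [z Kz hz] : exists2 z, K z & forall w, K w -> `|u w| <= `|u z|.
  apply: (@evt K (fun z => `|u z|)) => // z Kz e e0; have [d d0 hd] := cu z Kz e e0.
  by exists d => // w Kw /(hd w Kw); apply: le_trans; apply: ler_dist_dist.
by exists `|u z|.
Qed.

Lemma unif_cont K u : cl K `<=` K -> bdd K -> cont K u -> forall e, 0 < e ->
  exists2 d, 0 < d & forall z w, K z -> K w -> cn (w - z) < d -> `|u w - u z| <= e.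
Proof.
move=> cK bK cu e e0.
have h z : exists d : R, 0 < d /\ (K z -> forall w, K w -> cn (w - z) < d -> `|u w - u z| <= e / 2).
  case: (pselect (K z)) => Kz; last by exists 1.
  by have [d d0 hd] := cu z Kz (e / 2) (divr2_gt0 e0); exists d.
have [d hd] := choice h.
(* Half the local radius leaves room for the second point: [z] and [w] then lie in the full disk
   about one centre. *)
have [s [sK hs]] := @cover K (fun z => d z / 2) cK bK (fun z _ => divr2_gt0 (hd z).1).
have [d0 d00 hd0] : exists2 d0 : R, 0 < d0 & forall z, z \in s -> d0 <= d z / 2.
  elim: (s) => [|a s' [d1 d10 IH]]; first by exists 1.
  exists (Num.min d1 (d a / 2)).
    by rewrite lt_min d10 divr_gt0 // (hd a).1.
  move=> z; rewrite inE => /orP[/eqP->|/IH h']; first by rewrite ge_min lexx orbT.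
  by rewrite ge_min h'.
exists d0 => // z w Kz Kw wz; have [y ys hy] := hs z Kz.
have h1 := hd0 y ys.
have := (hd y).2 (sK y ys) z Kz; have := (hd y).2 (sK y ys) w Kw.
have := cn_tri z w y => h2.
move=> /(_ ltac:(have := (hd y).1; lra)) + /(_ ltac:(have := (hd y).1; lra)).
by rewrite !ler_norml => /andP[? ?] /andP[? ?]; apply/andP; lra.
Qed.

Lemma contD A u v : cont A u -> cont A v -> cont A (fun z => u z + v z).
Proof.
move=> hu hv z Az e e0; have e2 : 0 < e / 2 by rewrite divr_gt0.
have [d d0 hd] := hu z Az _ e2; have [d' d0' hd'] := hv z Az _ e2.
exists (Num.min d d'); first by rewrite lt_min d0.
move=> w Aw; rewrite lt_min => /andP[/(hd w Aw) + /(hd' w Aw)].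
by rewrite !ler_norml => /andP[? ?] /andP[? ?]; apply/andP; lra.
Qed.

Lemma contZ A (k : R) u : cont A u -> cont A (fun z => k * u z).
Proof.
move=> hu z Az e e0; have k1 : 0 < `|k| + 1 by have := normr_ge0 k; lra.
have [d d0 hd] := hu z Az (e / (`|k| + 1)) (divr_gt0 e0 k1).
exists d => // w Aw /(hd w Aw) h; rewrite -mulrBr normrM.
apply: le_trans (_ : (`|k| + 1) * (e / (`|k| + 1)) <= _).
  by apply: ler_pM => //; lra.
by rewrite mulrCA divff ?mulr1 // gt_eqF.
Qed.

Lemma contN A u : cont A u -> cont A (fun z => - u z).
Proof. by move=> /(contZ (-1)); under eq_fun do rewrite mulN1r. Qed.

Lemma contB A u v : cont A u -> cont A v -> cont A (fun z => u z - v z).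
Proof. by move=> hu /contN; apply: contD. Qed.

Lemma cont_cst A (k : R) : cont A (fun=> k).
Proof. by move=> z _ e e0; exists 1 => // w _ _; rewrite subrr normr0 ltW. Qed.

Lemma cont_sub A D u : A `<=` D -> cont D u -> cont A u.
Proof.
move=> AD hu z /AD Dz e e0; have [d d0 hd] := hu z Dz e e0.
by exists d => // w /AD; apply: hd.
Qed.

Lemma cont_eq A u v : (forall z, A z -> u z = v z) -> cont A u -> cont A v.
Proof.
move=> uv hu z Az e e0; have [d d0 hd] := hu z Az e e0.
by exists d => // w Aw; rewrite -!uv //; apply: hd.
Qed.

Lemma cont_max A u v : cont A u -> cont A v -> cont A (fun z => Num.max (u z) (v z)).
Proof.
move=> hu hv z Az e e0.
have [d d0 hd] := hu z Az _ e0; have [d' d0' hd'] := hv z Az _ e0.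
exists (Num.min d d'); first by rewrite lt_min d0.
move=> w Aw; rewrite lt_min => /andP[/(hd w Aw) + /(hd' w Aw)].
rewrite !ler_norml => /andP[? ?] /andP[? ?]; apply/andP.
by case: (leP (u w) (v w)); case: (leP (u z) (v z)); lra.
Qed.

Lemma cont_lip A (k : R) u : (forall z w, A z -> A w -> `|u w - u z| <= k * cn (w - z)) -> cont A u.
Proof.
move=> h z Az e e0; have k1 : 0 < `|k| + 1 by have := normr_ge0 k; lra.
exists (e / (`|k| + 1)); first exact: divr_gt0.
move=> w Aw wz; apply: le_trans (h _ _ Az Aw) _.
have kk : k <= `|k| + 1 by have := ler_norm k; lra.
apply: le_trans (ler_wpM2r (cn_ge0 _) kk) _.
apply: le_trans (ler_wpM2l (ltW k1) (ltW wz)) _.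
by rewrite mulrCA divff ?mulr1 // gt_eqF.
Qed.

Lemma cont_unif A u : (forall e, 0 < e -> exists2 v, cont A v & forall z, A z -> `|v z - u z| <= e) ->
  cont A u.
Proof.
move=> h z Az e e0; have e3 : 0 < e / 3 by rewrite divr_gt0.
have [v hv huv] := h _ e3; have [d d0 hd] := hv z Az _ e3.
exists d => // w Aw /(hd w Aw); have := huv w Aw; have := huv z Az.
by rewrite !ler_norml => /andP[? ?] /andP[? ?] /andP[? ?]; apply/andP; lra.
Qed.

End Plane.

(** * Harmonic functions and the maximum principle *)
Section Harmonic.
Context {R : realType}.
Local Notation C := R[i].
Implicit Types (A D K : set C) (u v : C -> R) (z w c : C).

Definition avg4 u c (s : R) : R :=
  u (c + s%:C%C) + u (c - s%:C%C) + u (c + 'i%C * s%:C%C) + u (c - 'i%C * s%:C%C).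

(* Second-difference form of subharmonicity: unlike the mean value property it
   is local and is preserved by maxima for trivial reasons. *)
Definition subh D v := forall c, D c -> forall e, 0 < e ->
  exists2 d, 0 < d & forall s, 0 < s < d -> 4 * v c - e * s ^+ 2 <= avg4 v c s.

Definition harm D u := cont D u /\ forall c, D c -> forall e, 0 < e ->
  exists2 d, 0 < d & forall s, 0 < s < d -> `|avg4 u c s - 4 * u c| <= e * s ^+ 2.

Lemma harm_subh D u : harm D u -> subh D u.
Proof.
move=> [_ h] c Dc e e0; have [d d0 hd] := h c Dc e e0; exists d => // s /hd.
by rewrite ler_norml => /andP[]; lra.
Qed.

Lemma avg4_ball D c : opn D -> D c -> exists2 d, 0 < d & forall s, 0 < s < d ->
  [/\ D (c + s%:C%C), D (c - s%:C%C), D (c + 'i%C * s%:C%C) & D (c - 'i%C * s%:C%C)].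
Proof.
move=> oD /oD[r r0 h]; exists r => // s /andP[s0 sr].
by split; apply: h; rewrite addrAC subrr add0r ?cnN ?cnM ?cni ?mul1r cnR gtr0_norm.
Qed.

Lemma harmD D u v : harm D u -> harm D v -> harm D (fun z => u z + v z).
Proof.
move=> [cu hu] [cv hv]; split; first exact: contD.
move=> c Dc e e0; have e2 := divr2_gt0 e0.
have [d d0 hd] := hu c Dc _ e2; have [d' d0' hd'] := hv c Dc _ e2.
exists (Num.min d d'); first by rewrite lt_min d0.
move=> s /andP[s0]; rewrite lt_min => /andP[sd sd'].
have := hd s; have := hd' s; rewrite s0 sd sd' => /(_ isT) + /(_ isT).
by rewrite /avg4 !ler_norml => /andP[? ?] /andP[? ?]; apply/andP; lra.
Qed.

Lemma harmZ D (k : R) u : harm D u -> harm D (fun z => k * u z).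
Proof.
move=> [cu hu]; split; first exact: contZ.
move=> c Dc e e0; have k1 : 0 < `|k| + 1 by have := normr_ge0 k; lra.
have [d d0 hd] := hu c Dc _ (divr_gt0 e0 k1); exists d => // s /hd h.
rewrite (_ : _ - _ = k * (avg4 u c s - 4 * u c)); last by rewrite /avg4; ring.
rewrite normrM; apply: le_trans (_ : (`|k| + 1) * (e / (`|k| + 1) * s ^+ 2) <= _).
  by apply: ler_pM => //; lra.
by rewrite mulrA (mulrC (_ + 1)) divfK // gt_eqF.
Qed.

Lemma harmN D u : harm D u -> harm D (fun z => - u z).
Proof. by move=> /(harmZ (-1)); under eq_fun do rewrite mulN1r. Qed.

Lemma harmB D u v : harm D u -> harm D v -> harm D (fun z => u z - v z).
Proof. by move=> hu /harmN; apply: harmD. Qed.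

Lemma harm_sub A D u : A `<=` D -> harm D u -> harm A u.
Proof. by move=> AD [cu hu]; split; [exact: cont_sub cu | move=> c /AD; exact: hu]. Qed.

Lemma harm_eq D u v : opn D -> (forall z, D z -> u z = v z) -> harm D u -> harm D v.
Proof.
move=> oD uv [cu hu]; split; first exact: cont_eq cu.
move=> c Dc e e0; have [d d0 hd] := hu c Dc e e0.
have [d' d0' hd'] := avg4_ball oD Dc; exists (Num.min d d'); first by rewrite lt_min d0.
move=> s /andP[s0]; rewrite lt_min => /andP[sd sd'].
have := hd s; have := hd' s; rewrite s0 sd sd' => /(_ isT)[h1 h2 h3 h4] /(_ isT).
by rewrite /avg4 !uv.
Qed.

Lemma harm_loc D u : (forall z, D z -> exists2 A, opn A /\ A z & harm A u) -> harm D u.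
Proof.
move=> h; split=> [z Dz e e0|z Dz].
  have [A [oA Az] [cu _]] := h z Dz; have [d d0 hd] := cu z Az e e0.
  have [r r0 hr] := oA z Az; exists (Num.min d r); first by rewrite lt_min d0.
  by move=> w _; rewrite lt_min => /andP[wd /hr Aw]; apply: hd.
by have [A [_ Az] [_ hu]] := h z Dz; apply: hu.
Qed.

Lemma harm_cst D (k : R) : harm D (fun=> k).
Proof.
split; first exact: cont_cst.
by move=> c Dc e e0; exists 1 => // s _; rewrite /avg4 (_ : _ - _ = 0) ?normr0; [rewrite mulr_ge0 ?sqr_ge0 ?ltW | ring].
Qed.

Lemma subhB D u v : subh D u -> harm D v -> subh D (fun z => u z - v z).
Proof.
move=> hu [_ hv] c Dc e e0; have e2 := divr2_gt0 e0.
have [d d0 hd] := hu c Dc _ e2; have [d' d0' hd'] := hv c Dc _ e2.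
exists (Num.min d d'); first by rewrite lt_min d0.
move=> s /andP[s0]; rewrite lt_min => /andP[sd sd'].
have := hd s; have := hd' s; rewrite s0 sd sd' => /(_ isT) + /(_ isT).
by rewrite /avg4 !ler_norml => /andP[? ?] ?; lra.
Qed.

Lemma subh_max D u v : subh D u -> subh D v -> subh D (fun z => Num.max (u z) (v z)).
Proof.
move=> hu hv c Dc e e0.
have [d d0 hd] := hu c Dc _ e0; have [d' d0' hd'] := hv c Dc _ e0.
exists (Num.min d d'); first by rewrite lt_min d0.
move=> s /andP[s0]; rewrite lt_min => /andP[sd sd'].
have := hd s; have := hd' s; rewrite s0 sd sd' => /(_ isT) + /(_ isT).
rewrite /avg4; set P := fun z => Num.max (u z) (v z).
have h z : u z <= P z /\ v z <= P z by rewrite /P !le_max !lexx orbT.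
rewrite -!/(P _); have : P c = u c \/ P c = v c by rewrite /P; case: leP; [right|left].
move: (h (c + s%:C%C)) (h (c - s%:C%C)) (h (c + 'i%C * s%:C%C)) (h (c - 'i%C * s%:C%C)).
by move=> [? ?] [? ?] [? ?] [? ?] [->|->]; lra.
Qed.

Lemma cn2D z w : cn (z + w) ^+ 2 = cn z ^+ 2 + 2 * (Re z * Re w + Im z * Im w) + cn w ^+ 2.
Proof. by rewrite !cn2 ReD ImD; ring. Qed.

Lemma avg4_sq c s : avg4 (fun z => cn z ^+ 2) c s = 4 * cn c ^+ 2 + 4 * s ^+ 2.
Proof.
rewrite /avg4 !cn2D !ReN !ImN !ReM !ImM /= !cnN !cnM cni !cnR !mul1r real_normK ?num_real //.
by ring.
Qed.

(** Adding [k |z| ^ 2], whose four-point sum exceeds four times its central value by exactly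
    [4 k s ^ 2], makes subharmonicity strict; an interior maximum of the sum is then impossible. *)
Lemma wmp D v M : opn D -> bdd D -> cont (cl D) v -> subh D v ->
  (forall z, bd D z -> v z <= M) -> forall z, cl D z -> v z <= M.
Proof.
move=> oD bD cv hv hM z0 Dz0; rewrite leNgt; apply/negP => Mz0.
have [B hB] := bdd_cl bD; have B0 : 0 <= B by apply: le_trans (cn_ge0 z0) (hB _ Dz0).
(* Small enough for the perturbation to stay below the excess [v z0 - M] on the whole closure, so
   that the maximum point cannot lie on the boundary. *)
pose k := (v z0 - M) / (2 * (B ^+ 2 + 1)).
have B1 : 0 < 2 * (B ^+ 2 + 1) by have := sqr_ge0 B; lra.
have k0 : 0 < k by rewrite divr_gt0 // subr_gt0.
have kB z : cl D z -> k * cn z ^+ 2 < v z0 - M.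
  move=> /hB hz; apply: le_lt_trans (_ : k * B ^+ 2 < _).
    by rewrite ler_wpM2l ?(ltW k0) // lerXn2r ?nnegrE ?cn_ge0.
  by rewrite /k mulrAC ltr_pdivrMr //; have := sqr_ge0 B; nra.
have [c Dc hc] : exists2 c, cl D c & forall w, cl D w ->
    v w + k * cn w ^+ 2 <= v c + k * cn c ^+ 2.
  apply: evt; [exact: cl_cl | exact: bdd_cl | | by exists z0].
  apply: contD => //; apply: contZ; apply: (@cont_lip _ _ (2 * B)) => z w Dz Dw.
  rewrite (_ : _ - _ = (cn w - cn z) * (cn w + cn z)); last by ring.
  have h1 : `|cn w - cn z| <= cn (w - z).
    by rewrite ler_norml; have := cnBD z w; have := cnBD w z; rewrite (cnB z); lra.
  have h2 : `|cn w + cn z| <= 2 * B.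
    by rewrite ger0_norm ?addr_ge0 ?cn_ge0 //; have := hB z Dz; have := hB w Dw; lra.
  by rewrite normrM mulrC ler_pM.
have nc : D c.
  apply: contrapT => nDc; have := hM c (conj Dc nDc).
  have := hc z0 Dz0; have := kB c Dc; have := cn_ge0 z0 => h0.
  by have := mulr_ge0 (ltW k0) (exprn_ge0 2 h0); lra.
(* The tolerance [2 * k] lies strictly below the gain [4 * k]. *)
have [d d0 hd] := hv c nc (2 * k) ltac:(lra).
have [d' d0' hd'] := avg4_ball oD nc.
pose s := Num.min d d' / 2.
have m0 : 0 < Num.min d d' by rewrite lt_min d0.
have s0 : 0 < s by rewrite divr_gt0.
have sd : s < d by have := ge_min d d d'; rewrite lexx /s /= => h; lra.
have sd' : s < d' by have := ge_min d' d d'; rewrite lexx orbT /s => h; lra.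
have := hd s; rewrite s0 sd => /(_ isT).
have [h1 h2 h3 h4] := hd' s ltac:(rewrite s0 sd' //).
have := hc _ (sub_cl h1); have := hc _ (sub_cl h2).
have := hc _ (sub_cl h3); have := hc _ (sub_cl h4).
have := avg4_sq c s; rewrite /avg4 => e1.
have s2 : 0 < k * s ^+ 2 by rewrite mulr_gt0 // exprn_gt0.
move: e1; set a1 := cn _ ^+ 2; set a2 := cn _ ^+ 2; set a3 := cn _ ^+ 2; set a4 := cn _ ^+ 2.
set a5 := cn _ ^+ 2 => e1 ? ? ? ? ?.
have e2 : k * a1 + k * a2 + k * a3 + k * a4 = 4 * (k * a5) + 4 * (k * s ^+ 2).
  by rewrite -!mulrDr e1; ring.
by lra.
Qed.

Lemma mp_le D u v : opn D -> bdd D -> cont (cl D) u -> cont (cl D) v ->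
  subh D u -> harm D v -> (forall z, bd D z -> u z <= v z) ->
  forall z, cl D z -> u z <= v z.
Proof.
move=> oD bD cu cv hu hv h z Dz; rewrite -subr_le0.
apply: (wmp (v := fun z => u z - v z) oD bD (contB cu cv) (subhB hu hv)) => // w /h.
by rewrite subr_le0.
Qed.

Lemma mp_abs D u v M : opn D -> bdd D -> cont (cl D) u -> cont (cl D) v ->
  harm D u -> harm D v -> (forall z, bd D z -> `|u z - v z| <= M) ->
  forall z, cl D z -> `|u z - v z| <= M.
Proof.
move=> oD bD cu cv hu hv h z Dz; rewrite ler_norml; apply/andP; split.
  rewrite lerNl opprB.
  apply: (wmp (v := fun z => v z - u z) oD bD) => //; first exact: contB.
    by apply: subhB => //; apply: harm_subh.
  by move=> w /h; rewrite ler_norml => /andP[]; lra.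
apply: (wmp (v := fun z => u z - v z) oD bD) => //; first exact: contB.
  by apply: subhB => //; apply: harm_subh.
by move=> w /h; rewrite ler_norml => /andP[].
Qed.

Lemma mp_uniq D u v : opn D -> bdd D -> cont (cl D) u -> cont (cl D) v ->
  harm D u -> harm D v -> (forall z, bd D z -> u z = v z) ->
  forall z, cl D z -> u z = v z.
Proof.
move=> oD bD cu cv hu hv h z Dz; apply/eqP; rewrite -subr_eq0 -normr_le0.
by apply: (mp_abs oD bD) => // w /h ->; rewrite subrr normr0.
Qed.

Definition locbnd (f : C -> C) :=
  exists B d, 0 < d /\ forall h, cn h < d -> cn (f h) <= B.

Lemma locbnd_cst k : locbnd (fun=> k).
Proof. by exists (cn k), 1. Qed.
Lemma locbnd_id : locbnd id.
Proof. by exists 1, 1; split => // h /ltW. Qed.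
Lemma locbndD f g : locbnd f -> locbnd g -> locbnd (fun h => f h + g h).
Proof.
move=> [B [d [d0 hB]]] [B' [d' [d0' hB']]]; exists (B + B'), (Num.min d d').
split; first by rewrite lt_min d0.
by move=> h; rewrite lt_min => /andP[/hB h1 /hB' h2]; apply: cnD_le.
Qed.
Lemma locbndM f g : locbnd f -> locbnd g -> locbnd (fun h => f h * g h).
Proof.
move=> [B [d [d0 hB]]] [B' [d' [d0' hB']]]; exists (B * B'), (Num.min d d').
split; first by rewrite lt_min d0.
move=> h; rewrite lt_min => /andP[/hB h1 /hB' h2]; rewrite cnM.
by apply: ler_pM => //; apply: cn_ge0.
Qed.

Lemma locbnd_quad k0 k1 k2 : locbnd (fun h => k0 + (k1 * h + k2 * (h * h))).
Proof.
apply: (locbndD (locbnd_cst _)); apply: locbndD.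
  exact: locbndM (locbnd_cst _) locbnd_id.
exact: locbndM (locbnd_cst _) (locbndM locbnd_id locbnd_id).
Qed.

(** Stands for holomorphy at [c]: an expansion to second order with a cubic remainder, which is all
    that harmonicity of the real part uses. It is stable under sums and products and covers [z^-1]
    away from 0. *)
Definition taylor3 (g : C -> C) c := exists g1 g2 r d,
  [/\ locbnd r, 0 < d & forall h, cn h < d -> g (c + h) = g c + g1 * h + g2 * h ^+ 2 + h ^+ 3 * r h].

Lemma taylor3_cst k c : taylor3 (fun=> k) c.
Proof.
exists 0, 0, (fun=> 0), 1; split => //; first exact: locbnd_cst.
by move=> h _; rewrite !mul0r mulr0 !addr0.
Qed.
Lemma taylor3_id c : taylor3 id c.
Proof.
exists 1, 0, (fun=> 0), 1; split => //; first exact: locbnd_cst.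
by move=> h _; rewrite mul1r mul0r mulr0 !addr0.
Qed.
Lemma taylor3D f g c : taylor3 f c -> taylor3 g c -> taylor3 (fun z => f z + g z) c.
Proof.
move=> [f1 [f2 [r [d [br d0 hf]]]]] [g1 [g2 [r' [d' [br' d0' hg]]]]].
exists (f1 + g1), (f2 + g2), (fun h => r h + r' h), (Num.min d d').
split; [exact: locbndD | by rewrite lt_min d0 | move=> h].
by rewrite lt_min => /andP[/hf -> /hg ->]; ring.
Qed.
Lemma taylor3M f g c : taylor3 f c -> taylor3 g c -> taylor3 (fun z => f z * g z) c.
Proof.
move=> [f1 [f2 [r [d [br d0 hf]]]]] [g1 [g2 [r' [d' [br' d0' hg]]]]].
exists (f1 * g c + f c * g1), (f2 * g c + f1 * g1 + f c * g2),
  (fun h => (f1 * g2 + f2 * g1 + (f2 * g2 * h + 0 * (h * h)))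
            + r h * (g c + (g1 * h + g2 * (h * h)))
            + r' h * (f c + (f1 * h + f2 * (h * h))) + r h * (r' h * (0 + (0 * h + h * (h * h))))),
  (Num.min d d').
split; last by move=> h; rewrite lt_min => /andP[/hf -> /hg ->]; ring.
  apply: locbndD; [apply: locbndD; [apply: locbndD|]|].
  - exact: locbnd_quad.
  - exact: locbndM br (locbnd_quad _ _ _).
  - exact: locbndM br' (locbnd_quad _ _ _).
  - apply: locbndM br (locbndM br' (locbndD (locbnd_cst _) (locbndD _ _))).
      exact: locbndM (locbnd_cst _) locbnd_id.
    exact: locbndM locbnd_id (locbndM locbnd_id locbnd_id).
by rewrite lt_min d0.
Qed.
Lemma taylor3V c : c != 0 -> taylor3 (fun z => z^-1) c.
Proof.
move=> c0; have cc : 0 < cn c by rewrite cn_gt0.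
exists (- c^-1 ^+ 2), (c^-1 ^+ 3), (fun h => - c^-1 ^+ 3 * (c + h)^-1), (cn c / 2).
have nz h : cn h < cn c / 2 -> cn c / 2 <= cn (c + h).
  by move=> hh; have := cnBD c (- h); rewrite opprK cnN; lra.
split; last 1 first.
- move=> h /nz hh; have : c + h != 0 by rewrite -cn_gt0; apply: lt_le_trans hh; exact: divr2_gt0.
  by move=> ch; field; rewrite ?c0 ?ch.
- apply: locbndM; first exact: locbnd_cst.
  exists (cn c / 2)^-1, (cn c / 2); split; first exact: divr2_gt0.
  move=> h /nz hh; rewrite cnV lef_pV2 ?posrE ?divr2_gt0 //.
  by apply: lt_le_trans hh; exact: divr2_gt0.
- exact: divr2_gt0.
Qed.
Lemma taylor3X f n c : taylor3 f c -> taylor3 (fun z => f z ^+ n) c.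
Proof.
move=> hf; elim: n => [|n IH]; first exact: taylor3_cst.
rewrite (_ : (fun z => _) = (fun z => f z * f z ^+ n)); first exact: taylor3M.
by apply/funext => z; rewrite exprS.
Qed.

(** In the four-point sum the linear terms cancel in pairs and the quadratic ones because
    [1 + 1 + i^2 + i^2 = 0]; what remains is cubic in [s], hence below [e * s ^ 2] for small [s]. *)
Lemma taylor3_harm D g : (forall c, D c -> taylor3 g c) -> harm D (fun z => Re (g z)).
Proof.
move=> hg; split=> c /hg[g1 [g2 [r [d [[B [b [b0 hB]]] d0 h]]]]] e e0.
  have B0 : 0 <= B by apply: le_trans (cn_ge0 (r 0)) (hB 0 _); rewrite cn0.
  pose L := cn g1 + cn g2 + B + 1.
  have L0 : 0 < L by rewrite /L; have := cn_ge0 g1; have := cn_ge0 g2; lra.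
  have eL := divr_gt0 e0 L0.
  exists (Num.min (Num.min d b) (Num.min 1 (e / L))); first by rewrite !lt_min d0 b0 eL ltr01.
  move=> w _; rewrite !lt_min => /andP[/andP[wd wb] /andP[w1 we]].
  set k := w - c in wd wb w1 we *; have -> : w = c + k by rewrite /k; ring.
  rewrite (h k wd) -ReB; apply: le_trans (Re_le _) _.
  rewrite (_ : _ - _ = k * (g1 + (g2 * k + k ^+ 2 * r k))); last by ring.
  rewrite cnM; apply: le_trans (_ : e / L * L <= _); last by rewrite divfK ?gt_eqF.
  apply: ler_pM; rewrite ?cn_ge0 ?(ltW we) //.
  apply: le_trans (cnD _ _) _; rewrite /L -!addrA lerD2l.
  apply: le_trans (cnD _ _) _; apply: lerD.
    by rewrite cnM ler_piMr ?cn_ge0 ?ltW.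
  apply: le_trans (_ : B <= _); last by lra.
  rewrite cnM cnX -[leRHS]mul1r; apply: ler_pM; rewrite ?exprn_ge0 ?cn_ge0 ?hB //.
  by rewrite exprn_ile1 ?cn_ge0 ?ltW.
have B0 : 0 <= B by apply: le_trans (cn_ge0 (r 0)) (hB 0 _); rewrite cn0.
have L0 : 0 < 4 * B + 1 by lra.
have eL := divr_gt0 e0 L0.
exists (Num.min (Num.min d b) (e / (4 * B + 1))); first by rewrite !lt_min d0 b0 eL.
move=> s /andP[s0]; rewrite !lt_min => /andP[/andP[sd sb] se].
have n1 : cn s%:C%C = s by rewrite cnR gtr0_norm.
have n2 : cn (- s%:C%C) = s by rewrite cnN.
have n3 : cn ('i%C * s%:C%C) = s by rewrite cnM cni mul1r.
have n4 : cn (- ('i%C * s%:C%C)) = s by rewrite cnN.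
rewrite /avg4 !h ?n1 ?n2 ?n3 ?n4 //.
rewrite -!ReD (_ : 4 * Re (g c) = Re (4%:R * g c)); last by rewrite ReM /= !addr0 mul0r subr0; ring.
rewrite -ReB; apply: le_trans (Re_le _) _.
set a := s%:C%C in n1 n2 n3 n4 *.
have i2 : 'i%C ^+ 2 = -1 :> C by exact: sqr_i.
rewrite (_ : _ - _ = a ^+ 3 * r a + (- a) ^+ 3 * r (- a) + ('i%C * a) ^+ 3 * r ('i%C * a)
   + (- ('i%C * a)) ^+ 3 * r (- ('i%C * a))); last by rewrite !exprMn i2; ring: i2.
have hk k : cn k = s -> cn (k ^+ 3 * r k) <= s ^+ 2 * (s * B).
  move=> ks; rewrite cnM cnX ks mulrA -exprSr ler_wpM2l ?exprn_ge0 ?(ltW s0) //.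
  by apply: hB; rewrite ks.
apply: le_trans (_ : s ^+ 2 * (s * B) * 4 <= _).
  have := cnD_le (cnD_le (cnD_le (hk _ n1) (hk _ n2)) (hk _ n3)) (hk _ n4) => h4.
  by apply: le_trans h4 _; lra.
rewrite -mulrA [leRHS]mulrC ler_wpM2l ?exprn_ge0 ?(ltW s0) //.
by move: se; rewrite ltr_pdivlMr // => se; nra.
Qed.

Lemma taylor3_poly (P : {poly C}) c : taylor3 (horner P) c.
Proof.
elim/poly_ind: P => [|P k IH].
  have -> : horner (0 : {poly C}) = fun=> 0 by apply/funext => z; rewrite horner0.
  exact: taylor3_cst.
have -> : horner (P * 'X + k%:P) = fun z => P.[z] * z + k.
  by apply/funext => z; rewrite hornerD hornerM hornerX hornerC.
by apply: taylor3D; [apply: taylor3M => //; apply: taylor3_id | apply: taylor3_cst].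
Qed.

Lemma harm_poly D (P : {poly C}) : harm D (fun z => Re P.[z]).
Proof. by apply: taylor3_harm => c _; apply: taylor3_poly. Qed.

End Harmonic.

(** * The Dirichlet problem on a disk *)

Section Fejer.
Context {R : realType}.
Local Notation C := R[i].
Implicit Types (A D K : set C) (u v f : C -> R) (z w c : C) (N n k l : nat) (P : {poly C}).

Definition zeta N : C := Complex (cos (2 * pi / N%:R)) (sin (2 * pi / N%:R)).

Lemma zetaX N k : zeta N ^+ k = Complex (cos (k%:R * (2 * pi / N%:R))) (sin (k%:R * (2 * pi / N%:R))).
Proof.
elim: k => [|k IH]; first by rewrite expr0 mul0r cos0 sin0.
rewrite exprSr IH -[k.+1%:R]natr1 (mulrDl k%:R) mul1r cosD sinD.
by apply: complex_eq; rewrite ?ReM ?ImM /=; ring.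
Qed.

Lemma cn_zeta N : cn (zeta N) = 1.
Proof. by rewrite /cn /= cos2Dsin2 sqrtr1. Qed.

Lemma zetaN N : (0 < N)%N -> zeta N ^+ N = 1.
Proof.
move=> N0; rewrite zetaX mulrC divfK ?pnatr_eq0 ?gtn_eqF //.
by rewrite (_ : 2 * pi = pi *+ 2) ?mulr_natl // cos2pi sin2pi.
Qed.

Lemma zeta_neq1 N k : (0 < k < N)%N -> zeta N ^+ k != 1.
Proof.
move=> /andP[k0 kN]; apply/eqP => /(congr1 (fun z => Re z)) /=.
rewrite zetaX /=; pose t : R := k%:R * pi / N%:R.
have N0 : (0 < N%:R :> R) by rewrite ltr0n (leq_trans _ kN).
have -> : k%:R * (2 * pi / N%:R) = t + t :> R by rewrite /t; field; rewrite gt_eqF.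
have : 0 < sin t.
  apply: sin_gt0_pi; rewrite /t; apply/andP; split.
    by rewrite divr_gt0 // mulr_gt0 ?pi_gt0 ?ltr0n.
  by rewrite ltr_pdivrMr // mulrC ltr_pM2l ?pi_gt0 // ltr_nat.
by have := cos2Dsin2 t; rewrite cosD; nra.
Qed.

Lemma conj_unit z : cn z = 1 -> z * conjc z = 1.
Proof. by move=> h; rewrite mul_conjc h expr1n. Qed.

Definition rt N (j : nat) : C := zeta N ^+ j.

Lemma cn_rt N j : cn (rt N j) = 1.
Proof. by rewrite cnX cn_zeta expr1n. Qed.

Lemma sum_rt N k : (0 < k < N)%N -> \sum_(j < N) rt N j ^+ k = 0.
Proof.
move=> kN; have N0 : (0 < N)%N by case/andP: kN => a /(leq_ltn_trans _); apply.
have h : zeta N ^+ k - 1 != 0 by rewrite subr_eq0 zeta_neq1.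
apply: (mulfI h); rewrite mulr0.
under eq_bigr do rewrite /rt -exprM mulnC exprM.
have := subrX1 (zeta N ^+ k) N; rewrite -exprM mulnC exprM zetaN // expr1n subrr => <- //.

Qed.

Lemma orth N k l : (k < N)%N -> (l < N)%N ->
  \sum_(j < N) rt N j ^+ l * conjc (rt N j) ^+ k = if l == k then N%:R else 0.
Proof.
move=> kN lN.
have u j : rt N j * conjc (rt N j) = 1 by apply/conj_unit/cn_rt.
have [->|] := eqVneq l k.
  under eq_bigr do rewrite -exprMn u expr1n.
  by rewrite sumr_const card_ord.
rewrite neq_ltn => /orP[lk|kl] /=.
  transitivity (conjc (\sum_(j < N) rt N j ^+ (k - l))); last first.
    by rewrite sum_rt ?(rmorph0 conjc) // subn_gt0 lk (leq_ltn_trans (leq_subr _ _) kN).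
  rewrite rmorph_sum; apply: eq_bigr => j _ /=.
  by rewrite -{1}(subnKC (ltnW lk)) exprD mulrA -exprMn u expr1n mul1r (conjc_X (rt _ _)).
rewrite -[RHS](@sum_rt N (l - k)); last by rewrite subn_gt0 kl (leq_ltn_trans (leq_subr _ _) lN).
by apply: eq_bigr => j _; rewrite -{1}(subnK (ltnW kl)) exprD -mulrA -exprMn u expr1n mulr1.
Qed.

Lemma sum_conj_rt N k : (0 < k < N)%N -> \sum_(j < N) conjc (rt N j) ^+ k = 0.
Proof.
move=> h; transitivity (conjc (\sum_(j < N) rt N j ^+ k)).
  by rewrite rmorph_sum; apply: eq_bigr => j _ /=; rewrite (conjc_X (rt _ _)).
by rewrite sum_rt // rmorph0.
Qed.

Lemma addr_conj w : w + conjc w = (2 * Re w)%:C%C.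
Proof. by apply: complex_eq; rewrite ?ReD ?ImD ?ReC ?ImC /=; ring. Qed.

(* Discrete Fourier inversion on the 2n-th roots of unity. *)
Lemma coef_extract P n k : (size P <= n)%N -> (0 < k < n)%N ->
  \sum_(j < n.*2) (2 * Re P.[rt n.*2 j])%:C%C * conjc (rt n.*2 j) ^+ k
    = n.*2%:R * P`_k.
Proof.
move=> hP /andP[k0 kn].
have lt2 (i : nat) : (i < n)%N -> (i < n.*2)%N by move=> h; rewrite -addnn ltn_addl.
under eq_bigr do rewrite -addr_conj mulrDl.
rewrite big_split /=.
rewrite [X in _ + X](_ : _ = 0) ?addr0.
  under eq_bigr do rewrite (horner_coef_wide _ hP) mulr_suml.
  rewrite exchange_big /= (bigD1 (Ordinal kn)) //= [X in _ + X]big1 ?addr0 => [|i ik].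
    under eq_bigr do rewrite -mulrA.
    by rewrite -mulr_sumr orth ?lt2 // eqxx mulrC.
  under eq_bigr do rewrite -mulrA.
  rewrite -mulr_sumr orth ?lt2 //.
  by move: ik; rewrite -(inj_eq val_inj) /= => /negbTE ->; rewrite mulr0.
under eq_bigr do rewrite (horner_coef_wide _ hP) rmorph_sum mulr_suml.
rewrite exchange_big /= big1 // => i _.
under eq_bigr do rewrite rmorphM /= (conjc_X (rt _ _)) -mulrA -exprD.
rewrite -mulr_sumr sum_conj_rt ?mulr0 // addn_gt0 k0 orbT -addnn.
by apply: (ltn_trans (n := i + n)); rewrite ?ltn_add2l ?ltn_add2r.
Qed.

Lemma archi (x : R) : exists n, x < n.+1%:R.
Proof.
exists (Num.bound `|x|); apply: le_lt_trans (ler_norm _) _.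
by apply: lt_trans (archi_boundP (normr_ge0 x)) _; rewrite ltr_nat.
Qed.

Lemma natC n : n%:R = (n%:R)%:C%C :> C.
Proof. by rewrite rmorph_nat. Qed.

Lemma cn_nat n : cn (n%:R : C) = n%:R.
Proof. by rewrite natC cnR ger0_norm. Qed.

(** Discrete Fourier inversion expresses the coefficients through the real part alone. An imaginary
    constant is invisible in [Re P], so of the constant term only the real part is controlled. *)
Lemma coef_bound P M : (forall z, cn z = 1 -> `|Re P.[z]| <= M) ->
  (forall k, (0 < k)%N -> cn P`_k <= 2 * M) /\ `|Re P`_0| <= M.
Proof.
move=> hM; have M0 : 0 <= M by apply: le_trans (hM 1 (@cn1 R)).
split=> [k k0|].
  case: (ltnP k (size P)) => [kn|kn]; last by rewrite nth_default // cn0 mulr_ge0.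
  have n0 : (0 < (size P).*2)%N by rewrite double_gt0 (leq_ltn_trans _ kn).
  have := @coef_extract P (size P) k (leqnn _); rewrite k0 kn => /(_ isT) /(congr1 cn).
  rewrite cnM cn_nat => h.
  rewrite -(ler_pM2l (_ : 0 < (size P).*2%:R)) ?ltr0n // -h.
  apply: le_trans (cn_sum _ _ _) _.
  apply: le_trans (_ : \sum_(j < (size P).*2) 2 * M <= _).
    apply: ler_sum => j _; rewrite cnM cnX cnC cn_rt expr1n mulr1 cnR normrM.
    by rewrite ger0_norm // ler_wpM2l // hM ?cn_rt.
  by rewrite sumr_const card_ord -[_ *+ (size P).*2]mulr_natl.
have h : \sum_(j < (size P).+1) Re P.[rt (size P).+1 j] = (size P).+1%:R * Re P`_0.
  rewrite -Re_sum; transitivity (Re ((size P).+1%:R * P`_0)); last by rewrite natC ReZ.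
  congr (Re _); under eq_bigr do rewrite (horner_coef_wide _ (leqnSn _)).
  rewrite exchange_big /= big_ord_recl [X in _ + X]big1 ?addr0 => [|i _].
    rewrite (eq_bigr (fun=> P`_0)) => [|j _]; first by rewrite sumr_const card_ord mulr_natl.
    by rewrite /= expr0 mulr1.
  by rewrite -mulr_sumr sum_rt ?mulr0 //= /bump leq0n add1n ltnS.
rewrite -(ler_pM2l (_ : 0 < (size P).+1%:R)) ?ltr0n //.
rewrite -[X in X * `|_|]ger0_norm // -normrM -h.
apply: le_trans (ler_norm_sum _ _ _) _.
apply: le_trans (_ : \sum_(j < (size P).+1) M <= _).
  by apply: ler_sum => j _; rewrite hM ?cn_rt.
by rewrite sumr_const card_ord mulr_natl.
Qed.

(** The exponent is [|k - l|] in truncated subtraction. On the unit circle [Re (w ^ |k - l|) = Re (w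
    ^ k * conj w ^ l)], so the real part is the classical Fejer kernel, while the kernel itself is a
    polynomial. *)
Definition fejer_kernel n : {poly C} :=
  n%:R^-1 *: \sum_(k < n) \sum_(l < n) 'X^((k - l) + (l - k)).

Lemma Re_unit_pow w k l : cn w = 1 -> Re (w ^+ k * conjc w ^+ l) = Re (w ^+ ((k - l) + (l - k))).
Proof.
move=> /conj_unit h; case: (leqP k l) => kl.
  rewrite (eqP (_ : (k - l == 0)%N)) // add0n -{1}(subnKC kl) exprD mulrA -exprMn h expr1n mul1r.
  by rewrite -conjc_X ReC.
rewrite (eqP (_ : (l - k == 0)%N)) ?subn_eq0 ?(ltnW kl) // addn0 -{1}(subnK (ltnW kl)) exprD.
by rewrite -mulrA -exprMn h expr1n mulr1.
Qed.

Lemma invn_ReZ n z : Re (n%:R^-1 * z) = n%:R^-1 * Re z.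
Proof. by rewrite natC -fmorphV ReZ. Qed.

Lemma fejer_kernelE n w : cn w = 1 ->
  Re (fejer_kernel n).[w] = n%:R^-1 * \sum_(k < n) \sum_(l < n) Re (w ^+ k * conjc w ^+ l).
Proof.
move=> w1; rewrite hornerZ horner_sum invn_ReZ Re_sum; congr (_ * _); apply: eq_bigr => k _.
rewrite horner_sum Re_sum; apply: eq_bigr => l _.
by rewrite hornerXn Re_unit_pow.
Qed.

Lemma fejer_kernel_sq n w : cn w = 1 ->
  Re (fejer_kernel n).[w] = n%:R^-1 * cn (\sum_(k < n) w ^+ k) ^+ 2.
Proof.
move=> w1; rewrite fejer_kernelE //; congr (_ * _).
transitivity (Re ((\sum_(k < n) w ^+ k) * conjc (\sum_(k < n) w ^+ k))); last by rewrite mul_conjc.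
rewrite mulr_suml Re_sum; apply: eq_bigr => k _.
rewrite rmorph_sum mulr_sumr Re_sum; apply: eq_bigr => l _ /=.
by rewrite conjc_X.
Qed.

(** The convolution with the kernel is a finite sum over roots of unity. Uniform approximation rests
    on positivity, on the exact total mass and on the decay of the kernel like the inverse square of
    the distance. *)
Lemma fejer f M e : cont [set z | cn z = 1] f -> (forall z, cn z = 1 -> `|f z| <= M) -> 0 < e ->
  exists P, forall z, cn z = 1 -> `|Re P.[z] - f z| <= e.
Proof.
move=> cf hM e0; have M0 : 0 <= M by apply: le_trans (hM 1 (@cn1 R)).
have [d d0 hd] : exists2 d, 0 < d & forall z w, cn z = 1 -> cn w = 1 -> cn (w - z) < d ->
    `|f w - f z| <= e / 2.
  apply: (@unif_cont _ [set z | cn z = 1]) => //; last exact: divr2_gt0.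
    move=> z hz /=; apply/eqP; rewrite -subr_eq0 -normr_le0; apply: eps_le => r r0.
    have [w /= w1 wz] := hz r r0; have := cnBD z w; have := cnBD w z.
    by rewrite (cnB z) w1 ler_norml; lra.
  by exists 1 => z /= ->.
(* Far from [z] the values of [f] differ by at most [2 * M], hence by
   [2 * M * |rt N j - z| ^ 2 / d ^ 2]; the remaining factor 4 is that of [moment]. *)
pose B := 8 * M / d ^+ 2.
have [n hn] : exists n, B * 2 / e < n.+1%:R.
  exact: archi.
pose N := n.+1.*2.
have n0 : 0 < n.+1%:R :> R by [].
have N0 : 0 < N%:R :> R by rewrite ltr0n.
exists (N%:R^-1 *: \sum_(j < N) (f (rt N j))%:C%C *: (fejer_kernel n.+1 \Po (conjc (rt N j) *: 'X))).
move=> z z1; pose w j := conjc (rt N j) * z.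
have w1 j : cn (w j) = 1 by rewrite cnM cnC cn_rt z1 mulr1.
pose K j := Re (fejer_kernel n.+1).[w j].
have -> : Re (N%:R^-1 *: \sum_(j < N) (f (rt N j))%:C%C *: (fejer_kernel n.+1 \Po (conjc (rt N j) *: 'X))).[z]
   = N%:R^-1 * \sum_(j < N) f (rt N j) * K j.
  rewrite hornerZ horner_sum invn_ReZ Re_sum; congr (_ * _); apply: eq_bigr => j _.
  by rewrite hornerZ horner_comp (hornerZ (conjc (rt N j)) 'X z) hornerX ReZ.
have K0 j : 0 <= K j by rewrite /K fejer_kernel_sq // mulr_ge0 ?sqr_ge0 ?invr_ge0.
(* All frequencies are below [N], so only the diagonal [k = l] survives. *)
have mass : \sum_(j < N) K j = N%:R.
  rewrite /K; under eq_bigr do rewrite fejer_kernelE //.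
  rewrite -mulr_sumr exchange_big /=.
  rewrite (eq_bigr (fun=> N%:R)) => [|k _]; first by rewrite sumr_const card_ord -[N%:R *+ n.+1]mulr_natl mulKf ?gt_eqF.
  rewrite exchange_big /=.
  have kN (l : 'I_n.+1) : (l < N)%N by rewrite /N -addnn ltn_addl.
  transitivity (\sum_(l < n.+1) Re (z ^+ k * conjc z ^+ l * (if l == k :> nat then N%:R else 0))).
    apply: eq_bigr => l _; rewrite -Re_sum -(orth (kN k) (kN l)) mulr_sumr; congr (Re _).
    apply: eq_bigr => j _; rewrite /w exprMn conjc_mul exprMn.
    by rewrite (_ : conjc (conjc (rt N j)) = rt N j) ?conjcK //; ring.
  rewrite (bigD1 k) //= eqxx big1 ?addr0 => [|l lk].
    by rewrite -exprMn conj_unit // expr1n mul1r natC.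
  by rewrite (negbTE (_ : (l != k :> nat))) ?mulr0 //; apply: contra lk => /eqP/val_inj ->.
(* The geometric sum telescopes: multiplied by [w j - 1] it becomes [w j ^ n.+1 - 1], of modulus at
   most 2. *)
have moment j : K j * cn (rt N j - z) ^+ 2 <= 4 / n.+1%:R.
  have -> : cn (rt N j - z) = cn (w j - 1).
    rewrite (_ : rt N j - z = rt N j * (1 - w j)); first by rewrite cnM cn_rt mul1r cnB.
    by rewrite /w mulrBr mulr1 mulrA conj_unit ?cn_rt // mul1r.
  rewrite /K fejer_kernel_sq // -mulrA -exprMn -cnM (mulrC (\sum_(_ < _) _)) -subrX1 mulrC ler_wpM2r ?invr_ge0 //.
  have : cn (w j ^+ n.+1 - 1) <= 2.
    by apply: le_trans (cnD _ _) _; rewrite cnN cn1 cnX w1 expr1n.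
  by have := cn_ge0 (w j ^+ n.+1 - 1); nra.
have -> : N%:R^-1 * (\sum_(j < N) f (rt N j) * K j) - f z = N%:R^-1 * \sum_(j < N) K j * (f (rt N j) - f z).
  under [in RHS]eq_bigr do rewrite mulrBr.
  rewrite big_split /= sumrN -mulr_suml mass mulrDr -mulrN mulKf ?gt_eqF //.
  by under eq_bigr do rewrite mulrC.
rewrite normrM ger0_norm ?invr_ge0 // mulrC ler_pdivrMr //.
apply: le_trans (ler_norm_sum _ _ _) _.
apply: le_trans (_ : \sum_(j < N) (K j * (e / 2) + e / 2) <= _); last first.
  by rewrite big_split /= -mulr_suml mass sumr_const card_ord -[(e / 2) *+ N]mulr_natl -mulrDr -splitr mulrC.
apply: ler_sum => j _; rewrite normrM (ger0_norm (K0 j)).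
have Be : B / n.+1%:R <= e / 2.
  by rewrite ler_pdivrMr //; move: hn; rewrite ltr_pdivrMr //; nra.
have B0 : 0 <= B by rewrite /B !mulr_ge0 ?invr_ge0 ?exprn_ge0 ?(ltW d0).
case: (ltP (cn (rt N j - z)) d) => hj.
  apply: le_trans (_ : K j * (e / 2) <= _); last by have := divr2_gt0 e0; lra.
  by rewrite ler_wpM2l // hd ?cn_rt.
apply: le_trans (_ : e / 2 <= _); last by have := mulr_ge0 (K0 j) (ltW (divr2_gt0 e0)); lra.
apply: le_trans Be; apply: le_trans (_ : K j * (2 * M / d ^+ 2 * cn (rt N j - z) ^+ 2) <= _).
  rewrite ler_wpM2l //; apply: le_trans (ler_normB _ _) _.
  apply: le_trans (lerD (hM _ (cn_rt _ _)) (hM _ z1)) _.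
  have hq : 1 <= cn (rt N j - z) ^+ 2 / d ^+ 2.
    by rewrite ler_pdivlMr ?exprn_gt0 // mul1r lerXn2r ?nnegrE ?cn_ge0 // ltW.
  rewrite (_ : M + M = 2 * M); last by ring.
  by rewrite mulrAC -mulrA ler_peMr ?mulr_ge0.
rewrite mulrCA; apply: le_trans (ler_wpM2l _ (moment j)) _.
  by rewrite !mulr_ge0 ?invr_ge0 ?exprn_ge0 ?(ltW d0).
by rewrite /B le_eqVlt; apply/orP; left; apply/eqP; field; rewrite ?gt_eqF.
Qed.
End Fejer.

(** * Power series on disks and the Dirichlet problem by approximation *)

Section Disk.
Context {R : realType}.
Local Notation C := R[i].
Implicit Types (A D K : set C) (u v f q : C -> R) (z w c : C) (n k : nat) (P : {poly C}) (r M e : R).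

Definition disk c r : set C := [set z | cn (z - c) < r].
Definition cdisk c r : set C := [set z | cn (z - c) <= r].

Arguments disk c r z /.
Arguments cdisk c r z /.

Lemma disk_opn c r : opn (disk c r).
Proof.
move=> z /= zc; exists (r - cn (z - c)); first by rewrite subr_gt0.
by move=> w wz /=; have := cn_tri z w c; rewrite /disk /=; lra.
Qed.

Lemma disk_cdisk c r : disk c r `<=` cdisk c r.
Proof. by move=> z /ltW. Qed.

Lemma cdisk_closed c r : cl (cdisk c r) `<=` cdisk c r.
Proof.
move=> z hz /=; apply: eps_le => e e0; have [w /= wc wz] := hz e e0.
by have := cn_tri w z c; rewrite (cnB z w); lra.
Qed.

Lemma cl_disk c r : cl (disk c r) `<=` cdisk c r.
Proof. by apply: subset_trans (@cdisk_closed c r); apply: cl_sub; exact: disk_cdisk. Qed.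

Lemma cdisk_bdd c r : bdd (cdisk c r).
Proof. by exists (r + cn c) => z /= h; have := cn_tri c z 0; rewrite !subr0; lra. Qed.

Lemma bdd_sub A D : A `<=` D -> bdd D -> bdd A.
Proof. by move=> AD [B hB]; exists B => z /AD /hB. Qed.

Lemma disk_bdd c r : bdd (disk c r).
Proof. exact: bdd_sub (@disk_cdisk c r) (@cdisk_bdd c r). Qed.

Lemma bd_disk c r z : bd (disk c r) z -> cn (z - c) = r.
Proof.
by move=> [/cl_disk /= h] /negP; rewrite -leNgt => h'; apply/eqP; rewrite eq_le h h'.
Qed.

Lemma cdisk_cl c r : 0 < r -> cdisk c r `<=` cl (disk c r).
Proof.
move=> r0 z /= zc e e0; case: (ltP (cn (z - c)) r) => h; first by exists z => //; rewrite subrr cn0.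
have zr : cn (z - c) = r by apply/eqP; rewrite eq_le zc h.
pose t := Num.min (e / 2) r / (2 * r).
have m0 : 0 < Num.min (e / 2) r by rewrite lt_min divr2_gt0.
have t0 : 0 < t by rewrite divr_gt0 // mulr_gt0.
have t1 : t <= 1 / 2.
  rewrite ler_pdivrMr ?mulr_gt0 // ge_min; apply/orP; right; lra.
have tr : t * r < e.
  have -> : t * r = Num.min (e / 2) r / 2 by rewrite /t; field; rewrite gt_eqF.
  have : Num.min (e / 2) r <= e / 2 by rewrite ge_min lexx.
  by lra.
exists (z - t%:C%C * (z - c)).
  rewrite /disk /= (_ : _ - c = (1 - t)%:C%C * (z - c)); last by rewrite rmorphB /=; ring.
  by rewrite cnM cnR zr ger0_norm; [have := mulr_gt0 t0 r0; lra | lra].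
by rewrite addrAC subrr add0r cnN cnM cnR zr ger0_norm // ltW.
Qed.

(* [w] is the coordinate centred at [c] and scaled by [r]. *)
Definition rep u c r M (a : nat -> C) := (forall k, cn (a k) <= 2 * M) /\
  forall w, cn w < 1 -> tends (fun n => \sum_(k < n) Re (a k * w ^+ k)) (u (c + r%:C%C * w)).

Lemma rep_geo (a : nat -> C) M w (t : R) : (forall k, cn (a k) <= M) -> cn w <= t ->
  geo M t (fun k => Re (a k * w ^+ k)).
Proof.
move=> ha wt k; apply: le_trans (Re_le _) _; rewrite cnM cnX.
by apply: ler_pM; rewrite ?cn_ge0 ?exprn_ge0 ?cn_ge0 // lerXn2r ?nnegrE ?(le_trans _ wt) ?cn_ge0.
Qed.

Lemma rep_tail u c r M a w (t : R) n : rep u c r M a -> cn w <= t -> t < 1 ->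
  `|u (c + r%:C%C * w) - \sum_(k < n) Re (a k * w ^+ k)| <= 2 * M * t ^+ n / (1 - t).
Proof.
move=> [ha hu] wt t1.
have ht : 0 <= t < 1 by rewrite t1 (le_trans _ wt) ?cn_ge0.
have := ser_tail n ht (rep_geo ha wt).
by rewrite (tends_ser (hu w (le_lt_trans wt t1))).
Qed.

Lemma rep_ge0 u c r M a : rep u c r M a -> 0 <= M.
Proof. by move=> [/(_ 0%N) h _]; have := cn_ge0 (a 0%N); lra. Qed.

(** Degrees 1 to 3 cancel over the four points [w], [- w], [i w], [- i w], so the error starts at
    degree 4. *)
Lemma rep_avg u c r M a : 0 < r -> rep u c r M a -> forall e, 0 < e ->
  exists2 d, 0 < d & forall s, 0 < s < d -> `|avg4 u c s - 4 * u c| <= e * s ^+ 2.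
Proof.
move=> r0 hr e e0; have M0 := rep_ge0 hr.
have M1 : 0 < 16 * M + 1 by lra.
pose m := Num.min (1 / 2) (e * r ^+ 2 / (16 * M + 1)).
have m0 : 0 < m by rewrite lt_min; apply/andP; split; [lra | rewrite !(divr_gt0, mulr_gt0) ?exprn_gt0].
exists (r * m); first exact: mulr_gt0.
move=> s /andP[s0 sd]; pose t := s / r.
have t0 : 0 < t by rewrite divr_gt0.
have tm : t < m by rewrite ltr_pdivrMr // mulrC.
have t2 : t < 1 / 2 by apply: lt_le_trans tm _; rewrite ge_min lexx.
have te : t < e * r ^+ 2 / (16 * M + 1) by apply: lt_le_trans tm _; rewrite ge_min lexx orbT.
have st : s%:C%C = r%:C%C * t%:C%C :> C by rewrite -rmorphM /= mulrC divfK ?gt_eqF.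
have uc : u c = Re (a 0%N).
  apply: tends_unique (_ : tends (fun=> Re (a 0%N)) _); last exact: tends_cst.
  have := (hr.2 0); rewrite cn0 mulr0 addr0 => /(_ ltr01) h.
  move=> e' e'0; have [N hN] := h e' e'0; exists N.+1 => -[//|n] Nn.
  have := hN n.+1 (ltnW Nn); rewrite big_ord_recl big1 ?addr0 => [|i _]; last by rewrite expr0n /= mulr0.
  by rewrite expr0 mulr1.
pose S w := \sum_(k < 4) Re (a k * w ^+ k).
have tail w : cn w = t -> `|u (c + r%:C%C * w) - S w| <= 4 * M * t ^+ 4.
  move=> wt; have := rep_tail 4 hr (t := t) (w := w) ltac:(by rewrite wt) ltac:(lra).
  move=> h; apply: le_trans h _; rewrite ler_pdivrMr; last by lra.
  by have := mulr_ge0 M0 (exprn_ge0 4 (ltW t0)); nra.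
have n1 : cn t%:C%C = t by rewrite cnR gtr0_norm.
have n3 : cn ('i%C * t%:C%C) = t by rewrite cnM cni mul1r.
have hS w : S w + S (- w) + S ('i%C * w) + S (- ('i%C * w)) = 4 * u c.
  have i2 : 'i%C ^+ 2 = -1 :> C by exact: sqr_i.
  rewrite /S -!big_split /= uc !big_ord_recl big_ord0 /= /bump /= addr0 -!ReD.
  rewrite (_ : 4 * Re (a 0%N) = Re (4%:R * a 0%N)); last by rewrite ReM /= !addr0 mul0r subr0; ring.
  by congr (Re _); ring: i2.
have key : 16 * M * t ^+ 4 <= e * s ^+ 2.
  have -> : e * s ^+ 2 = e * r ^+ 2 * t ^+ 2.
    by rewrite -mulrA -exprMn /t (mulrC r) divfK ?gt_eqF.
  have h1 : t * (16 * M + 1) < e * r ^+ 2 by rewrite -ltr_pdivlMr.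
  have h2 : t ^+ 2 * (16 * M) <= e * r ^+ 2.
    by apply: le_trans (ltW h1); rewrite expr2 -mulrA ler_wpM2l ?(ltW t0) //; nra.
  have -> : 16 * M * t ^+ 4 = t ^+ 2 * (16 * M) * t ^+ 2 by ring.
  by rewrite ler_wpM2r ?exprn_ge0 ?(ltW t0).
have := tail _ n1; have := tail (- t%:C%C); rewrite cnN => /(_ n1).
have := tail _ n3; have := tail (- ('i%C * t%:C%C)); rewrite cnN => /(_ n3).
rewrite !mulrN mulrCA -st => h1 h2 h3 h4; rewrite /avg4 -(hS t%:C%C).
clear tail hS; move: (S _) (S _) (S _) (S _) h1 h2 h3 h4 => S1 S2 S3 S4.
rewrite !ler_norml => /andP[? ?] /andP[? ?] /andP[? ?] /andP[? ?].
by apply/andP; lra.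
Qed.

Definition split_lim (x : nat -> C) (l : C) := forall e, 0 < e -> exists N, forall n, (N <= n)%N -> cn (x n - l) <= e.

Lemma cauchy_complex (x : nat -> C) :
  (forall e, 0 < e -> exists N, forall m n, (N <= m)%N -> (N <= n)%N -> cn (x m - x n) <= e) ->
  exists l, split_lim x l.
Proof.
move=> h.
have [a ha] : exists l, tends (fun n => Re (x n)) l.
  apply: cauchy_tends => e /h[N hN]; exists N => m n Nm Nn.
  by rewrite -ReB; apply: le_trans (Re_le _) (hN _ _ Nm Nn).
have [b hb] : exists l, tends (fun n => Im (x n)) l.
  apply: cauchy_tends => e /h[N hN]; exists N => m n Nm Nn.
  by rewrite -ImB; apply: le_trans (Im_le _) (hN _ _ Nm Nn).
exists (Complex a b) => e e0; have e2 := divr2_gt0 e0.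
have [N hN] := ha _ e2; have [N' hN'] := hb _ e2.
exists (maxn N N') => n; rewrite geq_max => /andP[/hN h1 /hN' h2].
by apply: le_trans (cn_ReIm _) _; rewrite ReB ImB /=; lra.
Qed.

(** Coefficient bounds applied to differences of the polynomials show that every coefficient
    converges, with an error uniform in the degree; the limits are the coefficients of the
    series. *)
Lemma poly_lim_rep (Ps : nat -> {poly C}) q c r M :
  (forall e, 0 < e -> exists N, forall n, (N <= n)%N -> forall z, cn (z - c) <= r ->
    `|Re (Ps n).[z] - q z| <= e) ->
  0 < r -> (forall z, cn (z - c) = r -> `|q z| <= M) -> exists a, rep q c r M a.
Proof.
move=> hP r0 hM.
pose Q n := Ps n \Po (r%:C%C *: 'X + c%:P).
have QE n w : (Q n).[w] = (Ps n).[c + r%:C%C * w].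
  by rewrite horner_comp hornerD hornerZ hornerX hornerC addrC.
have zc w : cn (c + r%:C%C * w - c) = r * cn w by rewrite addrAC subrr add0r cnM cnR gtr0_norm.
have hQ e : 0 < e -> exists N, forall n, (N <= n)%N -> forall w, cn w <= 1 ->
    `|Re (Q n).[w] - q (c + r%:C%C * w)| <= e.
  move=> /hP[N hN]; exists N => n Nn w w1; rewrite QE; apply: hN => //.
  by rewrite zc ler_piMr // ltW.
have cfB m n e : (forall w, cn w <= 1 -> `|Re (Q m).[w] - q (c + r%:C%C * w)| <= e) ->
    (forall w, cn w <= 1 -> `|Re (Q n).[w] - q (c + r%:C%C * w)| <= e) ->
    forall k, (0 < k)%N -> cn ((Q m)`_k - (Q n)`_k) <= 4 * e.
  move=> hm hn k k0; rewrite -coefB (_ : 4 * e = 2 * (2 * e)); last by ring.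
  apply: (coef_bound (M := 2 * e) _).1 => // w w1; rewrite hornerD hornerN ReB.
  have := hm w; have := hn w; rewrite w1 lexx => /(_ isT) + /(_ isT).
  by rewrite !ler_norml => /andP[? ?] /andP[? ?]; apply/andP; lra.
have cfB0 m n e : (forall w, cn w <= 1 -> `|Re (Q m).[w] - q (c + r%:C%C * w)| <= e) ->
    (forall w, cn w <= 1 -> `|Re (Q n).[w] - q (c + r%:C%C * w)| <= e) ->
    `|Re (Q m)`_0 - Re (Q n)`_0| <= 2 * e.
  move=> hm hn; rewrite -ReB -coefB.
  apply: (coef_bound (M := 2 * e) _).2 => // w w1; rewrite hornerD hornerN ReB.
  have := hm w; have := hn w; rewrite w1 lexx => /(_ isT) + /(_ isT).
  by rewrite !ler_norml => /andP[? ?] /andP[? ?]; apply/andP; lra.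
(* the imaginary part of the constant coefficient is not determined by q *)
pose b n k := if k is 0%N then (Re (Q n)`_0)%:C%C else (Q n)`_k.
have bB m n e k : (forall w, cn w <= 1 -> `|Re (Q m).[w] - q (c + r%:C%C * w)| <= e) ->
    (forall w, cn w <= 1 -> `|Re (Q n).[w] - q (c + r%:C%C * w)| <= e) ->
    cn (b m k - b n k) <= 4 * e.
  move=> hm hn; case: k => [|k]; last exact: cfB.
  rewrite /b -rmorphB cnR; have := cfB0 m n e hm hn.
  by have := le_trans (normr_ge0 _) (hm 0 ltac:(by rewrite cn0 ler01)); lra.
have hc k : exists l, split_lim (fun n => b n k) l.
  apply: cauchy_complex => e e0; have [N hN] := hQ (e / 4) ltac:(lra).
  by exists N => m n Nm Nn; have := bB m n (e / 4) k (hN _ Nm) (hN _ Nn); lra.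
have [a ha] := choice hc.
have aB n e k : 0 < e -> (exists N, forall m, (N <= m)%N -> forall w, cn w <= 1 ->
    `|Re (Q m).[w] - q (c + r%:C%C * w)| <= e) ->
    (forall w, cn w <= 1 -> `|Re (Q n).[w] - q (c + r%:C%C * w)| <= e) ->
    cn (b n k - a k) <= 4 * e.
  move=> e0 [N hN] hn; apply: eps_le => e' e'0; have [N' hN'] := ha k e' e'0.
  apply: le_trans (cn_tri (b (maxn N N') k) _ _) _; apply: lerD; last exact: hN' (leq_maxr _ _).
  by apply: bB => //; apply: hN (leq_maxl _ _).
exists a; split=> [k|w w1].
  apply: eps_le => e e0; have [N hN] := hQ (e / 6) ltac:(lra).
  have h1 : cn (b N k - a k) <= 4 * (e / 6).
    by apply: aB; [lra | exists N | apply: hN].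
  have hb w : cn w = 1 -> `|Re (Q N).[w]| <= M + e / 6.
    move=> w1; have := hN N (leqnn _) w; rewrite w1 lexx => /(_ isT).
    have := hM (c + r%:C%C * w); rewrite zc w1 mulr1 => /(_ erefl).
    by rewrite !ler_norml => /andP[? ?] /andP[? ?]; apply/andP; lra.
  have h2 : cn (b N k) <= 2 * (M + e / 6).
    case: (k) => [|k']; last exact: (coef_bound hb).1.
    by have := (coef_bound hb).2; rewrite /b cnR; have := normr_ge0 (Re (Q N)`_0); lra.
  by have := cn_tri (b N k) (a k) 0; rewrite !subr0 (cnB (a k)); lra.
move=> e e0; have w10 : 0 < 1 - cn w by rewrite subr_gt0.
(* Absorbs the geometric factor [1 / (1 - cn w)]: the change of coefficients costs [4 * e / 5] and
   the approximation by a polynomial [e / 5]. *)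
pose e' := e * (1 - cn w) / 5.
have e'0 : 0 < e' by rewrite /e' divr_gt0 // mulr_gt0.
have [N hN] := hQ e' e'0; exists (size (Q N)) => m hm.
have h1 := hN N (leqnn _) w (ltW w1).
have h2 : Re (Q N).[w] = \sum_(k < m) Re (b N k * w ^+ k).
  rewrite (horner_coef_wide _ hm) Re_sum; apply: eq_bigr => k _.
  by case: k => [[|k] hk]; rewrite /b /= ?expr0 ?mulr1 /= ?mulr1 ?mul0r ?subr0.
have h3 : `|\sum_(k < m) Re (a k * w ^+ k) - \sum_(k < m) Re (b N k * w ^+ k)| <= 4 * e' / (1 - cn w).
  rewrite -sumrB; have := @ser_tail _ (4 * e') (cn w) (fun k => Re ((a k - b N k) * w ^+ k)).
  have hg : geo (4 * e') (cn w) (fun k => Re ((a k - b N k) * w ^+ k)).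
    by apply: rep_geo => // k; rewrite cnB; apply: aB => //; [exists N | apply: hN].
  move=> _; have := @geo_tail _ _ _ _ 0 m _ hg (leq0n _); rewrite w1 cn_ge0 => /(_ isT).
  rewrite big_ord0 subr0 expr0 mulr1; under [in X in X -> _]eq_bigr do rewrite mulrBl ReB.
  by [].
rewrite h2 in h1.
have h4 : 4 * e' / (1 - cn w) = 4 * e / 5 by rewrite /e'; field; rewrite gt_eqF.
have h5 : e' <= e / 5 by rewrite /e' ler_pM2r ?invr_gt0 // ler_piMr ?(ltW e0) //; have := cn_ge0 w; lra.
rewrite h4 in h3; move: h1 h3; rewrite !ler_norml => /andP[? ?] /andP[? ?]; apply/andP; lra.
Qed.

Lemma rep_sub_disk c r z : disk c r z -> exists2 s, 0 < s & cdisk z s `<=` disk c r.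
Proof.
move=> h; exists ((r - cn (z - c)) / 2); first by rewrite divr2_gt0 // subr_gt0.
by move=> w /= wz; have := cn_tri z w c; move: h; rewrite /disk /= in wz *; lra.
Qed.

(** Fejer polynomials approximate the datum on the circle and the maximum principle carries the
    convergence into the disk. Around each interior point the limit is a uniform limit of real parts
    of polynomials, hence a power series, hence harmonic. *)
Theorem disk_dirichlet f c r M : 0 < r -> cont [set z | cn (z - c) = r] f ->
  (forall z, cn (z - c) = r -> `|f z| <= M) ->
  exists q, [/\ cont (cdisk c r) q, harm (disk c r) q, forall z, cn (z - c) = r -> q z = f z
    & exists a, rep q c r M a].
Proof.
move=> r0 cf hM.
have rC : r%:C%C != 0 :> C by rewrite -cn_eq0 cnR normr_eq0 gt_eqF.
have zw w : cn (c + r%:C%C * w - c) = r * cn w by rewrite addrAC subrr add0r cnM cnR gtr0_norm.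
have /choice[Ps hPs] : forall n, exists P, forall z, cn (z - c) = r -> `|Re P.[z] - f z| <= n.+1%:R^-1.
  move=> n.
  have [|w w1|//|P hP] := @fejer R (fun w => f (c + r%:C%C * w)) M n.+1%:R^-1.
  - move=> w /= w1 e e0; have [d d0 hd] := cf (c + r%:C%C * w) ltac:(by rewrite /= zw w1 mulr1) e e0.
    exists (d / r); first exact: divr_gt0.
    move=> w' /= w'1 ww; apply: hd; first by rewrite /= zw w'1 mulr1.
    rewrite (_ : _ - _ = r%:C%C * (w' - w)); last by ring.
    by rewrite cnM cnR gtr0_norm // mulrC -ltr_pdivlMr.
  - by apply: hM; rewrite zw w1 mulr1.
  exists (P \Po (r%:C%C^-1 *: ('X - c%:P))) => z zc.
  rewrite horner_comp hornerZ hornerD hornerN hornerX hornerC.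
  have := hP (r%:C%C^-1 * (z - c)); rewrite cnM cnV cnR zc gtr0_norm // mulVf ?gt_eqF // => /(_ erefl).
  by rewrite mulVKf // [c + _]addrC subrK.
have unif m n z : cn (z - c) <= r -> `|Re (Ps m).[z] - Re (Ps n).[z]| <= m.+1%:R^-1 + n.+1%:R^-1.
  move=> zc; apply: (@mp_abs _ (disk c r) (fun z => Re (Ps m).[z]) (fun z => Re (Ps n).[z])).
  - exact: disk_opn.
  - exact: disk_bdd.
  - exact: cont_sub (@subsetT _ _) (harm_poly setT _).1.
  - exact: cont_sub (@subsetT _ _) (harm_poly setT _).1.
  - exact: harm_poly.
  - exact: harm_poly.
  - move=> w /bd_disk wc; have := hPs m w wc; have := hPs n w wc.
    move: (m.+1%:R^-1) (n.+1%:R^-1) => a b.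
    by rewrite !ler_norml => /andP[? ?] /andP[? ?]; apply/andP; lra.
  - exact: cdisk_cl.
have small e : 0 < e -> exists N, forall n, (N <= n)%N -> n.+1%:R^-1 <= e.
  move=> e0; have [N hN] := archi (e^-1); exists N => n Nn.
  rewrite -[e]invrK lef_pV2 ?posrE ?invr_gt0 //; apply: le_trans (ltW hN) _.
  by rewrite ler_nat.
have /choice[q hq] : forall z, exists l, cn (z - c) <= r -> tends (fun n => Re (Ps n).[z]) l.
  move=> z.
  case: (leP (cn (z - c)) r) => zc; last by exists 0.
  have [|l hl] := @cauchy_tends _ (fun n => Re (Ps n).[z]); last by exists l.
  move=> e e0; have [N hN] := small _ (divr2_gt0 e0); exists N => m n /hN h1 /hN h2.
  apply: le_trans (unif m n z zc) _; move: (m.+1%:R^-1) (n.+1%:R^-1) h1 h2 => a b; lra.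
have hqu e : 0 < e -> exists N, forall n, (N <= n)%N -> forall z, cn (z - c) <= r -> `|Re (Ps n).[z] - q z| <= e.
  move=> e0; have [N hN] := small _ (divr2_gt0 e0); exists N => n Nn z zc.
  have h := tendsB (tends_cst (Re (Ps n).[z])) (hq z zc).
  have hh m : (N <= m)%N -> `|Re (Ps n).[z] - Re (Ps m).[z]| <= e.
    move=> Nm; apply: le_trans (unif n m z zc) _; have := hN n Nn; have := hN m Nm.
    by move: (m.+1%:R^-1) (n.+1%:R^-1) => a b; lra.
  rewrite ler_norml; apply/andP; split.
    rewrite lerNl; apply: (tends_le (tendsN h)); exists N => m /hh.
    by rewrite ler_norml => /andP[]; lra.
  by apply: (tends_le h); exists N => m /hh; rewrite ler_norml => /andP[].
have qf z : cn (z - c) = r -> q z = f z.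
  move=> zc; apply: tends_unique (hq z _) _; first by rewrite zc.
  by move=> e /small[N hN]; exists N => n /hN; apply: le_trans; apply: hPs.
have cq : cont (cdisk c r) q.
  apply: cont_unif => e /hqu[N hN]; exists (fun z => Re (Ps N).[z]).
    exact: cont_sub (@subsetT _ _) (harm_poly setT _).1.
  exact: hN.
exists q; split => //.
  split; first exact: cont_sub (@disk_cdisk _ _) cq.
  move=> z zD; have [s s0 hs] := rep_sub_disk zD.
  have [B B0 hB] := evt_bound (@cdisk_closed c r) (@cdisk_bdd c r) cq.
  have [|//||a ha] := @poly_lim_rep Ps q z s B.
  - by move=> e /hqu[N hN]; exists N => n Nn w wz; apply: hN => //; apply: ltW; apply: hs.
  - by move=> w wz; apply: hB; apply: ltW; apply: hs; rewrite /cdisk /= wz.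
  exact: rep_avg ha.
by apply: poly_lim_rep hqu _ _ => // z zc; rewrite qf // hM.
Qed.

End Disk.
Arguments disk {R} c r z /.
Arguments cdisk {R} c r z /.

(** * Local power series, changes of variable and the reflection principle *)

Section Representation.
Context {R : realType}.
Local Notation C := R[i].
Implicit Types (A D K : set C) (u v f q : C -> R) (z w c : C) (n k : nat) (r M e : R).

Lemma circle_cdisk c r : [set z | cn (z - c) = r] `<=` cdisk c r.
Proof. by move=> z /= ->. Qed.

Lemma cont_cl_disk c r u : cont (cdisk c r) u -> cont (cl (disk c r)) u.
Proof. exact: cont_sub (@cl_disk _ c r). Qed.

Lemma harm_rep u c r M : 0 < r -> cont (cdisk c r) u -> harm (disk c r) u ->
  (forall z, cn (z - c) = r -> `|u z| <= M) -> exists a, rep u c r M a.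
Proof.
move=> r0 cu hu hM.
have [q [cq hq qu [a ha]]] := disk_dirichlet r0 (cont_sub (@circle_cdisk c r) cu) hM.
exists a; split; first exact: ha.1.
move=> w w1; rewrite (_ : u _ = q (c + r%:C%C * w)); first exact: ha.2.
apply: (mp_uniq (@disk_opn _ c r) (@disk_bdd _ c r) (cont_cl_disk cu) (cont_cl_disk cq) hu hq).
  by move=> z /bd_disk /qu ->.
by apply: sub_cl; rewrite /= addrAC subrr add0r cnM cnR gtr0_norm // -[ltRHS]mulr1 ltr_pM2l.
Qed.

(** Second differences do not pass to the limit directly. On a disk the limit is identified with the
    Dirichlet solution having its boundary values, by the maximum principle applied to the
    approximants. *)
Lemma harm_unif D u : opn D ->
  (forall e, 0 < e -> exists2 v, harm D v & forall z, D z -> `|v z - u z| <= e) -> harm D u.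
Proof.
move=> oD h.
have cu : cont D u by apply: cont_unif => e /h[v [cv _] hv]; exists v.
apply: harm_loc => c Dc; have [r r0 hr] := oD c Dc.
have r2 := divr2_gt0 r0.
have sD : cdisk c (r / 2) `<=` D by move=> z /= zc; apply: hr; lra.
have cu' := cont_sub sD cu.
have [M _ hM] := evt_bound (@cdisk_closed _ c (r / 2)) (@cdisk_bdd _ c (r / 2)) cu'.
have [q [cq hq qu _]] := disk_dirichlet r2 (cont_sub (@circle_cdisk c _) cu')
  (fun z zc => hM z (circle_cdisk zc)).
exists (disk c (r / 2)); first by split; [exact: disk_opn | rewrite /= subrr cn0].
apply: (harm_eq _ _ hq); first exact: disk_opn.
move=> z /disk_cdisk zD; apply/eqP; rewrite -subr_eq0 -normr_le0; apply: eps_le => e e0.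
have [v hv uv] := h _ (divr2_gt0 e0); have [cv _] := hv.
have : `|q z - v z| <= e / 2.
  apply: (@mp_abs _ (disk c (r / 2)) q v) => //; last exact: cdisk_cl.
  - exact: disk_opn.
  - exact: disk_bdd.
  - exact: cont_cl_disk.
  - exact/cont_cl_disk/(cont_sub sD).
  - by apply: (harm_sub _ hv); apply: subset_trans sD; apply: disk_cdisk.
  move=> w /bd_disk wc; rewrite qu // distrC; apply: uv.
  exact/sD/circle_cdisk.
have := uv z (sD z zD).
by rewrite !ler_norml => /andP[? ?] /andP[? ?]; apply/andP; lra.
Qed.

Lemma harm_disk_rep D u c : opn D -> harm D u -> D c -> exists2 r, 0 < r &
  exists M a, rep u c r M a.
Proof.
move=> oD hu Dc; have [r r0 hr] := oD c Dc; have r2 := divr2_gt0 r0.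
have sD : cdisk c (r / 2) `<=` D by move=> z /= zc; apply: hr; lra.
have cu := cont_sub sD hu.1.
have [M _ hM] := evt_bound (@cdisk_closed _ c (r / 2)) (@cdisk_bdd _ c (r / 2)) cu.
exists (r / 2) => //; exists M.
have hd : harm (disk c (r / 2)) u.
  by apply: (harm_sub _ hu); apply: subset_trans sD; apply: disk_cdisk.
exact: (harm_rep r2 cu hd (fun z zc => hM z (circle_cdisk zc))).
Qed.

Lemma cont_affine A u c l : cont A u -> cont [set z | A (c + l * z)] (fun z => u (c + l * z)).
Proof.
move=> hu z Az e e0; have [d d0 hd] := hu _ Az e e0.
have l1 : 0 < cn l + 1 by have := cn_ge0 l; lra.
exists (d / (cn l + 1)); first exact: divr_gt0.
move=> w Aw wz; apply: hd => //; rewrite (_ : _ - _ = l * (w - z)); last by ring.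
rewrite cnM; apply: le_lt_trans (_ : (cn l + 1) * cn (w - z) < _).
  by rewrite ler_wpM2r ?cn_ge0 //; lra.
by rewrite mulrC -ltr_pdivlMr.
Qed.

(** Multiplication by [l] may turn the cross of four neighbours, so the condition cannot be
    transported pointwise. The local power series can: its coefficients are multiplied by powers of
    a unimodular number. *)
Lemma harm_affine D u c l : opn D -> l != 0 -> harm D u ->
  harm [set z | D (c + l * z)] (fun z => u (c + l * z)).
Proof.
move=> oD l0 hu; split; first exact: cont_affine hu.1.
move=> z Dz; have [r r0 [M [a [ha hr]]]] := harm_disk_rep oD hu Dz.
have ln : 0 < cn l by rewrite cn_gt0.
apply: (@rep_avg _ _ z (r / cn l) M (fun k => a k * (l / (cn l)%:C%C) ^+ k)).
  exact: divr_gt0.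
have lC : (cn l)%:C%C != 0 :> C by rewrite -cn_eq0 cnR normr_eq0 gt_eqF.
have l1 : cn (l / (cn l)%:C%C) = 1.
  by rewrite cnM cnV cnR ger0_norm ?cn_ge0 // mulfV ?gt_eqF.
split=> [k|w w1]; first by rewrite cnM cnX l1 expr1n mulr1.
have := hr (l / (cn l)%:C%C * w); rewrite cnM l1 mul1r => /(_ w1).
rewrite (_ : c + l * z + _ = c + l * (z + (r / cn l)%:C%C * w)).
  by apply: tends_eq => n; apply: eq_bigr => k _; rewrite exprMn mulrA.
by rewrite rmorphM /= fmorphV /=; ring.
Qed.

Lemma cont_conj A u : cont A u -> cont [set z | A (conjc z)] (fun z => u (conjc z)).
Proof.
move=> hu z Az e e0; have [d d0 hd] := hu _ Az e e0; exists d => // w Aw wz.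
by apply: hd => //; rewrite -conjc_sub cnC.
Qed.

Lemma harm_conj D u : opn D -> harm D u -> harm [set z | D (conjc z)] (fun z => u (conjc z)).
Proof.
move=> oD hu; split; first exact: cont_conj hu.1.
move=> z Dz; have [r r0 [M [a [ha hr]]]] := harm_disk_rep oD hu Dz.
apply: (@rep_avg _ _ z r M (fun k => conjc (a k))) => //.
split=> [k|w w1]; first by rewrite cnC.
have := hr (conjc w); rewrite cnC => /(_ w1).
rewrite (_ : conjc z + _ = conjc (z + r%:C%C * w)); last first.
  by rewrite conjc_add conjc_mul; congr (_ + _ * _); apply: complex_eq; rewrite ?ReC ?ImC /= ?oppr0.
by apply: tends_eq => n; apply: eq_bigr => k _; rewrite -(ReC (a k * _)) conjc_mul conjc_X conjcK.
Qed.

(** [G] is the first coefficient of the series divided by [r]; it encodes the gradient as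
    [u_x - i u_y], so that [Re (G * h)] is the differential. *)
Lemma harm_grad u c r M : 0 < r -> cont (cdisk c r) u -> harm (disk c r) u ->
  (forall z, cn (z - c) = r -> `|u z| <= M) -> exists2 G : C, cn G <= 2 * M / r &
  forall h, cn h <= r / 2 -> `|u (c + h) - u c - Re (G * h)| <= 4 * M / r ^+ 2 * cn h ^+ 2.
Proof.
move=> r0 cu hu hM; have [a ha] := harm_rep r0 cu hu hM; have M0 := rep_ge0 ha.
have rC : r%:C%C != 0 :> C by rewrite -cn_eq0 cnR normr_eq0 gt_eqF.
exists (a 1%N / r%:C%C).
  by rewrite cnM cnV cnR gtr0_norm // ler_pM2r ?invr_gt0 //; apply: ha.1.
move=> h hh; pose w := h / r%:C%C; pose t := cn h / r.
have wt : cn w = t by rewrite /w cnM cnV cnR gtr0_norm.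
have t1 : t <= 1 / 2 by rewrite /t ler_pdivrMr // mul1r mulrC.
have t0 : 0 <= t by rewrite -wt cn_ge0.
have uc : `|u c - Re (a 0%N)| <= 0.
  have := rep_tail 1 ha (w := 0) (t := 0); rewrite cn0 lexx ltr01 => /(_ isT isT).
  by rewrite big_ord1 mulr0 addr0 expr0 mulr1 expr1 mulr0 mul0r.
have := rep_tail 2 ha (w := w) (t := t); rewrite wt lexx => /(_ isT ltac:(lra)).
have -> : c + r%:C%C * w = c + h by rewrite /w mulrC divfK.
rewrite !big_ord_recl big_ord0 /= expr0 mulr1 addr0 /bump /= expr1.
have -> : a 1%N / r%:C%C * h = a 1%N * w by rewrite /w; ring.
move: uc; rewrite normr_le0 subr_eq0 => /eqP ->.
rewrite opprD addrA => h1; apply: le_trans h1 _.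
rewrite ler_pdivrMr; last by lra.
have -> : 4 * M / r ^+ 2 * cn h ^+ 2 = 4 * M * t ^+ 2 by rewrite /t exprMn exprVn; ring.
by have := mulr_ge0 M0 (exprn_ge0 2 t0); nra.
Qed.

Lemma harm_lip u c r M : 0 < r -> cont (cdisk c r) u -> harm (disk c r) u ->
  (forall z, cn (z - c) = r -> `|u z| <= M) ->
  forall h, cn h <= r / 2 -> `|u (c + h) - u c| <= 4 * M / r * cn h.
Proof.
move=> r0 cu hu hM h hh; have [G hG hu2] := harm_grad r0 cu hu hM.
have [a ha] := harm_rep r0 cu hu hM; have M0 := rep_ge0 ha.
have h1 := hu2 h hh; have h2 := le_trans (Re_le (G * h)) (_ : cn (G * h) <= 2 * M / r * cn h).
have {h2} := h2 ltac:(by rewrite cnM ler_wpM2r ?cn_ge0).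
have h3 : 4 * M / r ^+ 2 * cn h ^+ 2 <= 2 * M / r * cn h.
  have -> : 4 * M / r ^+ 2 * cn h ^+ 2 = 2 * M / r * cn h * (2 * (cn h / r)) by field; rewrite gt_eqF.
  apply: ler_piMr; first by rewrite !mulr_ge0 ?invr_ge0 ?cn_ge0 ?(ltW r0).
  by have : cn h / r <= 1 / 2; [rewrite ler_pdivrMr //; lra | lra].
have -> : 4 * M / r * cn h = 2 * M / r * cn h + 2 * M / r * cn h by ring.
move: h1; move: (2 * M / r * cn h) h3 => X h3.
by rewrite !ler_norml => /andP[? ?] /andP[? ?]; apply/andP; lra.
Qed.

Definition hdisk r : set C := [set z | cn z < r /\ 0 < Im z].
Definition chdisk r : set C := [set z | cn z <= r /\ 0 <= Im z].

Lemma opnI A D : opn A -> opn D -> opn (A `&` D).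
Proof.
move=> oA oD z [/oA[r r0 hr] /oD[s s0 hs]]; exists (Num.min r s); first by rewrite lt_min r0.
by move=> w; rewrite lt_min => /andP[/hr ? /hs ?].
Qed.

Lemma half_opn : opn [set z : C | 0 < Im z].
Proof.
move=> z /= z0; exists (Im z) => // w wz; have := Im_le (w - z); rewrite ImB ler_norml => /andP[]; lra.
Qed.

Lemma disk0E r : disk 0 r = [set z | cn z < r].
Proof. by apply/funext => z; rewrite /disk /mkset subr0. Qed.

Lemma hdisk_opn r : opn (hdisk r).
Proof. by have := opnI (@disk_opn R 0 r) half_opn; rewrite disk0E. Qed.

Lemma hdisk_bdd r : bdd (hdisk r).
Proof. by exists r => z [/ltW]. Qed.

Lemma chdisk_closed r : cl (chdisk r) `<=` chdisk r.
Proof.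
move=> z hz; split; apply: eps_le => e e0; have [w [w1 w2] wz] := hz e e0.
  by have := cn_tri w z 0; rewrite !subr0 (cnB z w); lra.
by have := Im_le (w - z); rewrite ImB ler_norml => /andP[]; lra.
Qed.

Lemma cl_hdisk r : cl (hdisk r) `<=` chdisk r.
Proof.
by apply: subset_trans (@chdisk_closed r); apply: cl_sub => z [/ltW ? /ltW].
Qed.

Lemma bd_hdisk r z : bd (hdisk r) z -> chdisk r z /\ (Im z = 0 \/ cn z = r).
Proof.
move=> [/cl_hdisk [h1 h2] h]; split => //.
case: (ltP 0 (Im z)) => hz; last by left; apply/eqP; rewrite eq_le h2 hz.
case: (ltP (cn z) r) => hr; last by right; apply/eqP; rewrite eq_le h1 hr.
by case: h.
Qed.

Definition oddext u z : R := if 0 <= Im z then u z else - u (conjc z).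

Lemma oddext_cont r u : cont (chdisk r) u -> (forall z, chdisk r z -> Im z = 0 -> u z = 0) ->
  cont (cdisk 0 r) (oddext u).
Proof.
move=> cu u0 z /=; rewrite subr0 => zr e e0; rewrite /oddext.
have refl w : cn w <= r -> Im w < 0 -> chdisk r (conjc w).
  by move=> h1 h2; split; rewrite ?cnC // ImC; lra.
have dist (w y : C) : cn (conjc w - conjc y) = cn (w - y) by rewrite -conjc_sub cnC.
case: (ltgtP 0 (Im z)) => hz.
- have [d d0 hd] := cu z (conj zr (ltW hz)) e e0; exists (Num.min d (Im z)).
    by rewrite lt_min d0.
  move=> w /=; rewrite subr0 lt_min => wr /andP[wd wz].
  have hw : 0 <= Im w by have := Im_le (w - z); rewrite ImB ler_norml => /andP[]; lra.
  by rewrite hw; apply: hd.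
- have [d d0 hd] := cu (conjc z) (refl _ zr hz) e e0; exists (Num.min d (- Im z)).
    by rewrite lt_min d0 oppr_gt0.
  move=> w /=; rewrite subr0 lt_min => wr /andP[wd wz].
  have hw : Im w < 0 by have := Im_le (w - z); rewrite ImB ler_norml => /andP[]; lra.
  rewrite [0 <= Im w]leNgt hw /= -opprD normrN; apply: hd; first exact: refl.
  by rewrite dist.
have z0 : chdisk r z by split; rewrite -?hz.
have cz : conjc z = z by apply: complex_eq; rewrite ?ReC ?ImC -?hz ?oppr0.
have [d d0 hd] := cu z z0 e e0; exists d => // w /=; rewrite subr0 => wr wz.
rewrite (u0 z z0 (esym hz)) subr0; case: (leP 0 (Im w)) => hw.
  by have := hd w (conj wr hw) wz; rewrite (u0 z z0 (esym hz)) subr0.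
rewrite normrN; have := hd (conjc w) (refl _ wr hw); rewrite -{1}cz dist => /(_ wz).
by rewrite (u0 z z0 (esym hz)) subr0.
Qed.

Lemma hdisk_cl r z : 0 < r -> chdisk r z -> 0 < Im z -> cl (hdisk r) z.
Proof.
move=> r0 [zr _] z0; rewrite (_ : hdisk r = [set z | 0 < Im z] `&` disk 0 r); last first.
  by apply/funext => w; apply/propext; rewrite /= subr0; split => -[].
apply: clU; first exact: half_opn.
by split => //; apply: cdisk_cl; rewrite //= subr0.
Qed.

(** [q] solves the problem on the full disk for the odd extension of [u]; it is tied to [u] only on
    the diameter and on the arc. This form accommodates the truncated data of the boundary
    estimates. *)
Lemma odd_disk u r M : 0 < r -> cont (chdisk r) u ->
  (forall z, chdisk r z -> Im z = 0 -> u z = 0) -> (forall z, chdisk r z -> `|u z| <= M) ->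
  exists q (b : nat -> R), [/\ cont (cdisk 0 r) q, harm (disk 0 r) q,
    forall z, chdisk r z -> (Im z = 0 -> q z = 0) /\ (cn z = r -> q z = u z),
    forall z, chdisk r z -> `|q z| <= M &
    (forall k, `|b k| <= 2 * M) /\
    forall w, cn w < 1 -> tends (fun n => \sum_(k < n) b k * Im (w ^+ k)) (q (r%:C%C * w))].
Proof.
move=> r0 cu u0 hM.
have co := oddext_cont cu u0.
have bo z : cn (z - 0) = r -> `|oddext u z| <= M.
  rewrite subr0 => zr; rewrite /oddext; case: (leP 0 (Im z)) => hz.
    by apply: hM; rewrite /chdisk /= zr.
  by rewrite normrN; apply: hM; split; rewrite ?cnC ?zr // ImC; lra.
have [q [cq hq qo [a ha]]] := disk_dirichlet r0 (cont_sub (@circle_cdisk 0 r) co) bo.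
have sym : [set z | disk (0 : C) r (conjc z)] = disk 0 r.
  by apply/funext => z; rewrite /= !subr0 cnC.
have csym : [set z | cdisk (0 : C) r (conjc z)] = cdisk 0 r.
  by apply/funext => z; rewrite /= !subr0 cnC.
have cq' := cont_conj cq; rewrite csym in cq'.
have hq' := harm_conj (@disk_opn _ _ _) hq; rewrite sym in hq'.
(* Both sides solve the same Dirichlet problem, the circle datum being odd under conjugation. *)
have qodd z : cdisk 0 r z -> q z = - q (conjc z).
  move=> /(cdisk_cl r0); apply: (mp_uniq (v := fun z => - q (conjc z)) (@disk_opn _ 0 r) (@disk_bdd _ 0 r)).
  - exact: cont_cl_disk.
  - exact: cont_cl_disk (contN cq').
  - exact: hq.
  - exact: harmN.
  move=> w /bd_disk wr; rewrite !qo //; last by rewrite subr0 cnC -[w]subr0.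
  rewrite subr0 in wr; rewrite /oddext ImC conjcK.
  case: (ltgtP 0 (Im w)) => hw.
  - by rewrite leNgt oppr_lt0 hw /= opprK.
  - by rewrite oppr_ge0 (ltW hw).
  have cz : conjc w = w by apply: complex_eq; rewrite ?ReC ?ImC -?hw ?oppr0.
  have wc : chdisk r w by split; rewrite ?wr -?hw.
  by rewrite -hw oppr0 lexx cz u0 ?oppr0.
have sub : chdisk r `<=` cdisk 0 r by move=> z [h _] /=; rewrite subr0.
exists q, (fun k => - Im (a k)); split => //.
- move=> z zc; split=> [z0|zr]; last by rewrite qo ?subr0 // /oddext zc.2.
  have := qodd z (sub _ zc); rewrite (_ : conjc z = z); first by lra.
  by apply: complex_eq; rewrite ?ReC ?ImC ?z0 ?oppr0.
- move=> z zc; rewrite -[q z]subr0.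
  apply: (@mp_abs _ (disk 0 r) q (fun=> 0) M (@disk_opn _ 0 r) (@disk_bdd _ 0 r)) => //.
  + exact: cont_cl_disk.
  + exact: cont_cst.
  + exact: harm_cst.
  + by move=> w /bd_disk wr; rewrite subr0 qo // bo.
  + exact: cdisk_cl (sub _ zc).
split=> [k|w w1].
  by rewrite normrN; apply: le_trans (Im_le _) _; apply: ha.1.
(* Half the difference of the expansions at [w] and at its conjugate retains of [a k * w ^ k] only
   [- Im (a k) * Im (w ^ k)]. *)
have h1 := ha.2 w w1; have := ha.2 (conjc w); rewrite cnC => /(_ w1) h2.
have := tendsZ (1/2) (tendsB h1 h2); rewrite !add0r.
have -> : r%:C%C * conjc w = conjc (r%:C%C * w).
  by rewrite conjc_mul; congr (_ * _); apply: complex_eq; rewrite ?ReC ?ImC /= ?oppr0.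
rewrite -[q (conjc _)]opprK -qodd; last first.
  by rewrite /= subr0 cnM cnR gtr0_norm // -[leRHS]mulr1 ler_pM2l // ltW.
rewrite opprK (_ : 1 / 2 * _ = q (r%:C%C * w)); last by field.
apply: tends_eq => n; rewrite -sumrB mulr_sumr; apply: eq_bigr => k _.
by rewrite !ReM -conjc_X ReC ImC; field.
Qed.

(* The reflection principle, in the form of an expansion at the origin. *)
Theorem odd_rep u r M : 0 < r -> cont (chdisk r) u -> harm (hdisk r) u ->
  (forall z, chdisk r z -> Im z = 0 -> u z = 0) -> (forall z, chdisk r z -> `|u z| <= M) ->
  exists2 b : nat -> R, forall k, `|b k| <= 2 * M &
    forall w, cn w < 1 -> 0 <= Im w -> tends (fun n => \sum_(k < n) b k * Im (w ^+ k)) (u (r%:C%C * w)).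
Proof.
move=> r0 cu hu u0 hM; have [q [b [cq hq qu _ [bM hb]]]] := odd_disk r0 cu u0 hM.
have sub : chdisk r `<=` cdisk 0 r by move=> z [h _] /=; rewrite subr0.
exists b => // w w1 w0; have := hb w w1.
have wc : chdisk r (r%:C%C * w).
  split; last by rewrite ImZ mulr_ge0 // ltW.
  by rewrite cnM cnR gtr0_norm // -[leRHS]mulr1 ler_pM2l // ltW.
suff -> : q (r%:C%C * w) = u (r%:C%C * w) by [].
move: wc; move: (_ * w) => z zc; case: (eqVneq (Im z) 0) => [z0|z0].
  by rewrite u0 // (qu z zc).1.
have z1 : 0 < Im z by rewrite lt_def z0; case: zc.
apply: (mp_uniq (@hdisk_opn r) (@hdisk_bdd r)) (hdisk_cl r0 zc z1) => //.
- exact: cont_sub (subset_trans (@cl_hdisk r) sub) cq.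
- exact: cont_sub (@cl_hdisk r) cu.
- by apply: (harm_sub _ hq) => y [] /=; rewrite subr0.
move=> y /bd_hdisk[yc [y0|yr]]; first by rewrite u0 // (qu y yc).1.
by rewrite (qu y yc).2.
Qed.

End Representation.

(** * The Perron method *)

Section Perron.
Context {R : realType}.
Local Notation C := R[i].
Implicit Types (A D K : set C) (u v f q : C -> R) (z w c x : C) (n k : nat) (r M e : R).

(* A one-sided flatness weak enough to hold at every boundary point of a C^1
   domain and of a convex domain, strong enough to replace a barrier. *)
Definition flatat D x0 := exists2 nu : C, cn nu = 1 & exists2 r0, 0 < r0 &
  forall r, 0 < r < r0 -> forall x, D x -> cn (x - x0) < r -> - (r / 10) < Re (conjc nu * (x - x0)).

Lemma sub_cl_ball A x0 r x : cl A x -> cn (x - x0) < r -> cl (A `&` disk x0 r) x.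
Proof.
move=> Ax xr; rewrite setIC; apply: clU; first exact: disk_opn.
by split.
Qed.

(** In units of [r] and shifted by 1/10, [zt] maps the part of [D] near [x0] into the right half
    plane. The comparison function is built on [Re (2 zt - zt ^ 2)], which is nonnegative there, at
    least 99/100 on the arc and less than 1/2 near the centre. *)
Lemma decay D v x0 nu r (eta m : R) : opn D -> bdd D -> cont (cl D) v -> subh D v -> 0 < r ->
  cn nu = 1 -> (forall x, D x -> cn (x - x0) < r -> - (r / 10) < Re (conjc nu * (x - x0))) ->
  eta <= m -> (forall x, cl D x -> cn (x - x0) <= r -> v x <= m) ->
  (forall x, bd D x -> cn (x - x0) <= r -> v x <= eta) ->
  forall x, cl D x -> cn (x - x0) <= r / 20 -> v x <= eta + (m - eta) / 2.
Proof.
move=> oD bD cv hv r0 nu1 hflat em hm heta x Dx xr.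
pose zt z := conjc nu * (z - x0) / r%:C%C + (1 / 10)%:C%C.
(* The factor 51/50 makes up for the value 99/100 on the arc. *)
pose h z := eta + (m - eta) * (51 / 50) * Re (2%:R * zt z - zt z ^+ 2).
have hE z : h z = eta + (m - eta) * (51 / 50) * (2 * Re (zt z) + Im (zt z) ^+ 2 - Re (zt z) ^+ 2).
  by rewrite /h ReB expr2 !ReM /= addr0 mul0r subr0; congr (_ + _ * _); ring.
have hh A : harm A h.
  apply: harmD; first exact: harm_cst.
  apply: harmZ; apply: taylor3_harm => c _.
  have hz : taylor3 zt c.
    apply: taylor3D; last exact: taylor3_cst.
    apply: taylor3M; last exact: taylor3_cst.
    apply: taylor3M; first exact: taylor3_cst.
    by apply: taylor3D; [exact: taylor3_id | exact: taylor3_cst].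
  have -> : (fun z => 2%:R * zt z - zt z ^+ 2) = (fun z => 2%:R * zt z + (-1) * (zt z * zt z)).
    by apply/funext => z; ring.
  apply: taylor3D; apply: taylor3M; try exact: taylor3_cst; first exact: hz.
  exact: taylor3M.
have rC : r%:C%C != 0 :> C by rewrite -cn_eq0 cnR normr_eq0 gt_eqF.
have Rez z : Re (zt z) = Re (conjc nu * (z - x0)) / r + 1 / 10.
  by rewrite /zt ReD /= -fmorphV /= [_ * (_^-1)%:C%C]mulrC ReZ mulrC.
have ztn z : (Re (zt z) - 1 / 10) ^+ 2 + Im (zt z) ^+ 2 = (cn (z - x0) / r) ^+ 2.
  have : cn (zt z - (1 / 10)%:C%C) = cn (z - x0) / r.
    by rewrite /zt addrK !cnM cnC nu1 mul1r cnV cnR gtr0_norm.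
  by move=> <-; rewrite cn2 ReB ImB /= subr0.
pose G := D `&` disk x0 r.
have clG z : cl G z -> [/\ cl D z, cn (z - x0) <= r & 0 <= Re (zt z)].
  move=> hz; split.
  - by apply: cl_sub hz => w [].
  - by apply: cl_disk; apply: cl_sub hz => w [].
  apply: eps_le => e e0; have re := mulr_gt0 r0 e0.
  have [w [Dw wr] wz] := hz _ re; have := hflat w Dw wr.
  rewrite Rez => h1.
  have h2 : Re (conjc nu * (w - x0)) - Re (conjc nu * (z - x0)) <= r * e.
    rewrite -ReB (_ : _ - _ = conjc nu * (w - z)); last by ring.
    by apply: le_trans (ler_norm _) _; apply: le_trans (Re_le _) _; rewrite cnM cnC nu1 mul1r ltW.
  rewrite -(ler_pM2l r0) mulr0 mulrDr mulrDr [r * (_ / r)]mulrC divfK ?gt_eqF //; lra.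
have oG : opn G by apply: opnI => //; exact: disk_opn.
have bG : bdd G by apply: bdd_sub bD => z [].
have key z : cl G z -> v z <= h z.
  apply: mp_le => //.
  - by apply: cont_sub cv => w /clG[].
  - exact: (hh _).1.
  - by move=> c [Dc _]; exact: hv.
  move=> w [clw nGw]; have [Dw wr y0] := clG w clw; rewrite hE.
  have wr1 : (cn (w - x0) / r) ^+ 2 <= 1.
    by rewrite expr_le1 ?divr_ge0 ?cn_ge0 ?(ltW r0) // ler_pdivrMr // mul1r.
  have := ztn w; have := sqr_ge0 (Im (zt w)); set y := Re (zt w) in y0 *; set s := Im (zt w) => s0 ys.
  have y1 : y <= 11 / 10 by nra.
  have d0 : 0 <= m - eta by lra.
  case: (pselect (D w)) => hD.
    have wr' : cn (w - x0) = r.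
      by apply/eqP; rewrite eq_le wr leNgt; apply/negP => h'; apply: nGw.
    have e1 : (y - 1 / 10) ^+ 2 + s ^+ 2 = 1 by rewrite ys wr' divff ?gt_eqF // expr1n.
    have h1 : 1 <= 51 / 50 * (2 * y + s ^+ 2 - y ^+ 2) by nra.
    have := hm w Dw wr; have := ler_wpM2l d0 h1; rewrite -mulrA; lra.
  have h1 : 0 <= 2 * y + s ^+ 2 - y ^+ 2 by nra.
  have := heta w (conj Dw hD) wr; have := mulr_ge0 (mulr_ge0 d0 (_ : 0 <= 51 / 50 :> R)) h1.
  by move=> /(_ ltac:(lra)); lra.
have clGx : cl G x by apply: sub_cl_ball => //; lra.
have [_ _ y0] := clG x clGx; apply: le_trans (key x clGx) _; rewrite hE lerD2l -mulrA.
rewrite ler_wpM2l //; first by lra.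
have : (cn (x - x0) / r) ^+ 2 <= (1 / 20) ^+ 2.
  by rewrite lerXn2r ?nnegrE ?divr_ge0 ?cn_ge0 ?(ltW r0) //; try lra; rewrite ler_pdivrMr //; lra.
rewrite -ztn; set y := Re (zt x) in y0 *; set s := Im (zt x) => h1.
have s0 := sqr_ge0 s; have y0' := sqr_ge0 y; have y1 : y <= 3 / 20 by nra.
by have := sqr_ge0 (y - 1 / 10); nra.
Qed.

(** Each division of the radius by 20 halves the excess over [eta]: a modulus of continuity at the
    boundary point with constants common to all competitors. *)
Lemma decay_iter D v x0 nu r0 (rho eta m : R) : opn D -> bdd D -> cont (cl D) v -> subh D v ->
  cn nu = 1 -> (forall r, 0 < r < r0 -> forall x, D x -> cn (x - x0) < r ->
     - (r / 10) < Re (conjc nu * (x - x0))) ->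
  eta <= m -> 0 < rho < r0 -> (forall x, cl D x -> v x <= m) ->
  (forall x, bd D x -> cn (x - x0) <= rho -> v x <= eta) ->
  forall n x, cl D x -> cn (x - x0) <= rho / 20 ^+ n -> v x <= eta + (m - eta) / 2 ^+ n.
Proof.
move=> oD bD cv hv nu1 hf em /andP[rho0 rr0] hm he; elim=> [|n IH] x Dx.
  by rewrite !expr0 !divr1 => _; have := hm x Dx; lra.
have p20 k : 0 < 20 ^+ k :> R by rewrite exprn_gt0.
have p2 k : 0 < 2 ^+ k :> R by rewrite exprn_gt0.
have rn0 : 0 < rho / 20 ^+ n by rewrite divr_gt0.
have rn1 : rho / 20 ^+ n <= rho by rewrite ler_pdivrMr // ler_peMr ?(ltW rho0) // exprn_ege1 //; lra.
have := @decay D v x0 nu (rho / 20 ^+ n) eta (eta + (m - eta) / 2 ^+ n) oD bD cv hv rn0 nu1.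
move=> /(_ _ _ IH _ x Dx); rewrite addrAC subrr add0r !exprSr !invfM !mulrA; apply.
- by move=> y Dy; apply: hf; rewrite ?rn0 ?(le_lt_trans rn1) // .
- by rewrite lerDl divr_ge0 ?(ltW (p2 _)) // subr_ge0.
- by move=> y Dy yr; apply: he => //; apply: le_trans yr _.
Qed.

Definition solv D f := exists u, [/\ cont (cl D) u, harm D u & forall z, bd D z -> u z = f z].

Lemma glue_disk D c r v q : cdisk c r `<=` D -> cont (cl D) v -> cont (cdisk c r) q ->
  (forall z, cn (z - c) = r -> q z = v z) ->
  cont (cl D) (fun z => if cn (z - c) < r then q z else v z).
Proof.
move=> rD cv cq qv z Dz e e0.
have [d d0 hd] := cv z Dz e e0.
case: (ltgtP (cn (z - c)) r) => zr.
- have [d' d0' hd'] := cq z (ltW zr) e e0.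
  exists (Num.min d' (r - cn (z - c))); first by rewrite lt_min d0' subr_gt0.
  move=> w _; rewrite lt_min => /andP[wd wz].
  have wr : cn (w - c) < r by have := cn_tri z w c; lra.
  by rewrite wr; apply: hd' => //; exact: ltW.
- exists (Num.min d (cn (z - c) - r)); first by rewrite lt_min d0 subr_gt0.
  move=> w Dw; rewrite lt_min => /andP[wd wz].
  case: ifP => wr; last exact: hd.
  by have := cn_tri w z c; rewrite (cnB z w); lra.
have [d' d0' hd'] := cq z (circle_cdisk zr) e e0.
exists (Num.min d d'); first by rewrite lt_min d0.
move=> w Dw; rewrite lt_min => /andP[wd wd']; case: ifP => wr; last exact: hd.
by rewrite -qv //; apply: hd' => //; exact: ltW.
Qed.

(** The datum is the trace of a subharmonic [v0], and competitors lie above [v0] inside and below it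
    on the boundary. Thus [v0] is itself the lower barrier, and flatness serves only for the upper
    one. *)
Lemma perron D v0 : opn D -> bdd D -> (forall x, bd D x -> flatat D x) ->
  cont (cl D) v0 -> subh D v0 -> solv D v0.
Proof.
move=> oD bD flat cv0 hv0.
have [M M0 hM] := evt_bound (@cl_cl _ D) (bdd_cl bD) cv0.
pose F v := [/\ cont (cl D) v, subh D v, forall z, bd D z -> v z <= v0 z
  & forall z, cl D z -> v0 z <= v z].
have Fv0 : F v0 by split.
have FM v z : F v -> cl D z -> `|v z| <= M.
  move=> [cv hv bv lv] Dz; rewrite ler_norml; apply/andP; split.
    by have := lv z Dz; have := hM z Dz; rewrite ler_norml => /andP[]; lra.
  apply: (wmp oD bD cv hv) => // w bw; apply: le_trans (bv w bw) _.
  by have := hM w bw.1; rewrite ler_norml => /andP[].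
have Fmax v (w : C -> R) : F v -> F w -> F (fun z => Num.max (v z) (w z)).
  move=> [cv hv bv lv] [cw hw bw lw]; split.
  - exact: cont_max.
  - exact: subh_max.
  - by move=> z bz; rewrite ge_max bv // bw.
  - by move=> z Dz; rewrite le_max lv.
(* Harmonic lifting: replacing [v] in a disk by the solution with the same values on the circle
   raises it and preserves subharmonicity. *)
have Fmod v c r : F v -> 0 < r -> cdisk c r `<=` D ->
    exists v', [/\ F v', harm (disk c r) v' & forall z, v z <= v' z \/ ~ cl D z].
  move=> [cv hv bv lv] r0 rD.
  have sub : cdisk c r `<=` cl D by move=> z /rD /sub_cl.
  have cvd := cont_sub sub cv.
  have [B B0 hB] := evt_bound (@cdisk_closed _ c r) (@cdisk_bdd _ c r) cvd.
  have [q [cq hq qv _]] := disk_dirichlet r0 (cont_sub (@circle_cdisk _ c r) cvd)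
    (fun z zc => hB z (circle_cdisk zc)).
  pose v' z := if cn (z - c) < r then q z else v z.
  have vv' z : v z <= v' z.
    rewrite /v'; case: ifP => // zr.
    apply: (mp_le (@disk_opn _ c r) (@disk_bdd _ c r) (cont_cl_disk cvd) (cont_cl_disk cq)) => //.
    - by move=> w wr; apply: hv; apply: rD; exact: ltW.
    - by move=> w /bd_disk wr; rewrite qv.
    - exact: sub_cl.
  have hv' : harm (disk c r) v'.
    by apply: (harm_eq _ _ hq) => [|z /= zr]; [exact: disk_opn | rewrite /v' zr].
  exists v'; split => //; last by left.
  split.
  - exact: glue_disk.
  - move=> x Dx e e0; case: (ltP (cn (x - c)) r) => xr; first exact: (harm_subh hv').
    have [d d0 hd] := hv x Dx e e0; exists d => // s /hd.
    have -> : v' x = v x by rewrite /v' ltNge xr.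
    move=> h; apply: le_trans h _; rewrite /avg4.
    by rewrite !lerD.
  - move=> z bz; rewrite /v'; case: ifP => [zr|_]; last exact: bv.
    by case: bz => _ []; apply: rD; exact: ltW.
  - by move=> z Dz; apply: le_trans (lv z Dz) (vv' z).
pose u z := sup [set t | exists2 v, F v & t = v z].
have hsup z : cl D z -> has_sup [set t | exists2 v, F v & t = v z].
  move=> Dz; split; first by exists (v0 z), v0.
  by exists M => _ [v Fv ->]; have := FM v z Fv Dz; rewrite ler_norml => /andP[].
have uge v z : F v -> cl D z -> v z <= u z.
  by move=> Fv Dz; apply: ub_le_sup; [case: (hsup z Dz) | exists v].
have ule z t : cl D z -> (forall v, F v -> v z <= t) -> u z <= t.
  move=> Dz ht; apply: ge_sup; first by case: (hsup z Dz).
  by move=> _ [v Fv ->]; exact: ht.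
have uadh z e : cl D z -> 0 < e -> exists2 v, F v & u z - e < v z.
  by move=> Dz e0; have [_ [v Fv ->] h] := sup_adherent e0 (hsup z Dz); exists v.
(* Competitors harmonic in the larger disk are equi-Lipschitz in the smaller one, so a single
   competitor that nearly attains [u] on a finite net is uniformly close to [u]. *)
have hu : harm D u.
  apply: harm_loc => c Dc; have [r1 r10 hr1] := oD c Dc.
  pose r := r1 / 2; have r0 : 0 < r by exact: divr2_gt0.
  have rD : cdisk c r `<=` D by move=> z /= zc; apply: hr1; rewrite /r in zc; lra.
  have r4 : 0 < r / 4 by rewrite divr_gt0.
  have clD z : cn (z - c) <= r -> cl D z by move=> /rD /sub_cl.
  exists (disk c (r / 4)); first by split; [exact: disk_opn | rewrite /= subrr cn0].
  pose L := 4 * M / (r / 2).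
  have L0 : 0 <= L by rewrite divr_ge0 ?mulr_ge0 // ltW // divr2_gt0.
  have lip v z w : F v -> harm (disk c r) v -> cn (z - c) <= r / 4 -> cn (w - c) <= r / 4 ->
      cn (w - z) <= r / 4 -> `|v w - v z| <= L * cn (w - z).
    move=> Fv hv zc wc wz; have [cv _ _ _] := Fv.
    have sub : cdisk z (r / 2) `<=` disk c r.
      by move=> y /= yz; have := cn_tri z y c; lra.
    have := @harm_lip _ v z (r / 2) M (divr2_gt0 r0).
    move=> /(_ _ _ _ (w - z)); rewrite [z + _]addrC subrK; apply.
    - by apply: cont_sub cv => y /sub /= /ltW; exact: clD.
    - by apply: harm_sub hv; apply: subset_trans sub; exact: disk_cdisk.
    - by move=> y yz; apply: FM => //; apply: clD; apply: ltW; apply: sub; rewrite /= yz.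
    - lra.
  apply: harm_unif; first exact: disk_opn.
  move=> e e0; pose dl := Num.min (r / 4) (e / (4 * (L + 1))).
  have L1 : 0 < L + 1 by lra.
  have dl0 : 0 < dl by rewrite lt_min r4 divr_gt0 // mulr_gt0.
  have dlr : dl <= r / 4 by rewrite ge_min lexx.
  have dle : L * dl <= e / 4.
    have : dl <= e / (4 * (L + 1)) by rewrite ge_min lexx orbT.
    by rewrite ler_pdivlMr ?mulr_gt0 //; nra.
  have [s [sK hs]] := cover (@cdisk_closed _ c (r / 4)) (@cdisk_bdd _ c (r / 4)) (fun z _ => dl0).
  (* Maxima and liftings only increase, so the values already nearly optimal at earlier points of
     the net remain so. *)
  have [v [Fv hv hsv]] : exists v, [/\ F v, harm (disk c r) v &
      forall z, z \in s -> u z - e / 4 < v z].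
    elim: (s) sK => [|a s' IH] sK.
      by have [v [Fv hv _]] := Fmod v0 c r Fv0 r0 rD; exists v.
    have [|v [Fv hv hsv]] := IH; first by move=> z zs; apply: sK; rewrite inE zs orbT.
    have aD : cl D a by apply: clD; have := sK a (mem_head _ _); rewrite /=; lra.
    have [w Fw aw] := uadh a _ aD (divr_gt0 e0 (ltr0Sn _ 3)).
    have [v' [Fv' hv' vv']] := Fmod _ c r (Fmax v w Fv Fw) r0 rD.
    exists v'; split => // z; rewrite inE => /orP[/eqP ->|zs].
      by case: (vv' a) => // h; apply: lt_le_trans aw (le_trans _ h); rewrite le_max lexx orbT.
    have zD : cl D z by apply: clD; have := sK z; rewrite inE zs orbT /= => /(_ isT); lra.
    by case: (vv' z) => // h; apply: lt_le_trans (hsv z zs) (le_trans _ h); rewrite le_max lexx.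
  exists v => [|z /= zc]; first by apply: (harm_sub _ hv) => z /=; lra.
  have zD : cl D z by apply: clD; clear - zc r0; lra.
  rewrite ler_norml; apply/andP; split; last by have := uge v z Fv zD; clear - e0; lra.
  have [y ys zy] := hs z (ltW zc); have yc : cn (y - c) <= r / 4 := sK y ys.
  have yD : cl D y by apply: clD; lra.
  have h1 (w : C -> R) : F w -> harm (disk c r) w -> `|w z - w y| <= e / 4.
    move=> Fw hw; apply: le_trans dle; apply: le_trans (lip w y z Fw hw yc (ltW zc) _) _; first by lra.
    by rewrite ler_wpM2l // ltW.
  have h2 : u z <= u y + e / 4.
    apply: ule => // w Fw; have [w' [Fw' hw' ww']] := Fmod w c r Fw r0 rD.
    case: (ww' z) => // h; have := h1 w' Fw' hw'; have := uge w' y Fw' yD.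
    by rewrite ler_norml => k1 /andP[k2 k3]; clear - h k1 k2 k3; lra.
  have := hsv y ys; have := h1 v Fv hv; rewrite ler_norml => /andP[h3 h4] h5; clear - h2 h3 h4 h5; lra.
have ub z : bd D z -> u z = v0 z.
  move=> bz; apply/eqP; rewrite eq_le uge ?andbT //; last exact: bz.1.
  by apply: ule => [|v [_ _ bv _]]; [exact: bz.1 | exact: bv].
exists u; split => //.
move=> x Dx e e0; case: (pselect (D x)) => hx.
  have [d d0 hd] := hu.1 x hx e e0; have [r r0 hr] := oD x hx.
  exists (Num.min d r); first by rewrite lt_min d0.
  by move=> w _; rewrite lt_min => /andP[wd /hr Dw]; apply: hd.
have bx : bd D x by split.
(* At the boundary [v0 <= u] bounds [u] from below; from above [decay_iter] applies to all
   competitors with the same constants, hence to their supremum. *)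
have [nu nu1 [r0 r00 hf]] := flat x bx.
have e4 : 0 < e / 4 by rewrite divr_gt0.
have [d d0 hd] := cv0 x Dx _ e4.
pose rho := Num.min d r0 / 2.
have m0 : 0 < Num.min d r0 by rewrite lt_min d0.
have rho0 : 0 < rho by exact: divr2_gt0.
have rhod : rho < d.
  have : Num.min d r0 <= d by rewrite ge_min lexx.
  by rewrite /rho; lra.
have rhor : rho < r0.
  have : Num.min d r0 <= r0 by rewrite ge_min lexx orbT.
  by rewrite /rho; lra.
have x0M : v0 x <= M by have := hM x Dx; rewrite ler_norml => /andP[].
have [n hn] : exists n, (M + e / 4 - (v0 x + e / 4)) / 2 ^+ n <= e / 4.
  have [n hn] := @expr_small R (1 / 2) (e / 4 / (M - v0 x + 1)) ltac:(clear; lra) ltac:(rewrite divr_gt0 //; clear - x0M; lra).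
  have t0 : 0 <= (1 / 2) ^+ n :> R by rewrite exprn_ge0 //; lra.
  exists n; have := hn n (leqnn _); rewrite ler_pdivlMr; last by lra.
  have -> : (M + e / 4 - (v0 x + e / 4)) / 2 ^+ n = (M - v0 x) * (1 / 2) ^+ n.
    by rewrite expr_div_n expr1n; ring.
  by rewrite mulrC; lra.
exists (rho / 20 ^+ n); first by rewrite divr_gt0 // exprn_gt0.
move=> w Dw wx; rewrite (ub x bx).
have wrho : cn (w - x) < rho.
  apply: lt_le_trans wx _; rewrite ler_pdivrMr ?exprn_gt0 // ler_peMr ?(ltW rho0) //.
  by rewrite exprn_ege1 // ler1n.
have := hd w Dw (lt_trans wrho rhod); rewrite !ler_norml => /andP[h1 h2].
apply/andP; split; first by have := uge v0 w Fv0 Dw; clear - h1 h2 e0; lra.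
suff : u w <= v0 x + e / 4 + e / 4 by clear - e0; lra.
apply: ule => // v Fv; have [cv hv bv lv] := Fv.
apply: le_trans (_ : (v0 x + e / 4) + (M + e / 4 - (v0 x + e / 4)) / 2 ^+ n <= _); last by clear - hn; lra.
apply: (@decay_iter D v x nu r0 rho) => //; first by clear - x0M; lra.
- by rewrite rho0.
- by move=> y Dy; have := FM v y Fv Dy; rewrite ler_norml; clear - e0 => /andP[]; lra.
- move=> y bdy yx; apply: le_trans (bv y bdy) _.
  by have := hd y bdy.1 (le_lt_trans yx rhod); rewrite ler_norml; clear => /andP[]; lra.
- exact: ltW.
Qed.

End Perron.

(** * The Dirichlet problem on bounded domains with continuous data *)

Section Dirichlet.
Context {R : realType}.
Local Notation C := R[i].
Implicit Types (A D K : set C) (u v f g q : C -> R) (z w c x y : C) (n k : nat) (r M e : R).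

Lemma inv_nat_small e : 0 < e -> exists N, forall n, (N <= n)%N -> n.+1%:R^-1 <= e.
Proof.
move=> e0; have [N hN] := archi (e^-1); exists N => n Nn.
by rewrite -[e]invrK lef_pV2 ?posrE ?invr_gt0 //; apply: le_trans (ltW hN) _; rewrite ler_nat.
Qed.

Lemma unif_cauchy_lim K (us : nat -> C -> R) (b : nat -> R) :
  (forall e, 0 < e -> exists N, forall n, (N <= n)%N -> b n <= e) ->
  (forall m n z, K z -> `|us m z - us n z| <= b m + b n) ->
  exists u, forall e, 0 < e -> exists N, forall n, (N <= n)%N -> forall z, K z -> `|us n z - u z| <= e.
Proof.
move=> hb h.
have /choice[u hu] : forall z, exists l, K z -> tends (fun n => us n z) l.
  move=> z; case: (pselect (K z)) => Kz; last by exists 0.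
  have [|l hl] := @cauchy_tends _ (fun n => us n z); last by exists l.
  move=> e e0; have [N hN] := hb _ (divr2_gt0 e0); exists N => m n /hN h1 /hN h2.
  by apply: le_trans (h m n z Kz) _; lra.
exists u => e e0; have [N hN] := hb _ (divr2_gt0 e0); exists N => n Nn z Kz.
have hh m : (N <= m)%N -> `|us n z - us m z| <= e.
  by move=> Nm; apply: le_trans (h n m z Kz) _; have := hN n Nn; have := hN m Nm; lra.
have ht := tendsB (tends_cst (us n z)) (hu z Kz).
rewrite ler_norml; apply/andP; split.
  rewrite lerNl; apply: (tends_le (tendsN ht)); exists N => m /hh.
  by rewrite ler_norml => /andP[]; lra.
by apply: (tends_le ht); exists N => m /hh; rewrite ler_norml => /andP[].
Qed.

Section Data.
Variable D : set C.
Hypotheses (oD : opn D) (bD : bdd D) (flat : forall x, bd D x -> flatat D x).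

Lemma solv_ext f g : (forall z, bd D z -> f z = g z) -> solv D f -> solv D g.
Proof. by move=> fg [u [cu hu uf]]; exists u; split => // z bz; rewrite uf ?fg. Qed.

Lemma solv_harm u : harm setT u -> solv D u.
Proof.
move=> hu; exists u; split => //; last exact: harm_sub (@subsetT _ _) hu.
exact: cont_sub (@subsetT _ _) hu.1.
Qed.

Lemma solvD f g : solv D f -> solv D g -> solv D (fun z => f z + g z).
Proof.
move=> [u [cu hu uf]] [v [cv hv vg]]; exists (fun z => u z + v z).
by split; [exact: contD | exact: harmD | move=> z bz; rewrite uf ?vg].
Qed.

Lemma solvZ (k : R) f : solv D f -> solv D (fun z => k * f z).
Proof.
move=> [u [cu hu uf]]; exists (fun z => k * u z).
by split; [exact: contZ | exact: harmZ | move=> z bz; rewrite uf].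
Qed.

(** The maximum of the two solutions is subharmonic and has the right boundary values, which is the
    situation of [perron]. *)
Lemma solv_max f g : solv D f -> solv D g -> solv D (fun z => Num.max (f z) (g z)).
Proof.
move=> [u [cu hu uf]] [v [cv hv vg]].
have := @perron R D (fun z => Num.max (u z) (v z)) oD bD flat (cont_max cu cv)
  (subh_max (harm_subh hu) (harm_subh hv)).
by apply: solv_ext => z bz; rewrite uf ?vg.
Qed.

Lemma solv_min f g : solv D f -> solv D g -> solv D (fun z => Num.min (f z) (g z)).
Proof.
move=> hf hg; have := solvZ (-1) (solv_max (solvZ (-1) hf) (solvZ (-1) hg)).
by apply: solv_ext => z _; case: (leP (f z)) => ?; case: (leP (-1 * f z)) => ?; lra.
Qed.

(** By the maximum principle, closeness of the data on the boundary becomes closeness of the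
    solutions on the closure. *)
Lemma solv_unif f : (forall e, 0 < e -> exists2 g, solv D g & forall z, bd D z -> `|g z - f z| <= e) ->
  solv D f.
Proof.
move=> h.
have /choice[us hus] : forall n, exists u, [/\ cont (cl D) u, harm D u
    & forall z, bd D z -> `|u z - f z| <= n.+1%:R^-1].
  move=> n; have [|g [u [cu hu ug]] gf] := h n.+1%:R^-1; first by rewrite invr_gt0.
  by exists u; split => // z bz; rewrite ug // gf.
have [u hu] := @unif_cauchy_lim (cl D) us (fun n => n.+1%:R^-1) inv_nat_small (fun m n z Dz =>
   let: And3 cm hm bm := hus m in let: And3 cn' hn bn := hus n in
   mp_abs oD bD cm cn' hm hn (fun w bw => le_trans (ler_distD (f w) _ _)
     (lerD (bm w bw) (eq_ind_r (fun t => t <= _) (bn w bw) (distrC _ _)))) Dz).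
exists u; split.
- by apply: cont_unif => e /hu[N hN]; exists (us N); [case: (hus N) | exact: hN].
- apply: harm_unif => // e /hu[N hN]; exists (us N); first by case: (hus N).
  by move=> z Dz; apply: hN => //; exact: sub_cl.
move=> z bz; apply/eqP; rewrite -subr_eq0 -normr_le0; apply: eps_le => e e0.
have [N hN] := hu _ (divr2_gt0 e0); have [N' hN'] := inv_nat_small (divr2_gt0 e0).
have h1 := hN _ (leq_maxl N N') z bz.1; have h2 := hN' _ (leq_maxr N N').
have [_ _ /(_ z bz)] := hus (maxn N N').
move: h1 h2; move: (us _ z) ((maxn N N').+1%:R^-1) => a b.
by rewrite !ler_norml => /andP[? ?] ? /andP[? ?]; apply/andP; lra.
Qed.

Lemma harm_Re : harm setT (fun z : C => Re z).
Proof. by apply: (taylor3_harm (g := id)) => c _; exact: taylor3_id. Qed.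

Lemma harm_Im : harm setT (fun z : C => Im z).
Proof.
have -> : (fun z : C => Im z) = (fun z => Re ((- 'i%C) * z)).
  by apply/funext => z; rewrite ReM /=; ring.
apply: taylor3_harm => c _; apply: taylor3M; [exact: taylor3_cst | exact: taylor3_id].
Qed.

Lemma solv_norm1 y : solv D (fun z => `|Re z - Re y| + `|Im z - Im y|).
Proof.
apply: solvD.
  have hf : solv D (fun z => Re z - Re y) by apply/solv_harm/harmB; [exact: harm_Re | exact: harm_cst].
  apply: solv_ext (solv_max hf (solvZ (-1) hf)) => z _.
  by rewrite mulN1r -[RHS]maxrN; congr (Num.max _ _); ring.
have hf : solv D (fun z => Im z - Im y) by apply/solv_harm/harmB; [exact: harm_Im | exact: harm_cst].
apply: solv_ext (solv_max hf (solvZ (-1) hf)) => z _.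
by rewrite mulN1r -[RHS]maxrN; congr (Num.max _ _); ring.
Qed.

(* Solvable data form a vector lattice containing the affine functions, and
   every continuous function is nearly an infimum of finitely many cones. *)
Theorem dirichlet f : cont (bd D) f -> solv D f.
Proof.
move=> cf; apply: solv_unif => e0 e00.
have cK := @bd_closed _ D oD.
have bK : bdd (bd D) by apply: bdd_sub (bdd_cl bD) => z [].
have [M M0 hM] := evt_bound cK bK cf.
pose e := e0 / 3; have e1 : 0 < e by rewrite divr_gt0.
have [d d0 hd] := unif_cont cK bK cf e1.
(* With this slope the cone at [y] rises by [2 * M], the largest variation of [f], at distance [d];
   closer than [d] the constant [e] suffices. *)
pose L := 2 * M / d; have L0 : 0 <= L by rewrite !mulr_ge0 // invr_ge0 ltW.
pose n1 y z := `|Re z - Re y| + `|Im z - Im y|.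
have n1ge y z : cn (z - y) <= n1 y z by apply: le_trans (cn_ReIm _) _; rewrite ReB ImB.
have n1le y z : n1 y z <= 2 * cn (z - y).
  by rewrite /n1; have := Re_le (z - y); have := Im_le (z - y); rewrite ReB ImB; lra.
have cone y z : bd D y -> bd D z -> f z <= f y + e + L * n1 y z.
  move=> Ky Kz; case: (ltP (cn (z - y)) d) => h.
    have := hd y z Ky Kz h; rewrite ler_norml => /andP[_ h1].
    have : 0 <= L * n1 y z by rewrite mulr_ge0 // (le_trans (cn_ge0 _) (n1ge y z)).
    lra.
  have : 2 * M <= L * n1 y z.
    by rewrite /L mulrAC ler_pdivlMr // ler_wpM2l ?mulr_ge0 // (le_trans h).
  have := hM y Ky; have := hM z Kz; rewrite !ler_norml => /andP[? ?] /andP[? ?]; lra.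
pose dl := Num.min d (e / (2 * L + 1)).
have L1 : 0 < 2 * L + 1 by lra.
have dl0 : 0 < dl by rewrite lt_min d0 divr_gt0.
have [s [sK hs]] := cover cK bK (fun z _ => dl0).
(* The starting value [M + e] lies above [f], so it never spoils the lower bound. *)
pose G z := foldr (fun y t => Num.min (f y + e + L * n1 y z) t) (M + e) s.
exists G.
  rewrite /G; elim: (s) => [|y s' IH] /=; first exact/solv_harm/harm_cst.
  apply: solv_min => //; apply: solvD; last exact/solvZ/solv_norm1.
  exact/solv_harm/harm_cst.
move=> z Kz; rewrite ler_norml; apply/andP; split.
  suff : f z <= G z by lra.
  rewrite /G; elim: (s) sK => [|y s' IH] sK /=.
    by have := hM z Kz; rewrite ler_norml => /andP[_]; lra.
  rewrite le_min (cone y z (sK y (mem_head _ _)) Kz) /=; apply: IH => w ws; apply: sK.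
  by rewrite inE ws orbT.
have [y ys zy] := hs z Kz; have Ky := sK y ys.
have zd : cn (z - y) < d by apply: lt_le_trans zy _; rewrite ge_min lexx.
have zl : L * n1 y z <= e.
  apply: le_trans (_ : L * (2 * (e / (2 * L + 1))) <= _).
    rewrite ler_wpM2l //; apply: le_trans (n1le y z) _; rewrite ler_wpM2l // ltW //.
    by apply: lt_le_trans zy _; rewrite ge_min lexx orbT.
  rewrite mulrA mulrA ler_pdivrMr //; nra.
have : G z <= f y + e + L * n1 y z.
  rewrite /G; elim: (s) ys => // a s' IH; rewrite inE => /orP[/eqP <-|ys] /=.
    by rewrite ge_min lexx.
  by rewrite ge_min IH ?orbT.
have e3 : e0 = 3 * e by rewrite /e; field.
by have := hd y z Ky Kz zd; rewrite ler_norml => /andP[? _]; lra.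
Qed.

Lemma dirichlet_bound f u M : cont (cl D) u -> harm D u -> (forall z, bd D z -> u z = f z) ->
  (forall z, bd D z -> `|f z| <= M) -> forall z, cl D z -> `|u z| <= M.
Proof.
move=> cu hu uf hM z Dz; rewrite -[u z]subr0.
apply: (@mp_abs _ D u (fun=> 0)) => //; [exact: cont_cst | exact: harm_cst|].
by move=> w bw; rewrite subr0 uf // hM.
Qed.

End Data.
End Dirichlet.

(** * Boundary regularity *)

(** Arithmetic of the tail in [flat_step]: for small parameters the denominator of the geometric
    series of ratio [3 * (theta + tau)] is absorbed. *)
Lemma quadratic_absorb (R : realFieldType) (theta tau : R) : 0 <= tau <= 1 / 100 -> 0 <= theta <= 1 / 8 ->
  18 * (theta + tau) ^+ 2 <= (72 * theta ^+ 2 + tau) * (1 - 3 * (theta + tau)).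
Proof.
move=> /andP[? ?] /andP[? ?].
have : (36 * theta ^+ 2 + 36 * tau ^+ 2) * 1 <= (72 * theta ^+ 2 + tau) * (1 - 3 * (theta + tau)).
  by have : 36 * tau ^+ 2 <= 36 / 100 * tau; nra.
by have := sqr_ge0 (theta - tau); nra.
Qed.

Lemma shifted_close (R : realDomainType) (w q b y t e1 e2 e3 : R) :
  `|w - q| <= e1 -> `|q - b * (y - t)| <= e2 -> `|b * t| <= e3 -> `|w - b * y| <= e1 + e2 + e3.
Proof. by rewrite !ler_norml => /andP[? ?] /andP[? ?] /andP[? ?]; apply/andP; lra. Qed.

Section FlatBoundary.
Context {R : realType}.
Local Notation C := R[i].
Implicit Types (A D K G : set C) (u v w f g q : C -> R) (z c x y : C) (n k : nat) (r M e tau sigma a : R).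

Lemma harm_sq D c : harm D (fun z => Re ((z - c) ^+ 2)).
Proof.
apply: taylor3_harm => x _; apply: taylor3X; apply: taylor3D; [exact: taylor3_id | exact: taylor3_cst].
Qed.

Lemma harm_setT D u : harm setT u -> harm D u.
Proof. exact: (harm_sub (@subsetT _ _)). Qed.

Lemma cl_Im_ge A a : (forall z, A z -> a <= Im z) -> forall z, cl A z -> a <= Im z.
Proof.
move=> h z hz; apply: eps_le => e e0; have [y Ay yz] := hz e e0.
by have := h y Ay; have := Im_le (y - z); rewrite ImB ler_norml => /andP[]; lra.
Qed.

(** Comparison on the disk of radius 1/2 about the foot [a] of [z0]. The barrier is linear in the
    height, plus [8 * Re ((z - c) ^ 2)], which lifts it above [M] on the arc and is nonpositive on
    the vertical line through [z0]. *)
Lemma flat_growth_le G w M tau sigma : opn G -> 0 <= tau <= 1 / 100 ->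
  (forall z, cn z < 2 -> G z -> - tau <= Im z) ->
  cont (cl G `&` cdisk 0 1) w -> harm (G `&` disk 0 1) w ->
  (forall z, cl G z -> cn z <= 1 -> w z <= M) -> 0 <= M -> 0 <= sigma ->
  (forall z, bd G z -> cn z <= 1 -> w z <= sigma) ->
  forall z, cl G z -> cn z < 1 / 2 -> w z <= sigma + 10 * M * (Im z + tau).
Proof.
move=> oG /andP[t0 t1] hG cw hw hM M0 s0 hs z0 Gz0 z01.
pose a : C := (Re z0)%:C%C; pose c : C := a - 'i%C * tau%:C%C.
have an : cn a < 1 / 2 by rewrite cnR; apply: le_lt_trans (Re_le _) z01.
pose h z := sigma + M * (10 * (Im z + tau) + 8 * Re ((z - c) ^+ 2)).
have hE z : h z = sigma + M * (10 * (Im z + tau) + 8 * ((Re z - Re z0) ^+ 2 - (Im z + tau) ^+ 2)).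
  by rewrite /h expr2 ReM !ReB !ImB ReM ImM /=; congr (_ + _ * (_ + _ * _)); ring.
have hh A : harm A h.
  apply: harmD; first exact: harm_cst.
  apply: harmZ; apply: harmD; last exact/harmZ/harm_sq.
  by apply: harmZ; apply: harmD; [exact/harm_setT/harm_Im | exact: harm_cst].
pose A := G `&` disk a (1 / 2).
have oA : opn A by apply: opnI => //; exact: disk_opn.
have A1 z : cn (z - a) <= 1 / 2 -> cn z < 1.
  by move=> za; have := cn_tri a z 0; rewrite !subr0; lra.
have clA z : cl A z -> [/\ cl G z, cn (z - a) <= 1 / 2 & - tau <= Im z].
  move=> hz; split.
  - by apply: cl_sub hz => y [].
  - by apply: cl_disk; apply: cl_sub hz => y [].
  apply: cl_Im_ge hz => y [Gy ya]; apply: hG => //.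
  by have := A1 y (ltW ya); lra.
have key z : cl A z -> w z <= h z.
  apply: mp_le => //.
  - by apply: bdd_sub (@disk_bdd _ a (1 / 2)) => y [].
  - by apply: cont_sub cw => y /clA[Gy ya _]; split; rewrite //= subr0 ltW // A1.
  - exact: (hh _).1.
  - apply: harm_subh; apply: harm_sub hw => y [Gy ya]; split; rewrite //= subr0.
    by apply: A1; exact: ltW.
  move=> y [cly nAy]; have [Gy ya y0] := clA y cly.
  have y1 : cn y <= 1 by rewrite ltW // A1.
  have ny : (Re y - Re z0) ^+ 2 + Im y ^+ 2 = cn (y - a) ^+ 2.
    by rewrite cn2 ReB ImB /= subr0.
  have nle : cn (y - a) ^+ 2 <= 1 / 4 by have := cn_ge0 (y - a); nra.
  rewrite hE; move: ny y0; set s := Re y - Re z0; set t := Im y => ny y0.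
  have sq := sqr_ge0 s.
  have t12 : t <= 1 / 2 by nra.
  case: (pselect (G y)) => hy.
    have ya2 : cn (y - a) = 1 / 2.
      by apply/eqP; rewrite eq_le ya leNgt; apply/negP => h'; apply: nAy.
    have e1 : s ^+ 2 = 1 / 4 - t ^+ 2 by move: ny; rewrite ya2; lra.
    have h1 : 1 <= 10 * (t + tau) + 8 * (s ^+ 2 - (t + tau) ^+ 2) by rewrite e1; nra.
    by have := hM y Gy y1; have := ler_wpM2l M0 h1; lra.
  have h1 : 0 <= 10 * (t + tau) + 8 * (s ^+ 2 - (t + tau) ^+ 2) by nra.
  by have := hs y (conj Gy hy) y1; have := mulr_ge0 M0 h1; lra.
have cz : cl A z0.
  apply: sub_cl_ball => //; rewrite (_ : z0 - a = 'i%C * (Im z0)%:C%C).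
    by rewrite cnM cni mul1r cnR; apply: le_lt_trans (Im_le _) z01.
  by apply: complex_eq; rewrite ?ReB ?ImB ?ReM ?ImM /=; ring.
apply: le_trans (key z0 cz) _; rewrite hE subrr expr0n /= sub0r.
by have := mulr_ge0 M0 (sqr_ge0 (Im z0 + tau)); lra.
Qed.

Lemma flat_growth G w M tau sigma : opn G -> 0 <= tau <= 1 / 100 ->
  (forall z, cn z < 2 -> G z -> - tau <= Im z) ->
  cont (cl G `&` cdisk 0 1) w -> harm (G `&` disk 0 1) w ->
  (forall z, cl G z -> cn z <= 1 -> `|w z| <= M) -> 0 <= M -> 0 <= sigma ->
  (forall z, bd G z -> cn z <= 1 -> `|w z| <= sigma) ->
  forall z, cl G z -> cn z < 1 / 2 -> `|w z| <= sigma + 10 * M * (Im z + tau).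
Proof.
move=> oG ht hG cw hw hM M0 s0 hs z Gz z1; rewrite ler_norml lerNl; apply/andP; split.
  apply: (@flat_growth_le G (fun z => - w z)) => //; [exact: contN | exact: harmN | |].
    by move=> y Gy /(hM y Gy); rewrite ler_norml => /andP[]; lra.
  by move=> y Gy /(hs y Gy); rewrite ler_norml => /andP[]; lra.
apply: (@flat_growth_le G w) => //.
  by move=> y Gy /(hM y Gy); rewrite ler_norml => /andP[].
by move=> y Gy /(hs y Gy); rewrite ler_norml => /andP[].
Qed.

(** Soft thresholding: boundary values that are merely small become exactly 0, as odd reflection
    demands, at the price of a uniform error [a]. *)
Definition soft (a t : R) : R := Num.max (t - a) 0 + Num.min (t + a) 0.

Lemma soft_dist a t : 0 <= a -> `|soft a t - t| <= a.
Proof. by rewrite /soft ler_norml => a0; apply/andP; case: (leP (t - a)); case: (leP (t + a)); lra. Qed.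

Lemma soft_le a t : 0 <= a -> `|soft a t| <= `|t|.
Proof.
rewrite /soft => a0; have := ler_norm t; have := ler_norm (- t); rewrite normrN => h1 h2.
by rewrite ler_norml; apply/andP; case: (leP (t - a)); case: (leP (t + a)); lra.
Qed.

Lemma soft0 a t : `|t| <= a -> soft a t = 0.
Proof.
by rewrite /soft ler_norml => /andP[? ?]; case: (leP (t - a)); case: (leP (t + a)); lra.
Qed.

Lemma cont_soft A u a : 0 <= a -> cont A u -> cont A (fun z => soft a (u z)).
Proof.
move=> a0 cu; apply: contD; first by apply: cont_max; [apply: contB => //; exact: cont_cst | exact: cont_cst].
have -> : (fun z => Num.min (u z + a) 0) = (fun z => - Num.max (- u z - a) 0).
  by apply/funext => z; case: (leP (u z + a)); case: (leP (- u z - a)); lra.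
apply/contN/cont_max; last exact: cont_cst.
by apply: contB; [exact: contN | exact: cont_cst].
Qed.

(** One step of the improvement of flatness. On a half disk raised by [tau], whose interior lies in
    [G], [w] is uniformly close to an odd harmonic [q]. The first coefficient of [q] gives the slope
    and the rest of its series is quadratically small. *)
Lemma flat_step G w M tau sigma : opn G -> 0 <= tau <= 1 / 100 ->
  (forall z, cn z < 2 -> G z -> - tau <= Im z) ->
  (forall z, cn z < 2 -> tau < Im z -> G z) ->
  cont (cl G `&` cdisk 0 1) w -> harm (G `&` disk 0 1) w ->
  (forall z, cl G z -> cn z <= 1 -> `|w z| <= M) -> 0 <= M -> 0 <= sigma ->
  (forall z, bd G z -> cn z <= 1 -> `|w z| <= sigma) ->
  exists2 b : R, `|b| <= 6 * M & forall theta z, cl G z -> cn z <= theta -> theta <= 1 / 8 ->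
    `|w z - b * Im z| <= sigma + 27 * M * tau + 72 * M * theta ^+ 2.
Proof.
move=> oG /andP[t0 t1] hG1 hG2 cw hw hM M0 s0 hs.
have ht : 0 <= tau <= 1 / 100 by rewrite t0.
have growth := flat_growth oG ht hG1 cw hw hM M0 s0 hs.
(* Raised by [tau], a half disk of this radius remains within modulus 1/2, where the growth bound
   holds. *)
pose r : R := 1 / 3; have r0 : 0 < r by rewrite /r; lra.
pose c : C := 'i%C * tau%:C%C.
have cnc : cn c = tau by rewrite cnM cni mul1r cnR ger0_norm.
have Imc z : Im (c + z) = tau + Im z by rewrite ImD ImM /=; ring.
pose W z := w (c + 1 * z).
have inG z : cn z < 1 -> tau <= Im z -> cl G z.
  move=> z1 zt e e0; have e2 : 0 < Num.min e (1 / 2) by rewrite lt_min e0; lra.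
  have e3 : Num.min e (1 / 2) <= e by rewrite ge_min lexx.
  have e4 : Num.min e (1 / 2) <= 1 / 2 by rewrite ge_min lexx orbT.
  have hn : cn ('i%C * (Num.min e (1 / 2) / 2)%:C%C : C) = Num.min e (1 / 2) / 2.
    by rewrite cnM cni mul1r cnR ger0_norm //; lra.
  exists (z + 'i%C * (Num.min e (1 / 2) / 2)%:C%C).
    apply: hG2; last by rewrite ImD ImM /=; lra.
    by apply: le_lt_trans (cnD _ _) _; rewrite hn; lra.
  by rewrite addrAC subrr add0r hn; lra.
have Wdom z : chdisk r z -> cl G (c + 1 * z) /\ cn (c + 1 * z) < 1 / 2.
  move=> [zr z0]; rewrite mul1r /r in zr *.
  have h1 : cn (c + z) < 1 / 2 by apply: le_lt_trans (cnD _ _) _; rewrite cnc; lra.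
  by split => //; apply: inG; rewrite ?Imc; lra.
have cW : cont (chdisk r) W.
  apply: (cont_sub (D := [set z | (cl G `&` cdisk 0 1) (c + 1 * z)])); last exact: cont_affine.
  by move=> z /Wdom[h1 h2]; split => //=; rewrite subr0; lra.
have hW : harm (hdisk r) W.
  apply: (@harm_sub _ _ [set z | (G `&` disk 0 1) (c + 1 * z)]).
    move=> z [zr z0]; have [h1 h2] := Wdom z (conj (ltW zr) (ltW z0)).
    split; last by rewrite /= subr0; lra.
    by apply: hG2; [lra | rewrite mul1r Imc; lra].
  by apply: harm_affine => //; apply: opnI => //; exact: disk_opn.
(* On the raised diameter the height is [tau], and the growth bound reads
   [sigma + 10 * M * (2 * tau)]. *)
pose eta := sigma + 20 * M * tau.
have eta0 : 0 <= eta by rewrite addr_ge0 // !mulr_ge0.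
have W0 z : chdisk r z -> Im z = 0 -> `|W z| <= eta.
  move=> zc z0; have [h1 h2] := Wdom z zc; apply: le_trans (growth _ h1 h2) _.
  by rewrite mul1r Imc z0 /eta; lra.
have WM z : chdisk r z -> `|W z| <= M.
  by move=> zc; have [h1 h2] := Wdom z zc; apply: hM => //; lra.
have [||q [b [cq hq qu _ [bM hb]]]] := @odd_disk _ (fun z => soft eta (W z)) r M r0 (cont_soft eta0 cW).
- by move=> z zc z0; rewrite soft0 // W0.
- by move=> z zc; apply: le_trans (soft_le _ eta0) (WM z zc).
have chs : chdisk r `<=` cdisk 0 r by move=> z [h _] /=; rewrite subr0.
have Wq z : chdisk r z -> `|W z - q z| <= eta.
  move=> zc; case: (eqVneq (Im z) 0) => [z0|z0].
    by rewrite (qu z zc).1 // subr0 W0.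
  have z1 : 0 < Im z by rewrite lt_def z0; case: zc.
  apply: (@mp_abs _ (hdisk r)) (hdisk_cl r0 zc z1) => //.
  - exact: hdisk_opn.
  - exact: hdisk_bdd.
  - exact: cont_sub (@cl_hdisk _ r) cW.
  - exact: cont_sub (subset_trans (@cl_hdisk _ r) chs) cq.
  - by apply: (harm_sub _ hq) => y [] /=; rewrite subr0.
  move=> y /bd_hdisk[yc [y0|yr]]; first by rewrite (qu y yc).1 // subr0 W0.
  by rewrite (qu y yc).2 // distrC soft_dist.
have b3 : `|3 * b 1%N| <= 6 * M by rewrite normrM ger0_norm //; have := bM 1%N; lra.
(* The factor 3 is the inverse of the radius: it turns a coefficient in the scaled variable into a
   slope. *)
exists (3 * b 1%N) => //.
move=> theta z Gz zt th.
have th0 : 0 <= theta := le_trans (cn_ge0 z) zt.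
have s1 : 3 * (theta + tau) < 1 by lra.
have Mt : 0 <= M * tau by rewrite mulr_ge0.
have Mth : 0 <= M * theta ^+ 2 by rewrite mulr_ge0 ?exprn_ge0.
have bt : `|3 * b 1%N * tau| <= 6 * M * tau.
  by rewrite normrM (ger0_norm t0) ler_wpM2r.
(* Below the raised half disk [w] and the linear term are small separately: the first by the growth
   bound, the second because the height is at most [tau] in absolute value. *)
case: (ltP (Im z) tau) => zI.
  have z2 : - tau <= Im z.
    apply: (@cl_Im_ge (G `&` disk 0 2)); last by apply: sub_cl_ball; rewrite ?subr0 //; clear - zt th; lra.
    by move=> y [Gy] /=; rewrite subr0 => y2; exact: hG1.
  have h1 := growth z Gz ltac:(clear - zt th; lra).
  have h2 : `|3 * b 1%N * Im z| <= 6 * M * tau.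
    by rewrite normrM ler_pM // ler_norml z2 ltW.
  have h3 : M * (Im z + tau) <= M * (2 * tau) by rewrite ler_wpM2l // mulr_natl mulr2n lerD2r ltW.
  apply: le_trans (ler_normB _ _) _; clear - h1 h2 h3 Mt Mth; lra.
pose y := z - c.
have yn : cn y <= theta + tau by rewrite /y; apply: le_trans (cnD _ _) _; rewrite cnN cnc lerD2r.
have Imy : Im y = Im z - tau by rewrite /y ImB ImM /=; ring.
have yc : chdisk r y by split; [apply: le_trans yn _; rewrite ler_pdivlMr // mulrC ltW | rewrite Imy subr_ge0].
have -> : w z = W y by rewrite /W mul1r /y addrC subrK.
pose s := y / r%:C%C.
have rC : r%:C%C != 0 :> C by rewrite -cn_eq0 cnR normr_eq0 gt_eqF.
have sy : r%:C%C * s = y by rewrite /s mulrC divfK.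
have sn : cn s <= 3 * (theta + tau).
  by rewrite /s cnM cnV cnR gtr0_norm // /r invf_div divr1 mulrC ler_wpM2l.
have hg : geo (2 * M) (3 * (theta + tau)) (fun k => b k * Im (s ^+ k)).
  move=> k; rewrite normrM; apply: ler_pM => //; apply: le_trans (Im_le _) _.
  by rewrite cnX lerXn2r ?nnegrE ?cn_ge0 // (le_trans _ sn) ?cn_ge0.
have := ser_tail 2 (_ : 0 <= 3 * (theta + tau) < 1) hg.
rewrite s1 (le_trans (cn_ge0 s) sn) => /(_ isT).
rewrite (tends_ser (hb s (le_lt_trans sn s1))) sy.
rewrite !big_ord_recl big_ord0 /= /bump /= ?expr0 ?expr1 mulr0 add0r addr0.
have -> : b 1%N * Im s = 3 * b 1%N * Im y.
  have -> : Im y = r * Im s by rewrite -ImZ sy.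
  by rewrite /r; field.
move=> hq2.
have hq3 : `|q y - 3 * b 1%N * Im y| <= 72 * M * theta ^+ 2 + M * tau.
  apply: le_trans hq2 _; rewrite ler_pdivrMr ?subr_gt0 //.
  have e1 : 2 * M * (3 * (theta + tau)) ^+ 2 = M * (18 * (theta + tau) ^+ 2) by ring.
  have e2 : (72 * M * theta ^+ 2 + M * tau) * (1 - 3 * (theta + tau))
    = M * ((72 * theta ^+ 2 + tau) * (1 - 3 * (theta + tau))) by ring.
  rewrite e1 e2 ler_wpM2l //.
  by apply: quadratic_absorb; apply/andP.
have := Wq y yc; rewrite Imy in hq3 * => hwq; apply: le_trans (shifted_close hwq hq3 bt) _.
by rewrite /eta le_eqVlt; apply/orP; left; apply/eqP; ring.
Qed.

End FlatBoundary.

(** * Iteration of the improvement of flatness *)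

Section Iteration.
Context {R : realType}.
Local Notation C := R[i].
Implicit Types (A D K G : set C) (u v w f g q : C -> R) (z c x y : C) (n k j : nat) (r M e a b : R).

Lemma opn_affine G c l : opn G -> opn [set z | G (c + l * z)].
Proof.
move=> oG z /= /oG[r r0 hr]; have l1 : 0 < cn l + 1 by have := cn_ge0 l; lra.
exists (r / (cn l + 1)); first exact: divr_gt0.
move=> w wz; apply: hr; rewrite (_ : _ - _ = l * (w - z)); last by ring.
rewrite cnM; apply: le_lt_trans (_ : (cn l + 1) * cn (w - z) < _).
  by rewrite ler_wpM2r ?cn_ge0 //; lra.
by rewrite mulrC -ltr_pdivlMr.
Qed.

Lemma cl_affine G c l z : l != 0 -> cl [set z | G (c + l * z)] z <-> cl G (c + l * z).
Proof.
move=> l0; have ln : 0 < cn l by rewrite cn_gt0.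
split=> h r r0.
  have [y Gy yz] := h _ (divr_gt0 r0 ln); exists (c + l * y) => //.
  rewrite (_ : _ - _ = l * (y - z)); last by ring.
  by rewrite cnM mulrC -ltr_pdivlMr.
have [y Gy yz] := h _ (mulr_gt0 ln r0); exists ((y - c) / l).
  by rewrite /= mulrC divfK // addrC subrK.
rewrite (_ : _ - z = (y - (c + l * z)) / l); last by field.
by rewrite cnM cnV ltr_pdivrMr // [r * _]mulrC.
Qed.

Lemma bd_affine G c l z : l != 0 -> bd [set z | G (c + l * z)] z <-> bd G (c + l * z).
Proof. by move=> l0; split=> -[hG nG]; split => //; apply/(cl_affine _ _ _ l0). Qed.

Section Steps.
Variables (G : set C) (v : C -> R) (r M theta lam kappa : R).
Hypotheses (oG : opn G) (r0 : 0 < r) (M0 : 0 <= M) (th : 0 < theta <= 1 / 8) (lm : 0 < lam < 1).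
Hypotheses (kp : 0 <= kappa <= 1 / 100) (h1 : 216 * theta <= lam) (h2 : 81 * kappa <= theta * lam)
  (h3 : 18 * kappa <= theta * lam * (1 - lam)).
Hypothesis flat : forall j z, cn z < 2 * (r * theta ^+ j) ->
  (G z -> - (r * theta ^+ j * (kappa * lam ^+ j)) <= Im z) /\
  (r * theta ^+ j * (kappa * lam ^+ j) < Im z -> G z).
Hypotheses (cv : cont (cl G `&` cdisk 0 r) v) (hv : harm (G `&` disk 0 r) v)
  (vM : forall z, cl G z -> cn z <= r -> `|v z| <= M) (v0 : forall z, bd G z -> cn z <= r -> v z = 0).

Let P j a := `|a| <= 6 * M / r / (1 - lam) * (1 - lam ^+ j) /\
  forall z, cl G z -> cn z <= r * theta ^+ j -> `|v z - a * Im z| <= M * (theta * lam) ^+ j.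

(** Rescaling by [r * theta ^ j] reduces to [flat_step]. The errors from the boundary values of the
    linear part, from the deviation of the boundary and from the quadratic tail each take one third
    of the allowed [theta * lam], by [h3], [h2] and [h1] respectively. *)
Lemma flat_iter_step j a : P j a ->
  exists2 a', P j.+1 a' & `|a' - a| <= 6 * M / r * lam ^+ j.
Proof.
move=> [ha hPa]; have /andP[th0 th1] := th; have /andP[lm0 lm1] := lm; have /andP[kp0 kp1] := kp.
have thj : 0 < theta ^+ j by rewrite exprn_gt0.
have lmj : 0 < lam ^+ j by rewrite exprn_gt0.
have lmj1 : lam ^+ j <= 1 by rewrite exprn_ile1 // ltW.
have thj1 : theta ^+ j <= 1 by rewrite exprn_ile1 ?(ltW th0) //; lra.
pose rho := r * theta ^+ j; have rho0 : 0 < rho by rewrite mulr_gt0.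
have rhor : rho <= r by rewrite /rho ler_piMr // ltW.
pose l : C := rho%:C%C.
have l0 : l != 0 by rewrite -cn_eq0 cnR normr_eq0 gt_eqF.
have ln : cn l = rho by rewrite cnR gtr0_norm.
pose tau := kappa * lam ^+ j.
have tau0 : 0 <= tau by rewrite mulr_ge0 // ltW.
have tauk : tau <= kappa by rewrite /tau ler_piMr.
pose G' := [set z | G (0 + l * z)].
pose w z := v (0 + l * z) - a * rho * Im z.
have Iml z : Im (0 + l * z) = rho * Im z by rewrite add0r ImZ.
have cnl z : cn (0 + l * z) = rho * cn z by rewrite add0r cnM ln.
have scale z : cn z <= 1 -> cn (0 + l * z) <= rho.
  by move=> z1; rewrite cnl ler_piMr // ltW.
pose Mj := M * (theta * lam) ^+ j.
have Mj0 : 0 <= Mj by rewrite mulr_ge0 // exprn_ge0 // mulr_ge0 // ltW.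
(* [v] vanishes on the boundary but [a * Im] does not; its size there plays the role of [sigma]. *)
have ag : `|a| * rho * tau <= Mj * (theta * lam) / 3.
  have h4 : `|a| <= 6 * M / r / (1 - lam).
    apply: le_trans ha _; rewrite ler_piMr ?divr_ge0 ?mulr_ge0 //; lra.
  have h5 : 6 * M / r / (1 - lam) * rho * tau = Mj * (6 * kappa / (1 - lam)).
    rewrite /Mj /rho /tau exprMn; field; rewrite ?gt_eqF //; lra.
  apply: le_trans (_ : 6 * M / r / (1 - lam) * rho * tau <= _).
    by rewrite ler_wpM2r // ler_wpM2r // ltW.
  rewrite h5 -[leRHS]mulrA; apply: ler_wpM2l => //.
  by rewrite ler_pdivrMr; have := h3; lra.
have [||||||||||b hb hstep] := @flat_step R G' w Mj tau (`|a| * rho * tau).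
- exact: opn_affine.
- by rewrite tau0 (le_trans tauk).
- move=> z z2 Gz; have [hf _] := flat (j := j) (z := 0 + l * z) ltac:(rewrite cnl -/rho mulrC ltr_pM2r //).
  by have := hf Gz; rewrite Iml -/rho -/tau -mulrN ler_pM2l.
- move=> z z2 tz; have [_ hf] := flat (j := j) (z := 0 + l * z) ltac:(rewrite cnl -/rho mulrC ltr_pM2r //).
  by apply: hf; rewrite Iml -/rho -/tau ltr_pM2l.
- apply: contB; last by apply: contZ; exact: cont_sub (@subsetT _ _) (@harm_Im R).1.
  apply: (cont_sub (D := [set z | (cl G `&` cdisk 0 r) (0 + l * z)])); last exact: cont_affine.
  move=> z [Gz /=]; rewrite subr0 => z1; split; first exact/(cl_affine _ _ _ l0).
  by rewrite /= subr0; apply: le_trans (scale z z1) _.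
- apply: harmB; last exact/harmZ/harm_setT/harm_Im.
  apply: (@harm_sub _ _ [set z | (G `&` disk 0 r) (0 + l * z)]); last first.
    by apply: harm_affine => //; apply: opnI => //; exact: disk_opn.
  move=> z [Gz /=]; rewrite subr0 => z1; split => //.
  by rewrite /= subr0 cnl; apply: lt_le_trans rhor; rewrite gtr_pMr.
- move=> z Gz z1; rewrite /w -mulrA -Iml; apply: hPa; last exact: scale.
  exact/(cl_affine _ _ _ l0).
- exact: Mj0.
- by rewrite !mulr_ge0 // ltW.
- move=> z bz z1; rewrite /w v0; last exact: le_trans (scale z z1) _; last exact/(bd_affine _ _ _ l0).
  rewrite sub0r normrN normrM normrM (gtr0_norm rho0) ler_wpM2l //; first by rewrite mulr_ge0 // ltW.
  have z2 : cn (0 + l * z) < 2 * rho by have := scale z z1; lra.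
  have [hf1 hf2] := flat (j := j) z2; have [cz nz] := bz.
  rewrite ler_norml; apply/andP; split.
    apply: (@cl_Im_ge _ (G' `&` disk 0 2)); last by apply: sub_cl_ball => //; rewrite subr0; lra.
    move=> y [Gy /=]; rewrite subr0 => y2.
    have [hf3 _] := flat (j := j) (z := 0 + l * y) ltac:(rewrite cnl -/rho mulrC ltr_pM2r //).
    by have := hf3 Gy; rewrite Iml -/rho -/tau -mulrN ler_pM2l.
  rewrite leNgt; apply/negP => tz; apply: nz; apply: hf2.
  by rewrite Iml -/rho -/tau ltr_pM2l.
exists (a + b / rho); last first.
  rewrite addrAC subrr add0r normrM normfV (gtr0_norm rho0) ler_pdivrMr //.
  apply: le_trans hb _; rewrite le_eqVlt; apply/orP; left; apply/eqP.
  by rewrite /Mj /rho exprMn; field; rewrite gt_eqF.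
split.
  have e1 : `|b / rho| <= 6 * M / r * lam ^+ j.
    rewrite normrM normfV (gtr0_norm rho0) ler_pdivrMr //.
    apply: le_trans hb _; rewrite le_eqVlt; apply/orP; left; apply/eqP.
    by rewrite /Mj /rho exprMn; field; rewrite gt_eqF.
  apply: le_trans (ler_normD _ _) _; apply: le_trans (lerD ha e1) _.
  rewrite le_eqVlt; apply/orP; left; apply/eqP; rewrite exprS; field.
  by rewrite ?gt_eqF //; lra.
move=> z Gz zr; pose y := z / l.
have zE : z = 0 + l * y by rewrite /y add0r mulrC divfK.
have yn : cn y <= theta.
  by rewrite /y cnM cnV ln ler_pdivrMr //; apply: le_trans zr _; rewrite /rho exprS; nra.
have := hstep theta y _ yn th1; rewrite /w -zE.
have -> : v z - a * rho * Im y - b * Im y = v z - (a + b / rho) * Im z.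
  by rewrite [in Im z]zE Iml; field; rewrite gt_eqF.
have cy : cl G' y by apply/(cl_affine _ _ _ l0); rewrite -zE.
move=> /(_ cy) hh; apply: le_trans hh _; rewrite [(theta * lam) ^+ j.+1]exprSr [leRHS]mulrA -/Mj.
have g1 : 27 * Mj * tau <= Mj * (theta * lam) / 3.
  have : 27 * tau <= theta * lam / 3 by have := h2; lra.
  by move=> /(ler_wpM2l Mj0); lra.
have g2 : 72 * Mj * theta ^+ 2 <= Mj * (theta * lam) / 3.
  have : 72 * theta ^+ 2 <= theta * lam / 3 by have := ler_wpM2l (ltW th0) h1; lra.
  by move=> /(ler_wpM2l Mj0); lra.
lra.
Qed.

(** The slopes converge geometrically with ratio [lam]; replacing the slope at scale [j] by the
    limit costs another multiple of [(theta * lam) ^ j]. *)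
Lemma flat_iter : exists2 a, `|a| <= 6 * M / r / (1 - lam) &
  forall j z, cl G z -> cn z <= r * theta ^+ j ->
    `|v z - a * Im z| <= M * (1 + 6 / (1 - lam)) * (theta * lam) ^+ j.
Proof.
have /andP[th0 th1] := th; have /andP[lm0 lm1] := lm.
have /choice[F hF] : forall ja : nat * R, exists a', P ja.1 ja.2 ->
    P ja.1.+1 a' /\ `|a' - ja.2| <= 6 * M / r * lam ^+ ja.1.
  move=> [j a] /=; case: (pselect (P j a)) => [h|]; last by exists 0.
  by have [a' h' h''] := flat_iter_step h; exists a'.
pose s := fix s j := if j is j'.+1 then F (j', s j') else 0.
have sP j : P j (s j).
  elim: j => [|j IH]; last by have [] := hF (j, s j) IH.
  split=> [|z Gz]; first by rewrite normr0 subrr mulr0.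
  by rewrite !expr0 !mulr1 mul0r subr0; exact: vM.
pose d k := s k.+1 - s k.
have hd : geo (6 * M / r) lam d by move=> k; have [] := hF (k, s k) (sP k).
have sE n : \sum_(k < n) d k = s n.
  elim: n => [|n IH]; first by rewrite big_ord0.
  by rewrite big_ord_recr /= IH /d addrC subrK.
have lmb : 0 <= lam < 1 by rewrite lm1 ltW.
exists (ser d); first exact: ser_le lmb hd.
move=> j z Gz zr; have := ser_tail j lmb hd; rewrite sE => h4.
have := (sP j).2 z Gz zr => h5.
have -> : v z - ser d * Im z = (v z - s j * Im z) - (ser d - s j) * Im z by ring.
apply: le_trans (ler_normB _ _) _; rewrite mulrDr mulr1 mulrDl lerD //.
rewrite normrM; apply: le_trans (ler_pM _ _ h4 (le_trans (Im_le z) zr)) _ => //.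
rewrite le_eqVlt; apply/orP; left; apply/eqP; rewrite exprMn; field.
by rewrite ?gt_eqF //; lra.
Qed.

End Steps.
End Iteration.

Lemma kappa_small (R : realFieldType) (k k0 a b : R) : 0 <= k -> k <= k0 -> k0 <= 1 / 100 -> k0 <= b / 81 ->
  b <= a -> [/\ 0 <= k <= 1 / 100, 81 * k <= a & 18 * k <= b].
Proof. by move=> *; split; lra. Qed.

(** * First-order expansion at a boundary point *)

Section Expansion.
Context {R : realType}.
Local Notation C := R[i].
Implicit Types (A D K G Om : set C) (u v w f g q : C -> R) (z c x y nu : C) (n k j : nat) (r M e a b d : R).

Definition hpow (alpha d : R) := d * d `^ alpha.

(** [nu] is the inner unit normal at [x0]. The two implications confine the boundary near [x0] to
    within [C0 * d ^ (1 + alpha)] of the tangent line, [hpow] being this power. *)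
Definition geo_bd (alpha : R) Om (C0 r0 : R) x0 nu := cn nu = 1 /\ forall x, cn (x - x0) < r0 ->
  (Om x -> - (C0 * hpow alpha (cn (x - x0))) <= Re (conjc nu * (x - x0))) /\
  (C0 * hpow alpha (cn (x - x0)) < Re (conjc nu * (x - x0)) -> Om x).

Lemma powR_lt1 (x alpha : R) : 0 <= x < 1 -> 0 < alpha -> x `^ alpha < 1.
Proof.
move=> /andP[x0 x1] a0; have : x `^ alpha < 1 `^ alpha by apply: gt0_ltr_powR; rewrite // nnegrE.
by rewrite powR1.
Qed.

Lemma powR_le (alpha x y : R) : 0 < alpha -> 0 <= x <= y -> x `^ alpha <= y `^ alpha.
Proof.
by move=> a0 /andP[x0 xy]; apply: ge0_ler_powR; rewrite ?nnegrE ?(ltW a0) // (le_trans x0).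
Qed.

Lemma powRX (alpha x : R) n : 0 <= x -> (x ^+ n) `^ alpha = (x `^ alpha) ^+ n.
Proof.
move=> x0; elim: n => [|n IH]; first by rewrite !expr0 powR1.
by rewrite !exprS powRM ?exprn_ge0 // IH.
Qed.

Lemma hpow_le (alpha x y : R) : 0 < alpha -> 0 <= x <= y -> hpow alpha x <= hpow alpha y.
Proof.
move=> a0 /andP[x0 xy]; apply: ler_pM => //; first exact: powR_ge0.
by apply: powR_le; rewrite ?x0.
Qed.

Lemma hpow_ge0 (alpha x : R) : 0 <= x -> 0 <= hpow alpha x.
Proof. by move=> x0; rewrite mulr_ge0 ?powR_ge0. Qed.

(* The iteration runs at the ratio theta for which 216 theta = theta^alpha. *)
Lemma iteration_scale (alpha C0 r0 : R) : 0 < alpha < 1 -> 0 <= C0 -> 0 < r0 ->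
  exists theta r, [/\ 0 < theta <= 1 / 8, 0 < theta `^ alpha < 1, 216 * theta <= theta `^ alpha,
    0 < r /\ 2 * r < r0 & let kappa := 4 * C0 * r `^ alpha in
    [/\ 0 <= kappa <= 1 / 100, 81 * kappa <= theta * theta `^ alpha
     & 18 * kappa <= theta * theta `^ alpha * (1 - theta `^ alpha)]].
Proof.
move=> /andP[a0 a1] C00 r00.
have [q [q0 q1 q216]] : exists q : R, [/\ 0 < q, q <= 1 / 216 & 216 * q = 1].
  by exists (1 / 216); split; lra.
have ia : 1 <= (1 - alpha)^-1 by rewrite invf_ge1; lra.
pose theta : R := q `^ (1 - alpha)^-1.
have th0 : 0 < theta by exact: powR_gt0.
have th1 : theta <= 1 / 216 by apply: le_trans q1; apply: ge1r_powR => //; rewrite q0 /=; lra.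
pose lam := theta `^ alpha.
have lm0 : 0 < lam by exact: powR_gt0.
have lm1 : lam < 1 by apply: powR_lt1 => //; rewrite (ltW th0) /=; lra.
have e1 : theta `^ (1 - alpha) = q.
  by rewrite /theta -powRrM mulVf ?powRr1 ?(ltW q0) // gt_eqF //; lra.
have e2 : lam * q = theta.
  rewrite -e1 /lam -powRD; first by rewrite addrC subrK powRr1 // ltW.
  by rewrite (gt_eqF th0) implybT.
pose k0 := Num.min (1 / 100) (theta * lam * (1 - lam) / 81).
have tl : 0 < theta * lam by rewrite mulr_gt0.
have tl1 : 0 < theta * lam * (1 - lam) by rewrite mulr_gt0 // subr_gt0.
have k00 : 0 < k0 by rewrite lt_min; apply/andP; split; [lra | rewrite divr_gt0].
have k01 : k0 <= 1 / 100 by rewrite ge_min lexx.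
have k02 : k0 <= theta * lam * (1 - lam) / 81 by rewrite ge_min lexx orbT.
have C1 : 0 < 4 * C0 + 1 by lra.
pose r := Num.min (r0 / 3) ((k0 / (4 * C0 + 1)) `^ alpha^-1).
have qq : 0 < k0 / (4 * C0 + 1) by rewrite divr_gt0.
have r_gt0 : 0 < r by rewrite lt_min divr_gt0 // powR_gt0.
have r1 : r <= r0 / 3 by rewrite ge_min lexx.
have r2 : r `^ alpha <= k0 / (4 * C0 + 1).
  have -> : k0 / (4 * C0 + 1) = ((k0 / (4 * C0 + 1)) `^ alpha^-1) `^ alpha.
    by rewrite -powRrM mulVf ?gt_eqF // powRr1 // ltW.
  by apply: powR_le => //; rewrite (ltW r_gt0) ge_min lexx orbT.
have kk : 4 * C0 * r `^ alpha <= k0.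
  apply: le_trans (_ : (4 * C0 + 1) * (k0 / (4 * C0 + 1)) <= _); last by rewrite mulrC divfK // gt_eqF.
  by apply: ler_pM; rewrite ?powR_ge0 ?mulr_ge0 ?lerDl.
have kg : 0 <= 4 * C0 * r `^ alpha by rewrite !mulr_ge0 // powR_ge0.
have m1 : theta * lam * (1 - lam) <= theta * lam by rewrite ler_piMr ?(ltW tl) // lerBlDr lerDl ltW.
exists theta, r; split => //.
- by rewrite th0 /=; clear - th1; lra.
- by rewrite lm0.
- by rewrite -/lam -e2 mulrCA q216 mulr1.
- by split => //; clear q216 k01 k02; lra.
exact: kappa_small kg kk k01 k02 m1.
Qed.

(** [r] and [K] are fixed before the domain, the point and the function, because the Hoelder
    estimate compares expansions at different points. Passing from the discrete scales to all
    distances loses only the factor [theta * lam]. *)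
Theorem bdry_expansion (alpha C0 r0 : R) : 0 < alpha < 1 -> 0 <= C0 -> 0 < r0 ->
  exists r K : R, [/\ 0 < r, 2 * r < r0 & 0 <= K] /\ forall Om x0 nu v M,
   opn Om -> geo_bd alpha Om C0 r0 x0 nu -> bd Om x0 ->
   cont (cl Om `&` cdisk x0 r) v -> harm (Om `&` disk x0 r) v -> 0 <= M ->
   (forall x, cl Om x -> cn (x - x0) <= r -> `|v x| <= M) ->
   (forall x, bd Om x -> cn (x - x0) <= r -> v x = 0) ->
   exists2 a, `|a| <= K * M & forall x, cl Om x -> cn (x - x0) <= r ->
     `|v x - Re (a%:C%C * conjc nu * (x - x0))| <= K * M * hpow alpha (cn (x - x0)).
Proof.
move=> ha C00 r00; have [theta [r [th lm h1 [rp r2] [kp h2 h3]]]] := iteration_scale ha C00 r00.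
have /andP[a0 a1] := ha.
set lam := theta `^ alpha in lm h1 h2 h3; set kappa := 4 * C0 * r `^ alpha in kp h2 h3.
have /andP[th0 th1] := th; have /andP[lm0 lm1] := lm.
have lm10 : 0 < 1 - lam by rewrite subr_gt0.
have th11 : theta < 1 by lra.
have rpow : 0 < hpow alpha r by rewrite mulr_gt0 // powR_gt0.
have tl : 0 < theta * lam by rewrite mulr_gt0.
pose K1 := (1 + 6 / (1 - lam)) / (hpow alpha r * (theta * lam)).
pose K := 6 / r / (1 - lam) + K1.
have k60 : 0 <= 6 / (1 - lam) by rewrite divr_ge0 ?(ltW lm10).
have K10 : 0 <= K1 by rewrite divr_ge0 ?addr_ge0 // mulr_ge0 ?(ltW rpow) ?(ltW tl).
have K20 : 0 <= 6 / r / (1 - lam) by rewrite !divr_ge0 ?(ltW rp) ?(ltW lm10).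
exists r, K; split; first by split => //; rewrite /K addr_ge0.
move=> Om x0 nu v M oO [nu1 hgeo] bx0 cv hv M0 vM v0.
(* A rotation carrying the vertical direction to the inner normal: [conj nu * mu = - i], so the
   normal coordinate becomes [Im z]. *)
pose mu := - 'i%C * nu.
have mu1 : cn mu = 1 by rewrite cnM cnN cni mul1r.
have mu0 : mu != 0 by rewrite -cn_gt0 mu1.
have nn : conjc nu * nu = 1 by rewrite mulrC conj_unit.
pose G := [set z | Om (x0 + mu * z)].
pose w z := v (x0 + mu * z).
have cnx z : cn (x0 + mu * z - x0) = cn z by rewrite addrAC subrr add0r cnM mu1 mul1r.
have Rex z : Re (conjc nu * (x0 + mu * z - x0)) = Im z.
  have -> : conjc nu * (x0 + mu * z - x0) = - 'i%C * z.
    by transitivity (- 'i%C * (conjc nu * nu) * z); [rewrite /mu; ring | rewrite nn mulr1].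
  by rewrite ReM /=; ring.
(* The factor 4 in [kappa] pays for the doubled radius, as [2 ^ (1 + alpha) <= 4]. *)
have scale j z : cn z < 2 * (r * theta ^+ j) ->
    C0 * hpow alpha (cn z) <= r * theta ^+ j * (kappa * lam ^+ j).
  move=> zj; pose t := 2 * (r * theta ^+ j).
  have t0 : 0 <= t by rewrite !mulr_ge0 ?exprn_ge0 ?(ltW rp) ?(ltW th0).
  apply: le_trans (_ : C0 * hpow alpha t <= _).
    by rewrite ler_wpM2l // hpow_le // cn_ge0 ltW.
  have e1 : t `^ alpha = 2 `^ alpha * (r `^ alpha * lam ^+ j).
    by rewrite /t !powRM ?mulr_ge0 ?exprn_ge0 ?(ltW rp) ?(ltW th0) // powRX // ltW.
  have e2 : 2 `^ alpha <= 2 :> R by apply: ler1_powR; rewrite ?ler1n ?(ltW a1).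
  rewrite /hpow e1 /t /kappa.
  have X0 : 0 <= C0 * (r * theta ^+ j) * (r `^ alpha * lam ^+ j).
    by rewrite !mulr_ge0 ?exprn_ge0 ?powR_ge0 ?(ltW rp) ?(ltW th0) ?(ltW lm0).
  by have := ler_wpM2r X0 e2; clear h1 h2 h3 kp; lra.
have sj j : r * theta ^+ j <= r by rewrite ler_piMr ?(ltW rp) // exprn_ile1 ?(ltW th0) ?(ltW th11).
have [||||||a ha1 hexp] := @flat_iter R G w r M theta lam kappa _ rp M0 th lm kp h1 h2 h3 _ _ _ _ _.
- exact: opn_affine.
- move=> j z zj; have z0 : cn (x0 + mu * z - x0) < r0 by rewrite cnx; have := sj j; clear h1 h2 h3 kp; lra.
  have [hg1 hg2] := hgeo _ z0; rewrite cnx Rex in hg1 hg2; have sc := scale j z zj.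
  split=> [Gz|Iz]; first by have := hg1 Gz; clear - sc; lra.
  by apply: hg2; clear - sc Iz; lra.
- apply: (cont_sub (D := [set z | (cl Om `&` cdisk x0 r) (x0 + mu * z)])); last exact: cont_affine.
  move=> z [Gz /=]; rewrite subr0 => z1; split; first exact/(cl_affine _ _ _ mu0).
  by rewrite /= cnx.
- apply: (@harm_sub _ _ [set z | (Om `&` disk x0 r) (x0 + mu * z)]); last first.
    by apply: harm_affine => //; apply: opnI => //; exact: disk_opn.
  move=> z [Gz /=]; rewrite subr0 => z1; split => //.
  by rewrite /= cnx.
- by move=> z Gz z1; apply: vM; [exact/(cl_affine _ _ _ mu0) | rewrite cnx].
- by move=> z Gz z1; apply: v0; [exact/(bd_affine _ _ _ mu0) | rewrite cnx].
exists a.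
  apply: le_trans ha1 _; have -> : 6 * M / r / (1 - lam) = 6 / r / (1 - lam) * M by ring.
  by rewrite ler_wpM2r // /K lerDl.
move=> x Ox xr; pose z := conjc mu * (x - x0).
have xE : x = x0 + mu * z by rewrite /z mulrA conj_unit // mul1r addrC subrK.
have zn : cn z = cn (x - x0) by rewrite -(cnx z) -xE.
have -> : Re (a%:C%C * conjc nu * (x - x0)) = a * Im z.
  by rewrite -mulrA ReZ -Rex -xE.
have Gz : cl G z by apply/(cl_affine _ _ _ mu0); rewrite -xE.
have wx : w z = v x by rewrite /w -xE.
have [z0|z0] := eqVneq (cn z) 0.
  have xx : x = x0 by apply/eqP; rewrite -subr_eq0 -cn_eq0 -zn z0.
  rewrite v0; [|by rewrite xx|by []].
  rewrite (cn0_eq z0) /= mulr0 subrr normr0 mulr_ge0 ?hpow_ge0 ?cn_ge0 //.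
  by rewrite mulr_ge0 // addr_ge0.
have zp : 0 < cn z by rewrite lt_def z0 cn_ge0.
(* [j] will be the last scale that contains [z]; since the scale [j.+1] misses it,
   [(theta * lam) ^ j] is bounded by a multiple of [hpow alpha (cn z)]. *)
have ex : exists n, r * theta ^+ n < cn z.
  have [n hn] := @expr_small R theta (cn z / (2 * r)) ltac:(by rewrite (ltW th0)) ltac:(rewrite divr_gt0 ?mulr_gt0 //).
  exists n; have := hn n (leqnn _); rewrite ler_pdivlMr ?mulr_gt0 //; apply: lt_le_trans.
  rewrite (_ : theta ^+ n * (2 * r) = r * theta ^+ n + r * theta ^+ n); last by ring.
  by rewrite ltrDl mulr_gt0 ?exprn_gt0.
have jn : (0 < ex_minn ex)%N.
  by case: ex_minnP => -[|//]; rewrite expr0 mulr1 zn ltNge xr.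
pose j := (ex_minn ex).-1.
have hj1 : r * theta ^+ j.+1 < cn z by rewrite /j prednK //; case: ex_minnP.
have hj2 : cn z <= r * theta ^+ j.
  rewrite leNgt; apply/negP => h; have : (ex_minn ex <= j)%N by case: ex_minnP => m _; apply.
  by rewrite /j; case: (ex_minn ex) jn => // m _; rewrite ltnn.
have := hexp j z Gz hj2; rewrite wx => hh; apply: le_trans hh _.
apply: le_trans (_ : K1 * M * hpow alpha (cn (x - x0)) <= _); last first.
  by rewrite ler_wpM2r ?hpow_ge0 ?cn_ge0 // ler_wpM2r // /K lerDr.
have h6 : hpow alpha r * (theta * lam) ^+ j.+1 <= hpow alpha (cn z).
  apply: le_trans (_ : hpow alpha (r * theta ^+ j.+1) <= _).
    rewrite /hpow powRM ?exprn_ge0 ?(ltW rp) ?(ltW th0) // powRX ?(ltW th0) // -/lam exprMn.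
    by move: (theta ^+ j.+1) (lam ^+ j.+1) (r `^ alpha) => p q s; rewrite (_ : r * s * (p * q) = r * p * (s * q)); last by ring.
  by apply: hpow_le => //; rewrite (ltW hj1) mulr_ge0 ?exprn_ge0 ?(ltW rp) ?(ltW th0).
have X0 : 0 <= M * (1 + 6 / (1 - lam)) by rewrite mulr_ge0 // addr_ge0.
have -> : K1 * M * hpow alpha (cn (x - x0))
    = M * (1 + 6 / (1 - lam)) * (hpow alpha (cn z) / (hpow alpha r * (theta * lam))).
  by rewrite /K1 zn; ring.
rewrite ler_wpM2l // ler_pdivlMr; last exact: mulr_gt0.
by rewrite mulrCA [X in _ * X]mulrC -exprS.
Qed.

End Expansion.

(** * Gradients as complex numbers and interior estimates *)

Section GradientHolder.
Context {R : realType}.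
Local Notation C := R[i].
Implicit Types (A D K G Om : set C) (u v f q : C -> R) (z w c x y nu : C) (n k j : nat) (r M e a b d t : R).

(** The boundary point is the first exit along the segment, at the supremum of the parameters up to
    which the segment stays in [Om]. *)
Lemma bd_segment Om x y : opn Om -> Om x -> ~ Om y -> exists2 z, bd Om z & cn (x - z) <= cn (x - y).
Proof.
move=> oO Ox nOy; pose p t := x + t%:C%C * (y - x).
have pp s t : cn (p s - p t) = `|s - t| * cn (y - x).
  by rewrite (_ : p s - p t = (s - t)%:C%C * (y - x)) ?cnM ?cnR // /p rmorphB /=; ring.
pose T := [set t | 0 <= t <= 1 /\ forall s, 0 <= s <= t -> Om (p s)].
have T0 : T 0.
  split=> [|s /andP[s0 s1]]; first by rewrite lexx ler01.
  have -> : s = 0 by apply/eqP; rewrite eq_le s0 s1.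
  by rewrite /p mul0r addr0.
have hT : has_sup T by split; [exists 0 | exists 1 => t [/andP[]]].
set m := sup T.
have m0 : 0 <= m by apply: ub_le_sup => //; case: hT.
have m1 : m <= 1 by apply: ge_sup; [exists 0 | move=> t [/andP[]]].
have inT s : 0 <= s < m -> Om (p s).
  move=> /andP[s0 sm]; have [t [_ ht] st] := @sup_adherent _ _ (m - s) ltac:(lra) hT.
  by apply: ht; rewrite s0 /=; move: st; rewrite -/m; lra.
have clm : cl Om (p m).
  move=> e e0; have d1 : 0 < cn (y - x) + 1 by have := cn_ge0 (y - x); lra.
  have [t [/andP[t0 t1] ht] st] := sup_adherent (divr_gt0 e0 d1) hT.
  exists (p t); first by apply: ht; rewrite t0 lexx.
  have tm : t <= m by apply: ub_le_sup; [case: hT | split => //; rewrite t0].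
  rewrite pp distrC ger0_norm ?subr_ge0 //.
  apply: le_lt_trans (_ : (m - t) * (cn (y - x) + 1) < _).
    by rewrite ler_wpM2l ?subr_ge0 //; lra.
  by rewrite -ltr_pdivlMr //; move: st; rewrite -/m; lra.
exists (p m); last first.
  have -> : cn (x - p m) = m * cn (x - y).
    rewrite (_ : x - p m = - (m%:C%C * (y - x))); last by rewrite /p; ring.
    by rewrite cnN cnM cnR ger0_norm // cnB.
  by rewrite ler_piMl ?cn_ge0.
split=> // Om_m; have [r r0 hr] := oO _ Om_m.
have mlt : m < 1.
  rewrite lt_neqAle m1 andbT; apply/eqP => me; apply: nOy; move: Om_m; rewrite me.
  by rewrite /p mul1r addrC subrK.
have d1 : 0 < cn (y - x) + 1 by have := cn_ge0 (y - x); lra.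
pose t := m + Num.min (1 - m) (r / (cn (y - x) + 1) / 2).
have rd : 0 < r / (cn (y - x) + 1) by exact: divr_gt0.
have mn0 : 0 < Num.min (1 - m) (r / (cn (y - x) + 1) / 2) by rewrite lt_min subr_gt0 mlt divr2_gt0.
have mn1 : Num.min (1 - m) (r / (cn (y - x) + 1) / 2) <= 1 - m by rewrite ge_min lexx.
have mn2 : Num.min (1 - m) (r / (cn (y - x) + 1) / 2) <= r / (cn (y - x) + 1) / 2 by rewrite ge_min lexx orbT.
have : T t.
  split=> [|s /andP[s0 st]]; first by apply/andP; rewrite /t; lra.
  case: (ltP s m) => sm; first by apply: inT; rewrite s0.
  apply: hr; rewrite pp ger0_norm ?subr_ge0 //.
  apply: le_lt_trans (_ : (s - m) * (cn (y - x) + 1) < _).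
    by rewrite ler_wpM2l ?subr_ge0 //; lra.
  by rewrite -ltr_pdivlMr //; rewrite /t in st; lra.
by move=> /(ub_le_sup hT.2); rewrite -/m /t; lra.
Qed.

Lemma nearest_bd Om x rho : opn Om -> bdd Om -> Om x -> ~ disk x rho `<=` Om ->
  exists x0, [/\ bd Om x0, 0 < cn (x - x0) < rho & disk x (cn (x - x0)) `<=` Om].
Proof.
move=> oO bO Ox nd.
have [y yr nOy] : exists2 y, cn (x - y) < rho & ~ Om y.
  apply: contrapT => h; apply: nd => y /= yx; apply: contrapT => nOy; apply: h.
  by exists y => //; rewrite cnB.
have [z bz zy] := bd_segment oO Ox nOy.
have [x0 bx0 hx0] : exists2 x0, bd Om x0 & forall w, bd Om w -> - cn (x - w) <= - cn (x - x0).
  apply: evt; [exact: bd_closed | by apply: bdd_sub (bdd_cl bO) => w [] | | by exists z].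
  apply/contN/(@cont_lip _ _ 1) => a b _ _; rewrite mul1r ler_norml.
  by have := cn_tri b x a; have := cn_tri a x b; rewrite (cnB a b) => h1 h2; apply/andP; lra.
exists x0; split => //.
  apply/andP; split; last by have := hx0 z bz; lra.
  by rewrite cn_gt0 subr_eq0; apply/eqP => xx; case: bx0 => _ []; rewrite -xx.
move=> w /= wx; apply: contrapT => nOw; have [p bp hp] := bd_segment oO Ox nOw.
by have := hx0 p bp; rewrite (cnB x w) in hp; lra.
Qed.

(** The number [G] encodes the differential [h |-> Re (G * h)]. The quadratic remainder makes [G]
    unique, so gradients obtained on different disks can be identified. *)
Definition isgrad v x (G : C) := exists r B : R, 0 < r /\
  forall h, cn h < r -> `|v (x + h) - v x - Re (G * h)| <= B * cn h ^+ 2.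

(** The direction [conj G / |G|] turns [Re (G * h)] into [|G| * t]. *)
Lemma cn_dual (G : C) t M : 0 < t -> (forall h, cn h = t -> Re (G * h) <= M) -> cn G * t <= M.
Proof.
move=> t0 h; case: (eqVneq G 0) => [G0|G0].
  by have := h t%:C%C; rewrite cnR gtr0_norm // G0 cn0 !mul0r => /(_ erefl).
have n0 : 0 < cn G by rewrite cn_gt0.
have nC : (cn G)%:C%C != 0 :> C by rewrite -cn_eq0 cnR normr_eq0 gt_eqF.
have := h (t%:C%C * (conjc G / (cn G)%:C%C)).
rewrite !cnM cnV !cnR cnC (gtr0_norm t0) (gtr0_norm n0) mulfV ?gt_eqF // mulr1 => /(_ erefl).
have -> : G * (t%:C%C * (conjc G / (cn G)%:C%C)) = t%:C%C * (cn G)%:C%C.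
  rewrite (_ : G * _ = t%:C%C * (G * conjc G) / (cn G)%:C%C); last by ring.
  by rewrite mul_conjc rmorphXn /= expr2; field.
by rewrite ReZ /= mulrC.
Qed.

Lemma isgrad_uniq v x (G H : C) : isgrad v x G -> isgrad v x H -> G = H.
Proof.
move=> [r [B [r0 hG]]] [r' [B' [r0' hH]]]; apply/eqP; rewrite -subr_eq0 -cn_eq0.
rewrite eq_le cn_ge0 andbT; apply: eps_le => e e0; rewrite add0r.
pose L := `|B| + `|B'| + 1; have L0 : 0 < L by rewrite /L ltr_wpDl // addr_ge0.
pose t := Num.min (Num.min r r' / 2) (e / L).
have m0 : 0 < Num.min r r' by rewrite lt_min r0.
have t0 : 0 < t by rewrite lt_min divr2_gt0 // divr_gt0.
have t1 : t <= Num.min r r' / 2 by rewrite ge_min lexx.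
have t2 : t <= e / L by rewrite ge_min lexx orbT.
have tr : t < r by have : Num.min r r' <= r; [rewrite ge_min lexx | lra].
have tr' : t < r' by have : Num.min r r' <= r'; [rewrite ge_min lexx orbT | lra].
have : cn (G - H) * t <= L * t ^+ 2.
  apply: cn_dual => // h ht; have := hG h; have := hH h; rewrite ht => /(_ tr') + /(_ tr).
  rewrite mulrBl ReB !ler_norml => /andP[h1 h2] /andP[h3 h4].
  have : B * t ^+ 2 <= `|B| * t ^+ 2 by rewrite ler_wpM2r ?sqr_ge0 ?ler_norm.
  have : B' * t ^+ 2 <= `|B'| * t ^+ 2 by rewrite ler_wpM2r ?sqr_ge0 ?ler_norm.
  by have := sqr_ge0 t; rewrite /L; lra.
rewrite expr2 mulrA ler_pM2r // => h; apply: le_trans h _.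
by rewrite mulrC -ler_pdivlMr.
Qed.

Lemma isgrad_affine v x (G H : C) c : isgrad v x G -> isgrad (fun z => v z - Re (H * (z - c))) x (G - H).
Proof.
move=> [r [B [r0 hG]]]; exists r, B; split => // h /hG.
rewrite (_ : v (x + h) - v x - Re (G * h) = v (x + h) - Re (H * (x + h - c)) - (v x - Re (H * (x - c))) - Re ((G - H) * h)) //.
have -> : H * (x + h - c) = H * (x - c) + H * h by ring.
by rewrite mulrBl !ReD !ReN; ring.
Qed.

Lemma harm_isgrad u x r M : 0 < r -> cont (cdisk x r) u -> harm (disk x r) u ->
  (forall z, cn (z - x) = r -> `|u z| <= M) -> exists2 G : C, isgrad u x G &
  cn G <= 2 * M / r /\ forall h, cn h <= r / 2 -> `|u (x + h) - u x - Re (G * h)| <= 4 * M / r ^+ 2 * cn h ^+ 2.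
Proof.
move=> r0 cu hu hM; have [G hG hq] := harm_grad r0 cu hu hM; exists G => //.
exists (r / 2), (4 * M / r ^+ 2); split; first exact: divr2_gt0.
by move=> h /ltW; exact: hq.
Qed.

(** The expansions at [x], on radius [rho], and at [y], on radius [rho / 2], are compared at [y + h]
    with [cn h = cn (y - x)]. Their quadratic remainders contribute [16 + 4 + 16 = 36]. *)
Lemma grad_lip u x y rho M (G H : C) : 0 < rho -> cont (cdisk x rho) u -> harm (disk x rho) u ->
  (forall z, cn (z - x) <= rho -> `|u z| <= M) -> isgrad u x G -> isgrad u y H ->
  cn (y - x) <= rho / 8 -> cn (G - H) <= 36 * M / rho ^+ 2 * cn (y - x).
Proof.
move=> r0 cu hu hM gG gH; set t := cn (y - x) => tr.
have M0 : 0 <= M by apply: le_trans (normr_ge0 _) (hM x _); rewrite subrr cn0 ltW.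
have [G' gG' [_ qG]] := harm_isgrad r0 cu hu (fun z zr => hM z (circle_cdisk zr)).
have sub : cdisk y (rho / 2) `<=` disk x rho.
  by move=> z /= zy; have := cn_tri y z x; rewrite -/t; lra.
have r2 := divr2_gt0 r0.
have [H' gH' [_ qH]] := @harm_isgrad u y (rho / 2) M r2
  (cont_sub (subset_trans sub (@disk_cdisk _ x rho)) cu)
  (harm_sub (subset_trans (@disk_cdisk _ y (rho / 2)) sub) hu)
  (fun z zr => hM z (ltW (sub z (circle_cdisk zr)))).
rewrite -(isgrad_uniq gG gG') in qG; rewrite -(isgrad_uniq gH gH') in qH.
have [t0|t0] := eqVneq t 0.
  have yx : y = x by apply/eqP; rewrite -subr_eq0 -cn_eq0 -/t t0.
  by rewrite yx in gH; rewrite (isgrad_uniq gG gH) subrr cn0 t0 mulr0.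
have tp : 0 < t by rewrite lt_def t0 cn_ge0.
rewrite -(ler_pM2r tp); apply: cn_dual => // h ht.
have e1 := qG (y - x + h) ltac:(apply: le_trans (cnD _ _) _; rewrite -/t ht; lra).
have e2 := qG (y - x) ltac:(rewrite -/t; lra).
have e3 := qH h ltac:(rewrite ht; lra).
have n1 : cn (y - x + h) ^+ 2 <= 4 * t ^+ 2.
  have := cnD (y - x) h; have := cn_ge0 (y - x + h); rewrite -/t ht; nra.
have X : x + (y - x + h) = y + h by ring.
have Y : x + (y - x) = y by ring.
rewrite X in e1; rewrite Y -/t in e2; rewrite ht in e3.
set q := M / rho ^+ 2; have q0 : 0 <= q by rewrite divr_ge0 ?exprn_ge0 ?(ltW r0).
have -> : 36 * M / rho ^+ 2 * t * t = 36 * (q * t ^+ 2) by rewrite /q; ring.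
have E1 : 4 * M / rho ^+ 2 * cn (y - x + h) ^+ 2 <= 16 * (q * t ^+ 2).
  have -> : 4 * M / rho ^+ 2 = 4 * q by rewrite /q; ring.
  by have := ler_wpM2l q0 n1; lra.
have E2 : 4 * M / rho ^+ 2 * t ^+ 2 = 4 * (q * t ^+ 2) by rewrite /q; ring.
have E3 : 4 * M / (rho / 2) ^+ 2 * t ^+ 2 = 16 * (q * t ^+ 2) by rewrite /q; field; rewrite gt_eqF.
rewrite E2 in e2; rewrite E3 in e3.
have := le_trans e1 E1; move: e2 e3.
rewrite (mulrDr G (y - x) h) (ReD (G * (y - x))) mulrBl ReB !ler_norml.
by move=> /andP[? ?] /andP[? ?] /andP[? ?]; lra.
Qed.

Lemma powR_scale (alpha k t : R) : 0 < alpha < 1 -> 1 <= k -> 0 <= t -> (k * t) `^ alpha <= k * t `^ alpha.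
Proof.
move=> /andP[a0 a1] k1 t0; rewrite powRM //; last by lra.
by rewrite ler_wpM2r ?powR_ge0 // ler1_powR // ltW.
Qed.

End GradientHolder.

Lemma three_constants (R : realFieldType) (k p X Y Z W a b : R) :
  0 <= k -> 0 <= k * p -> a <= 16 * p -> b <= 17 * p -> X <= 16 * k * a -> Y <= 5120 * k * p ->
  Z <= 16 * k * b -> W <= X + Y + Z -> W <= 6000 * (k * p).
Proof. by move=> k0 kp /(ler_wpM2l k0) ? /(ler_wpM2l k0) ? *; lra. Qed.

Lemma one_constant (R : realFieldType) (k p X : R) : 0 <= k * p -> X <= 576 * k * p -> X <= 6000 * (k * p).
Proof. by move=> *; lra. Qed.

Lemma close_bd (R : realFieldType) (t d c rho r : R) :
  0 < t -> t < rho -> 200 * rho <= r -> d / 16 < t -> c <= d + t -> c < r / 8 /\ c <= 17 * t.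
Proof. by move=> *; split; lra. Qed.

Lemma two_close (R : realDomainType) (x a b e : R) : `|x - a| <= e -> `|x - b| <= e -> `|a - b| <= 2 * e.
Proof. by rewrite !ler_norml => /andP[? ?] /andP[? ?]; apply/andP; lra. Qed.

(** * Hoelder estimate for the gradient up to the boundary *)

Section GlobalHolder.
Context {R : realType}.
Local Notation C := R[i].
Implicit Types (A D K G Om : set C) (u v f q : C -> R) (z w x y nu : C) (n k j : nat) (M e a b d t : R).

Lemma geo_bd_sub (alpha : R) Om (C0 r0 r1 : R) x0 nu : r1 <= r0 ->
  geo_bd alpha Om C0 r0 x0 nu -> geo_bd alpha Om C0 r1 x0 nu.
Proof. by move=> r10 [nu1 h]; split => // x xr; apply: h; apply: lt_le_trans r10. Qed.

Section Fixed.
Variables (alpha : R) (Om : set C) (s C0 r0 r K0 : R).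
Hypotheses (ha : 0 < alpha < 1) (oO : opn Om) (bO : bdd Om) (s0 : 0 < s) (C00 : 0 <= C0).
Hypotheses (r0s : r0 <= s) (r01 : r0 <= 1) (rp : 0 < r) (r2 : 2 * r < r0) (K00 : 0 <= K0).
Hypothesis geo : forall x0, bd Om x0 -> s < cn x0 -> exists nu, geo_bd alpha Om C0 r0 x0 nu.
Variables (v : C -> R) (M : R).
Hypotheses (cv : cont (cl Om `&` [set z | s < cn z]) v) (hv : harm (Om `&` [set z | s < cn z]) v)
  (M0 : 0 <= M) (vM : forall z, cl Om z -> s < cn z -> `|v z| <= M)
  (v0 : forall z, bd Om z -> s < cn z -> v z = 0).
Hypothesis expand : forall x0 nu, geo_bd alpha Om C0 r0 x0 nu -> bd Om x0 ->
   cont (cl Om `&` cdisk x0 r) v -> harm (Om `&` disk x0 r) v ->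
   (forall x, cl Om x -> cn (x - x0) <= r -> `|v x| <= M) ->
   (forall x, bd Om x -> cn (x - x0) <= r -> v x = 0) ->
   exists2 a, `|a| <= K0 * M & forall x, cl Om x -> cn (x - x0) <= r ->
     `|v x - Re (a%:C%C * conjc nu * (x - x0))| <= K0 * M * hpow alpha (cn (x - x0)).

Let a0 : 0 < alpha. Proof. by case/andP: ha. Qed.
Let a1 : alpha < 1. Proof. by case/andP: ha. Qed.
Let rho0 := r / 8.
Let KM0 : 0 <= K0 * M. Proof. exact: mulr_ge0. Qed.
Let rho00 : 0 < rho0. Proof. by rewrite divr_gt0. Qed.
Let rhor : rho0 = r / 8. Proof. by []. Qed.

Lemma near_data x : Om x -> 2 * s <= cn x -> ~ disk x rho0 `<=` Om ->
  exists x0 nu (A : C), [/\ bd Om x0 /\ geo_bd alpha Om C0 r0 x0 nu, 0 < cn (x - x0) < rho0,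
    disk x (cn (x - x0)) `<=` Om, cn A <= K0 * M &
    forall z, cl Om z -> cn (z - x0) <= r -> `|v z - Re (A * (z - x0))| <= K0 * M * hpow alpha (cn (z - x0))].
Proof.
move=> Ox xs nd; have [x0 [bx0 /andP[d0 d1] hd]] := nearest_bd oO bO Ox nd.
(* [x] has modulus at least [2 * s], and [rho0 + r], which is [9 * r / 8], is less than [s]. *)
have far z : cn (z - x0) <= r -> s < cn z.
  move=> zr; have := cn_tri x0 x 0; have := cn_tri z x0 0; rewrite !subr0 (cnB x0 z).
  by have := rhor; have := r2; have := r0s; have := rp; lra.
have [nu hnu] : exists nu, geo_bd alpha Om C0 r0 x0 nu by apply: geo => //; apply: far; rewrite subrr cn0 ltW.
have [||||a ha1 hexp] := expand hnu bx0.
- by apply: cont_sub cv => z [Oz zr]; split => //; exact: far.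
- by apply: harm_sub hv => z [Oz zr]; split => //; apply: far; exact: ltW.
- by move=> z Oz zr; apply: vM => //; exact: far.
- by move=> z bz zr; apply: v0 => //; exact: far.
exists x0, nu, (a%:C%C * conjc nu); split => //; first by rewrite d0.
by rewrite cnM cnR cnC hnu.1 mulr1.
Qed.

(** Subtracting the expansion at [x0] leaves a harmonic function of size [d ^ (1 + alpha)] on the
    disk of radius [d / 2]. Interior estimates divide by [d] for the gradient and by [d ^ 2] for its
    Lipschitz constant, and [d ^ alpha * (t / d) <= t ^ alpha] because [t <= d]. *)
Lemma near_grad x x0 (A g : C) : Om x -> 2 * s <= cn x -> 0 < cn (x - x0) < rho0 ->
  disk x (cn (x - x0)) `<=` Om ->
  (forall z, cl Om z -> cn (z - x0) <= r -> `|v z - Re (A * (z - x0))| <= K0 * M * hpow alpha (cn (z - x0))) ->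
  isgrad v x g ->
  cn (g - A) <= 16 * (K0 * M) * cn (x - x0) `^ alpha /\
  forall y gy, cn (y - x) <= cn (x - x0) / 16 -> isgrad v y gy ->
    cn (g - gy) <= 576 * (K0 * M) * cn (x - y) `^ alpha.
Proof.
move=> Ox xs /andP[]; set d := cn (x - x0) => d0 dr hd hA gx.
have d2 : 0 < d / 2 := divr2_gt0 d0.
have sub : cdisk x (d / 2) `<=` Om `&` [set z | s < cn z].
  move=> z /= zx; split; first by apply: hd; rewrite /= -/d; lra.
  have := cn_tri z x 0; rewrite !subr0 (cnB x z).
  by have := rhor; have := r2; have := r0s; have := rp; lra.
pose u z := v z - Re (A * (z - x0)).
have hlin D : harm D (fun z => Re (A * (z - x0))).
  apply: taylor3_harm => c _; apply: taylor3M; first exact: taylor3_cst.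
  by apply: taylor3D; [exact: taylor3_id | exact: taylor3_cst].
have cu : cont (cdisk x (d / 2)) u.
  apply: contB; last exact: (hlin _).1.
  by apply: cont_sub cv => z /sub[Oz sz]; split => //; exact: sub_cl.
have hu : harm (disk x (d / 2)) u.
  apply: harmB => //; apply: harm_sub hv; apply: subset_trans sub; exact: disk_cdisk.
have hp : hpow alpha (2 * d) <= 4 * (d * d `^ alpha).
  rewrite /hpow; have := powR_scale (t := d) ha (_ : 1 <= 2) (ltW d0).
  by move=> /(_ ltac:(lra)) h; have := ler_wpM2l (ltW d0) h; lra.
have uM z : cn (z - x) <= d / 2 -> `|u z| <= 4 * (K0 * M) * (d * d `^ alpha).
  move=> zx; have z2 : cn (z - x0) <= 2 * d by have := cn_tri x z x0; rewrite -/d; lra.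
  apply: le_trans (hA z _ _) _.
  - exact/sub_cl/(sub z zx).1.
  - by have := rhor; have := rp; lra.
  have hq : hpow alpha (cn (z - x0)) <= hpow alpha (2 * d) by apply: hpow_le => //; rewrite cn_ge0.
  by have := ler_wpM2l KM0 (le_trans hq hp); lra.
have gu : isgrad u x (g - A) := isgrad_affine A x0 gx.
have dd : d != 0 by rewrite gt_eqF.
split.
  have [G gG [hG _]] := harm_isgrad d2 cu hu (fun z zr => uM z (circle_cdisk zr)).
  rewrite (isgrad_uniq gu gG); apply: le_trans hG _.
  by rewrite le_eqVlt; apply/orP; left; apply/eqP; field.
move=> y gy yx hgy; have gu' : isgrad u y (gy - A) := isgrad_affine A x0 hgy.
have := grad_lip d2 cu hu uM gu gu' ltac:(lra); rewrite opprB addrA subrK => h; apply: le_trans h _.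
rewrite (cnB x y); set t := cn (y - x) in yx *; have t0 : 0 <= t := cn_ge0 _.
have -> : 36 * (4 * (K0 * M) * (d * d `^ alpha)) / (d / 2) ^+ 2 * t = 576 * (K0 * M) * (d `^ alpha * (t / d)).
  by field.
have KK : 0 <= 576 * (K0 * M) by have := KM0; lra.
apply: ler_wpM2l => //.
have [->|tn] := eqVneq t 0; first by rewrite mul0r mulr0 powR_ge0.
have tp : 0 < t / d by rewrite divr_gt0 // lt_def tn.
have t1 : t / d <= 1 by rewrite ler_pdivrMr // mul1r; lra.
apply: le_trans (_ : d `^ alpha * (t / d) `^ alpha <= _).
  by rewrite ler_wpM2l ?powR_ge0 // ger1_powR ?tp // ltW.
by rewrite -powRM ?(ltW d0) ?(ltW tp) // mulrC divfK.
Qed.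

Lemma deep_grad x (g : C) : 2 * s <= cn x -> disk x rho0 `<=` Om -> isgrad v x g ->
  cn g <= 4 / rho0 * M /\
  forall y gy, cn (y - x) <= rho0 / 16 -> isgrad v y gy -> cn (g - gy) <= 144 / rho0 ^+ 2 * M * cn (x - y) `^ alpha.
Proof.
move=> xs hd gx; have d2 : 0 < rho0 / 2 := divr2_gt0 rho00.
have sub : cdisk x (rho0 / 2) `<=` Om `&` [set z | s < cn z].
  move=> z /= zx; split; first by apply: hd => /=; have := rho00; lra.
  have := cn_tri z x 0; rewrite !subr0 (cnB x z).
  by have := rhor; have := r2; have := r0s; have := rp; lra.
have cu : cont (cdisk x (rho0 / 2)) v.
  by apply: cont_sub cv => z /sub[Oz sz]; split => //; exact: sub_cl.
have hu : harm (disk x (rho0 / 2)) v.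
  by apply: harm_sub hv; apply: subset_trans sub; exact: disk_cdisk.
have uM z : cn (z - x) <= rho0 / 2 -> `|v z| <= M.
  by move=> /sub[Oz sz]; apply: vM => //; exact: sub_cl.
have rr : rho0 != 0 by rewrite gt_eqF // rho00.
split.
  have [G gG [hG _]] := harm_isgrad d2 cu hu (fun z zr => uM z (circle_cdisk zr)).
  rewrite (isgrad_uniq gx gG); apply: le_trans hG _.
  by rewrite le_eqVlt; apply/orP; left; apply/eqP; field.
move=> y gy yx hgy.
have := grad_lip d2 cu hu uM gx hgy ltac:(lra) => h; apply: le_trans h _.
rewrite (cnB x y); set t := cn (y - x) in yx *; have t0 : 0 <= t := cn_ge0 _.
have -> : 36 * M / (rho0 / 2) ^+ 2 * t = 144 / rho0 ^+ 2 * M * t by field.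
have KK : 0 <= 144 / rho0 ^+ 2 * M.
  by apply: mulr_ge0 => //; apply: divr_ge0; [lra | rewrite exprn_ge0 // ltW // rho00].
apply: ler_wpM2l => //.
have [->|tn] := eqVneq t 0; first exact: powR_ge0.
apply: ger1_powR; last exact: ltW.
by rewrite lt_def tn t0 /=; have := rhor; have := r2; have := r01; have := rp; lra.
Qed.

(** Both linear functions approximate [v] on a common disk of radius comparable to [t] inside [Om].
    Their difference is of order [t ^ (1 + alpha)] there, which bounds the difference of the slopes
    by [t ^ alpha]. *)
Lemma near_both x0 nu (A : C) y0 (B : C) t : bd Om x0 -> geo_bd alpha Om C0 r0 x0 nu ->
  (forall z, cl Om z -> cn (z - x0) <= r -> `|v z - Re (A * (z - x0))| <= K0 * M * hpow alpha (cn (z - x0))) ->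
  (forall z, cl Om z -> cn (z - y0) <= r -> `|v z - Re (B * (z - y0))| <= K0 * M * hpow alpha (cn (z - y0))) ->
  0 < t -> cn (x0 - y0) <= 34 * t -> 160 * t <= r -> (120 * t) `^ alpha * (3 * C0) < 1 ->
  cn (A - B) <= 5120 * (K0 * M) * t `^ alpha.
Proof.
move=> bx0 [nu1 hgeo] hA hB t0 xy tr tC.
(* Moving [2 * T] along the inner normal keeps the disk of radius [T] about [z0] within
   [3 * T = 120 * t] of [x0], where the boundary deviates from its tangent by less than [T]; its
   points are within [160 * t] of [y0] as well. *)
pose T := 40 * t; pose z0 := x0 + (2 * T)%:C%C * nu.
have T0 : 0 < T by rewrite mulr_gt0.
have t160 : 0 <= 160 * t by lra.
have P0 : 0 <= K0 * M * hpow alpha (160 * t) by exact: mulr_ge0 KM0 (hpow_ge0 _ t160).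
have nn : conjc nu * nu = 1 by rewrite mulrC conj_unit.
have good h : cn h < T -> [/\ Om (z0 + h), cn (z0 + h - x0) <= 160 * t & cn (z0 + h - y0) <= 160 * t].
  move=> hT.
  have n1 : cn (z0 + h - x0) < 3 * T.
    rewrite (_ : z0 + h - x0 = (2 * T)%:C%C * nu + h); last by rewrite /z0; ring.
    by apply: le_lt_trans (cnD _ _) _; rewrite cnM cnR nu1 mulr1 ger0_norm; lra.
  split; last 2 first.
  - by rewrite /T in n1; lra.
  - by have := cn_tri x0 (z0 + h) y0; rewrite /T in n1; lra.
  have [_ h2] := hgeo (z0 + h) ltac:(have := r2; rewrite /T in n1; lra).
  apply: h2.
  have -> : conjc nu * (z0 + h - x0) = (2 * T)%:C%C + conjc nu * h.
    transitivity ((2 * T)%:C%C * (conjc nu * nu) + conjc nu * h); first by rewrite /z0; ring.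
    by rewrite nn mulr1.
  rewrite ReD /=.
  have := Re_le (conjc nu * h); rewrite cnM cnC nu1 mul1r ler_norml => /andP[h3 _].
  apply: le_lt_trans (_ : T < _); last by lra.
  apply: le_trans (_ : C0 * hpow alpha (3 * T) <= _).
    by rewrite ler_wpM2l // hpow_le // cn_ge0 ltW.
  rewrite /hpow (_ : 3 * T = 120 * t); last by rewrite /T; ring.
  have := ler_wpM2l (ltW T0) (ltW tC); rewrite /T; lra.
pose F h := Re (A * (z0 + h - x0)) - Re (B * (z0 + h - y0)).
have FM h : cn h < T -> `|F h| <= 2 * (K0 * M * hpow alpha (160 * t)).
  move=> /good[Oz zx zy].
  have := hA _ (sub_cl Oz) (le_trans zx tr); have := hB _ (sub_cl Oz) (le_trans zy tr).
  have e1 : K0 * M * hpow alpha (cn (z0 + h - x0)) <= K0 * M * hpow alpha (160 * t).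
    by rewrite ler_wpM2l // hpow_le // cn_ge0.
  have e2 : K0 * M * hpow alpha (cn (z0 + h - y0)) <= K0 * M * hpow alpha (160 * t).
    by rewrite ler_wpM2l // hpow_le // cn_ge0.
  move=> /le_trans /(_ e2) + /le_trans /(_ e1) => h1 h2; exact: two_close h2 h1.
have T2 : 0 < T / 2 := divr2_gt0 T0.
have : cn (A - B) * (T / 2) <= 4 * (K0 * M * hpow alpha (160 * t)).
  apply: cn_dual => // h hT; have := FM h ltac:(lra); have := FM 0 ltac:(by rewrite cn0).
  have : Re ((A - B) * h) = F h - F 0.
    rewrite /F; have -> : A * (z0 + h - x0) = A * (z0 + 0 - x0) + A * h by ring.
    have -> : B * (z0 + h - y0) = B * (z0 + 0 - y0) + B * h by ring.
    by rewrite mulrBl !ReD !ReN; ring.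
  by move=> ->; rewrite !ler_norml => /andP[? ?] /andP[? ?]; lra.
rewrite -ler_pdivlMr // => h; apply: le_trans h _; rewrite ler_pdivrMr //.
have e3 := powR_scale (k := 160) ha ltac:(lra) (ltW t0).
have tk : 0 <= K0 * M * t by rewrite mulr_ge0 // ltW.
by have := ler_wpM2l tk e3; rewrite /hpow /T; lra.
Qed.

Lemma grad_exists x : Om x -> 2 * s <= cn x -> exists g : C, isgrad v x g.
Proof.
move=> Ox xs; have [r' r'0 hr'] := oO Ox.
pose e := Num.min (r' / 2) (s / 2).
have e0 : 0 < e by rewrite lt_min !divr2_gt0.
have e1 : e <= r' / 2 by rewrite ge_min lexx.
have e2 : e <= s / 2 by rewrite ge_min lexx orbT.
have sub : cdisk x e `<=` Om `&` [set z | s < cn z].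
  move=> z /= zx; split; first by apply: hr'; lra.
  by have := cn_tri z x 0; rewrite !subr0 (cnB x z); have := s0; lra.
have [|||g hg _] := @harm_isgrad R v x e M e0; last by exists g.
- by apply: cont_sub cv => z /sub[Oz sz]; split => //; exact: sub_cl.
- by apply: harm_sub hv; apply: subset_trans sub; exact: disk_cdisk.
- by move=> z /circle_cdisk /sub[Oz sz]; apply: vM => //; exact: sub_cl.
Qed.

(** If [t] is small compared with the distance of [x] to the boundary, one disk serves both points.
    Otherwise both distances to the boundary are at most of order [t], and the gradients are
    compared through two boundary slopes, with [16 * 16 + 5120 + 16 * 17 <= 6000]. *)
Lemma near_case (x y gx gy : C) (rho1 : R) : Om x -> Om y -> 2 * s <= cn x -> 2 * s <= cn y ->
  isgrad v x gx -> isgrad v y gy -> ~ disk x rho0 `<=` Om -> 0 < cn (x - y) < rho1 -> 200 * rho1 <= r ->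
  (forall q : R, 0 <= q <= rho1 -> (120 * q) `^ alpha * (3 * C0) < 1) ->
  cn (gx - gy) <= 6000 * (K0 * M * cn (x - y) `^ alpha).
Proof.
move=> Ox Oy xs ys hgx hgy nd; have [t tE] : exists t, t = cn (x - y) by exists (cn (x - y)).
rewrite -tE => /andP[t0 tr] pr pC; have yx : cn (y - x) = t by rewrite cnB.
have [x0 [nu [A [[bx0 geox] dr hd _ hA]]]] := near_data Ox xs nd.
have /andP[d0 d1] := dr; have KMt : 0 <= K0 * M * t `^ alpha by rewrite mulr_ge0 ?powR_ge0.
case: (leP t (cn (x - x0) / 16)) => td.
  have [_ h2] := near_grad Ox xs dr hd hA hgx; have := h2 y gy; rewrite yx -tE => /(_ td hgy).
  exact: one_constant.
have tx := cn_tri x x0 y; rewrite (cnB x0 x) -tE in tx; have [g1 _] := close_bd t0 tr pr td tx.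
have ndy : ~ disk y rho0 `<=` Om by move=> hy; case: bx0 => _ []; apply: hy.
have [y0 [nuy [B' [[by0 geoy] dry hdy _ hB]]]] := near_data Oy ys ndy.
have dyt : cn (y - y0) <= 17 * t.
  rewrite leNgt; apply/negP => hlt; case: bx0 => _ []; apply: hdy => /=.
  by have [_ g2] := close_bd t0 tr pr td tx; exact: le_lt_trans g2 hlt.
have k16 : 1 <= 16 :> R by rewrite ler1n.
have k17 : 1 <= 17 :> R by rewrite ler1n.
have td16 : cn (x - x0) <= 16 * t by rewrite mulrC -ler_pdivrMr // ltW.
have p16 : cn (x - x0) `^ alpha <= 16 * t `^ alpha.
  refine (le_trans _ (powR_scale ha k16 (ltW t0))); apply: powR_le a0 _.
  by apply/andP; split; [exact: cn_ge0 | exact: td16].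
have p17 : cn (y - y0) `^ alpha <= 17 * t `^ alpha.
  refine (le_trans _ (powR_scale ha k17 (ltW t0))); apply: powR_le a0 _.
  by apply/andP; split; [exact: cn_ge0 | exact: dyt].
have [h1 _] := near_grad Ox xs dr hd hA hgx; have [h3 _] := near_grad Oy ys dry hdy hB hgy.
have h4 : cn (A - B') <= 5120 * (K0 * M) * t `^ alpha.
  apply: (near_both bx0 geox hA hB t0).
  - have := cn_tri x x0 y0; have := cn_tri y x y0; rewrite (cnB x0 x) -tE.
    by clear h1 h3 p16 p17 hA hB pC tx g1; lra.
  - by clear h1 h3 p16 p17 hA hB pC tx g1 dyt td16; lra.
  by apply: pC; rewrite (ltW t0) ltW.
apply: (@three_constants R (K0 * M) (t `^ alpha) _ _ _ _ _ _ KM0 KMt p16 p17 h1 h4 h3).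
have := cn_tri A gx gy; have := cn_tri B' A gy; rewrite (cnB B' gy).
by clear h1 h3 h4 p16 p17 hA hB pC tx g1 td16 dyt k16 k17; lra.
Qed.

(** Beyond the distance [rho1] the bound on the gradient suffices. Closer pairs use interior
    estimates if [x] is deep inside and [near_case] otherwise; the constant adds the three. *)
Lemma holder_bound (rho1 : R) : 0 < rho1 -> 200 * rho1 <= r ->
  (forall q : R, 0 <= q <= rho1 -> (120 * q) `^ alpha * (3 * C0) < 1) ->
  exists g : C -> C, forall x, Om x -> 2 * s <= cn x ->
   let B := 4 / rho0 + 17 * K0 in
   [/\ isgrad v x (g x), cn (g x) <= B * M & forall y, Om y -> 2 * s <= cn y ->
     cn (g x - g y) <= (2 * B / rho1 `^ alpha + 144 / rho0 ^+ 2 + 6000 * K0) * M * cn (x - y) `^ alpha].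
Proof.
move=> p0 pr pC.
have /choice[g hg] : forall x, exists G : C, Om x -> 2 * s <= cn x -> isgrad v x G.
  move=> x; case: (pselect (Om x /\ 2 * s <= cn x)) => [[Ox xs]|h].
    by have [G hG] := grad_exists Ox xs; exists G.
  by exists 0 => Ox xs; case: h.
pose B := 4 / rho0 + 17 * K0.
have B0 : 0 <= 4 / rho0 by rewrite divr_ge0 // ltW // rho00.
have gB x : Om x -> 2 * s <= cn x -> cn (g x) <= B * M.
  move=> Ox xs; have gx := hg x Ox xs; case: (pselect (disk x rho0 `<=` Om)) => nd.
    apply: le_trans (deep_grad xs nd gx).1 _; rewrite ler_wpM2r // /B lerDl mulr_ge0 //.
  have [x0 [nu [A [_ dr hd hA1 hA]]]] := near_data Ox xs nd.
  have [h1 _] := near_grad Ox xs dr hd hA gx; have /andP[d0 d1] := dr.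
  have h2 : cn (x - x0) `^ alpha <= 1.
    rewrite -(@powRr0 R 1) powR1; apply: le_trans (_ : 1 `^ alpha <= _); last by rewrite powR1.
    by apply: powR_le => //; rewrite cn_ge0 /=; have := rhor; have := r2; have := r01; have := rp; lra.
  have := ler_wpM2l KM0 h2; have := cn_tri A (g x) 0; rewrite !subr0 /B mulrDl => h3 h4.
  by have := mulr_ge0 B0 M0; lra.
exists g => x Ox xs /=; split; [exact: hg | exact: gB | move=> y Oy ys].
have [t tE] : exists t, t = cn (x - y) by exists (cn (x - y)).
have t0 : 0 <= t by rewrite tE cn_ge0.
rewrite -tE.
have gx := hg x Ox xs; have gy := hg y Oy ys.
have B00 : 0 <= B by rewrite /B addr_ge0 // mulr_ge0.
have q1 : 0 <= 2 * B / rho1 `^ alpha by rewrite divr_ge0 ?mulr_ge0 ?powR_ge0.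
have q2 : 0 <= 144 / rho0 ^+ 2 by rewrite divr_ge0 ?ler0n ?exprn_ge0 // ltW // rho00.
have ta := powR_ge0 t alpha.
have split3 (a b c X : R) : 0 <= a -> 0 <= b -> 0 <= c -> X <= a * M * t `^ alpha \/ X <= b * M * t `^ alpha \/ X <= c * M * t `^ alpha ->
   X <= (a + b + c) * M * t `^ alpha.
  move=> ? ? ? hX; have Mt := mulr_ge0 M0 ta.
  case: hX => [|[]] h; apply: le_trans h _; rewrite -!(mulrA _ M) ler_wpM2r //.
  - by rewrite -addrA lerDl addr_ge0.
  - by rewrite addrAC lerDr addr_ge0.
  - by rewrite lerDr addr_ge0.
have q3 : 0 <= 6000 * K0 by rewrite mulr_ge0 ?ler0n ?K00.
apply: (split3 _ _ _ _ q1 q2 q3).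
case: (leP rho1 t) => tp1.
  left; have pw : 0 < rho1 `^ alpha := powR_gt0 _ p0.
  have h1 : 1 <= t `^ alpha / rho1 `^ alpha.
    by rewrite ler_pdivlMr // mul1r; apply: powR_le => //; rewrite (ltW p0).
  apply: le_trans (_ : 2 * B * M <= _).
    apply: le_trans (cnD _ _) _; rewrite cnN; apply: le_trans (lerD (gB x Ox xs) (gB y Oy ys)) _.
    by rewrite -mulrA mulr_natl mulr2n.
  have := ler_wpM2l (_ : 0 <= 2 * B * M) h1; rewrite mulr1 => h2.
  apply: le_trans (h2 _) _; first by rewrite !mulr_ge0.
  by rewrite le_eqVlt; apply/orP; left; apply/eqP; ring.
right; have [tz|tz] := eqVneq t 0.
  have xy : x = y by apply/eqP; rewrite -subr_eq0 -cn_eq0 -tE tz.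
  left; have -> : g x - g y = 0 by rewrite xy subrr.
  by rewrite cn0; exact: mulr_ge0 (mulr_ge0 q2 M0) ta.
have tp : 0 < t by rewrite lt_def tz.
case: (pselect (disk x rho0 `<=` Om)) => nd.
  left; have := (deep_grad xs nd gx).2 y (g y); rewrite cnB -tE; apply => //.
  by have := rhor; have := rp; clear q1 q2 q3 split3 B0 B00 gB; lra.
right; rewrite -(mulrA (6000 * K0)) -(mulrA 6000) (mulrA K0) tE.
by apply: near_case Ox Oy xs ys gx gy nd _ pr pC; rewrite -tE tp.
Qed.

End Fixed.

(** [K] depends on the geometry alone, so the estimate is linear in [M] and applies to whole
    families of functions. The loss from [s] to [2 * s] leaves room for the disks around boundary
    points. *)
Theorem grad_holder (alpha : R) Om (s C0 r0 : R) : 0 < alpha < 1 -> opn Om -> bdd Om -> 0 < s ->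
  0 <= C0 -> 0 < r0 ->
  (forall x0, bd Om x0 -> s < cn x0 -> exists nu, geo_bd alpha Om C0 r0 x0 nu) ->
  exists2 K : R, 0 <= K & forall v M,
    cont (cl Om `&` [set z | s < cn z]) v -> harm (Om `&` [set z | s < cn z]) v -> 0 <= M ->
    (forall z, cl Om z -> s < cn z -> `|v z| <= M) -> (forall z, bd Om z -> s < cn z -> v z = 0) ->
    exists g : C -> C, forall x, Om x -> 2 * s <= cn x ->
     [/\ isgrad v x (g x), cn (g x) <= K * M & forall y, Om y -> 2 * s <= cn y ->
       cn (g x - g y) <= K * M * cn (x - y) `^ alpha].
Proof.
move=> ha oO bO s0 C00 r00 geo; have /andP[a0 a1] := ha.
pose r1 := Num.min r0 (Num.min s 1).
have r10 : 0 < r1 by rewrite !lt_min r00 s0 ltr01.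
have r1a : r1 <= r0 by rewrite ge_min lexx.
have r1b : r1 <= s by rewrite !ge_min lexx orbT.
have r1c : r1 <= 1 by rewrite !ge_min lexx !orbT.
have [r [K0 [[rp r2 K00] expand]]] := bdry_expansion ha C00 r10.
have C1 : 0 < 3 * C0 + 1 by lra.
(* Solves [q ^ alpha * (3 * C0 + 1) = 1], giving the smallness asked by [near_both]; the added 1
   makes the inequality strict and covers [C0 = 0]. *)
pose q := (1 / (3 * C0 + 1)) `^ alpha^-1.
have q0 : 0 < q by rewrite powR_gt0 // divr_gt0.
pose rho1 := Num.min (r / 200) (q / 120).
have p0 : 0 < rho1 by rewrite lt_min !divr_gt0 ?ltr0n.
have p1 : rho1 <= r / 200 by rewrite ge_min lexx.
have p2 : rho1 <= q / 120 by rewrite ge_min lexx orbT.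
have pC (q' : R) : 0 <= q' <= rho1 -> (120 * q') `^ alpha * (3 * C0) < 1.
  move=> /andP[q0' q1']; pose X := 1 / (3 * C0 + 1).
  have X0 : 0 < X by rewrite divr_gt0.
  have XE : X * (3 * C0 + 1) = 1 by rewrite /X divfK // gt_eqF.
  have h : (120 * q') `^ alpha <= X.
    have -> : X = q `^ alpha.
      by rewrite /q -powRrM mulVf ?gt_eqF // powRr1 // ltW.
    apply: powR_le => //; rewrite mulr_ge0 ?ler0n //= mulrC -ler_pdivlMr ?ltr0n //.
    exact: le_trans p2.
  have C3 : 0 <= 3 * C0 by rewrite mulr_ge0.
  rewrite mulrC; apply: le_lt_trans (ler_wpM2l C3 h) _.
  have -> : 3 * C0 * X = X * (3 * C0 + 1) - X by clearbody X; ring.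
  by rewrite XE ltrBlDr ltrDl.
have pr : 200 * rho1 <= r by rewrite mulrC -ler_pdivlMr ?ltr0n.
have [B BE] : exists B, B = 4 / (r / 8) + 17 * K0 by eexists.
have [H HE] : exists H, H = 2 * B / rho1 `^ alpha + 144 / (r / 8) ^+ 2 + 6000 * K0 by eexists.
have B0 : 0 <= B by rewrite BE addr_ge0 ?divr_ge0 ?mulr_ge0 // ltW // divr_gt0.
have H0 : 0 <= H.
  have q1 : 0 <= 2 * B / rho1 `^ alpha by rewrite divr_ge0 ?mulr_ge0 ?powR_ge0.
  have q2 : 0 <= 144 / (r / 8) ^+ 2 by rewrite divr_ge0 ?ler0n ?exprn_ge0 ?divr_ge0 // ltW.
  by rewrite HE; apply: addr_ge0; [exact: addr_ge0 | exact: mulr_ge0 (ler0n _ _) K00].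
exists (B + H); first exact: addr_ge0.
move=> v M cv hv M0 vM v0.
have geo1 x0 : bd Om x0 -> s < cn x0 -> exists nu, geo_bd alpha Om C0 r1 x0 nu.
  by move=> bx sx; have [nu h] := geo x0 bx sx; exists nu; exact: geo_bd_sub h.
have [g hg] := holder_bound ha oO bO s0 C00 r1b r1c rp r2 K00 geo1 cv hv M0 vM v0
  (fun x0 nu hnu bx0 c h vm vz => expand Om x0 nu v M oO hnu bx0 c h M0 vm vz) p0 pr pC.
exists g => x Ox xs; have := hg x Ox xs; rewrite /= -BE -HE => -[h1 h2 h3]; split => //.
  by apply: le_trans h2 _; rewrite ler_wpM2r // lerDl.
move=> y Oy ys; apply: le_trans (h3 y Oy ys) _.
by rewrite ler_wpM2r ?powR_ge0 // ler_wpM2r // lerDr.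
Qed.

End GlobalHolder.

(** * Exterior problem in the half plane *)

Section Exterior.
Context {R : realType}.
Local Notation C := R[i].
Implicit Types (A D : set C) (u v f q y : C -> R) (z w c x : C) (n k m : nat) (r M e F : R).

Lemma realC_neq0 (r : R) : r != 0 -> r%:C%C != 0 :> C.
Proof. by move=> r0; rewrite -cn_eq0 cnR normr_eq0. Qed.

Lemma inv_near z e : z != 0 -> 0 < e -> exists2 d, 0 < d & forall w, cn (w - z) < d ->
  w != 0 /\ cn (w^-1 - z^-1) < e.
Proof.
move=> z0 e0; have zp : 0 < cn z by rewrite cn_gt0.
pose d := Num.min (cn z / 2) (e * cn z ^+ 2 / 4).
have e1 : 0 < e * cn z ^+ 2 / 4 by rewrite divr_gt0 // mulr_gt0 // exprn_gt0.
exists d; first by rewrite lt_min divr2_gt0.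
move=> w; rewrite lt_min => /andP[w1 w2].
have wz : cn z / 2 <= cn w by have := cnBD z w; rewrite cnB; lra.
have wp : 0 < cn w by lra.
have w0 : w != 0 by rewrite -cn_gt0.
split=> //; rewrite (_ : w^-1 - z^-1 = - ((w - z) / (w * z))); last by field; rewrite z0.
rewrite cnN cnM cnV cnM ltr_pdivrMr ?mulr_gt0 //; apply: lt_le_trans w2 _.
have := ler_wpM2l (ltW (mulr_gt0 e0 zp)) wz; have := mulr_gt0 (mulr_gt0 e0 zp) zp; rewrite expr2; lra.
Qed.

Definition invset D : set C := [set z | z != 0 /\ D z^-1].

Lemma invset_opn D : opn D -> opn (invset D).
Proof.
move=> oD z [z0 Dz]; have [r r0 hr] := oD _ Dz; have [d d0 hd] := inv_near z0 r0.
by exists d => // w /hd[w0 wr]; split => //; exact: hr.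
Qed.

Lemma cont_inv A u : cont A u -> cont (invset A) (fun z => u z^-1).
Proof.
move=> cu z [z0 Az] e e0; have [r r0 hr] := cu _ Az e e0; have [d d0 hd] := inv_near z0 r0.
by exists d => // w [_ Aw] /hd[_ wr]; exact: hr.
Qed.

(** In the variable [(z^-1 - c) / r] the partial sums of the local power series of [u] are real
    parts of functions with third-order expansions, and they converge uniformly. *)
Lemma harm_inv D u : opn D -> harm D u -> harm (invset D) (fun z => u z^-1).
Proof.
move=> oD hu; apply: harm_loc => z0 [z00 Dz]; have [r r0 [M [a ha]]] := harm_disk_rep oD hu Dz.
set c := z0^-1 in Dz ha.
exists (invset (disk c (r / 2))).
  split; first exact/invset_opn/disk_opn.
  by split => //; rewrite /= subrr cn0 divr2_gt0.
apply: harm_unif => [|e e0]; first exact/invset_opn/disk_opn.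
have M0 := rep_ge0 ha.
pose wt z : C := (z^-1 - c) / r%:C%C.
have wr z : invset (disk c (r / 2)) z -> cn (wt z) <= 1 / 2.
  by move=> [_ /= h]; rewrite cnM cnV cnR gtr0_norm // ler_pdivrMr //; lra.
have half : 0 <= 1 / 2 :> R by lra.
have half1 : 1 / 2 < 1 :> R by lra.
have [N hN] := expr_small (s := 1 / 2) (e := e / (4 * M + 1)) ltac:(by apply/andP; split) ltac:(by rewrite divr_gt0 //; lra).
exists (fun z => Re (\sum_(k < N) a k * wt z ^+ k)).
  apply: taylor3_harm => x [x0 _].
  have hw : taylor3 wt x.
    apply: taylor3M; last exact: taylor3_cst.
    by apply: taylor3D; [exact: taylor3V | exact: taylor3_cst].
  elim: N {hN} => [|N IH].
    by under eq_fun do rewrite big_ord0; exact: taylor3_cst.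
  under eq_fun do rewrite big_ord_recr /=; apply: taylor3D => //.
  by apply: taylor3M; [exact: taylor3_cst | exact: taylor3X].
move=> z hz; have := rep_tail N ha (wr z hz) half1; rewrite -Re_sum.
have -> : c + r%:C%C * wt z = z^-1.
  by rewrite /wt mulrC divfK ?realC_neq0 ?gt_eqF // addrC subrK.
rewrite distrC => h; apply: le_trans h _.
have L0 : 0 < 4 * M + 1 by lra.
have := hN N (leqnn N); rewrite (ler_pdivlMr _ _ L0).
have h0 : 0 <= (1 / 2 : R) ^+ N by rewrite exprn_ge0.
move: ((1 / 2 : R) ^+ N) h0 => X X0 hX.
have -> : 2 * M * X / (1 - 1 / 2) = 4 * M * X by field.
by clear - hX X0; lra.
Qed.

Lemma cont_loc A u : (forall z, A z -> exists2 r, 0 < r & cont (A `&` disk z r) u) -> cont A u.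
Proof.
move=> h z Az e e0; have [r r0 cu] := h z Az.
have zz : disk z r z by rewrite /= subrr cn0.
have [d d0 hd] := cu z (conj Az zz) e e0; exists (Num.min d r); first by rewrite lt_min d0.
by move=> w Aw; rewrite lt_min => /andP[wd wr]; apply: hd.
Qed.

Lemma flatat_sub A D x : A `<=` D -> flatat D x -> flatat A x.
Proof. by move=> AD [nu n1 [r r0 h]]; exists nu => //; exists r => // s hs z /AD; exact: h. Qed.

(** A half disk is convex: the half plane above the diameter, or the tangent half plane of the
    circle, contains it, also at the two corners. *)
Lemma flat_hdisk r x : 0 < r -> bd (hdisk r) x -> flatat (hdisk r) x.
Proof.
move=> r0 /bd_hdisk[_ [x0|xr]].
  exists 'i%C; first exact: cni.
  exists 1 => // s /andP[s0 _] z [_ zI] _.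
  by rewrite ReM ReC ImC /= ImB x0; lra.
have x0 : x != 0 by rewrite -cn_gt0 xr.
have rr : r%:C%C != 0 :> C by rewrite realC_neq0 ?gt_eqF.
exists (- (r^-1%:C%C * x)).
  by rewrite cnN cnM cnR xr ger0_norm ?invr_ge0 ?ltW // mulVf // gt_eqF.
exists 1 => // s /andP[s0 _] z [zr _] _.
suff : 0 <= Re (conjc (- (r^-1%:C%C * x)) * (z - x)) by lra.
have -> : conjc (- (r^-1%:C%C * x)) * (z - x) = r^-1%:C%C * (x * conjc x - conjc x * z).
  have -> : conjc (- (r^-1%:C%C * x)) = - (r^-1%:C%C * conjc x).
    by apply: complex_eq; rewrite ?ReN ?ImN ?ReC ?ImC ?ReN ?ImN ?ReZ ?ImZ ?ReC ?ImC //; ring.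
  by ring.
rewrite ReZ mulr_ge0 ?invr_ge0 ?(ltW r0) // ReB mul_conjc /= xr subr_ge0.
apply: le_trans (ler_norm _) _; apply: le_trans (Re_le _) _.
by rewrite cnM cnC xr expr2 ler_wpM2l // ltW.
Qed.

(* The barrier [Im (-1 / (z + i))]. *)
Definition barrier z : R := Re ('i%C * (z + 'i%C)^-1).

Lemma shift_i z : 0 <= Im z -> z + 'i%C != 0 /\ Num.max (cn z) 1 <= cn (z + 'i%C).
Proof.
move=> z0; have h2 : cn (z + 'i%C) ^+ 2 = cn z ^+ 2 + 2 * Im z + 1.
  by rewrite !cn2 ReD ImD /=; ring.
have h := cn_ge0 z; have h' := cn_ge0 (z + 'i%C).
have h1 : 1 <= cn (z + 'i%C) by nra.
split; first by rewrite -cn_gt0; lra.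
by rewrite ge_max h1 andbT; nra.
Qed.

Lemma barrierE z : 0 <= Im z -> barrier z = (Im z + 1) / cn (z + 'i%C) ^+ 2.
Proof.
move=> z0; have [n0 _] := shift_i z0; have p0 : 0 < cn (z + 'i%C) by rewrite cn_gt0.
have -> : barrier z = Re ((cn (z + 'i%C) ^+ 2)^-1%:C%C * ('i%C * conjc (z + 'i%C))).
  rewrite /barrier mulrCA; congr (Re (_ * _)); apply: (mulfI n0).
  by rewrite mulfV // mulrCA mul_conjc -rmorphM /= mulVf // expf_neq0 // gt_eqF.
by rewrite ReZ ReM ReC ImC ImD /=; field; rewrite gt_eqF.
Qed.

Lemma barrier_bounds z : 0 <= Im z -> [/\ 0 <= barrier z, barrier z * cn z <= 1 &
  forall rho, cn z <= rho -> 1 <= (rho + 1) ^+ 2 * barrier z].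
Proof.
move=> z0; have [n0 hm] := shift_i z0; have p0 : 0 < cn (z + 'i%C) by rewrite cn_gt0.
have q0 : 0 < cn (z + 'i%C) ^+ 2 by rewrite exprn_gt0.
have hz : cn z <= cn (z + 'i%C) by apply: le_trans hm; rewrite le_max lexx.
have hI : Im z + 1 <= cn (z + 'i%C).
  by have := Im_le (z + 'i%C); rewrite ImD /= ler_norml => /andP[].
rewrite barrierE //; split.
- by rewrite divr_ge0 ?(ltW q0) //; lra.
- rewrite mulrAC ler_pdivrMr // mul1r expr2; apply: ler_pM; rewrite ?cn_ge0 //; lra.
move=> rho zr; rewrite mulrA ler_pdivlMr // mul1r.
have := cnD z 'i%C; rewrite cni => h; have rz := cn_ge0 z.
by apply: le_trans (_ : (rho + 1) ^+ 2 * 1 <= _); [rewrite mulr1; nra | rewrite ler_wpM2l ?sqr_ge0 //; lra].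
Qed.

Lemma harm_barrier D : (forall z, D z -> 0 <= Im z) -> harm D barrier.
Proof.
move=> hD; apply: taylor3_harm => c /hD /shift_i[c0 _].
apply: taylor3M; first exact: taylor3_cst.
have [f1 [f2 [r [d [br d0 h]]]]] := taylor3V c0; exists f1, f2, r, d; split => // x xd.
by rewrite -h // addrAC.
Qed.

End Exterior.

(** * The half plane outside a compact set *)

Section ExteriorSolution.
Context {R : realType}.
Local Notation C := R[i].
Implicit Types (A D : set C) (u v f q y : C -> R) (z w c x : C) (n k m : nat) (r M e F : R).
Variables (K : set C) (rho : R).
Hypotheses (clK : cl K `<=` K) (Khalf : forall z, K z -> 0 < Im z) (Krho : forall z, K z -> cn z < rho)
  (rho0 : 0 < rho) (flatK : forall x, bd (~` K) x -> flatat (~` K) x).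

Definition extd r := hdisk r `\` K.
Definition ext := [set z : C | 0 < Im z] `\` K.

Lemma coK_opn : opn (~` K).
Proof.
move=> z nz; apply: contrapT => h; apply: nz; apply: clK => r r0.
apply: contrapT => h'; apply: h; exists r => // w wr Kw; apply: h'.
by exists w.
Qed.

Lemma extd_opn r : opn (extd r).
Proof. by rewrite /extd setDE; apply: opnI coK_opn; exact: hdisk_opn. Qed.

Lemma ext_opn : opn ext.
Proof. by rewrite /ext setDE; apply: opnI coK_opn; exact: half_opn. Qed.

Lemma extd_bdd r : bdd (extd r).
Proof. by apply: bdd_sub (hdisk_bdd r) => z []. Qed.

Lemma cl_extd r : cl (extd r) `<=` chdisk r.
Proof. by apply: subset_trans (@cl_hdisk _ r); apply: cl_sub => z []. Qed.

Lemma bd_extd r z : bd (extd r) z -> bd (~` K) z /\ K z \/ bd (hdisk r) z /\ ~ K z.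
Proof.
move=> [cz nz]; case: (pselect (K z)) => Kz; [left | right]; split => //; split.
- by apply: cl_sub cz => w [].
- by move=> /(_ Kz).
- by apply: cl_sub cz => w [].
- by move=> hz; apply: nz.
Qed.

Lemma extd_flat r x : 0 < r -> bd (extd r) x -> flatat (extd r) x.
Proof.
move=> r0 /bd_extd[[bx _]|[bx _]].
  by apply: flatat_sub (flatK bx) => z [].
by apply: flatat_sub (flat_hdisk r0 bx) => z [].
Qed.

(** The problem truncated at radius [r], with zero datum on the outer half circle. The last bound, a
    decay like [1 / |z|] uniform in [r], makes the truncations converge as [r] grows. *)
Definition ext_sol r f F y := [/\ cont (cl (extd r)) y, harm (extd r) y,
  forall z, cl (extd r) z -> [/\ K z -> y z = f z, Im z = 0 -> y z = 0 & cn z = r -> y z = 0],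
  forall z, cl (extd r) z -> `|y z| <= F &
  forall z, cl (extd r) z -> `|y z| * cn z <= F * (rho + 1) ^+ 2].

Lemma ext_half_disk r f F : rho <= r -> 0 <= F -> cont (bd (~` K)) f ->
  (forall z, bd (~` K) z -> `|f z| <= F) -> exists y, ext_sol r f F y.
Proof.
move=> rr F0 cf fF; have r0 : 0 < r := lt_le_trans rho0 rr.
pose phi z : R := if pselect (K z) then f z else 0.
have phiK z : K z -> phi z = f z by rewrite /phi; case: pselect.
have phiN z : ~ K z -> phi z = 0 by rewrite /phi; case: pselect.
have cphi : cont (bd (extd r)) phi.
  move=> z bz e e0; case: (pselect (K z)) => Kz.
    have bKz : bd (~` K) z by case: (bd_extd bz) => -[].
    have [d d0 hd] := cf z bKz e e0.
    have hz : hdisk r z by split; [exact: lt_le_trans (Krho Kz) rr | exact: Khalf].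
    have [d' d0' hd'] := hdisk_opn hz; exists (Num.min d d'); first by rewrite lt_min d0.
    move=> w bw; rewrite lt_min => /andP[wd /hd' hw].
    case: (bd_extd bw) => [[bKw Kw]|[[_ nh] _]]; last by case: nh.
    by rewrite !phiK //; exact: hd.
  have [d d0 hd] := coK_opn Kz; exists d => // w _ /hd Kw; rewrite !phiN //.
  by rewrite subrr normr0 ltW.
have phiF z : bd (extd r) z -> `|phi z| <= F.
  move=> /bd_extd h; case: (pselect (K z)) => Kz; last by rewrite phiN // normr0.
  rewrite phiK //.
  by apply: fF; case: h => -[].
have oD := @extd_opn r; have bD := extd_bdd r.
have [y [cy hy yphi]] := dirichlet oD bD (fun x => @extd_flat _ x r0) cphi.
exists y; split => //.
- move=> z cz; have [z1 z2] := cl_extd cz.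
  have edge : ~ hdisk r z -> y z = 0.
    move=> nh; rewrite yphi; last by split => // -[].
    case: (pselect (K z)) => [Kz|/phiN //]; case: nh; split; last exact: Khalf.
    exact: lt_le_trans (Krho Kz) rr.
  split=> [Kz|z0|zr].
  + rewrite yphi; last by split => // -[].
    exact: phiK.
  + by apply: edge => -[_]; rewrite z0 ltxx.
  + by apply: edge => -[]; rewrite zr ltxx.
- exact: (dirichlet_bound oD bD cy hy yphi phiF).
move=> z cz; have [_ z2] := cl_extd cz; have [b0 b1 _] := barrier_bounds z2.
have hI w : cl (extd r) w -> 0 <= Im w by move=> /cl_extd[].
have hb A (l : R) : (forall w, A w -> 0 <= Im w) -> harm A (fun w => l * barrier w).
  by move=> hA; apply: harmZ; exact: harm_barrier.
pose L := F * (rho + 1) ^+ 2; have L0 : 0 <= L by rewrite mulr_ge0 ?sqr_ge0.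
have bL w : bd (extd r) w -> `|phi w| <= L * barrier w.
  move=> bw; have [c0 _ hc] := barrier_bounds (hI w bw.1).
  case: (pselect (K w)) => Kw; last by rewrite phiN // normr0 mulr_ge0.
  rewrite phiK //.
  have bKw : bd (~` K) w by case: (bd_extd bw) => -[].
  have h2 := hc rho (ltW (Krho Kw)); have h1 := fF w bKw.
  by have := ler_wpM2l F0 h2; rewrite /L; lra.
have L1 : `|y z| <= L * barrier z.
  rewrite ler_norml; apply/andP; split.
    rewrite lerNl; apply: (mp_le (u := fun z => - y z) (v := fun z => L * barrier z) oD bD) => //.
    - exact: contN.
    - exact: (hb _ _ hI).1.
    - exact/harm_subh/harmN.
    - by apply: hb => w /sub_cl /hI.
    by move=> w bw; rewrite yphi //; have := bL w bw; rewrite ler_norml => /andP[]; lra.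
  apply: (mp_le (v := fun z => L * barrier z) oD bD) => //.
  - exact: (hb _ _ hI).1.
  - exact/harm_subh.
  - by apply: hb => w /sub_cl /hI.
  by move=> w bw; rewrite yphi //; have := bL w bw; rewrite ler_norml => /andP[].
have := ler_wpM2r (cn_ge0 z) L1; have := ler_wpM2l L0 b1; rewrite mulrA mulr1 -/L; lra.
Qed.

Lemma extdS r r' : r <= r' -> extd r `<=` extd r'.
Proof. by move=> rr z [[zr z0] Kz]; split => //; split => //; exact: lt_le_trans rr. Qed.

Lemma ext_cl_extd r z : cl ext z -> cn z < r -> cl (extd r) z.
Proof.
move=> cz zr; rewrite (_ : extd r = disk 0 r `&` ext); last first.
  apply/funext => w; apply/propext; rewrite /extd /ext /hdisk /= subr0.
  by split => [[[]]|[? []]].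
by apply: clU; [exact: disk_opn | rewrite /= subr0].
Qed.

(** On the boundary of the smaller truncation the two solutions differ only on the arc of radius
    [r], where the larger one has already decayed. *)
Lemma ext_sol_diff r r' f F y y' : rho <= r -> r <= r' -> ext_sol r f F y -> ext_sol r' f F y' ->
  forall z, cl (extd r) z -> `|y z - y' z| <= F * (rho + 1) ^+ 2 / r.
Proof.
move=> rr rr' [cy hy ey _ _] [cy' hy' ey' bF bL].
have r0 : 0 < r := lt_le_trans rho0 rr.
have cs := cl_sub (extdS rr').
apply: (mp_abs (@extd_opn r) (extd_bdd r)) => //.
- exact: cont_sub cy'.
- exact: harm_sub (extdS rr') hy'.
move=> z bz; have cz := bz.1; have cz' := cs _ cz.
have [yK y0 yr] := ey z cz; have [yK' y0' _] := ey' z cz'.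
have L0 : 0 <= F * (rho + 1) ^+ 2 / r.
  have F0 := le_trans (normr_ge0 _) (bF z cz').
  exact: divr_ge0 (mulr_ge0 F0 (sqr_ge0 _)) (ltW r0).
case: (bd_extd bz) => [[_ Kz]|[bh _]]; first by rewrite yK // yK' // subrr normr0.
have [_ [z0|zr]] := bd_hdisk bh; first by rewrite y0 // y0' // subrr normr0.
by rewrite yr // sub0r normrN ler_pdivlMr // -{1}zr; exact: bL.
Qed.

Definition mpole k z : R := - Im (z^-1 ^+ k).

Lemma ext_exists f F : 0 <= F -> cont (bd (~` K)) f -> (forall z, bd (~` K) z -> `|f z| <= F) ->
  exists y, [/\ cont (cl ext) y, harm ext y,
    forall z, cl ext z -> (K z -> y z = f z) /\ (Im z = 0 -> y z = 0),
    forall z, cl ext z -> `|y z| <= F &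
    forall z, cl ext z -> `|y z| * cn z <= F * (rho + 1) ^+ 2].
Proof.
move=> F0 cf fF; pose L := F * (rho + 1) ^+ 2; have L0 : 0 <= L by rewrite mulr_ge0 ?sqr_ge0.
pose rr n : R := rho + n%:R.
have rrho n : rho <= rr n by rewrite lerDl.
have nrr n : n%:R <= rr n by have := rho0; rewrite /rr; lra.
have rr0 n : 0 < rr n := lt_le_trans rho0 (rrho n).
have rrS m n : (m <= n)%N -> rr m <= rr n by move=> mn; rewrite lerD2l ler_nat.
have /choice[ys hys] : forall n, exists y, ext_sol (rr n) f F y.
  by move=> n; exact: ext_half_disk.
have small e : 0 < e -> exists N, forall n, (N <= n)%N -> L / rr n <= e.
  move=> e0; have [N hN] := archi (L / e); exists N.+1 => n Nn.
  rewrite ler_pdivrMr // mulrC -ler_pdivrMr //; apply: le_trans (ltW hN) _.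
  by apply: le_trans (nrr n); rewrite ler_nat.
have cauchy m n z : (m <= n)%N -> cl (extd (rr m)) z -> `|ys m z - ys n z| <= L / rr m.
  by move=> mn; apply: ext_sol_diff (hys m) (hys n) _ => //; exact: rrS.
have /choice[y hy] : forall z, exists l, forall n, cl (extd (rr n)) z -> `|ys n z - l| <= L / rr n.
  move=> z; case: (pselect (exists n, cl (extd (rr n)) z)) => [[n0 cz]|nz]; last first.
    by exists 0 => n cz; case: nz; exists n.
  have mono m n : (m <= n)%N -> cl (extd (rr m)) z -> cl (extd (rr n)) z.
    by move=> mn; apply: cl_sub; apply: extdS; exact: rrS.
  have [|l hl] := @cauchy_tends _ (fun n => ys n z).
    move=> e e0; have [N hN] := small _ e0; exists (maxn N n0) => m n.
    rewrite !geq_max => /andP[Nm n0m] /andP[Nn n0n]; case: (leqP m n) => mn.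
      by apply: le_trans (cauchy m n z mn (mono _ _ n0m cz)) _; exact: hN.
    by rewrite distrC; apply: le_trans (cauchy n m z (ltnW mn) (mono _ _ n0n cz)) _; exact: hN.
  exists l => n cn1; have ht := tendsB (tends_cst (ys n z)) hl.
  rewrite ler_norml; apply/andP; split.
    rewrite lerNl; apply: (tends_le (tendsN ht)); exists n => m nm.
    by have := cauchy n m z nm cn1; rewrite ler_norml => /andP[]; lra.
  apply: (tends_le ht); exists n => m nm.
  by have := cauchy n m z nm cn1; rewrite ler_norml => /andP[]; lra.
have big z N : exists2 n, (N <= n)%N & cn z < rr n.
  have [n hn] := archi (cn z); exists (maxn n.+1 N); first exact: leq_maxr.
  apply: lt_le_trans hn _; apply: le_trans (nrr _).
  by rewrite ler_nat leq_maxl.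
have approx z e : 0 < e -> exists n, cn z < rr n /\ L / rr n <= e.
  by move=> e0; have [N hN] := small _ e0; have [n Nn zn] := big z N; exists n; split => //; exact: hN.
have near z e : cl ext z -> 0 < e -> exists n, [/\ cl (extd (rr n)) z & `|ys n z - y z| <= e].
  move=> cz e0; have [n [zn ne]] := approx z e e0; exists n.
  have cn1 := ext_cl_extd cz zn; split => //; exact: le_trans (hy z n cn1) ne.
have bound z (a B : R) : 0 <= a -> cl ext z -> (forall n, cl (extd (rr n)) z -> `|ys n z| * a <= B) -> `|y z| * a <= B.
  move=> a0 cz h; apply: eps_le => e e0; have a1 : 0 < a + 1 by lra.
  have [n [cn1 ne]] := near z _ cz (divr_gt0 e0 a1); have := h n cn1.
  have hh : `|y z| <= `|ys n z| + e / (a + 1).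
    by have := ler_normB (ys n z) (ys n z - y z); rewrite opprB addrCA subrr addr0; lra.
  have : e / (a + 1) * a <= e by rewrite mulrAC ler_pdivrMr // ler_wpM2l ?ltW //; lra.
  have := ler_wpM2r a0 hh; rewrite mulrDl; lra.
have ball z r : exists n, cl ext `&` disk z 1 `<=` cl (extd (rr n)) /\ (0 < r -> L / rr n <= r).
  have [N hN] : exists N, forall n, (N <= n)%N -> 0 < r -> L / rr n <= r.
    case: (ltP 0 r) => r0; last by exists 0%N.
    by have [N hN] := small _ r0; exists N => n /hN.
  have [n Nn zn] := big ((cn z + 1)%:C%C) N; exists n; split; last exact: hN.
  move=> w [cw /= wz]; apply: ext_cl_extd => //; apply: lt_trans zn.
  by rewrite cnR ger0_norm; have := cnBD w z; have := cn_ge0 z; lra.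
exists y; split.
- apply: cont_loc => z cz; exists 1 => //; apply: cont_unif => e e0.
  have [n [sub /(_ e0) ne]] := ball z e; exists (ys n); first by apply: cont_sub sub _; case: (hys n).
  by move=> w hw; apply: le_trans (hy w n (sub w hw)) ne.
- apply: harm_loc => z ez; exists (ext `&` disk z 1).
    by split; [apply: opnI; [exact: ext_opn | exact: disk_opn] | split; rewrite //= subrr cn0].
  apply: harm_unif => [|e e0]; first by apply: opnI; [exact: ext_opn | exact: disk_opn].
  have [n zn ne] : exists2 n, cn z + 1 < rr n & L / rr n <= e.
    by have [n [zn ne]] := approx (cn z + 1)%:C%C e e0; exists n => //; move: zn; rewrite cnR ger0_norm //; have := cn_ge0 z; lra.
  have sub : ext `&` disk z 1 `<=` extd (rr n).
    by move=> w [[w0 Kw] /= wz]; split => //; split => //; have := cnBD w z; lra.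
  exists (ys n); first by apply: harm_sub sub _; case: (hys n).
  by move=> w hw; apply: le_trans (hy w n (sub_cl (sub w hw))) ne.
- move=> z cz; split=> [Kz|z0]; apply/eqP; rewrite -subr_eq0 -normr_le0; apply: eps_le => e e0;
    have [n [cn1 ne]] := near z e cz e0; have [_ _ h _ _] := hys n; have [h1 h2 _] := h z cn1.
    by rewrite -h1 // distrC add0r.
  by rewrite -[in X in _ - X](h2 z0) distrC add0r.
- move=> z cz; rewrite -[`|y z|]mulr1; apply: bound => // n cn1; rewrite mulr1.
  by case: (hys n) => _ _ _ h _; exact: h.
- move=> z cz; apply: bound => // [|n cn1]; first exact: cn_ge0.
  by case: (hys n) => _ _ _ _; apply.
Qed.

Lemma im_cl_ext z : 0 <= Im z -> ~ K z -> cl ext z.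
Proof.
move=> z0 Kz r r0; have [d d0 hd] := coK_opn Kz.
pose t := Num.min d r / 2.
have m0 : 0 < Num.min d r by rewrite lt_min d0.
have t0 : 0 < t := divr2_gt0 m0.
have m1 : Num.min d r <= d by rewrite ge_min lexx.
have m2 : Num.min d r <= r by rewrite ge_min lexx orbT.
have e1 : z + 'i%C * t%:C%C - z = 'i%C * t%:C%C by ring.
exists (z + 'i%C * t%:C%C); last by rewrite e1 cnM cni cnR mul1r gtr0_norm // /t; lra.
split; first by rewrite /= ImD ImM /=; lra.
by apply: hd; rewrite e1 cnM cni cnR mul1r gtr0_norm // /t; lra.
Qed.

(* The expansion comes from reflecting the Kelvin transform [z |-> y (1 / conj z)] across the real axis. *)
Theorem exterior f F : 0 <= F -> cont (bd (~` K)) f -> (forall z, bd (~` K) z -> `|f z| <= F) ->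
  exists y (a : nat -> R), [/\ cont (cl ext) y, harm ext y,
    forall z, cl ext z -> (K z -> y z = f z) /\ (Im z = 0 -> y z = 0),
    forall k, `|a k| <= 2 * F * rho ^+ k &
    forall z, rho < cn z -> 0 <= Im z -> tends (fun n => \sum_(k < n) a k * mpole k z) (y z)].
Proof.
move=> F0 cf fF; have [y [cy hy ey bF bL]] := ext_exists F0 cf fF.
pose L := F * (rho + 1) ^+ 2; have L0 : 0 <= L by rewrite mulr_ge0 ?sqr_ge0.
pose q z := y (conjc z)^-1; pose r := rho^-1.
have r0 : 0 < r by rewrite invr_gt0.
have Imv z : Im (conjc z)^-1 = Im z * (cn z ^- 2).
  have [->|z0] := eqVneq z 0; first by rewrite (_ : conjc 0 = 0) ?invr0 ?mul0r //; apply: complex_eq; rewrite ?ReC ?ImC ?oppr0.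
  have zp : 0 < cn z by rewrite cn_gt0.
  have -> : (conjc z)^-1 = (cn z ^+ 2)^-1%:C%C * z.
    have c0 : conjc z != 0 by rewrite -cn_eq0 cnC gt_eqF.
    by apply: (mulfI c0); rewrite mulfV // mulrCA [conjc z * z]mulrC mul_conjc -rmorphM /= mulVf // expf_neq0 // gt_eqF.
  by rewrite ImZ mulrC.
have far z : z != 0 -> chdisk r z -> rho <= cn (conjc z)^-1 /\ 0 <= Im (conjc z)^-1.
  move=> z0 [zr zI]; have zp : 0 < cn z by rewrite cn_gt0.
  split; first by rewrite cnV cnC -[rho]invrK lef_pV2 ?posrE.
  by rewrite Imv mulr_ge0 // invr_ge0 sqr_ge0.
have nK z : rho <= cn z -> ~ K z by move=> h /Krho; rewrite ltNge h.
have cex z : rho <= cn z -> 0 <= Im z -> cl ext z by move=> h h'; apply: im_cl_ext => //; exact: nK.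
have c0 : cl ext 0 by apply: im_cl_ext => //= /Khalf; rewrite ltxx.
have v0 : (conjc (0 : C))^-1 = 0 by rewrite (_ : conjc 0 = 0) ?invr0 //; apply: complex_eq; rewrite ?ReC ?ImC ?oppr0.
(* By the convention [0^-1 = 0] the value at the origin is [y 0], which vanishes because 0 is on the
   real axis; it is also the limit of [y] at infinity. *)
have q0 : q 0 = 0 by rewrite /q v0; apply: (ey 0 c0).2.
have cq : cont (chdisk r) q.
  move=> z zr; have [->|z0] := eqVneq z 0.
    move=> e e0; have L1 : 0 < L + 1 by lra.
    exists (e / (L + 1)); first exact: divr_gt0.
    move=> w wr; rewrite subr0 q0 subr0 => we; have [->|w0] := eqVneq w 0; first by rewrite q0 normr0 ltW.
    have [f1 f2] := far w w0 wr; have wp : 0 < cn w by rewrite cn_gt0.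
    have := bL _ (cex _ f1 f2); rewrite cnV cnC -/(q w) ler_pdivrMr // -/L => h.
    apply: le_trans h _; move: we; rewrite ltr_pdivlMr // => h; have := cn_ge0 w; lra.
  have := @cont_conj _ _ _ (@cont_inv _ _ _ cy) z => h e e0.
  have cz0 : conjc z != 0 by rewrite -cn_eq0 cnC cn_eq0.
  have [f1 f2] := far z z0 zr.
  have [d d0 hd] := h (conj cz0 (cex _ f1 f2)) e e0.
  exists (Num.min d (cn z)); first by rewrite lt_min d0 cn_gt0.
  move=> w wr; rewrite lt_min => /andP[wd wz]; apply: hd wd.
  have w0 : w != 0.
    by apply/eqP => w0; move: wz; rewrite w0 sub0r cnN ltxx.
  have [g1 g2] := far w w0 wr; split; first by rewrite -cn_eq0 cnC cn_eq0.
  exact: cex.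
have hq : harm (hdisk r) q.
  have := harm_conj (@invset_opn _ _ ext_opn) (harm_inv ext_opn hy); apply: harm_sub => z [zr zI].
  have z0 : z != 0 by apply/eqP => z0; move: zI; rewrite z0 /= ltxx.
  have [f1 f2] := far z z0 (conj (ltW zr) (ltW zI)).
  split; first by rewrite -cn_eq0 cnC cn_eq0.
  split; last exact: nK.
  by rewrite /= Imv mulr_gt0 // invr_gt0 exprn_gt0 // cn_gt0.
have qI z : chdisk r z -> Im z = 0 -> q z = 0.
  move=> zr zI; have [->|z0] := eqVneq z 0; first exact: q0.
  have [f1 f2] := far z z0 zr; apply: (ey _ (cex _ f1 f2)).2.
  by rewrite Imv zI mul0r.
have qF z : chdisk r z -> `|q z| <= F.
  move=> zr; have [->|z0] := eqVneq z 0; first by rewrite q0 normr0.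
  by have [f1 f2] := far z z0 zr; exact: bF _ (cex _ f1 f2).
have [b bF2 hb] := odd_rep r0 cq hq qI qF.
(* Undoing the scaling by [rho^-1] multiplies the coefficients by [rho ^ k]; conjugation supplies
   the sign of [mpole]. *)
exists y, (fun k => b k * rho ^+ k); split => //.
  by move=> k; rewrite normrM (ger0_norm (exprn_ge0 _ (ltW rho0))) ler_wpM2r // exprn_ge0 // ltW.
move=> z zr zI; pose w := rho%:C%C * conjc z^-1.
have zp : 0 < cn z := lt_trans rho0 zr.
have w1 : cn w < 1 by rewrite cnM cnR cnC cnV gtr0_norm // ltr_pdivrMr // mul1r.
have wI : 0 <= Im w.
  rewrite /w ImZ mulr_ge0 ?(ltW rho0) // ImC -ImC.
  have := Imv (conjc z); rewrite conjcK ImC ImC => ->.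
  by rewrite mulNr opprK mulr_ge0 // invr_ge0 exprn_ge0 // cn_ge0.
have := hb w w1 wI.
have -> : r%:C%C * w = conjc z^-1 by rewrite /w mulrA -rmorphM /= mulVf ?gt_eqF // mul1r.
rewrite /q conjcK invrK; apply: tends_eq => n; apply: eq_bigr => k _.
rewrite /w exprMn -rmorphXn /= ImZ mulrA -conjc_X ImC /mpole.
by [].
Qed.

End ExteriorSolution.

(** * Expansion in the size of the hole *)

Section Recursion.

(** Course-of-values recursion: [G n] applies [Phi] to a constant sequence [n] times, and its entry
    at [m] is stationary once [m < n]. *)
Lemma strong_rec (T : Type) (x0 : T) (Phi : nat -> (nat -> T) -> T) :
  (forall n g g', (forall m, (m < n)%N -> g m = g' m) -> Phi n g = Phi n g') ->
  exists f, forall n, f n = Phi n f.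
Proof.
move=> ext; pose G n : nat -> T := iter n (fun g m => Phi m g) (fun=> x0).
have claim m : forall n n', (m < n)%N -> (m < n')%N -> G n m = G n' m.
  elim/ltn_ind: m => m IH [|n] [|n'] // mn mn'; apply: ext => j jm.
  by apply: IH => //; exact: leq_trans jm _.
exists (fun m => G m.+1 m) => n; apply: ext => m mn.
exact: claim.
Qed.

Context {R : realType}.

Lemma triangular_sum (F : nat -> nat -> R) L :
  \sum_(n < L) \sum_(m < n) F m (n - m.+1)%N = \sum_(m < L) \sum_(j < L - m.+1) F m j.
Proof.
elim: L => [|L IH]; first by rewrite !big_ord0.
rewrite big_ord_recr IH [RHS]big_ord_recr /= subnn big_ord0 addr0 -big_split /=.
by apply: eq_bigr => m _; rewrite -(big_ord_recr _ (F m)) /= subSS -subSn.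
Qed.

(** 1/9 is the sum of [10 ^ - i] over [i >= 1]: with decay ratio 1/10 per delay, all earlier orders
    together remain a fraction of the current power. *)
Lemma conv_le (mu : R) n : 0 <= mu ->
  \sum_(m < n) mu ^+ m * (mu / 10) ^+ (n - m) <= mu ^+ n / 9.
Proof.
move=> m0; elim: n => [|n IH]; first by rewrite big_ord0 expr0; lra.
have -> : \sum_(m < n.+1) mu ^+ m * (mu / 10) ^+ (n.+1 - m) =
    (mu / 10) * (\sum_(m < n) mu ^+ m * (mu / 10) ^+ (n - m) + mu ^+ n).
  rewrite big_ord_recr /= subSnn expr1 mulrDr mulr_sumr; congr (_ + _); last by rewrite mulrC.
  by apply: eq_bigr => m _; rewrite subSn ?(ltnW (ltn_ord m)) // exprS mulrCA.
have h : 0 <= mu / 10 by lra.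
apply: le_trans (_ : mu / 10 * (mu ^+ n / 9 + mu ^+ n) <= _); first by rewrite ler_wpM2l // lerD2r.
by rewrite exprS; lra.
Qed.

Lemma geo_half (A s : R) b l n : 0 <= s <= 1 / 2 -> geo A s b ->
  tends (fun n => \sum_(k < n) b k) l -> `|l - \sum_(k < n) b k| <= 2 * A * s ^+ n.
Proof.
move=> /andP[s0 s1] hb /tends_ser <-; have A0 := geo_A0 hb.
have := ser_tail n (_ : 0 <= s < 1) hb; rewrite s0 /= => /(_ ltac:(lra)) h.
apply: le_trans h _; rewrite ler_pdivrMr; last by lra.
by have := mulr_ge0 A0 (exprn_ge0 n s0); nra.
Qed.

Lemma nat_exp2 n : n%:R <= 2 ^+ n :> R.
Proof. by rewrite -natrX ler_nat ltnW // ltn_expl. Qed.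

Lemma cont_sum (D : set R[i]) n (u : nat -> R[i] -> R) : (forall m, (m < n)%N -> cont D (u m)) ->
  cont D (fun z => \sum_(m < n) u m z).
Proof.
elim: n => [|n IH] hu.
  by rewrite (_ : (fun z => _) = fun=> 0); [exact: cont_cst | apply/funext => z; rewrite big_ord0].
rewrite (_ : (fun z => _) = fun z => \sum_(m < n) u m z + u n z).
  by apply: contD; [apply: IH => m /ltnW; exact: hu | exact: hu].
by apply/funext => z; rewrite big_ord_recr.
Qed.

Lemma harm_sum (D : set R[i]) n (u : nat -> R[i] -> R) : (forall m, (m < n)%N -> harm D (u m)) ->
  harm D (fun z => \sum_(m < n) u m z).
Proof.
elim: n => [|n IH] hu.
  by rewrite (_ : (fun z => _) = fun=> 0); [exact: harm_cst | apply/funext => z; rewrite big_ord0].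
rewrite (_ : (fun z => _) = fun z => \sum_(m < n) u m z + u n z).
  by apply: harmD; [apply: IH => m /ltnW; exact: hu | exact: hu].
by apply/funext => z; rewrite big_ord_recr.
Qed.

End Recursion.

(** * Correctors for the outer boundary *)

Section OuterCorrectors.
Context {R : realType}.
Local Notation C := R[i].
Implicit Types (u v f y : C -> R) (z w c x : C) (n k m j : nat) (e : R).
Variables (Om : set C) (r1 : R).
Hypotheses (oO : opn Om) (bO : bdd Om) (Ohalf : forall z, Om z -> 0 < Im z)
  (r10 : 0 < r1) (Or1 : hdisk r1 `<=` Om) (flatO : forall x, bd Om x -> flatat Om x).

Lemma cl_Om_Im z : cl Om z -> 0 <= Im z.
Proof.
move=> cz; rewrite leNgt; apply/negP => z0.
have [w Ow wz] := cz (- Im z) ltac:(by rewrite oppr_gt0).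
by have := Ohalf Ow; have := Im_le (w - z); rewrite ImB ler_norml => /andP[]; lra.
Qed.

Lemma bd_Om_near z : bd Om z -> cn z < r1 -> Im z = 0.
Proof.
move=> [cz nz] zr; apply/eqP; rewrite eq_le cl_Om_Im // andbT leNgt; apply/negP => z0.
by apply: nz; exact: Or1.
Qed.

Lemma real_inv z : Im z = 0 -> Im z^-1 = 0.
Proof.
move=> z0; have -> : z = (Re z)%:C%C by apply: complex_eq.
by have [->|h] := eqVneq (Re z) 0; [rewrite invr0 | rewrite -fmorphV].
Qed.

Lemma real_X z n : Im z = 0 -> Im (z ^+ n) = 0.
Proof. by move=> z0; have -> : z = (Re z)%:C%C by [apply: complex_eq]; rewrite -rmorphXn. Qed.

Lemma mpole_real k z : Im z = 0 -> mpole k z = 0.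
Proof. by move=> z0; rewrite /mpole real_X ?oppr0 //; exact: real_inv. Qed.

Lemma mpole_le k z (s : R) : 0 < s -> s <= cn z -> `|mpole k z| <= s^-1 ^+ k.
Proof.
move=> s0 sz; rewrite normrN; apply: le_trans (Im_le _) _; rewrite cnX cnV.
have z0 : 0 < cn z := lt_le_trans s0 sz.
by rewrite lerXn2r ?nnegrE ?invr_ge0 ?(ltW s0) ?(ltW z0) // lef_pV2.
Qed.

Lemma mpole_scale k (e : R) z : mpole k (e^-1%:C%C * z) = e ^+ k * mpole k z.
Proof.
rewrite /mpole invfM -fmorphV invrK exprMn -rmorphXn /= ImZ mulrN; congr (- _).
Qed.

Lemma mpole0 z : mpole 0 z = 0.
Proof. by rewrite /mpole expr0 /= oppr0. Qed.

Lemma harm_mpole k (D : set C) : (forall z, D z -> z != 0) -> harm D (mpole k).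
Proof.
move=> hD; have -> : mpole k = (fun z => Re ('i%C * z^-1 ^+ k)).
  by apply/funext => z; rewrite ReM /= mul0r mul1r sub0r.
apply: taylor3_harm => c /hD c0; apply: taylor3M; first exact: taylor3_cst.
exact: taylor3X (taylor3V c0).
Qed.

(** The pole 0 lies on the boundary, but near 0 the boundary is real and the multipoles vanish on
    the real axis, at 0 itself by [0^-1 = 0]. *)
Lemma mpole_bd_cont k : cont (bd Om) (mpole k).
Proof.
apply: cont_loc => z bz; case: (ltP (cn z) r1) => zr.
  exists (r1 - cn z); first by rewrite subr_gt0.
  apply: (@cont_eq _ _ (fun=> 0)); last exact: cont_cst.
  move=> w [bw /= wz]; rewrite mpole_real // bd_Om_near //.
  by have := cnBD w z; lra.
exists r1 => //; apply: cont_sub (_ : _ `<=` [set w | w != 0]) _; last first.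
  exact: (harm_mpole _ _).1.
move=> w [bw /= wz]; apply/eqP => w0; move: wz; rewrite w0 sub0r cnN; lra.
Qed.

Lemma mpole_bd_le k z : bd Om z -> `|mpole k z| <= r1^-1 ^+ k.
Proof.
move=> bz; case: (ltP (cn z) r1) => zr; last exact: mpole_le.
by rewrite mpole_real ?normr0 ?exprn_ge0 ?invr_ge0 ?(ltW r10) // bd_Om_near.
Qed.

Let r := r1 / 2.

(** The datum vanishes on the flat part of the boundary, so odd reflection gives the expansion
    [eta k] at 0. The radius [r1 / 2] keeps the closed half disk within the region where the
    boundary is known to be flat. *)
Lemma correctors : exists (h : nat -> C -> R) (eta : nat -> nat -> R), forall k,
  [/\ cont (cl Om) (h k) /\ harm Om (h k), forall z, bd Om z -> h k z = - mpole k z,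
      forall z, cl Om z -> `|h k z| <= r^-1 ^+ k, forall j, `|eta k j| <= 2 * r^-1 ^+ k &
      forall w, cn w < 1 -> 0 <= Im w -> tends (fun n => \sum_(j < n) eta k j * Im (w ^+ j)) (h k (r%:C%C * w))].
Proof.
have r0 : 0 < r := divr2_gt0 r10.
have rE : r1 = 2 * r by rewrite /r mulrC divfK.
suff /choice[h hh] : forall k, exists he : (C -> R) * (nat -> R),
   [/\ cont (cl Om) he.1 /\ harm Om he.1, forall z, bd Om z -> he.1 z = - mpole k z,
      forall z, cl Om z -> `|he.1 z| <= r^-1 ^+ k, forall j, `|he.2 j| <= 2 * r^-1 ^+ k &
      forall w, cn w < 1 -> 0 <= Im w -> tends (fun n => \sum_(j < n) he.2 j * Im (w ^+ j)) (he.1 (r%:C%C * w))].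
  by exists (fun k => (h k).1), (fun k => (h k).2).
move=> k; have [u [cu hu bu]] := dirichlet oO bO flatO (contN (@mpole_bd_cont k)).
have uM z : cl Om z -> `|u z| <= r^-1 ^+ k.
  move=> cz; apply: le_trans (_ : r1^-1 ^+ k <= _).
    by apply: (dirichlet_bound oO bO cu hu bu) cz => w bw; rewrite normrN; exact: mpole_bd_le.
  by rewrite lerXn2r ?nnegrE ?invr_ge0 ?(ltW r10) ?(ltW r0) // lef_pV2 ?posrE // /r; lra.
have csub : chdisk r `<=` cl Om.
  move=> z [zr z0] t t0; pose s := Num.min t r / 2.
  have m0 : 0 < Num.min t r by rewrite lt_min t0.
  have s0 : 0 < s := divr2_gt0 m0.
  have m1 : Num.min t r <= t by rewrite ge_min lexx.
  have m2 : Num.min t r <= r by rewrite ge_min lexx orbT.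
  have cs : cn ('i%C * s%:C%C) = s by rewrite cnM cni cnR mul1r gtr0_norm.
  exists (z + 'i%C * s%:C%C); last by rewrite addrC addKr cs /s; lra.
  apply: Or1; split; last by rewrite ImD ImM /=; lra.
  by apply: le_lt_trans (cnD _ _) _; rewrite cs /s; rewrite rE; lra.
have [||||eta e1 e2] := @odd_rep _ u r (r^-1 ^+ k) r0; last by exists (u, eta); split.
- exact: cont_sub csub cu.
- by apply: harm_sub hu => z [zr z0]; apply: Or1; split => //; rewrite rE; lra.
- move=> z zr z0; rewrite bu ?mpole_real ?oppr0 //; split; first exact: csub.
  by move=> /Ohalf; rewrite z0 ltxx.
- by move=> z /csub; exact: uM.
Qed.

End OuterCorrectors.

Lemma exp_absorb (R : realFieldType) (G n w T : R) : n * (G * T) <= w * (G * T) -> 1 * (G * T) <= w * (G * T) ->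
  0 <= w * T -> n * (32 * G * T) + 2 * G * T + n * (16 * G * T) <= w * T * (50 * G + 1).
Proof. by move=> *; lra. Qed.

(** * The recursion on orders and its convergence *)

Section Core.
Context {R : realType}.
Local Notation C := R[i].
Implicit Types (u v f y : C -> R) (z w c x X : C) (n k m j L N : nat) (e : R).
Variables (Om K : set C) (r1 rho : R).
Hypotheses (oO : opn Om) (bO : bdd Om) (Ohalf : forall z, Om z -> 0 < Im z)
  (r10 : 0 < r1) (Or1 : hdisk r1 `<=` Om) (flatO : forall x, bd Om x -> flatat Om x).
Hypotheses (clK : cl K `<=` K) (Khalf : forall z, K z -> 0 < Im z) (Krho : forall z, K z -> cn z < rho)
  (rr1 : r1 <= rho) (flatK : forall x, bd (~` K) x -> flatat (~` K) x).
Let r := r1 / 2.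
Let lam := rho / r.
Let mu := 20 * lam.
Let r0 : 0 < r. Proof. exact: divr2_gt0. Qed.
Let rho0 : 0 < rho. Proof. exact: lt_le_trans rr1. Qed.
Let lam1 : 1 <= lam.
Proof. by rewrite ler_pdivlMr // mul1r; apply: le_trans rr1; rewrite ler_pdivrMr //; have := r10; lra. Qed.
Let lamr : lam = rho * r^-1. Proof. by []. Qed.

Definition scaled e := [set z : C | K (e^-1%:C%C * z)].
Definition perf e := Om `\` scaled e.

Variables (g : C -> R) (P : nat -> C -> R) (G : R).
Hypotheses (G0 : 0 <= G) (cg : cont (bd (~` K)) g) (gG : forall z, bd (~` K) z -> `|g z| <= G)
  (cP : forall n, cont (bd (~` K)) (P n)) (PG : forall n z, bd (~` K) z -> `|P n z| <= G * lam ^+ n).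
Variables (h : nat -> C -> R) (eta : nat -> nat -> R).
Hypothesis hh : forall k,
  [/\ cont (cl Om) (h k) /\ harm Om (h k), forall z, bd Om z -> h k z = - mpole k z,
      forall z, cl Om z -> `|h k z| <= r^-1 ^+ k, forall j, `|eta k j| <= 2 * r^-1 ^+ k &
      forall w, cn w < 1 -> 0 <= Im w -> tends (fun n => \sum_(j < n) eta k j * Im (w ^+ j)) (h k (r%:C%C * w))].

Let bdK z : bd (~` K) z -> [/\ K z, 0 < Im z & cn z < rho].
Proof. by move=> [_ /contrapT Kz]; split; [|exact: Khalf|exact: Krho]. Qed.

(* Taylor coefficient of [e |-> \sum_k a k e^k h k (e X)]. *)
Definition resp (a : nat -> R) i X : R :=
  \sum_(k < i) a k.+1 * (eta k.+1 (i - k.+1) * Im ((r^-1%:C%C * X) ^+ (i - k.+1))).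

Let scX X : cn X < rho -> cn (r^-1%:C%C * X) <= lam.
Proof. by move=> Xr; rewrite cnM cnR ger0_norm ?invr_ge0 ?(ltW r0) // lamr mulrC ler_wpM2r ?invr_ge0 ?(ltW r0) // ltW. Qed.

(** All [i] terms have the same size, since [rho ^ k * r ^ - k * lam ^ (i - k) = lam ^ i]; their
    number is absorbed by [2 ^ i]. *)
Lemma resp_le a F i X : (forall k, `|a k| <= 2 * F * rho ^+ k) -> cn X < rho ->
  `|resp a i X| <= 4 * F * (2 * lam) ^+ i.
Proof.
move=> ha Xr; have F0 : 0 <= F by have := ha 0%N; rewrite expr0 mulr1; have := normr_ge0 (a 0%N); lra.
apply: le_trans (_ : \sum_(k < i) 4 * F * lam ^+ i <= _); last first.
  have p0 : 0 <= 4 * F * lam ^+ i by rewrite !mulr_ge0 // exprn_ge0 //; have := lam1; lra.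
  have p1 : i%:R * (4 * F * lam ^+ i) <= 2 ^+ i * (4 * F * lam ^+ i) by rewrite ler_wpM2r // nat_exp2.
  rewrite sumr_const card_ord -(mulr_natl (4 * F * lam ^+ i) i); apply: le_trans p1 _.
  by rewrite (exprMn i (2 : R) lam) le_eqVlt; apply/orP; left; apply/eqP; ring.
apply: le_trans (ler_norm_sum _ _ _) _; apply: ler_sum => k _.
rewrite !normrM.
have e1 : lam ^+ i = rho ^+ k.+1 * r^-1 ^+ k.+1 * lam ^+ (i - k.+1).
  by rewrite -exprMn -lamr -exprD subnKC.
have e2 : `|Im ((r^-1%:C%C * X) ^+ (i - k.+1))| <= lam ^+ (i - k.+1).
  apply: le_trans (Im_le _) _; rewrite cnX lerXn2r ?nnegrE ?cn_ge0 //; last exact: scX.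
  by have := lam1; lra.
have [_ _ _ he _] := hh k.+1.
have := ler_pM (normr_ge0 _) (normr_ge0 _) (he (i - k.+1)%N) e2 => e3.
have := ler_pM (normr_ge0 _) (mulr_ge0 (normr_ge0 _) (normr_ge0 _)) (ha k.+1) e3 => e4.
by apply: le_trans e4 _; rewrite e1 le_eqVlt; apply/orP; left; apply/eqP; ring.
Qed.

Lemma resp_cont a i : cont setT (resp a i).
Proof.
suff hs k j : cont setT (fun X => a k.+1 * (eta k.+1 j * Im ((r^-1%:C%C * X) ^+ j))).
  have hr n : cont setT (fun X => \sum_(k < n) a k.+1 * (eta k.+1 (i - k.+1) * Im ((r^-1%:C%C * X) ^+ (i - k.+1)))).
    elim: n => [|n IH]; first by under eq_fun do rewrite big_ord0; exact: cont_cst.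
    by under eq_fun do rewrite big_ord_recr /=; apply: contD.
  exact: hr.
apply/contZ/contZ; have -> : (fun X : C => Im ((r^-1%:C%C * X) ^+ j)) = (fun X => Re (- 'i%C * (r^-1%:C%C * X) ^+ j)).
  by apply/funext => X; rewrite ReM /=; ring.
apply: (harm_setT _ _).1 => //.
apply: taylor3_harm => c _; apply: taylor3M; first exact: taylor3_cst.
by apply/taylor3X/taylor3M; [exact: taylor3_cst | exact: taylor3_id].
Qed.


Definition profile y (f : C -> R) F (a : nat -> R) := [/\ cont (cl (ext K)) y, harm (ext K) y,
  forall z, cl (ext K) z -> (K z -> y z = f z) /\ (Im z = 0 -> y z = 0),
  forall k, `|a k| <= 2 * F * rho ^+ k &
  forall z, rho < cn z -> 0 <= Im z -> tends (fun n => \sum_(k < n) a k * mpole k z) (y z)].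

Let mu0 : 0 <= mu. Proof. by have := lam1; rewrite /mu; lra. Qed.

(** The datum of order [n] is the given coefficient corrected by the responses to all earlier inner
    solutions. The bound propagates because inner datum, Taylor coefficient and convolution add up
    to [1 + 1 + 16 / 9 <= 4]. *)
Lemma hierarchy : exists (f y : nat -> C -> R) (a : nat -> nat -> R), forall n,
  profile (y n) (f n) (4 * G * mu ^+ n) (a n) /\
  forall X, f n X = (if n == 0%N then g X else 0) - P n X - \sum_(m < n) resp (a m) (n - m) X.
Proof.
pose F n := 4 * G * mu ^+ n.
have F0 n : 0 <= F n by rewrite !mulr_ge0 // exprn_ge0.
pose good (f : C -> R) n := cont (bd (~` K)) f /\ forall z, bd (~` K) z -> `|f z| <= F n.
(* A total solution map, with a dummy value on bad data, allows the recursion to be defined before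
   its bounds are proved. *)
have /choice[sol hsol] : forall fn : (C -> R) * nat, exists ya : (C -> R) * (nat -> R),
   good fn.1 fn.2 -> profile ya.1 fn.1 (F fn.2) ya.2.
  move=> [f n] /=; case: (pselect (good f n)) => [[cf fF]|ng]; last by exists ((fun=> 0), (fun=> 0)).
  have [y [a [h1 h2 h3 h4 h5]]] := exterior clK Khalf Krho rho0 flatK (F0 n) cf fF.
  by exists (y, a).
pose Phi n (f : nat -> C -> R) X :=
  (if n == 0%N then g X else 0) - P n X - \sum_(m < n) resp (sol (f m, nat_of_ord m)).2 (n - m) X.
have [f hf] : exists f : nat -> C -> R, forall n, f n = Phi n f.
  apply: (@strong_rec _ (fun=> 0)) => n f f' ff; apply/funext => X; rewrite /Phi; congr (_ - _).
  by apply: eq_bigr => m _; rewrite ff.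
have hgood n : good (f n) n.
  elim/ltn_ind: n => n IH; have pr m : (m < n)%N -> profile (sol (f m, m)).1 (f m) (F m) (sol (f m, m)).2.
    by move=> mn; have := hsol (f m, m); apply; exact: IH.
  rewrite hf; split.
    apply: contB; first by apply: contB => //; case: (n == 0%N) => //; exact: cont_cst.
    have hc : forall N, cont (bd (~` K)) (fun X => \sum_(m < N) resp (sol (f m, nat_of_ord m)).2 (n - m) X).
      elim=> [|N IHN]; first by under eq_fun do rewrite big_ord0; exact: cont_cst.
      under eq_fun do rewrite big_ord_recr /=; apply: contD => //.
      exact: cont_sub (@subsetT _ _) (resp_cont _ _).
    exact: hc.
  move=> z bz; have [Kz zI zr] := bdK bz.
  have h1 : `|\sum_(m < n) resp (sol (f m, nat_of_ord m)).2 (n - m) z| <= 4 * (4 * G) * (mu ^+ n / 9).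
    apply: le_trans (ler_norm_sum _ _ _) _.
    apply: le_trans (_ : \sum_(m < n) 4 * (4 * G) * (mu ^+ m * (mu / 10) ^+ (n - m)) <= _).
      apply: ler_sum => m _; have [_ _ _ ha _] := pr m (ltn_ord m).
      (* Here the factor 20 in [mu] is used: the rate of [resp_le] is a tenth of [mu]. *)
      have -> : mu / 10 = 2 * lam by rewrite /mu; field.
      apply: le_trans (resp_le _ ha zr) _; rewrite le_eqVlt /F; apply/orP; left; apply/eqP; ring.
    by rewrite -mulr_sumr ler_wpM2l ?conv_le // !mulr_ge0.
  have l1 : lam ^+ n <= mu ^+ n.
    by rewrite lerXn2r ?nnegrE //; have := lam1; rewrite /mu; lra.
  have h2 : `|P n z| <= G * mu ^+ n by apply: le_trans (PG n bz) _; rewrite ler_wpM2l.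
  have h3 : `|if n == 0%N then g z else 0| <= G * mu ^+ n.
    case: eqP => [->|_]; first by rewrite expr0 mulr1 gG.
    by rewrite normr0 mulr_ge0 // exprn_ge0.
  rewrite /Phi; apply: le_trans (ler_normB _ _) _; apply: le_trans (lerD (ler_normB _ _) h1) _.
  by have := mulr_ge0 G0 (exprn_ge0 n mu0); rewrite /F; lra.
exists f, (fun n => (sol (f n, n)).1), (fun n => (sol (f n, n)).2) => n.
by split; [exact: hsol (f n, n) (hgood n) | rewrite {1}hf].
Qed.

(** As [mpole 0] vanishes, the [J] terms starting at [k.+1] form the truncation of the series of [y]
    at [J.+1]. *)
Lemma far_tail y f F a e s J z : profile y f F a -> 0 < e -> 0 < s -> e * rho / s <= 1 / 2 ->
  s <= cn z -> 0 <= Im z ->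
  `|y (e^-1%:C%C * z) - \sum_(k < J) e ^+ k.+1 * (a k.+1 * mpole k.+1 z)| <= 4 * F * (e * rho / s) ^+ J.
Proof.
move=> [_ _ _ ha hy] e0 s0 es sz zI; set t := e * rho / s in es *.
have t0 : 0 <= t by rewrite divr_ge0 ?mulr_ge0 ?(ltW e0) ?(ltW rho0) ?(ltW s0).
have ie : 0 < e^-1 by rewrite invr_gt0.
have F0 : 0 <= F by have := ha 0%N; rewrite expr0 mulr1; have := normr_ge0 (a 0%N); lra.
have ces : e^-1 * s <= cn (e^-1%:C%C * z) by rewrite cnM cnR (gtr0_norm ie) ler_pM2l.
have far : rho < cn (e^-1%:C%C * z).
  apply: lt_le_trans ces; rewrite mulrC ltr_pdivlMr //; move: es; rewrite /t ler_pdivrMr //.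
  by have := mulr_gt0 rho0 e0; have := s0; lra.
have zI' : 0 <= Im (e^-1%:C%C * z) by rewrite ImZ mulr_ge0 // ltW.
have hb : geo (2 * F) t (fun k => a k * mpole k (e^-1%:C%C * z)).
  move=> k; rewrite normrM.
  have -> : t ^+ k = rho ^+ k * (e^-1 * s)^-1 ^+ k.
    by rewrite -exprMn invfM invrK /t; congr (_ ^+ _); ring.
  rewrite mulrA; apply: ler_pM => //; exact: mpole_le (mulr_gt0 ie s0) ces.
have ht : 0 <= t <= 1 / 2 by rewrite t0.
have := geo_half J.+1 ht hb (hy _ far zI'); rewrite big_ord_recl /= mpole0 mulr0 add0r.
have -> : \sum_(i < J) a (bump 0 i) * mpole (bump 0 i) (e^-1%:C%C * z)
    = \sum_(k < J) e ^+ k.+1 * (a k.+1 * mpole k.+1 z).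
  by apply: eq_bigr => k _; rewrite mpole_scale mulrCA.
move=> h1; apply: le_trans h1 _; rewrite exprS.
have p : 0 <= F * t ^+ J by rewrite mulr_ge0 // exprn_ge0.
have := ler_wpM2r p (_ : t <= 1); move=> /(_ ltac:(lra)); lra.
Qed.

(** Each corrector is expanded up to total order [J]; reordering the triangular double sum collects
    the coefficient of [e ^ i], which is [resp a i]. *)
Lemma near_tail a F e J X : (forall k, `|a k| <= 2 * F * rho ^+ k) -> 0 < e -> e * lam <= 1 / 2 ->
  cn X < rho -> 0 <= Im X ->
  `|\sum_(k < J) e ^+ k.+1 * (a k.+1 * h k.+1 (e%:C%C * X)) - \sum_(i < J) e ^+ i * resp a i X|
    <= 8 * F * (2 * (e * lam)) ^+ J.
Proof.
move=> ha e0 el Xr XI; set t := e * lam in el *.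
have t0 : 0 <= t by have := lam1; rewrite /t => l1; rewrite mulr_ge0 ?(ltW e0) //; lra.
have F0 : 0 <= F by have := ha 0%N; rewrite expr0 mulr1; have := normr_ge0 (a 0%N); lra.
have ht : 0 <= t <= 1 / 2 by rewrite t0.
pose w := e%:C%C * (r^-1%:C%C * X).
have wt : cn w <= t by rewrite cnM cnR (gtr0_norm e0) ler_pM2l // scX.
have w1 : cn w < 1 by apply: le_lt_trans wt _; lra.
have wI : 0 <= Im w by rewrite !ImZ !mulr_ge0 ?invr_ge0 ?(ltW e0) ?(ltW r0).
have rw : r%:C%C * w = e%:C%C * X.
  transitivity ((r%:C%C * r^-1%:C%C) * (e%:C%C * X)); first by rewrite /w; ring.
  by rewrite -rmorphM /= mulfV ?mul1r // gt_eqF.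
have expand k n : `|h k (e%:C%C * X) - \sum_(j < n) e ^+ j * (eta k j * Im ((r^-1%:C%C * X) ^+ j))|
    <= 4 * r^-1 ^+ k * t ^+ n.
  have [_ _ _ he hs] := hh k.
  have hb : geo (2 * r^-1 ^+ k) t (fun j => eta k j * Im (w ^+ j)).
    move=> j; rewrite normrM; apply: ler_pM => //.
    by apply: le_trans (Im_le _) _; rewrite cnX lerXn2r ?nnegrE ?cn_ge0.
  have := geo_half n ht hb (hs w w1 wI); rewrite rw.
  have -> : \sum_(k0 < n) eta k k0 * Im (w ^+ k0) = \sum_(j < n) e ^+ j * (eta k j * Im ((r^-1%:C%C * X) ^+ j)).
    by apply: eq_bigr => j _; rewrite /w exprMn -rmorphXn /= ImZ mulrCA.
  by move=> h1; apply: le_trans h1 _; rewrite !mulrA; lra.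
have -> : \sum_(i < J) e ^+ i * resp a i X = \sum_(k < J) e ^+ k.+1 * (a k.+1 *
    \sum_(j < J - k.+1) e ^+ j * (eta k.+1 j * Im ((r^-1%:C%C * X) ^+ j))).
  under [RHS]eq_bigr => k _ do rewrite mulr_sumr mulr_sumr.
  rewrite -(triangular_sum (fun k j => e ^+ k.+1 * (a k.+1 * (e ^+ j * (eta k.+1 j * Im ((r^-1%:C%C * X) ^+ j)))))).
  apply: eq_bigr => i _; rewrite /resp mulr_sumr; apply: eq_bigr => k _.
  have -> : e ^+ i = e ^+ k.+1 * e ^+ (i - k.+1) by rewrite -exprD subnKC.
  by ring.
rewrite -sumrB; apply: le_trans (ler_norm_sum _ _ _) _.
apply: le_trans (_ : \sum_(k < J) 8 * F * t ^+ J <= _); last first.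
  have p0 : 0 <= 8 * F * t ^+ J by rewrite !mulr_ge0 // exprn_ge0.
  have p1 : J%:R * (8 * F * t ^+ J) <= 2 ^+ J * (8 * F * t ^+ J) by rewrite ler_wpM2r // nat_exp2.
  rewrite sumr_const card_ord -(mulr_natl (8 * F * t ^+ J) J); apply: le_trans p1 _.
  by rewrite (exprMn J (2 : R) t) le_eqVlt; apply/orP; left; apply/eqP; ring.
apply: ler_sum => k _; rewrite -mulrBr -mulrBr !normrM normrX (gtr0_norm e0).
have h1 := ler_pM (normr_ge0 _) (normr_ge0 _) (ha k.+1) (expand k.+1 (J - k.+1)%N).
apply: le_trans (ler_wpM2l (exprn_ge0 _ (ltW e0)) h1) _.
have -> : t ^+ J = e ^+ k.+1 * (rho ^+ k.+1 * r^-1 ^+ k.+1) * t ^+ (J - k.+1).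
  by rewrite -!exprMn -lamr -/t -exprD subnKC.
by rewrite le_eqVlt; apply/orP; left; apply/eqP; ring.
Qed.

Lemma scaled_closed e z : 0 < e -> cl (scaled e) z -> scaled e z.
Proof.
move=> e0 cz; apply: clK; have en : e^-1%:C%C != 0 :> C by rewrite realC_neq0 // invr_neq0 // gt_eqF.
rewrite -[_ * z]add0r; apply/(cl_affine _ _ _ en).
by rewrite (_ : [set z0 | _] = scaled e) //; apply/funext => w; rewrite /= add0r.
Qed.

Lemma co_scaled_opn e : 0 < e -> opn (~` scaled e).
Proof.
move=> e0 z nz; apply: contrapT => hn; apply: nz; apply: scaled_closed => // d d0.
apply: contrapT => h'; apply: hn; exists d => // w wd Kw; apply: h'.
by exists w.
Qed.

Lemma perf_opn e : 0 < e -> opn (perf e).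
Proof. by move=> e0; rewrite /perf setDE; apply: opnI => //; exact: co_scaled_opn. Qed.

Lemma perf_bdd e : bdd (perf e).
Proof. by apply: bdd_sub bO => z []. Qed.

Let einv e : 0 < e -> e^-1%:C%C != 0 :> C.
Proof. by move=> e0; rewrite realC_neq0 // invr_neq0 // gt_eqF. Qed.

Lemma perf_ext e z : 0 < e -> perf e z -> ext K (e^-1%:C%C * z).
Proof. by move=> e0 [Oz nz]; split => //=; rewrite ImZ mulr_gt0 ?invr_gt0 //; exact: Ohalf. Qed.

Lemma cl_perf_ext e z : 0 < e -> cl (perf e) z -> cl (ext K) (e^-1%:C%C * z).
Proof.
move=> e0 cz; rewrite -[_ * z]add0r; apply/(cl_affine _ _ _ (einv e0)); apply: cl_sub cz => w /(perf_ext e0).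
by rewrite /= add0r.
Qed.

Lemma bd_perf e z : 0 < e -> bd (perf e) z ->
  bd (~` K) (e^-1%:C%C * z) /\ scaled e z \/ bd Om z /\ ~ scaled e z.
Proof.
move=> e0 [cz nz]; case: (pselect (scaled e z)) => Kz; [left | right]; split => //.
  split; last by move=> /(_ Kz).
  rewrite -[_ * z]add0r; apply/(cl_affine _ _ _ (einv e0)); apply: cl_sub cz => w [_ nw].
  by rewrite /= add0r.
by split; [apply: cl_sub cz => w [] | move=> Oz; apply: nz].
Qed.

(** Every order contributes the same power [T ^ L]; the count [L] is absorbed only at the end. *)
Lemma conv_bound e (mu' T B : R) (D : nat -> R) L : 0 <= e -> 0 <= mu' -> 0 <= B -> e * mu' <= T ->
  (forall m, (m < L)%N -> `|D m| <= B * mu' ^+ m * T ^+ (L - m)) ->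
  `|\sum_(m < L) e ^+ m * D m| <= L%:R * (B * T ^+ L).
Proof.
move=> e0 m0 B0 eT hD; apply: le_trans (ler_norm_sum _ _ _) _.
have T0 : 0 <= T by apply: le_trans eT; rewrite mulr_ge0.
have -> : L%:R * (B * T ^+ L) = \sum_(m < L) B * T ^+ L.
  by rewrite sumr_const card_ord -(mulr_natl (B * T ^+ L) L).
apply: ler_sum => m _; rewrite normrM normrX (ger0_norm e0).
apply: le_trans (ler_wpM2l (exprn_ge0 _ e0) (hD m (ltn_ord m))) _.
have -> : T ^+ L = T ^+ m * T ^+ (L - m) by rewrite -exprD subnKC // ltnW.
have p : (e * mu') ^+ m <= T ^+ m by rewrite lerXn2r ?nnegrE ?mulr_ge0.
have q : 0 <= B * T ^+ (L - m) by rewrite mulr_ge0 ?exprn_ge0.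
by have := ler_wpM2l q p; rewrite exprMn; lra.
Qed.

(** [A N] collects the multipoles with their correctors at total order [N]. The intermediate [vL L]
    keeps the inner solutions exact: it is compared with [v] by the maximum principle and with the
    partial sums of [A N] by the far-field expansion. *)
Theorem outer_expansion : exists A : nat -> C -> R, (forall z, A 0%N z = 0) /\
  (forall N, [/\ cont (cl Om `&` [set z | z != 0]) (A N), harm Om (A N) &
     forall z, bd Om z -> z != 0 -> A N z = 0]) /\
  forall s, 0 < s <= r1 -> exists M B : R, [/\ 0 < M, 0 <= B,
    forall N z, cl Om z -> s <= cn z -> `|A N z| <= B * M ^+ N &
    forall e v, 0 < e -> 2 * (e * M) < 1 -> cont (cl (perf e)) v -> harm (perf e) v ->
      (forall z, bd (perf e) z -> ~ scaled e z -> v z = 0) ->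
      (forall X, bd (~` K) X -> bd (perf e) (e%:C%C * X) ->
         tends (fun n => \sum_(k < n) e ^+ k * P k X) (g X - v (e%:C%C * X))) ->
      forall z, cl Om z -> s <= cn z -> tends (fun L => \sum_(N < L) e ^+ N * A N z) (v z)].
Proof.
have [f [y [a hf]]] := hierarchy.
pose F n := 4 * G * mu ^+ n.
have F0 n : 0 <= F n by rewrite !mulr_ge0 // exprn_ge0.
have ha n k : `|a n k| <= 2 * F n * rho ^+ k by have [[]] := hf n.
pose wk k z := mpole k z + h k z.
(* The index [(N - m.+1).+1] is [N - m] in a visibly positive form: order 0 multipoles never
   occur. *)
pose A N z := \sum_(m < N) a m (N - m.+1).+1 * wk (N - m.+1).+1 z.
have nz0 : forall z, (cl Om `&` [set z | z != 0]) z -> z != 0 by move=> z [].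
exists A; split; first by move=> z; rewrite /A big_ord0.
split.
  move=> N; rewrite /A; split.
  - apply: (cont_sum (u := fun m z => a m (N - m.+1).+1 * wk (N - m.+1).+1 z)) => m _.
    apply/contZ/contD; first exact: (harm_mpole _ nz0).1.
    by have [[ch _] _ _ _ _] := hh (N - m.+1).+1; apply: cont_sub ch => z [].
  - apply: (harm_sum (u := fun m z => a m (N - m.+1).+1 * wk (N - m.+1).+1 z)) => m _.
    apply/harmZ/harmD; last by have [[_ hk] _ _ _ _] := hh (N - m.+1).+1.
    by apply: harm_mpole => z /Ohalf zI; apply/eqP => z0; move: zI; rewrite z0 ltxx.
  move=> z bz _; rewrite big1 // => m _; have [_ hb _ _ _] := hh (N - m.+1).+1.
  by rewrite /wk hb // subrr mulr0.
(* [M] dominates the rate [mu] of the recursion, the rate [rho / s] of the multipoles and the rate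
   [rho / r] of the correctors. *)
move=> s /andP[s0 sr]; pose q := s^-1 + r^-1; pose M := mu + rho * q.
have is0 : 0 < s^-1 by rewrite invr_gt0.
have ir0 : 0 < r^-1 by rewrite invr_gt0.
have q0 : 0 < q by rewrite addr_gt0.
have rq0 : 0 < rho * q by rewrite mulr_gt0.
have muM : mu <= M by rewrite /M; lra.
have rM : rho * q <= M by rewrite /M; have := mu0; lra.
have M0 : 0 < M by apply: lt_le_trans rM.
have rsM t : s <= t -> rho / t <= M.
  move=> st; apply: le_trans rM; rewrite ler_pM2l //; apply: le_trans (_ : s^-1 <= _).
    by rewrite lef_pV2 ?posrE // (lt_le_trans s0).
  by rewrite /q; lra.
have lamM : 2 * lam <= M by apply: le_trans muM; rewrite /mu; have := lam1; lra.
(* The ratio is doubled to absorb the number of terms in [A N]. *)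
exists (2 * M), (16 * G); split; first by rewrite mulr_gt0.
- exact: mulr_ge0.
- move=> N z cz sz; rewrite /A.
  have -> : 16 * G * (2 * M) ^+ N = 2 ^+ N * (16 * G * M ^+ N).
    by rewrite (exprMn N (2 : R) M); ring.
  have p0 : 0 <= 16 * G * M ^+ N by rewrite !mulr_ge0 // exprn_ge0 // ltW.
  have p1 : N%:R * (16 * G * M ^+ N) <= 2 ^+ N * (16 * G * M ^+ N) by rewrite ler_wpM2r // nat_exp2.
  apply: le_trans p1; have -> : N%:R * (16 * G * M ^+ N) = \sum_(m < N) 16 * G * M ^+ N.
    by rewrite sumr_const card_ord -(mulr_natl (16 * G * M ^+ N) N).
  apply: le_trans (ler_norm_sum _ _ _) _; apply: ler_sum => m _; set k := (N - m.+1).+1.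
  have Nk : N = (m + k)%N by rewrite /k addnS -addSn subnKC.
  have hw : `|wk k z| <= 2 * q ^+ k.
    have [_ _ hb _ _] := hh k; apply: le_trans (ler_normD _ _) _.
    have h1 : r^-1 ^+ k <= q ^+ k by rewrite lerXn2r ?nnegrE ?ltW // /q; lra.
    have h2 : s^-1 ^+ k <= q ^+ k by rewrite lerXn2r ?nnegrE ?ltW // /q; lra.
    by have := mpole_le k s0 sz; have := hb z cz; lra.
  rewrite normrM; apply: le_trans (ler_pM (normr_ge0 _) (normr_ge0 _) (ha m k) hw) _.
  have p2 : mu ^+ m * (rho * q) ^+ k <= M ^+ N.
    have -> : M ^+ N = M ^+ m * M ^+ k by rewrite -exprD -Nk.
    apply: ler_pM; rewrite ?exprn_ge0 ?(ltW rq0) ?mu0 //.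
      by rewrite lerXn2r ?nnegrE ?mu0 ?(ltW M0).
    by rewrite lerXn2r ?nnegrE ?(ltW rq0) ?(ltW M0).
  have := ler_wpM2l G0 p2; rewrite (exprMn k rho q) /F; lra.
move=> e v e0 eM cv hv v0 vK z cz sz.
pose T := e * M; have T0 : 0 < T by rewrite mulr_gt0.
have T2 : T <= 1 / 2 by rewrite /T; lra.
have emuT : e * mu <= T by rewrite ler_pM2l.
have eml : 2 * (e * lam) <= T by rewrite mulrCA ler_pM2l.
have elT : e * lam <= 1 / 2 by have := mulr_gt0 e0 (lt_le_trans ltr01 lam1); lra.
have esT t : s <= t -> e * rho / t <= T by move=> /rsM st; rewrite -mulrA ler_pM2l.
(* Since [D m L] is weighted by [e ^ m], its correctors stop at total order [L]. *)
pose D m L z := y m (e^-1%:C%C * z) + \sum_(k < L - m) e ^+ k.+1 * (a m k.+1 * h k.+1 z).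
pose vL L z := \sum_(m < L) e ^+ m * D m L z.
have cD m L : cont (cl (perf e)) (D m L).
  apply: contD; last first.
    apply: (cont_sum (u := fun k z => e ^+ k.+1 * (a m k.+1 * h k.+1 z))) => k _.
    apply/contZ/contZ; have [[ch _] _ _ _ _] := hh k.+1; apply: cont_sub ch.
    by apply: cl_sub => w [].
  have [[cy _ _ _ _] _] := hf m.
  apply: (cont_eq (u := fun z => y m (0 + e^-1%:C%C * z))); first by move=> w _; rewrite add0r.
  apply: cont_sub (cont_affine (c := 0) (l := e^-1%:C%C) cy) => w cw.
  by rewrite /= add0r; exact: cl_perf_ext.
have hD m L : harm (perf e) (D m L).
  apply: harmD; last first.
    apply: (harm_sum (u := fun k z => e ^+ k.+1 * (a m k.+1 * h k.+1 z))) => k _.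
    apply/harmZ/harmZ; have [[_ hk] _ _ _ _] := hh k.+1; apply: harm_sub hk.
    by move=> w [].
  have [[_ hy _ _ _] _] := hf m.
  apply: (harm_eq (u := fun z => y m (0 + e^-1%:C%C * z))); first exact: perf_opn.
    by move=> w _; rewrite add0r.
  apply: harm_sub (harm_affine 0 (ext_opn clK) (einv e0) hy) => w cw.
  by rewrite /= add0r; exact: perf_ext.
have cvL L : cont (cl (perf e)) (vL L).
  by apply: (cont_sum (u := fun m z => e ^+ m * D m L z)) => m _; exact: contZ.
have hvL L : harm (perf e) (vL L).
  by apply: (harm_sum (u := fun m z => e ^+ m * D m L z)) => m _; exact: harmZ.
have far t m J w : s <= t -> t <= cn w -> 0 <= Im w ->
    `|y m (e^-1%:C%C * w) - \sum_(k < J) e ^+ k.+1 * (a m k.+1 * mpole k.+1 w)| <= 16 * G * mu ^+ m * T ^+ J.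
  move=> st tw wI; have t0 : 0 < t := lt_le_trans s0 st.
  have := far_tail J (hf m).1 e0 t0 (le_trans (esT t st) T2) tw wI => hh1; apply: le_trans hh1 _.
  have -> : 4 * (4 * G * mu ^+ m) = 16 * G * mu ^+ m by ring.
  rewrite ler_wpM2l ?mulr_ge0 ?exprn_ge0 ?mu0 // lerXn2r ?nnegrE ?(ltW T0) ?esT //.
  by rewrite divr_ge0 ?mulr_ge0 ?(ltW e0) ?(ltW rho0) ?(ltW t0).
(* On the outer boundary each corrector is minus its multipole. Far from 0 this is the situation of
   [far_tail]; on the flat part near 0 both the inner solution and the multipoles vanish. *)
have bdO L w : bd (perf e) w -> ~ scaled e w -> bd Om w -> `|vL L w| <= L%:R * (16 * G * T ^+ L).
  move=> bw nw bOw; apply: (@conv_bound e mu T (16 * G) (fun m => D m L w)) => //; rewrite ?mulr_ge0 ?mu0 ?(ltW e0) //.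
  move=> m mL; rewrite /D; have hb k : h k w = - mpole k w by have [_ ->] := hh k.
  under eq_bigr => k _ do rewrite hb mulrN mulrN; rewrite sumrN.
  case: (ltP (cn w) r1) => wr; last by apply: far wr _ => //; exact: (cl_Om_Im Ohalf bOw.1).
  have w0 := bd_Om_near Ohalf Or1 bOw wr.
  have [[_ _ hy _ _] _] := hf m.
  rewrite (hy _ (cl_perf_ext e0 bw.1)).2; last by rewrite ImZ w0 mulr0.
  rewrite big1; first by rewrite subrr normr0 !mulr_ge0 ?exprn_ge0 ?mu0 ?(ltW T0).
  by move=> k _; rewrite mpole_real // !mulr0.
(* On the hole the responses cancel order by order by the definition of [f], and the Taylor
   polynomial of the datum remains. *)
have bdH L X : bd (~` K) X -> bd (perf e) (e%:C%C * X) ->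
    `|vL L.+1 (e%:C%C * X) - (g X - \sum_(n < L.+1) e ^+ n * P n X)| <= L.+1%:R * (32 * G * T ^+ L.+1).
  move=> bX bw; have [KX XI Xr] := bdK bX.
  have eX : e^-1%:C%C * (e%:C%C * X) = X by rewrite mulrA -rmorphM /= mulVf ?gt_eqF // mul1r.
  have hs : \sum_(m < L.+1) e ^+ m * (f m X + \sum_(i < L.+1 - m) e ^+ i * resp (a m) i X)
      = g X - \sum_(n < L.+1) e ^+ n * P n X.
    have tri := triangular_sum (fun m j => e ^+ m * (e ^+ j.+1 * resp (a m) j.+1 X)) L.+1.
    have -> : \sum_(m < L.+1) e ^+ m * (f m X + \sum_(i < L.+1 - m) e ^+ i * resp (a m) i X) =
       \sum_(m < L.+1) e ^+ m * f m X + \sum_(m < L.+1) \sum_(j < L.+1 - m.+1) e ^+ m * (e ^+ j.+1 * resp (a m) j.+1 X).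
      rewrite -big_split /=; apply: eq_bigr => m _; rewrite mulrDr; congr (_ + _).
      rewrite subSn -1?ltnS // big_ord_recl /= {1}/resp big_ord0 mulr0 add0r mulr_sumr.
      by rewrite subSS; apply: eq_bigr.
    rewrite -tri -big_split /=.
    have -> : g X = \sum_(n < L.+1) e ^+ n * (if n == 0%N :> nat then g X else 0).
      rewrite big_ord_recl /= expr0 mul1r big1 ?addr0 // => n _; by rewrite mulr0.
    rewrite -sumrB; apply: eq_bigr => n _; rewrite (hf n).2.
    have -> : \sum_(m < n) e ^+ m * (e ^+ (n - m.+1).+1 * resp (a m) (n - m.+1).+1 X) =
       e ^+ n * \sum_(m < n) resp (a m) (n - m) X.
      rewrite mulr_sumr; apply: eq_bigr => m _; rewrite subnSK // mulrA -exprD subnKC //.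
      exact: ltnW.
    by ring.
  rewrite -hs /vL -sumrB.
  under eq_bigr => m _ do rewrite -mulrBr.
  apply: (@conv_bound e mu T (32 * G) (fun m => D m L.+1 (e%:C%C * X) - (f m X + \sum_(i < L.+1 - m) e ^+ i * resp (a m) i X))) => //; rewrite ?mulr_ge0 ?mu0 ?(ltW e0) //.
  move=> m mL; rewrite /D eX; have [[_ _ hy hk _] _] := hf m.
  have cX : cl (ext K) X by have := cl_perf_ext e0 bw.1; rewrite eX.
  rewrite (hy _ cX).1 // opprD addrACA subrr add0r.
  apply: le_trans (near_tail _ hk e0 elT Xr (ltW XI)) _.
  have -> : 8 * (4 * G * mu ^+ m) = 32 * G * mu ^+ m by ring.
  rewrite ler_wpM2l ?mulr_ge0 ?exprn_ge0 ?mu0 // lerXn2r ?nnegrE ?(ltW T0) //.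
  by have := mulr_gt0 e0 (lt_le_trans ltr01 lam1); lra.
have PX L X : bd (~` K) X -> bd (perf e) (e%:C%C * X) ->
    `|v (e%:C%C * X) - (g X - \sum_(n < L) e ^+ n * P n X)| <= 2 * G * T ^+ L.
  move=> bX bw; have hb : geo G T (fun k => e ^+ k * P k X).
    move=> k; rewrite normrM normrX (gtr0_norm e0).
    apply: le_trans (ler_wpM2l (exprn_ge0 _ (ltW e0)) (PG k bX)) _.
    rewrite mulrCA -exprMn ler_wpM2l // lerXn2r ?nnegrE ?(ltW T0) //.
      by have := mulr_gt0 e0 (lt_le_trans ltr01 lam1); lra.
    by have := mulr_gt0 e0 (lt_le_trans ltr01 lam1); lra.
  have ht : 0 <= T <= 1 / 2 by rewrite (ltW T0).
  have := geo_half L ht hb (vK X bX bw); rewrite -normrN.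
  by congr (`|_| <= _); ring.
have close L : `|v z - vL L.+1 z| <= L.+1%:R * (32 * G * T ^+ L.+1) + 2 * G * T ^+ L.+1.
  have TL : 0 <= G * T ^+ L.+1 by rewrite mulr_ge0 // exprn_ge0 // ltW.
  have L0 : 0 <= L.+1%:R :> R by [].
  have LT : 0 <= L.+1%:R * (G * T ^+ L.+1) by rewrite mulr_ge0.
  apply: (mp_abs (perf_opn e0) (@perf_bdd e)) => //.
    move=> w bw; case: (bd_perf e0 bw) => [[bX Kw]|[bOw nw]]; last first.
      rewrite v0 // sub0r normrN; apply: le_trans (bdO L.+1 w bw nw bOw) _.
      rewrite (_ : L.+1%:R * (16 * G * T ^+ L.+1) = 16 * (L.+1%:R * (G * T ^+ L.+1))); last by ring.
      rewrite (_ : L.+1%:R * (32 * G * T ^+ L.+1) = 32 * (L.+1%:R * (G * T ^+ L.+1))); last by ring.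
      by rewrite -mulrA; lra.
    have ew : e%:C%C * (e^-1%:C%C * w) = w by rewrite mulrA -rmorphM /= mulfV ?gt_eqF // mul1r.
    have bw' : bd (perf e) (e%:C%C * (e^-1%:C%C * w)) by rewrite ew.
    have := bdH L _ bX bw'; have := PX L.+1 _ bX bw'; rewrite ew.
    set q1 := g _ - _ => k1 k2; rewrite (_ : v w - vL L.+1 w = (v w - q1) - (vL L.+1 w - q1)); last by ring.
    by apply: le_trans (ler_normB _ _) _; rewrite addrC lerD.
  have nz : (~` scaled e) z.
    move=> Kz; have := Krho Kz; rewrite cnM cnR gtr0_norm ?invr_gt0 // mulrC ltr_pdivrMr // => zr.
    have := le_trans (esT s (lexx s)) T2; rewrite ler_pdivrMr //; have := s0; lra.
  by rewrite /perf setDE setIC; apply: clU; [exact: co_scaled_opn | split].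
have farz L : `|vL L.+1 z - \sum_(N < L.+2) e ^+ N * A N z| <= L.+1%:R * (16 * G * T ^+ L.+1).
  have -> : \sum_(N < L.+2) e ^+ N * A N z = \sum_(m < L.+1) e ^+ m * \sum_(k < L.+1 - m) e ^+ k.+1 * (a m k.+1 * wk k.+1 z).
    have tri := triangular_sum (fun m k => e ^+ m * (e ^+ k.+1 * (a m k.+1 * wk k.+1 z))) L.+2.
    rewrite [RHS]big_ord_recr /= subnn big_ord0 addr0 in tri.
    transitivity (\sum_(i < L.+1) \sum_(j < L.+2 - i.+1) e ^+ i * (e ^+ j.+1 * (a i j.+1 * wk j.+1 z))).
      rewrite -tri; apply: eq_bigr => N _; rewrite /A mulr_sumr; apply: eq_bigr => m _.
      rewrite [in RHS]mulrA -exprD; congr (e ^+ _ * _).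
      by rewrite addnS -addSn subnKC.
    by apply: eq_bigr => m _; rewrite subSS mulr_sumr.
  rewrite /vL -sumrB; under eq_bigr => m _ do rewrite -mulrBr.
  apply: (@conv_bound e mu T (16 * G) (fun m => D m L.+1 z - \sum_(k < L.+1 - m) e ^+ k.+1 * (a m k.+1 * wk k.+1 z))) => //; rewrite ?mulr_ge0 ?mu0 ?(ltW e0) //.
  move=> m mL; rewrite /D.
  have -> : \sum_(k < L.+1 - m) e ^+ k.+1 * (a m k.+1 * wk k.+1 z) =
     \sum_(k < L.+1 - m) e ^+ k.+1 * (a m k.+1 * mpole k.+1 z) + \sum_(k < L.+1 - m) e ^+ k.+1 * (a m k.+1 * h k.+1 z).
    by rewrite -big_split /=; apply: eq_bigr => k _; rewrite /wk; ring.
  rewrite opprD addrACA subrr addr0; apply: (far s) => //.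
  exact: (cl_Om_Im Ohalf cz).
have T2' : 0 <= 2 * T < 1 by rewrite mulr_ge0 ?(ltW T0) //=; rewrite /T; lra.
move=> d d0; have G1 : 0 < 50 * G + 1 by rewrite ltr_wpDl // mulr_ge0 ?ler0n ?G0.
(* The counts [L.+1] are at most [2 ^ L.+1], so [2 * T < 1] suffices for convergence. *)
have [N0 hN0] := expr_small T2' (divr_gt0 d0 G1).
exists N0.+2 => -[|[|L]] // NL; rewrite distrC.
have {}hN0 : (2 * T) ^+ L.+1 <= d / (50 * G + 1) by apply: hN0; exact: ltnW.
rewrite ler_pdivlMr // in hN0.
have e2 : (2 * T) ^+ L.+1 = 2 ^+ L.+1 * T ^+ L.+1 := exprMn _ _ _.
rewrite e2 in hN0.
have p0 : 0 <= G * T ^+ L.+1 by rewrite mulr_ge0 ?exprn_ge0 ?(ltW T0).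
have p1 : 1 <= 2 ^+ L.+1 :> R by rewrite exprn_ege1 // ler1n.
have p2 : 0 <= 2 ^+ L.+1 * T ^+ L.+1 by rewrite mulr_ge0 ?exprn_ge0 ?(ltW T0).
have p3 := ler_wpM2r p0 (nat_exp2 L.+1); have p4 := ler_wpM2r p0 p1.
have h1 := close L; have h2 := farz L.
rewrite (_ : v z - _ = (v z - vL L.+1 z) + (vL L.+1 z - \sum_(N < L.+2) e ^+ N * A N z)); last by ring.
apply: le_trans (ler_normD _ _) _; apply: le_trans (lerD h1 h2) _.
move: p3 p4 hN0 p2; set tw := 2 ^+ L.+1; set TL := T ^+ L.+1; set n := L.+1%:R => p3 p4 hN0 p2.
exact: le_trans (exp_absorb p3 p4 p2) hN0.
Qed.

End Core.

(** * Translation to two real variables *)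

Section Lines.
Context {R : realType}.
Implicit Types (f : 'rV[R]_2 -> R) (x v : 'rV[R]_2) (s t B l : R).

Lemma is_derive_line f x v t : derivable f (x + t *: v) v ->
  is_derive t (1 : R) (fun s => f (x + s *: v)) ('D_v f (x + t *: v)).
Proof.
have e : (fun h : R => h^-1 *: (((fun s => f (x + s *: v)) \o shift t) (h *: (1 : R)) - f (x + t *: v)))
  = (fun h : R => h^-1 *: ((f \o shift (x + t *: v)) (h *: v) - f (x + t *: v))).
  apply/funext => h /=; congr (_ *: (f _ - _)).
  by rewrite scalerDl [_ *: 1]mulr1 addrCA.
by move=> h; split; rewrite /derivable /derive e.
Qed.

Lemma mvt_line f x v t B l : (forall s, `|s| <= `|t| -> derivable f (x + s *: v) v /\ `|'D_v f (x + s *: v) - l| <= B) ->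
  `|f (x + t *: v) - f x - l * t| <= B * `|t|.
Proof.
move=> h; pose phi s := f (x + s *: v).
have ph0 : phi 0 = f x by rewrite /phi scale0r addr0.
have main a b : a <= b -> `|a| <= `|t| -> `|b| <= `|t| -> `|phi b - phi a - l * (b - a)| <= B * (b - a).
  move=> ab ha hb; have inr s : s \in `[a, b]%R -> `|s| <= `|t|.
    rewrite in_itv /= => /andP[s1 s2]; move: ha hb; rewrite !ler_norml => /andP[? ?] /andP[? ?].
    by apply/andP; lra.
  have [||c cab ->] := @MVT_segment R phi (fun s => 'D_v f (x + s *: v)) a b ab.
  - move=> s /subset_itv_oo_cc si; apply: is_derive_line; exact: (h s (inr s si)).1.
  - apply: derivable_within_continuous => s si.
    by have [] := is_derive_line (h s (inr s si)).1.
  rewrite -mulrBl normrM [`|b - a|]ger0_norm ?subr_ge0 // ler_wpM2r ?subr_ge0 //.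
  exact: (h c (inr c cab)).2.
rewrite -ph0 -/(phi t); case: (leP 0 t) => t0.
  have := main 0 t t0; rewrite normr0 subr0 => /(_ (normr_ge0 _) (lexx _)); by rewrite (ger0_norm t0).
have := main t 0 (ltW t0) (lexx _); rewrite normr0 sub0r => /(_ (normr_ge0 _)).
rewrite -normrN (ltr0_norm t0).
by have -> : - (phi 0 - phi t - l * - t) = phi t - phi 0 - l * t by ring.
Qed.

Lemma toC_delta0 : toC (delta_mx 0 0 : 'rV[R]_2) = 1.
Proof. by rewrite /toC !mxE. Qed.
Lemma toC_delta1 : toC (delta_mx 0 1 : 'rV[R]_2) = 'i%C.
Proof. by rewrite /toC !mxE. Qed.

Lemma rV2_split x : x = x 0 0 *: delta_mx 0 0 + x 0 1 *: delta_mx 0 1.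
Proof.
apply: (can_inj (@toCK R)); rewrite toCD !toCZ toC_delta0 toC_delta1 mulr1.
by apply: complex_eq; rewrite ?ReD ?ImD ?ReZ ?ImZ /=; ring.
Qed.

(** The path from [x] to [y] follows the two axes, where only partial derivatives enter, and stays
    in the disk. *)
Lemma taylor_box f x d B (l : 'I_2 -> R) : (forall y, enorm (y - x) <= d ->
    forall i, derivable f y (delta_mx 0 i) /\ `|partial i f y - l i| <= B) ->
  forall y, enorm (y - x) <= d ->
    `|f y - f x - (l 0 * (y - x) 0 0 + l 1 * (y - x) 0 1)| <= 2 * B * enorm (y - x).
Proof.
move=> h y yd; pose k : 'rV[R]_2 := y - x.
have k0 : `|k 0 0| <= enorm k by rewrite -toC_enorm; exact: Re_le (toC k).
have k1 : `|k 0 1| <= enorm k by rewrite -toC_enorm; exact: Im_le (toC k).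
have B0 : 0 <= B by apply: le_trans (normr_ge0 _) (h y yd 0).2.
pose m := x + k 0 0 *: delta_mx 0 0.
have ym : y = m + k 0 1 *: delta_mx 0 1 by rewrite /m -addrA -rV2_split addrC subrK.
have e1 : `|f y - f m - l 1 * k 0 1| <= B * `|k 0 1|.
  rewrite ym; apply: mvt_line => s sk; apply: h; apply: le_trans yd; rewrite -!toC_enorm -/k.
  rewrite /m addrAC [x + _]addrC addrK toCD !toCZ toC_delta0 toC_delta1 mulr1.
  have cn0 (z : R[i]) : 0 <= cn z := cn_ge0 z.
  rewrite -(@ler_pXn2r _ 2) ?nnegrE // !cn2 !ReD !ImD !ReZ !ImZ /=.
  have : s ^+ 2 <= (k 0 1) ^+ 2 by rewrite -[s ^+ 2]real_normK ?num_real // -[leRHS]real_normK ?num_real // lerXn2r ?nnegrE.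
  by rewrite -/k; lra.
have e2 : `|f m - f x - l 0 * k 0 0| <= B * `|k 0 0|.
  apply: mvt_line => s sk; apply: h; apply: le_trans yd; apply: le_trans k0; apply: le_trans sk.
  by rewrite addrC addKr -toC_enorm toCZ toC_delta0 mulr1 cnR.
have := ler_wpM2l B0 k0; have := ler_wpM2l B0 k1.
have := ler_normD (f y - f m - l 1 * k 0 1) (f m - f x - l 0 * k 0 0); rewrite -/k.
have -> : f y - f m - l 1 * k 0 1 + (f m - f x - l 0 * k 0 0) = f y - f x - (l 0 * k 0 0 + l 1 * k 0 1) by ring.
lra.
Qed.

Lemma lip_box f x d B : (forall y, enorm (y - x) <= d ->
    forall i, derivable f y (delta_mx 0 i) /\ `|partial i f y| <= B) ->
  forall y, enorm (y - x) <= d -> `|f y - f x| <= 2 * B * enorm (y - x).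
Proof.
move=> h y yd; have := @taylor_box f x d B (fun=> 0) _ y yd; rewrite !mul0r addr0 subr0; apply.
by move=> z zd i; rewrite subr0; exact: h.
Qed.

End Lines.

(** * Harmonic functions of two real variables on the complex plane *)

Section Bridge.
Context {R : realType}.
Local Notation C := R[i].
Implicit Types (A O : set 'rV[R]_2) (f u : 'rV[R]_2 -> R) (x y : 'rV[R]_2).

Definition CS A : set C := [set z | A (toV z)].

Lemma open_opn A : open A -> opn (CS A).
Proof.
rewrite openE => oA z /oA /nbhs_cn[r r0 hr]; exists r => // w wz.
by apply: hr; rewrite !toVK.
Qed.

Lemma CS_cl A : cl (CS A) = CS (closure A).
Proof.
apply/funext => z; apply/propext; split => [h B /nbhs_cn[r r0 hr]|h r r0].
  have [w Aw wz] := h r r0; exists (toV w); split => //; apply: hr.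
  by rewrite !toVK.
have [|y [Ay yz]] := h [set y | cn (toC y - toC (toV z)) < r]; first by apply/nbhs_cn; exists r.
by exists (toC y); [rewrite /CS /= toCK | rewrite -[z]toVK].
Qed.

Lemma CS_bd A z : open A -> bd (CS A) z <-> bdry A (toV z).
Proof.
by move=> oA; rewrite /bd /bdry CS_cl (interior_id _).1.
Qed.

Lemma bounded_bdd A : bounded_set A -> bdd (CS A).
Proof.
move=> [M [_ /(_ (M + 1))]]; rewrite ltrDl => /(_ ltr01) h; exists (2 * (M + 2)) => z /h.
rewrite /= => hz; have : `|toV z| < M + 2 by lra.
rewrite norm_rV2 !mxE /= => -[_ [h0 h1]].
by apply: le_trans (cn_ReIm z) _; lra.
Qed.

Lemma within_cont A f : {within A, continuous f} <-> cont (CS A) (f \o toV).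
Proof.
split=> [/subspace_continuousP h z Az e e0|h].
  have /cvgrPdist_le /(_ e e0) /nbhs_cn[r r0 hr] := h (toV z) Az; exists r => // w Aw wz.
  by rewrite distrC; apply: hr => //; rewrite !toVK.
apply/subspace_continuousP => x Ax; apply/cvgrPdist_le => e e0.
have cx : CS A (toC x) by rewrite /CS /= toCK.
have [d d0 hd] := h _ cx e e0; apply/nbhs_cn; exists d => // y yx Ay.
have := hd (toC y); rewrite /CS /= !toCK distrC; exact.
Qed.

(** Mean value theorem for [phi t + phi (- t) - l t ^ 2]: its derivative is [o(t)] by the
    differentiability of [dphi] at the single point 0. *)
Lemma second_diff (phi dphi : R -> R) (r l : R) : 0 < r ->
  (forall t, `|t| < r -> is_derive t (1 : R) phi (dphi t)) -> is_derive (0 : R) (1 : R) dphi l ->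
  forall e, 0 < e -> exists2 d, 0 < d & forall s, 0 < s < d ->
    `|phi s + phi (- s) - 2 * phi 0 - l * s ^+ 2| <= e * s ^+ 2.
Proof.
move=> r0 hphi hl e e0; have e2 := divr2_gt0 e0.
have [d d0 hd] : exists2 d, 0 < d & forall h, `|h| < d -> `|dphi h - dphi 0 - l * h| <= e / 2 * `|h|.
  have [hc hv] := hl; move: hc; rewrite /derivable => /cvg_ex[l' hl'].
  have ll : l' = l by rewrite -hv; apply/esym/cvg_lim.
  move: hl'; rewrite ll => /cvgrPdist_le /(_ _ e2) /nbhs_normP[d /= d0 hd].
  exists d => // h hh; have [->|h0] := eqVneq h 0; first by rewrite subrr mulr0 subrr !normr0 mulr0.
  have := hd h; rewrite /= sub0r normrN => /(_ hh h0); rewrite /shift /= addr0 [h *: 1]mulr1 => hq.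
  have -> : dphi h - dphi 0 - l * h = - ((l - h^-1 *: (dphi h - dphi 0)) * h).
    by rewrite /GRing.scale /=; field.
  by rewrite normrN normrM ler_wpM2r.
exists (Num.min d r); first by rewrite lt_min d0.
move=> s /andP[s0]; rewrite lt_min => /andP[sd sr].
pose psi t := phi t + phi (- t) - l * (t * t).
have hpsi t : `|t| < r -> is_derive t (1 : R) psi (dphi t - dphi (- t) - 2 * l * t).
  move=> tr; have h1 := hphi t tr; have h2 := hphi (- t) ltac:(by rewrite normrN).
  have h3 : is_derive t (1 : R) (phi \o -%R) (- dphi (- t)).
    have h4 : is_derive t (1 : R) (-%R : R -> R) (- 1) by apply: is_deriveN.
    by have := is_derive1_comp h2 h4; rewrite mulrN1.
  have -> : psi = phi + (phi \o -%R) - l \*: (id * id) by apply/funext => y.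
  apply: is_derive_eq; rewrite /GRing.scale /=; ring.
have [||c] := @MVT_segment R psi (fun t => dphi t - dphi (- t) - 2 * l * t) 0 s (ltW s0).
- move=> t; rewrite in_itv /= => /andP[t0 ts]; apply: hpsi; rewrite ger0_norm ?ltW //; lra.
- apply: derivable_within_continuous => t; rewrite in_itv /= => /andP[t0 ts].
  by have [] := hpsi t ltac:(rewrite ger0_norm //; lra).
rewrite in_itv /= => /andP[c0 cs] hc.
have -> : phi s + phi (- s) - 2 * phi 0 - l * s ^+ 2 = psi s - psi 0.
  by rewrite /psi oppr0; ring.
rewrite hc subr0 normrM (gtr0_norm s0) expr2 mulrA ler_pM2r //.
have h1 := hd c ltac:(rewrite ger0_norm //; lra).
have h2 := hd (- c) ltac:(rewrite normrN ger0_norm //; lra).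
move: h1 h2; rewrite normrN (ger0_norm c0) !ler_norml => /andP[? ?] /andP[? ?].
have : e * c <= e * s by rewrite ler_pM2l.
by move=> ?; apply/andP; lra.
Qed.

Lemma I2_ind (P : 'I_2 -> Prop) : P 0 -> P 1 -> forall i, P i.
Proof.
move=> P0 P1 [[|[|//]] hi].
  by rewrite (_ : Ordinal hi = 0) //; apply: val_inj.
by rewrite (_ : Ordinal hi = 1) //; apply: val_inj.
Qed.

Lemma sum2 (F : 'I_2 -> R) : \sum_(i < 2) F i = F 0 + F 1.
Proof.
rewrite big_ord_recl big_ord_recl big_ord0 addr0; congr (F _ + F _); exact: val_inj.
Qed.

Lemma enorm_cn x y : enorm (x - y) = cn (toC x - toC y).
Proof. by rewrite -toC_enorm toCB. Qed.

Lemma cont_atP f x : {for x, continuous f} <->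
  forall e, 0 < e -> exists2 r : R, 0 < r & forall y, cn (toC y - toC x) < r -> `|f y - f x| <= e.
Proof.
split=> [h e e0|h].
  have /cvgrPdist_le /(_ e e0) := (h : f @ nbhs x --> f x) => /nbhs_cn[r r0 hr].
  by exists r => // y /hr; rewrite distrC.
suff : f @ nbhs x --> f x by [].
apply/cvgrPdist_le => e e0; apply/nbhs_cn; have [r r0 hr] := h e e0.
by exists r => // y /hr; rewrite distrC.
Qed.

Lemma lip_cont_at f x d B : 0 < d -> (forall y, enorm (y - x) <= d -> `|f y - f x| <= B * enorm (y - x)) ->
  {for x, continuous f}.
Proof.
move=> d0 h; apply/cont_atP => e e0.
have B1 : 0 < `|B| + 1 by have := normr_ge0 B; lra.
exists (Num.min d (e / (`|B| + 1))); first by rewrite lt_min d0 divr_gt0.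
move=> y; rewrite -enorm_cn lt_min => /andP[yd ye].
apply: le_trans (h y (ltW yd)) _; move: ye; rewrite ltr_pdivlMr //.
have := ler_norm B; have : 0 <= enorm (y - x) by rewrite enorm_cn cn_ge0.
by nra.
Qed.

Lemma c1_lip O f x : open O -> O x -> (forall y, O y -> forall i, derivable f y (delta_mx 0 i)) ->
  (forall i, {for x, continuous (partial i f)}) ->
  exists d B : R, 0 < d /\ forall y, enorm (y - x) <= d -> `|f y - f x| <= B * enorm (y - x).
Proof.
rewrite openE => oO Ox hd hc; have /nbhs_cn[r r0 hr] := oO x Ox.
have near i : exists d : R, 0 < d /\ forall y, cn (toC y - toC x) < d -> `|partial i f y| <= `|partial i f x| + 1.
  have /cont_atP /(_ 1 ltr01)[d d0 hd1] := hc i; exists d; split => // y /hd1.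
  by have := ler_normD (partial i f y - partial i f x) (partial i f x); rewrite subrK; lra.
have [d0 [d00 h0]] := near 0; have [d1 [d10 h1]] := near 1.
pose d := Num.min r (Num.min d0 d1) / 2.
have m0 : 0 < Num.min r (Num.min d0 d1) by rewrite !lt_min r0 d00 d10.
have m1 : Num.min r (Num.min d0 d1) <= r by rewrite ge_min lexx.
have m2 : Num.min r (Num.min d0 d1) <= d0 by rewrite !ge_min lexx orbT.
have m3 : Num.min r (Num.min d0 d1) <= d1 by rewrite !ge_min lexx !orbT.
pose B := `|partial 0 f x| + `|partial 1 f x| + 1.
exists d, (2 * B); split; first exact: divr2_gt0.
apply: lip_box => y; rewrite enorm_cn => yd; have dE : d = Num.min r (Num.min d0 d1) / 2 by [].
move: (Num.min r _) m0 m1 m2 m3 dE => m m0 m1 m2 m3 dE; apply: I2_ind; split.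
- by apply: hd; apply: hr; lra.
- by apply: le_trans (h0 y _) _; [lra | by rewrite /B addrAC lerDl].
- by apply: hd; apply: hr; lra.
- by apply: le_trans (h1 y _) _; [lra | by rewrite /B -addrA lerDr].
Qed.

Lemma toV_add (z w : C) : toV (z + w) = toV z + toV w.
Proof. by apply: (can_inj (@toCK R)); rewrite toCD !toVK. Qed.

Lemma toV_re (s : R) : toV s%:C%C = s *: delta_mx 0 0.
Proof. by apply: (can_inj (@toCK R)); rewrite toCZ toC_delta0 toVK mulr1. Qed.

Lemma toV_im (s : R) : toV ('i%C * s%:C%C) = s *: delta_mx 0 1.
Proof. by apply: (can_inj (@toCK R)); rewrite toCZ toC_delta1 toVK mulrC. Qed.

Lemma second_sum (u1 u2 u3 u4 c l e q : R) : `|u1 + u2 - 2 * c - l * q| <= e / 2 * q ->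
  `|u3 + u4 - 2 * c - - l * q| <= e / 2 * q -> `|u1 + u2 + u3 + u4 - 4 * c| <= e * q.
Proof. by rewrite !ler_norml => /andP[? ?] /andP[? ?]; apply/andP; lra. Qed.

(** The four-point sum splits into second differences along the axes, governed by the two pure
    second derivatives, which cancel. Continuity of [u] comes from that of the second derivatives by
    applying [c1_lip] twice. *)
Theorem harmonic_harm O u : open O -> harmonic_on O u -> harm (CS O) (u \o toV).
Proof.
move=> oO hu; have hd y : O y -> forall i, derivable u y (delta_mx 0 i) by move=> /hu[].
have oO' := oO; rewrite openE in oO'.
split=> c Oc e e0; set x := toV c in Oc; have [_ [h2 hs]] := hu x Oc.
  have c1 i : {for x, continuous (partial i u)}.
    have [d [B [d0 hB]]] := @c1_lip O (partial i u) x oO Oc (fun y Oy j => ((hu y Oy).2.1 i j).1) (fun j => (h2 i j).2).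
    exact: lip_cont_at d0 hB.
  have [d [B [d0 hB]]] := c1_lip oO Oc hd c1.
  have /cont_atP /(_ e e0)[r r0 hr] := lip_cont_at d0 hB.
  by exists r => // w _ wc; apply: hr; rewrite !toVK.
have /nbhs_cn[r r0 hr] := oO' x Oc.
have line i : exists2 d, 0 < d & forall s, 0 < s < d ->
    `|u (x + s *: delta_mx 0 i) + u (x + (- s) *: delta_mx 0 i) - 2 * u x - partial i (partial i u) x * s ^+ 2| <= e / 2 * s ^+ 2.
  have cnd (t : R) : cn (toC (t *: delta_mx 0 i : 'rV[R]_2)) = `|t|.
    rewrite toCZ cnM cnR; move: i; apply: I2_ind; first by rewrite toC_delta0 cn1 mulr1.
    by rewrite toC_delta1 cni mulr1.
  have [||d d0 h] := @second_diff (fun t => u (x + t *: delta_mx 0 i)) (fun t => partial i u (x + t *: delta_mx 0 i)) r (partial i (partial i u) x) r0 _ _ _ (divr2_gt0 e0).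
  - move=> t tr; apply: is_derive_line; apply: hd; apply: hr.
    by rewrite -toCB addrC addKr cnd.
  - have x0 : x = x + (0 : R) *: delta_mx 0 i by rewrite scale0r addr0.
    by rewrite {2}x0; apply: is_derive_line; rewrite -x0; exact: (h2 i i).1.
  by exists d => // s /h; rewrite scale0r addr0.
have [d0 d00 h0] := line 0; have [d1 d10 h1] := line 1.
have hl : partial 1 (partial 1 u) x = - partial 0 (partial 0 u) x.
  have := sum2 (fun i => partial i (partial i u) x); rewrite hs => /eqP.
  by rewrite eq_sym addr_eq0 => /eqP ->; rewrite opprK.
rewrite hl in h1; move: (partial 0 _ _) h0 h1 => l h0 h1.
exists (Num.min d0 d1); first by rewrite lt_min d00.
move=> s /andP[s0]; rewrite lt_min => /andP[s1 s2].
have := h0 s ltac:(by rewrite s0); have := h1 s ltac:(by rewrite s0).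
rewrite /avg4 /= (_ : c - s%:C%C = c + (- s)%:C%C); last by rewrite rmorphN.
rewrite (_ : c - 'i%C * s%:C%C = c + 'i%C * (- s)%:C%C); last by rewrite rmorphN mulrN.
rewrite !toV_add !toV_re !toV_im -/x.
by move=> k1 k0; exact: second_sum k0 k1.
Qed.

End Bridge.

(** * From charts to quantitative flatness of the boundary *)

Section Charts.
Context {R : realType}.
Local Notation C := R[i].
Implicit Types (A O Om V W : set 'rV[R]_2) (f u : 'rV[R]_2 -> R) (x y : 'rV[R]_2).

Lemma C1a_holder (alpha : R) O f : C1a alpha O f -> exists2 H : R, 0 <= H & forall i x y, O x -> O y ->
  `|partial i f x - partial i f y| <= H * enorm (x - y) `^ alpha.
Proof.
move=> [_ h].
have one i : exists2 H : R, 0 <= H & forall x y, O x -> O y ->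
    `|partial i f x - partial i f y| <= H * enorm (x - y) `^ alpha.
  have [_ _ hs] := h i; pose S := holder_seminorm alpha O (partial i f).
  have S0 : (0 <= S)%E by apply: ereal_sup_ubound; left.
  have fS : S \is a fin_num by rewrite ge0_fin_numE.
  exists (fine S); first exact: fine_ge0.
  move=> x y Ox Oy; have [->|xy] := eqVneq x y.
    by rewrite subrr normr0 mulr_ge0 ?powR_ge0 ?fine_ge0.
  have n0 : 0 < enorm (x - y).
    rewrite enorm_cn cn_gt0 subr_eq0; apply: contra_neq xy; exact: (can_inj (@toCK R)).
  rewrite -ler_pdivrMr ?powR_gt0 // -lee_fin fineK //; apply: ereal_sup_ubound; right.
  by exists (x, y) => //=; split => //; split => //; exact/eqP.
have [H0 h0 k0] := one 0; have [H1 h1 k1] := one 1.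
exists (H0 + H1); first exact: addr_ge0.
apply: I2_ind => x y Ox Oy; rewrite mulrDl.
  by apply: le_trans (k0 x y Ox Oy) _; rewrite lerDl mulr_ge0 ?powR_ge0.
by apply: le_trans (k1 x y Ox Oy) _; rewrite lerDr mulr_ge0 ?powR_ge0.
Qed.

Lemma open_ball A x : open A -> A x -> exists2 r : R, 0 < r & forall y, enorm (y - x) < 2 * r -> A y.
Proof.
rewrite openE => oA /oA /nbhs_cn[r r0 hr]; exists (r / 2); first exact: divr2_gt0.
by move=> y yx; apply: hr; rewrite -enorm_cn; lra.
Qed.

Lemma Re_grad (a b : R) (z : C) : Re (Complex a (- b) * z) = a * Re z + b * Im z.
Proof. by rewrite ReM /=; ring. Qed.

Lemma geo_bd_le (alpha : R) (D : set C) (C0 C1 r0 r1 : R) z nu : C0 <= C1 -> r1 <= r0 ->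
  geo_bd alpha D C0 r0 z nu -> geo_bd alpha D C1 r1 z nu.
Proof.
move=> C01 r10 [nu1 h]; split => // w wr; have [h1 h2] := h w (lt_le_trans wr r10).
have p : C0 * hpow alpha (cn (w - z)) <= C1 * hpow alpha (cn (w - z)).
  by rewrite ler_wpM2r // hpow_ge0 // cn_ge0.
split=> [/h1|]; first by apply: le_trans; rewrite lerN2.
by move=> hw; apply: h2; exact: le_lt_trans hw.
Qed.

(** The second component of [psi] is a defining function, and its Taylor expansion at [x1] yields
    tangent and normal. Uniformity in [x1] requires a lower bound on its gradient, which comes from
    the Lipschitz bound on the inverse chart. *)
Lemma C1a_chart_geo (alpha : R) Om x0 V W psi phi : 0 < alpha < 1 ->
  C1a_chart alpha x0 V W psi phi -> flattens Om V psi ->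
  exists d C0 r0 : R, [/\ 0 < d, 0 <= C0 & 0 < r0] /\
    forall x1, bdry Om x1 -> enorm (x1 - x0) < d -> exists nu, geo_bd alpha (CS Om) C0 r0 (toC x1) nu.
Proof.
move=> /andP[a0 a1] [[oV Vx0 oW] [hpsi hphi cpsi cphi]] flat.
have [rV rV0 hrV] := open_ball oV Vx0.
have [rW rW0 hrW] := open_ball oW (hpsi x0 Vx0).1.
have [H H0 hH] := C1a_holder (cpsi 1).
have [L L0 hL] : exists2 L : R, 0 < L & forall w1 w, enorm (w1 - psi x0) < rW -> enorm (w - w1) <= rW ->
    enorm (phi w - phi w1) <= L * enorm (w - w1).
  have one i : exists2 B : R, 0 <= B & forall w1 w, enorm (w1 - psi x0) < rW -> enorm (w - w1) <= rW ->
      `|phi w 0 i - phi w1 0 i| <= B * enorm (w - w1).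
    have [H' H'0 hH'] := C1a_holder (cphi i).
    pose g w := phi w 0 i.
    pose B := `|partial 0 g (psi x0)| + `|partial 1 g (psi x0)| + H' * (2 * rW) `^ alpha.
    exists (2 * B); first by rewrite mulr_ge0 // !addr_ge0 // mulr_ge0 ?powR_ge0.
    move=> w1 w w1r; apply: (@lip_box _ g w1 rW B) => y yw j.
    have yr : enorm (y - psi x0) < 2 * rW.
      rewrite enorm_cn; have := cn_tri (toC w1) (toC y) (toC (psi x0)); rewrite -!enorm_cn; lra.
    have Wy := hrW y yr; split; first by have [dd _ _] := (cphi i).2 j; exact: dd.
    have Wx := (hpsi x0 Vx0).1.
    have h1 : H' * enorm (y - psi x0) `^ alpha <= H' * (2 * rW) `^ alpha.
      rewrite ler_wpM2l //; apply: powR_le => //.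
      by apply/andP; split; [rewrite enorm_cn cn_ge0 | exact: ltW].
    have h2 := hH' j y (psi x0) Wy Wx.
    have h3 : `|partial j g (psi x0)| <= `|partial 0 g (psi x0)| + `|partial 1 g (psi x0)|.
      by move: j {h2}; apply: I2_ind; [rewrite lerDl | rewrite lerDr].
    have := ler_normD (partial j g y - partial j g (psi x0)) (partial j g (psi x0)).
    rewrite subrK => h4; apply: le_trans h4 _; rewrite /B addrC.
    exact: lerD h3 (le_trans h2 h1).
  have [B0 b0 k0] := one 0; have [B1 b1 k1] := one 1.
  exists (B0 + B1 + 1); first by lra.
  move=> w1 w h1 h2; have := k0 w1 w h1 h2; have := k1 w1 w h1 h2.
  have := cn_ReIm (toC (phi w) - toC (phi w1)); rewrite -enorm_cn ReB ImB /=.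
  have : 0 <= enorm (w - w1) by rewrite enorm_cn cn_ge0.
  lra.
have [d1 d10 hd1] : exists2 d : R, 0 < d & forall x, V x -> enorm (x - x0) < d -> enorm (psi x - psi x0) < rW.
  have one i : exists2 d : R, 0 < d & forall x, V x -> enorm (x - x0) < d -> `|psi x 0 i - psi x0 0 i| <= rW / 4.
    have /within_cont h := (cpsi i).1.
    have Vc : CS (closure V) (toC x0) by rewrite /CS /= toCK; exact: subset_closure.
    have [d d0 hd] := h _ Vc (rW / 4) ltac:(by rewrite divr_gt0); exists d => // x Vx xd.
    have := hd (toC x); rewrite /= !toCK; apply; last by rewrite -enorm_cn.
    by rewrite /CS /= toCK; exact: subset_closure.
  have [e0 e00 k0] := one 0; have [e1 e10 k1] := one 1.
  exists (Num.min e0 e1); first by rewrite lt_min e00.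
  move=> x Vx; rewrite lt_min => /andP[x0' x1'].
  have := k0 x Vx x0'; have := k1 x Vx x1'.
  by have := cn_ReIm (toC (psi x) - toC (psi x0)); rewrite -enorm_cn ReB ImB /=; lra.
exists (Num.min d1 rV), (4 * H * L), rV; split; first by rewrite lt_min d10 !mulr_ge0 // ltW.
move=> x1 bx1; rewrite lt_min => /andP[x1d x1r].
have Vx1 : V x1 by apply: hrV; lra.
have ball x : enorm (x - x1) < rV -> V x.
  by move=> xr; apply: hrV; have := cn_tri (toC x1) (toC x) (toC x0); rewrite -!enorm_cn; lra.
have w1r := hd1 x1 Vx1 x1d.
have p0 : psi x1 0 1 = 0 by apply: (flat x1 Vx1).2.1.
pose f x := psi x 0 1; pose G : C := Complex (partial 0 f x1) (- partial 1 f x1).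
have taylor x : enorm (x - x1) < rV -> `|f x - Re (G * (toC x - toC x1))| <= 2 * H * hpow alpha (enorm (x - x1)).
  move=> xr; have := @taylor_box _ f x1 (enorm (x - x1)) (H * enorm (x - x1) `^ alpha) (fun i => partial i f x1).
  move=> /(_ _ x (lexx _)); rewrite (p0 : f x1 = 0) subr0 /G Re_grad ReB ImB /= !mxE /hpow => h.
  apply: le_trans (h _) _; last by rewrite le_eqVlt; apply/orP; left; apply/eqP; ring.
  move=> y yx i; have Vy : V y by apply: ball; exact: le_lt_trans yx xr.
  split; first by have [dd _ _] := (cpsi 1).2 i; exact: dd.
  apply: le_trans (hH i y x1 Vy Vx1) _; apply: (ler_wpM2l H0); apply: (powR_le a0).
  by rewrite yx enorm_cn cn_ge0.
have cL : 0 < 4 * H * L + 1 by have := mulr_ge0 H0 (ltW L0); lra.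
(* A step of height [t] in the chart corresponds to a displacement of at most [L * t]. For small [t]
   the remainder is at most [t / 2], so the linear part accounts for the other half. *)
have Glow : 1 <= 2 * L * cn G.
  pose q := (1 / (4 * H * L + 1)) `^ alpha^-1.
  have q0 : 0 < q by rewrite powR_gt0 // divr_gt0.
  have qE : q `^ alpha = 1 / (4 * H * L + 1).
    by rewrite /q -powRrM mulVf ?gt_eqF // powRr1 // divr_ge0 // ltW.
  pose t := Num.min rW (Num.min (rV / 2) q / L).
  have m0 : 0 < Num.min (rV / 2) q by rewrite lt_min divr2_gt0.
  have t0 : 0 < t by rewrite lt_min rW0 divr_gt0.
  have tW : t <= rW by rewrite ge_min lexx.
  have tL : L * t <= Num.min (rV / 2) q.
    by rewrite mulrC -ler_pdivlMr // /t ge_min lexx orbT.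
  have tV : L * t <= rV / 2 by apply: le_trans tL _; rewrite ge_min lexx.
  have tq : L * t <= q by apply: le_trans tL _; rewrite ge_min lexx orbT.
  pose w := psi x1 + t *: delta_mx 0 1.
  have ww : enorm (w - psi x1) = t.
    by rewrite /w addrC addKr -toC_enorm toCZ toC_delta1 cnM cni cnR mulr1 gtr0_norm.
  have Ww : W w.
    apply: hrW; have := cn_tri (toC (psi x1)) (toC w) (toC (psi x0)); rewrite -!enorm_cn ww; lra.
  have [_ pw] := hphi w Ww.
  have xx : enorm (phi w - x1) <= L * t.
    by have := hL (psi x1) w w1r; rewrite ww (hpsi x1 Vx1).2; apply.
  have e0 : 0 <= enorm (phi w - x1) by rewrite enorm_cn cn_ge0.
  have := taylor (phi w) ltac:(lra).
  have -> : f (phi w) = t by rewrite /f pw /w !mxE p0 add0r mulr1.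
  have h1 : Re (G * (toC (phi w) - toC x1)) <= cn G * (L * t).
    apply: le_trans (ler_norm _) _; apply: le_trans (Re_le _) _; rewrite cnM -enorm_cn.
    by rewrite ler_wpM2l ?cn_ge0.
  have Lt0 : 0 <= L * t by rewrite mulr_ge0 // ltW.
  have h2 : hpow alpha (enorm (phi w - x1)) <= L * t * (1 / (4 * H * L + 1)).
    apply: le_trans (hpow_le a0 (_ : 0 <= _ <= L * t)) _; first by rewrite e0.
    by rewrite /hpow ler_wpM2l // -qE powR_le // Lt0.
  have h3 : 2 * H * (L * t * (1 / (4 * H * L + 1))) <= t / 2.
    rewrite (_ : 2 * H * _ = 2 * H * L * t / (4 * H * L + 1)); last by ring.
    rewrite ler_pdivrMr //; have := mulr_ge0 (mulr_ge0 H0 (ltW L0)) (ltW t0); have := t0; clear; lra.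
  have h4 := ler_wpM2l (_ : 0 <= 2 * H) h2; move=> /(le_trans (ler_norm _)) h5.
  have {}h4 := h4 ltac:(by rewrite mulr_ge0).
  have : t <= t * (2 * L * cn G) by clear - h1 h3 h4 h5; lra.
  by rewrite -{1}[t]mulr1 ler_pM2l.
have G0 : 0 < cn G by rewrite lt_def cn_ge0 andbT; apply/eqP => g0; move: Glow; rewrite g0 mulr0 ler10.
(* The gradient vector of a real function is the conjugate of the number encoding its
   differential. *)
exists (conjc ((cn G)^-1%:C%C * G)); split.
  by rewrite cnC cnM cnR ger0_norm ?invr_ge0 ?cn_ge0 // mulVf // gt_eqF.
move=> z zr; rewrite conjcK -(mulrA (cn G)^-1%:C%C G) ReZ.
have := taylor (toV z); rewrite enorm_cn toVK => /(_ zr).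
have hp0 : 0 <= hpow alpha (cn (z - toC x1)) by rewrite hpow_ge0 // cn_ge0.
have Vz : V (toV z) by apply: ball; rewrite enorm_cn toVK.
have [hOm _] := flat _ Vz.
have iG : (cn G)^-1 <= 2 * L by rewrite -[leLHS]mul1r ler_pdivrMr.
have iG0 : 0 < (cn G)^-1 by rewrite invr_gt0.
move: (Re _) (hpow _ _) hp0 => X h h0; rewrite ler_norml => /andP[f1 f2].
have Hh : 0 <= 2 * H * h by rewrite !mulr_ge0.
have e1 := ler_wpM2r Hh iG.
split=> [/hOm|hX].
  rewrite /half_plane /= -/(f _) => f0; have : 0 <= X + 2 * H * h by clear - f0 f2; lra.
  by move=> /(mulr_ge0 (ltW iG0)); rewrite mulrDr; clear - e1; lra.
apply/hOm; rewrite /half_plane /= -/(f _).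
have : (cn G)^-1 * (2 * H * h) < (cn G)^-1 * X by clear - e1 hX; lra.
by rewrite ltr_pM2l //; clear - f1; lra.
Qed.

(** Compactness of the boundary makes the constants uniform: over a finite cover the values of [C0]
    are added and the least [r0] is taken. *)
Theorem C1a_geo (alpha : R) Om : 0 < alpha < 1 -> open Om -> bounded_set Om -> C1a_set alpha Om ->
  exists C0 r0 : R, [/\ 0 <= C0, 0 < r0 &
    forall z, bd (CS Om) z -> exists nu, geo_bd alpha (CS Om) C0 r0 z nu].
Proof.
move=> ha oO bO hO.
have /choice[D hD] : forall z : C, exists D : R * R * R, bd (CS Om) z ->
    [/\ 0 < D.1.1, 0 <= D.1.2 & 0 < D.2] /\
    forall x1, bdry Om x1 -> enorm (x1 - toV z) < D.1.1 -> exists nu, geo_bd alpha (CS Om) D.1.2 D.2 (toC x1) nu.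
  move=> z; case: (pselect (bd (CS Om) z)) => [/(CS_bd _ oO) bz|nz]; last by exists (0, 0, 0).
  have [V [W [psi [phi [ch fl]]]]] := hO _ bz.
  by have [d [C0 [r0 h]]] := C1a_chart_geo ha ch fl; exists (d, C0, r0).
have oC := open_opn oO.
have bK : bdd (bd (CS Om)) by apply: bdd_sub (bdd_cl (bounded_bdd bO)) => z [].
have dpos z : bd (CS Om) z -> 0 < (D z).1.1 by move=> /hD[[]].
have [s [sK hs]] := cover (@bd_closed _ _ oC) bK dpos.
have [C0 [r0 [C00 r00 hb]]] : exists C0 r0 : R, [/\ 0 <= C0, 0 < r0 & forall z, z \in s -> (D z).1.2 <= C0 /\ r0 <= (D z).2].
  elim: (s) sK => [|a t IH] sK; first by exists 0, 1; split.
  have [C0 [r0 [C00 r00 hb]]] := IH (fun z zt => sK z ltac:(by rewrite inE zt orbT)).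
  have [[_ h1 h2] _] := hD a (sK a (mem_head _ _)).
  exists (C0 + (D a).1.2), (Num.min r0 (D a).2); split; first exact: addr_ge0.
    by rewrite lt_min r00.
  move=> z; rewrite inE => /orP[/eqP ->|/hb[k1 k2]]; first by rewrite lerDr C00 ge_min lexx orbT.
  by rewrite ge_min k2; split => //; apply: le_trans k1 _; rewrite lerDl.
exists C0, r0; split => // z bz; have [y ys zy] := hs z bz.
have [_ h] := hD y (sK y ys); have [h1 h2] := hb y ys.
have [nu hnu] := h (toV z) ((CS_bd _ oO).1 bz) ltac:(by rewrite enorm_cn !toVK).
by exists nu; rewrite toVK in hnu; exact: geo_bd_le hnu.
Qed.

Lemma geo_small (alpha C0 r0 : R) : 0 < alpha -> 0 <= C0 -> 0 < r0 -> exists2 d, 0 < d <= r0 &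
  forall r t : R, 0 < r < d -> 0 <= t < r -> C0 * hpow alpha t < r / 10.
Proof.
move=> a0 C00 r00; have C1 : 0 < 20 * C0 + 1 by lra.
pose q := (1 / (20 * C0 + 1)) `^ alpha^-1.
have q0 : 0 < q by rewrite powR_gt0 // divr_gt0.
have qE : q `^ alpha = 1 / (20 * C0 + 1) by rewrite /q -powRrM mulVf ?gt_eqF // powRr1 // divr_ge0 // ltW.
exists (Num.min r0 q); first by rewrite lt_min r00 q0 ge_min lexx.
move=> r t /andP[rp]; rewrite lt_min => /andP[_ rq] /andP[t0 tr].
have h1 : hpow alpha t <= r * (1 / (20 * C0 + 1)).
  apply: le_trans (hpow_le a0 (_ : 0 <= _ <= r)) _; first by rewrite t0 ltW.
  by rewrite /hpow ler_wpM2l ?(ltW rp) // -qE powR_le // !ltW.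
apply: le_lt_trans (ler_wpM2l C00 h1) _.
rewrite (_ : C0 * _ = C0 * r / (20 * C0 + 1)); last by ring.
by rewrite ltr_pdivrMr //; have := mulr_ge0 C00 (ltW rp); lra.
Qed.

Lemma geo_flat (alpha C0 r0 : R) (D : set C) z nu : 0 < alpha -> 0 <= C0 -> 0 < r0 ->
  geo_bd alpha D C0 r0 z nu -> flatat D z.
Proof.
move=> a0 C00 r00 [nu1 h]; have [d /andP[d0 dr] hd] := geo_small a0 C00 r00.
exists nu => //; exists d => // r /andP[rp rd] x Dx xr.
have := (h x ltac:(lra)).1 Dx; have := hd r (cn (x - z)); rewrite rp rd cn_ge0 xr.
by move=> /(_ isT isT); lra.
Qed.

(** The two-sided bound is symmetric under exchanging the sides, with normal [- nu]; thus the
    exterior of the hole inherits flatness from the hole. *)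
Lemma geo_flat_ext (alpha C0 r0 : R) (D E : set C) z nu : 0 < alpha -> 0 <= C0 -> 0 < r0 ->
  (forall x : C, E x -> ~ D x) -> geo_bd alpha D C0 r0 z nu -> flatat E z.
Proof.
move=> a0 C00 r00 ED [nu1 h]; have [d /andP[d0 dr] hd] := geo_small a0 C00 r00.
exists (- nu); first by rewrite cnN.
exists d => // r /andP[rp rd] x Ex xr.
have := (h x ltac:(lra)).2; have := hd r (cn (x - z)); rewrite rp rd cn_ge0 xr => /(_ isT isT) h1 h2.
have : Re (conjc nu * (x - z)) <= C0 * hpow alpha (cn (x - z)) by rewrite leNgt; apply/negP => /h2; exact: ED.
rewrite (_ : conjc (- nu) * (x - z) = - (conjc nu * (x - z))) ?ReN; first by lra.
by rewrite (_ : conjc (- nu) = - conjc nu) ?mulNr //; apply: complex_eq; rewrite ?ReN ?ImN ?ReC ?ImC ?ReN ?ImN.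
Qed.

End Charts.

(** * From complex gradients to the C^{1,alpha} norm *)

Section Regularity.
Context {R : realType}.
Local Notation C := R[i].
Implicit Types (A O : set 'rV[R]_2) (f g : 'rV[R]_2 -> R) (x y : 'rV[R]_2).

Lemma derive_estimate f x (e : 'rV[R]_2) (l r B : R) : 0 < r ->
  (forall h : R, `|h| < r -> `|f (x + h *: e) - f x - h * l| <= B * h ^+ 2) ->
  derivable f x e /\ 'D_e f x = l.
Proof.
move=> r0 hf; suff hc : (fun h : R => h^-1 *: ((f \o shift x) (h *: e) - f x)) @ 0^' --> l.
  by split; [exact: cvgP hc | exact: cvg_lim hc].
apply/cvgrPdist_le => d d0; have B1 : 0 < `|B| + 1 by have := normr_ge0 B; lra.
apply/nbhs_normP; exists (Num.min r (d / (`|B| + 1))); first by rewrite /= lt_min r0 divr_gt0.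
move=> h /=; rewrite sub0r normrN lt_min => /andP[hr]; rewrite ltr_pdivlMr // => hd h0.
have hp : 0 < `|h| by rewrite normr_gt0.
rewrite -(ler_pM2r hp) -normrM.
have -> : (l - h^-1 *: (f (h *: e + x) - f x)) * h = - (f (x + h *: e) - f x - h * l).
  by rewrite [h *: e + x]addrC /GRing.scale /=; field.
rewrite normrN; apply: le_trans (hf h hr) _; rewrite -[h ^+ 2]real_normK ?num_real // expr2 mulrA ler_pM2r //.
by have := ler_norm B; nra.
Qed.

Lemma isgrad_partial (v : C -> R) x (G : C) : isgrad v (toC x) G ->
  [/\ forall i, derivable (v \o toC) x (delta_mx 0 i), partial 0 (v \o toC) x = Re G &
      partial 1 (v \o toC) x = - Im G].
Proof.
move=> [r [B [r0 h]]].
have [h0 h1] : derivable (v \o toC) x (delta_mx 0 0) /\ 'D_(delta_mx 0 0) (v \o toC) x = Re G.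
  apply: (derive_estimate (B := B) r0) => s sr /=; rewrite toCD toCZ toC_delta0 mulr1.
  by have := h s%:C%C; rewrite cnR real_normK ?num_real // mulrC ReZ; apply.
have [h2 h3] : derivable (v \o toC) x (delta_mx 0 1) /\ 'D_(delta_mx 0 1) (v \o toC) x = - Im G.
  apply: (derive_estimate (B := B) r0) => s sr /=; rewrite toCD toCZ toC_delta1.
  have := h (s%:C%C * 'i%C); rewrite cnM cni mulr1 cnR real_normK ?num_real //.
  have -> : Re (G * (s%:C%C * 'i%C)) = s * - Im G by rewrite mulrCA ReZ ReM /=; ring.
  exact.
split; [exact: (@I2_ind (fun i => derivable (v \o toC) x (delta_mx 0 i)) h0 h2) | exact: h1 | exact: h3].
Qed.

Lemma powR_add (alpha a b : R) : 0 < alpha < 1 -> 0 <= a -> 0 <= b ->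
  (a + b) `^ alpha <= 2 * (a `^ alpha + b `^ alpha).
Proof.
move=> ha a0 b0; have /andP[al0 _] := ha; have pa := powR_ge0 a alpha; have pb := powR_ge0 b alpha.
have k2 : 1 <= 2 :> R by rewrite ler1n.
case: (leP a b) => ab.
  apply: le_trans (_ : (2 * b) `^ alpha <= _); first by apply: powR_le => //; apply/andP; lra.
  by have := powR_scale ha k2 b0; lra.
apply: le_trans (_ : (2 * a) `^ alpha <= _); first by apply: powR_le => //; apply/andP; lra.
by have := powR_scale ha k2 a0; lra.
Qed.

(** McShane's formula: the extension is the supremum of [f y - 2 H |x - y| ^ alpha]. The factor 2 is
    that of [powR_add], applied to the triangle inequality. *)
Lemma holder_ext (alpha H : R) O f : 0 < alpha < 1 -> 0 <= H ->
  (forall x y, O x -> O y -> `|f x - f y| <= H * enorm (x - y) `^ alpha) ->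
  exists2 h : 'rV[R]_2 -> R, {within closure O, continuous h} & forall x, O x -> h x = f x.
Proof.
move=> ha H0 hf; have /andP[a0 _] := ha.
have en0 x y : 0 <= enorm (x - y) by rewrite enorm_cn cn_ge0.
have sym x y : enorm (x - y) = enorm (y - x) by rewrite !enorm_cn cnB.
have tri x y z : enorm (x - y) `^ alpha <= 2 * (enorm (x - z) `^ alpha + enorm (y - z) `^ alpha).
  apply: le_trans (powR_add ha (en0 _ _) (en0 _ _)); apply: powR_le => //.
  by rewrite en0 !enorm_cn; have := cn_tri (toC z) (toC x) (toC y); rewrite (cnB (toC z)).
have /choice[h hh] : forall x, exists l, forall y, O y -> `|f y - l| <= 2 * H * enorm (x - y) `^ alpha.
  move=> x; case: (pselect (O !=set0)) => [[y0 Oy0]|nO]; last by exists 0 => y Oy; case: nO; exists y.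
  pose T := [set f y - 2 * H * enorm (x - y) `^ alpha | y in O].
  have key y y' : O y -> O y' -> f y - 2 * H * enorm (x - y) `^ alpha <= f y' + 2 * H * enorm (x - y') `^ alpha.
    move=> Oy Oy'; have := hf y y' Oy Oy'; rewrite ler_norml => /andP[_ h1].
    have := ler_wpM2l H0 (tri y y' x); rewrite (sym y x) (sym y' x).
    move: h1; move: (enorm _ `^ alpha) (enorm _ `^ alpha) (enorm _ `^ alpha) => p q r h1 h2.
    by clear - h1 h2; lra.
  have hs : has_sup T.
    split; first by exists (f y0 - 2 * H * enorm (x - y0) `^ alpha), y0.
    by exists (f y0 + 2 * H * enorm (x - y0) `^ alpha) => _ [y Oy <-]; exact: key.
  exists (sup T) => y Oy.
  have h1 : f y - 2 * H * enorm (x - y) `^ alpha <= sup T by apply: ub_le_sup; [case: hs | exists y].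
  have h2 : sup T <= f y + 2 * H * enorm (x - y) `^ alpha.
    by apply: ge_sup; [case: hs | move=> _ [y' Oy' <-]; exact: key].
  by rewrite ler_norml; apply/andP; lra.
exists h; last first.
  move=> x Ox; have := hh x x Ox; rewrite subrr.
  have -> : enorm (0 : 'rV[R]_2) = 0 by rewrite -toC_enorm -(subrr x) toCB subrr cn0.
  rewrite powR0 ?gt_eqF // mulr0 normr_le0 subr_eq0 => /eqP //.
apply/within_cont => z cz e e0.
have H1 : 0 < 12 * H + 1 by lra.
pose d := (e / (12 * H + 1)) `^ alpha^-1.
have d0 : 0 < d by rewrite powR_gt0 // divr_gt0.
have dE : d `^ alpha = e / (12 * H + 1).
  by rewrite /d -powRrM mulVf ?gt_eqF // powRr1 // divr_ge0 // ltW.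
exists (d / 2); first exact: divr2_gt0.
move=> w cw wz; have := cz; rewrite -CS_cl => /(_ _ (divr2_gt0 d0))[y' Oy' yz].
have h1 := hh (toV w) (toV y') Oy'; have h2 := hh (toV z) (toV y') Oy'.
have e1 : enorm (toV z - toV y') `^ alpha <= d `^ alpha.
  by apply: powR_le => //; rewrite en0 enorm_cn !toVK cnB; clear - yz d0; lra.
have e2 : enorm (toV w - toV y') `^ alpha <= d `^ alpha.
  apply: powR_le => //; rewrite en0 enorm_cn !toVK.
  by have := cn_tri z w y'; rewrite (cnB z y'); clear - yz wz d0; lra.
rewrite dE in e1 e2.
have e3 : 4 * H * (e / (12 * H + 1)) <= e by rewrite mulrA ler_pdivrMr //; have := mulr_ge0 H0 (ltW e0); clear - e0; lra.
have k1 := ler_wpM2l H0 e1; have k2 := ler_wpM2l H0 e2; move: h1 h2; rewrite /= !ler_norml.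
move=> /andP[g1 g2] /andP[g3 g4]; apply/andP.
move: (enorm _ `^ alpha) (enorm _ `^ alpha) k1 k2 g1 g2 g3 g4 => p q k1 k2 g1 g2 g3 g4.
by clear - k1 k2 g1 g2 g3 g4 e3; lra.
Qed.

Lemma holder_le (alpha H : R) O f : 0 <= H ->
  (forall x y, O x -> O y -> `|f x - f y| <= H * enorm (x - y) `^ alpha) ->
  (holder_seminorm alpha O f <= H%:E)%E.
Proof.
move=> H0 hf; apply: ge_ereal_sup => _ [->|[[x y] /= [Ox [Oy xy]] <-]]; first by rewrite lee_fin.
have n0 : 0 < enorm (x - y).
  by rewrite enorm_cn cn_gt0 subr_eq0; apply/eqP => h; apply: xy; exact: (can_inj (@toCK R)).
by rewrite lee_fin ler_pdivrMr ?powR_gt0 //; exact: hf.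
Qed.

Lemma sup_norm_le M O f : 0 <= M -> (forall x, O x -> `|f x| <= M) -> (sup_norm O f <= M%:E)%E.
Proof.
by move=> M0 h; apply: ge_ereal_sup => _ [->|[x Ox <-]]; rewrite lee_fin //; exact: h.
Qed.

(** Two partial derivatives, each counted once in the supremum and once in the seminorm, give
    [4 * H]. *)
Lemma C1a_of_grad (alpha M H : R) O (v : C -> R) (g : C -> C) : 0 < alpha < 1 -> 0 <= M -> 0 <= H ->
  cont (CS (closure O)) v -> (forall z, CS (closure O) z -> `|v z| <= M) ->
  (forall z, CS O z -> [/\ isgrad v z (g z), cn (g z) <= H &
     forall w, CS O w -> cn (g z - g w) <= H * cn (z - w) `^ alpha]) ->
  C1a alpha O (v \o toC) /\ (C1a_norm alpha O (v \o toC) <= (M + 4 * H)%:E)%E.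
Proof.
move=> ha M0 H0 cv vM hg; pose f := v \o toC.
have Oc x : O x -> CS O (toC x) by rewrite /CS /= toCK.
have pd x : O x -> [/\ forall i, derivable f x (delta_mx 0 i), partial 0 f x = Re (g (toC x)) &
    partial 1 f x = - Im (g (toC x))].
  by move=> /Oc /hg[h _ _]; exact: isgrad_partial.
have hol i x y : O x -> O y -> `|partial i f x - partial i f y| <= H * enorm (x - y) `^ alpha.
  move=> Ox Oy; have [_ _ h] := hg _ (Oc x Ox); have {h} := h _ (Oc y Oy).
  have [_ p0 p1] := pd x Ox; have [_ q0 q1] := pd y Oy; rewrite enorm_cn => h.
  apply: le_trans h; move: i; apply: I2_ind; rewrite ?p0 ?q0 ?p1 ?q1.
    by rewrite -ReB Re_le.
  by rewrite -opprD normrN -ImB Im_le.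
have sup i x : O x -> `|partial i f x| <= H.
  move=> Ox; have [_ h _] := hg _ (Oc x Ox); have [_ p0 p1] := pd x Ox; apply: le_trans h.
  by move: i; apply: I2_ind; rewrite ?p0 ?p1 ?normrN ?Re_le ?Im_le.
split.
  split.
    apply/within_cont; apply: (cont_eq (u := v)); last exact: cv.
    by move=> z _; rewrite /= toVK.
  move=> i; split.
  - by move=> x Ox; have [h _ _] := pd x Ox.
  - by apply: holder_ext ha H0 _ => x y; exact: hol.
  - by apply: le_lt_trans (holder_le H0 (hol i)) _; rewrite ltry.
rewrite /C1a_norm.
have s2 (F : 'I_2 -> \bar R) : (forall i, F i <= H%:E)%E -> (\sum_(i < 2) F i <= (H + H)%:E)%E.
  by move=> hF; rewrite big_ord_recl big_ord_recl big_ord0 adde0 EFinD leeD.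
have -> : (M + 4 * H)%:E = (M%:E + (H + H)%:E + (H + H)%:E)%E.
  by rewrite -!EFinD; congr (_%:E); ring.
apply: leeD; last by apply: s2 => i; exact: holder_le (hol i).
apply: leeD; last by apply: s2 => i; exact: sup_norm_le (sup i).
by apply: sup_norm_le => // x cx; apply: vM; rewrite /CS /= toCK.
Qed.

Lemma C1a_sub (alpha : R) O A f : A `<=` O -> C1a alpha O f -> C1a alpha A f.
Proof.
move=> AO [cf h]; split.
  by apply/within_cont; move/within_cont: cf; apply: cont_sub => z; exact: closure_subset AO _.
move=> i; have [h1 [q cq hq] h3] := h i; split.
- by move=> x /AO; exact: h1.
- exists q; last by move=> x /AO; exact: hq.
  by apply/within_cont; move/within_cont: cq; apply: cont_sub => z; exact: closure_subset AO _.
apply: le_lt_trans h3; apply: ereal_sup_le => _ [->|[z [Az [Az' zz]] <-]]; first by left.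
by right; exists z => //; split; [exact: AO | split => //; exact: AO].
Qed.

Lemma C1aD (alpha : R) O f g : C1a alpha O f -> C1a alpha O g -> C1a alpha O (fun x => f x + g x).
Proof.
move=> hf hg; have [H H0 fH] := C1a_holder hf; have [H' H'0 gH] := C1a_holder hg.
case: hf hg => [cf hf] [cg hg].
have pD i x : O x -> partial i (fun x => f x + g x) x = partial i f x + partial i g x.
  move=> Ox; have [df _ _] := hf i; have [dg _ _] := hg i.
  exact: (deriveD (df x Ox) (dg x Ox)).
split.
  by apply/within_cont; apply: (contD (u := f \o toV) (v := g \o toV)); apply/within_cont.
move=> i; have [df [p cp hp] _] := hf i; have [dg [q cq hq] _] := hg i; split.
- by move=> x Ox; exact: (derivableD (df x Ox) (dg x Ox)).
- exists (fun x => p x + q x); last by move=> x Ox; rewrite pD // hp // hq.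
  by apply/within_cont; apply: (contD (u := p \o toV) (v := q \o toV)); apply/within_cont.
apply: le_lt_trans (_ : (H + H')%:E < +oo)%E; last by rewrite ltry.
apply: holder_le; first exact: addr_ge0.
move=> x y Ox Oy; rewrite !pD // opprD addrACA mulrDl; apply: le_trans (ler_normD _ _) _.
by apply: lerD; [exact: fH | exact: gH].
Qed.

End Regularity.

(** * Power series with values in C^{1,alpha} *)

Section Analyticity.
Context {R : realType}.
Local Notation C := R[i].
Implicit Types (b : nat -> R) (z : C) (N j k : nat).

(** For [k >= N] the factor [(t - t0) ^ k] is at most [2 ^ - N * tau ^ k]; what is left sums to at
    most the binomial expansion of [(|t0| + tau) ^ j]. *)
Lemma re_expansion (t t0 tau : R) N j : `|t - t0| <= tau / 2 ->
  `|t ^+ j - \sum_(k < N) (t - t0) ^+ k * ('C(j, k)%:R * t0 ^+ (j - k))| <= (1 / 2) ^+ N * (`|t0| + tau) ^+ j.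
Proof.
move=> ht; pose T k := (t - t0) ^+ k * ('C(j, k)%:R * t0 ^+ (j - k)).
pose m := maxn j.+1 N.
have tau0 : 0 <= tau by have := normr_ge0 (t - t0); lra.
have -> : t ^+ j = \sum_(k < j.+1) T k.
  rewrite -{1}(subrK t0 t) addrC exprDn; apply: eq_bigr => k _.
  by rewrite /T -mulr_natr; ring.
have wide (F : nat -> R) n : (n <= m)%N -> \sum_(k < n) F k = \sum_(k < m) (if (k < n)%N then F k else 0).
  by move=> nm; rewrite (big_ord_widen _ _ nm) big_mkcond.
rewrite (wide T) ?leq_maxl // (wide T N) ?leq_maxr // -sumrB.
have -> : (1 / 2) ^+ N * (`|t0| + tau) ^+ j =
    \sum_(k < j.+1) (1 / 2) ^+ N * ('C(j, k)%:R * (`|t0| ^+ (j - k) * tau ^+ k)).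
  rewrite exprDn mulr_sumr; apply: eq_bigr => k _; congr (_ * _).
  by rewrite -mulr_natl.
rewrite (wide (fun k => (1 / 2) ^+ N * ('C(j, k)%:R * (`|t0| ^+ (j - k) * tau ^+ k)))) ?leq_maxl //.
apply: le_trans (ler_norm_sum _ _ _) _; apply: ler_sum => k _.
have half : 0 <= 1 / 2 :> R by lra.
case: (ltnP k j.+1) => kj; last first.
  have -> : T k = 0 by rewrite /T bin_small // mul0r mulr0.
  by case: ifP; rewrite subrr normr0.
have p0 : 0 <= (1 / 2) ^+ N * ('C(j, k)%:R * (`|t0| ^+ (j - k) * tau ^+ k)) by rewrite !mulr_ge0 ?exprn_ge0.
case: (ltnP k N) => kN; first by rewrite subrr normr0.
rewrite subr0 /T !normrM !normrX normr_nat mulrC -mulrA.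
have -> : (1 / 2) ^+ N * ('C(j, k)%:R * (`|t0| ^+ (j - k) * tau ^+ k)) =
  'C(j, k)%:R * (`|t0| ^+ (j - k) * ((1 / 2) ^+ N * tau ^+ k)) by ring.
rewrite ler_wpM2l // ler_wpM2l ?exprn_ge0 //.
apply: le_trans (_ : (tau / 2) ^+ k <= _); first by rewrite lerXn2r ?nnegrE //; lra.
have -> : tau / 2 = (1 / 2) * tau by ring.
rewrite exprMn ler_wpM2r ?exprn_ge0 // -(subnK kN) exprD ler_piMl ?exprn_ge0 //.
by rewrite exprn_ile1 //; lra.
Qed.

Lemma C1a_norm_ge0 (a : R) (D : set 'rV[R]_2) f : (0 <= C1a_norm a D f)%E.
Proof.
rewrite /C1a_norm !adde_ge0 ?sume_ge0 //; first by apply: ereal_sup_ubound; left.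
  by move=> i _; apply: ereal_sup_ubound; left.
by move=> i _; apply: ereal_sup_ubound; left.
Qed.

Variables (alpha s B M : R) (Om : set C) (O : set 'rV[R]_2) (A : nat -> C -> R).
Hypotheses (ha : 0 < alpha < 1) (s0 : 0 < s) (B0 : 0 <= B) (M0 : 0 < M) (oO : opn Om) (bO : bdd Om)
  (cA : forall N, cont (cl Om `&` [set z | s < cn z]) (A N))
  (hA : forall N, harm (Om `&` [set z | s < cn z]) (A N))
  (zA : forall N z, bd Om z -> s < cn z -> A N z = 0)
  (bA : forall N z, `|A N z| <= B * M ^+ N)
  (subO : forall z, CS O z -> Om z) (subcO : forall z, CS (closure O) z -> cl Om z /\ 2 * s <= cn z).

(** The coefficients are a parameter so that the powers [t ^ j], their Taylor coefficients in [t]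
    and the remainders are treated alike. *)
Definition powser b z : R := ser (fun j => b j * A j z).

Let term_geo b (Q th : R) z : 0 <= Q -> 0 <= th -> (forall j, `|b j| <= Q * th ^+ j) ->
  geo (Q * B) (th * M) (fun j => b j * A j z).
Proof.
move=> Q0 th0 hb j; rewrite normrM exprMn.
have := ler_pM (normr_ge0 _) (normr_ge0 _) (hb j) (bA j z) => h; apply: le_trans h _.
by rewrite le_eqVlt; apply/orP; left; apply/eqP; ring.
Qed.

Lemma powser_tends b (Q th : R) z : 0 <= Q -> 0 <= th -> th * M <= 1 / 2 -> (forall j, `|b j| <= Q * th ^+ j) ->
  tends (fun n => \sum_(j < n) b j * A j z) (powser b z).
Proof.
move=> Q0 th0 tM hb; apply: ser_tends (term_geo z Q0 th0 hb).
by apply/andP; split; [rewrite mulr_ge0 // ltW | lra].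
Qed.

(** The gradient estimate is applied to the sum, harmonic as a uniform limit, and it is linear in
    the supremum; hence a small [Q] gives a small norm. *)
Theorem powser_C1a C0 r0 : 0 <= C0 -> 0 < r0 ->
  (forall x0, bd Om x0 -> s < cn x0 -> exists nu, geo_bd alpha Om C0 r0 x0 nu) ->
  exists2 K : R, 0 <= K & forall b (Q th : R), 0 <= Q -> 0 <= th -> th * M <= 1 / 2 ->
    (forall j, `|b j| <= Q * th ^+ j) ->
    C1a alpha O (powser b \o toC) /\ (C1a_norm alpha O (powser b \o toC) <= (K * Q)%:E)%E.
Proof.
move=> C00 r00 geo; have [K K0 hK] := grad_holder ha oO bO s0 C00 r00 geo.
exists (2 * B + 8 * (K * B)); first by rewrite addr_ge0 ?mulr_ge0.
move=> b Q th Q0 th0 tM hb; have QB : 0 <= Q * B by rewrite mulr_ge0.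
have ht : 0 <= th * M <= 1 / 2 by rewrite tM mulr_ge0 // ltW.
have tail n z : `|powser b z - \sum_(j < n) b j * A j z| <= 2 * (Q * B) * (1 / 2) ^+ n.
  have := geo_half n ht (term_geo z Q0 th0 hb) (powser_tends z Q0 th0 tM hb) => h; apply: le_trans h _.
  have h12 : 0 <= 1 / 2 :> R by lra.
  by rewrite ler_wpM2l ?mulr_ge0 // lerXn2r ?nnegrE //; case/andP: ht.
have half : 0 <= (1 / 2 : R) < 1 by apply/andP; lra.
have approx (e : R) : 0 < e -> exists n, forall z, `|\sum_(j < n) b j * A j z - powser b z| <= e.
  move=> e0; have Q1 : 0 < 2 * (Q * B) + 1 by lra.
  have [n hn] := expr_small half (divr_gt0 e0 Q1); exists n => z.
  rewrite distrC; apply: le_trans (tail n z) _; have := hn n (leqnn n); rewrite ler_pdivlMr //.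
  have : 0 <= (1 / 2 : R) ^+ n by rewrite exprn_ge0 //; lra.
  by move: ((1 / 2 : R) ^+ n) => X X0 X1; lra.
have vM z : `|powser b z| <= 2 * (Q * B).
  by have := tail 0%N z; rewrite big_ord0 subr0 expr0 mulr1.
have cv : cont (cl Om `&` [set z | s < cn z]) (powser b).
  apply: cont_unif => e /approx[n hn]; exists (fun z => \sum_(j < n) b j * A j z) => //.
  by apply: (cont_sum (u := fun j z => b j * A j z)) => j _; exact: contZ.
have os : opn [set z : C | s < cn z].
  move=> z sz; exists (cn z - s); first by rewrite subr_gt0.
  by move=> w wz /=; have := cnBD z w; rewrite (cnB z w); lra.
have hv : harm (Om `&` [set z | s < cn z]) (powser b).
  apply: harm_unif; first exact: opnI.
  move=> e /approx[n hn]; exists (fun z => \sum_(j < n) b j * A j z) => //.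
  by apply: (harm_sum (u := fun j z => b j * A j z)) => j _; exact: harmZ.
have QB2 : 0 <= 2 * (Q * B) by rewrite mulr_ge0.
have v0 z : bd Om z -> s < cn z -> powser b z = 0.
  move=> bz sz; apply: tends_ser; apply: tends_eq (tends_cst 0) => n.
  by rewrite big1 // => j _; rewrite zA // mulr0.
have [g hg] := hK (powser b) (2 * (Q * B)) cv hv QB2 (fun z _ _ => vM z) v0.
have subc z : CS O z -> 2 * s <= cn z by move=> Oz; apply: (subcO _).2; exact: subset_closure.
have [|||h1 h2] := @C1a_of_grad R alpha (2 * (Q * B)) (K * (2 * (Q * B))) O (powser b) g ha QB2 (mulr_ge0 K0 QB2).
- apply: cont_sub cv => z /subcO[cz sz]; split => //=; have := s0; lra.
- by move=> z _; exact: vM.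
- move=> z Oz; have [k1 k2 k3] := hg z (subO Oz) (subc z Oz); split => // w Ow.
  by apply: k3; [exact: subO | exact: subc].
split=> //; rewrite (_ : (2 * B + 8 * (K * B)) * Q = 2 * (Q * B) + 4 * (K * (2 * (Q * B)))) //; ring.
Qed.

Lemma powser_analytic C0 r0 (e : R) (u0 : 'rV[R]_2 -> R) : 0 <= C0 -> 0 < r0 ->
  (forall x0, bd Om x0 -> s < cn x0 -> exists nu, geo_bd alpha Om C0 r0 x0 nu) ->
  C1a alpha O u0 -> 0 < e -> 4 * (e * M) <= 1 ->
  real_analytic_C1a alpha O [set t : R | - e < t < e]
    (fun t x => u0 x + powser (fun j => t ^+ j) (toC x)).
Proof.
move=> C00 r00 geo cu0 e0 eM; have [K K0 hK] := powser_C1a C00 r00 geo.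
have inI (t : R) : - e < t < e -> `|t| <= e by rewrite ler_norml => /andP[h1 h2]; rewrite !ltW.
have eM2 : e * M <= 1 / 2 by lra.
have epow (t : R) : - e < t < e -> forall j, `|t ^+ j| <= 1 * e ^+ j.
  by move=> /inI te j; rewrite mul1r normrX lerXn2r ?nnegrE ?normr_ge0 // ltW.
split.
  move=> t /epow te; apply: C1aD; first exact: cu0.
  by have [] := hK _ 1 e ler01 (ltW e0) eM2 te.
move=> t0 ht0; have t0e := inI _ ht0; exists (e / 2); first exact: divr2_gt0.
(* Re-expansion at [t0] replaces the ratio [e] by [|t0| + e], at most [2 * e]; the assumption
   [4 * (e * M) <= 1] leaves this room. *)
pose th := `|t0| + e; have th0 : 0 <= th by rewrite addr_ge0 // ltW.
have thM : th * M <= 1 / 2.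
  apply: le_trans (_ : (2 * e) * M <= _); last by lra.
  by rewrite ler_wpM2r ?(ltW M0) // /th; lra.
pose c k j := 'C(j, k)%:R * t0 ^+ (j - k).
have ek k : 0 < e ^+ k by rewrite exprn_gt0.
(* A single binomial term is at most the whole expansion of [(|t0| + e) ^ j]. *)
have cb k j : `|c k j| <= (e ^- k) * th ^+ j.
  rewrite mulrC ler_pdivlMr // normrM normr_nat normrX /th exprDn.
  case: (leqP k j) => kj; last first.
    by rewrite bin_small // !mul0r sumr_ge0 // => i _; rewrite mulrn_wge0 // mulr_ge0 // exprn_ge0 // ltW.
  have kj' : (k < j.+1)%N by [].
  have -> : 'C(j, k)%:R * `|t0| ^+ (j - k) * e ^+ k = (`|t0| ^+ (j - k) * e ^+ k) *+ 'C(j, k).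
    by rewrite -[RHS]mulr_natl mulrA.
  rewrite (bigD1 (Ordinal kj')) //= lerDl sumr_ge0 // => i _.
  by rewrite mulrn_wge0 // mulr_ge0 // exprn_ge0 // ltW.
(* The constant family [u0] goes into the coefficient of order 0, so the remainder has the form
   [powser (b N)] once [0 < N]. *)
exists (fun k x => (if k == 0%N then u0 x else 0) + powser (c k) (toC x)); split.
  move=> k; have iek : 0 <= e ^- k by rewrite invr_ge0 ltW.
  have [hc _] := hK (c k) (e ^- k) th iek th0 thM (cb k).
  case: (k == 0%N); first exact: (C1aD cu0 hc).
  rewrite (_ : (fun x => _) = powser (c k) \o toC); first exact: hc.
  by apply/funext => x; rewrite add0r.
move=> t ht td.
have tt : `|t - t0| <= e / 2 := ltW td.
pose b N j := t ^+ j - \sum_(k < N) (t - t0) ^+ k * c k j.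
have bb N j : `|b N j| <= (1 / 2) ^+ N * th ^+ j by exact: re_expansion.
have half : 0 <= (1 / 2 : R) < 1 by apply/andP; lra.
have h0 N : 0 <= (1 / 2 : R) ^+ N by rewrite exprn_ge0 //; lra.
have eqF N : (0 < N)%N -> (fun x => u0 x + powser (fun j => t ^+ j) (toC x) -
    \sum_(0 <= k < N) (t - t0) ^+ k * ((if k == 0%N then u0 x else 0) + powser (c k) (toC x))) = powser (b N) \o toC.
  move=> N0; apply/funext => x /=; set z := toC x.
  have e1 : \sum_(0 <= k < N) (t - t0) ^+ k * ((if k == 0%N then u0 x else 0) + powser (c k) z)
      = u0 x + \sum_(k < N) (t - t0) ^+ k * powser (c k) z.
    rewrite big_mkord; under eq_bigr => k _ do rewrite mulrDr.
    rewrite big_split /=; congr (_ + _); case: N N0 => // N _; rewrite big_ord_recl /= mul1r big1 ?addr0 //.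
    by move=> k _; rewrite mulr0.
  rewrite e1 opprD addrACA subrr add0r; apply/esym.
  have hs n : tends (fun m => \sum_(j < m) (\sum_(k < n) (t - t0) ^+ k * c k j) * A j z)
     (\sum_(k < n) (t - t0) ^+ k * powser (c k) z).
    elim: n => [|n IH].
      rewrite big_ord0; apply: tends_eq (tends_cst 0) => m.
      by rewrite big1 // => j _; rewrite big_ord0 mul0r.
    rewrite big_ord_recr /=; have iek : 0 <= e ^- n by rewrite invr_ge0 ltW.
    have hc := powser_tends z iek th0 thM (cb n).
    apply: tends_eq (tendsD IH (tendsZ ((t - t0) ^+ n) hc)) => m.
    rewrite mulr_sumr -big_split /=; apply: eq_bigr => j _.
    by rewrite big_ord_recr /=; ring.
  have ht' := powser_tends z ler01 (ltW e0) eM2 (epow t ht).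
  have hb := powser_tends z (h0 N) th0 thM (bb N).
  apply: tends_unique hb _; apply: tends_eq (tendsB ht' (hs N)) => m.
  by rewrite -sumrB; apply: eq_bigr => j _; rewrite /b; ring.
apply: (@squeeze_cvge _ _ _ _ (fun=> 0%E) _ (fun N => (K * (1 / 2) ^+ N)%:E)).
- exists 1%N => // N /= N1; rewrite C1a_norm_ge0 /= eqF //.
  by have [] := hK (b N) _ th (h0 N) th0 thM (bb N).
- exact: cvg_cst.
apply: cvg_EFin; first by near=> N.
apply/tends_cvg; rewrite -[0](mulr0 K); apply: tendsZ => d d0.
have [N0 hN0] := expr_small half d0; exists N0 => N /hN0.
by rewrite subr0 ger0_norm.
Unshelve. all: by end_near.
Qed.

End Analyticity.

(** * Geometry of the hole and choice of its size *)

Section Geometry.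
Context {R : realType}.
Local Notation C := R[i].
Implicit Types (om O : set 'rV[R]_2) (p x y : 'rV[R]_2) (z w X : C) (e : R).

Lemma eball_CS (r : R) : CS (eball r) = disk (0 : C) r.
Proof. by apply/funext => z; rewrite /CS /eball /= subr0 -toC_enorm toVK. Qed.

Lemma eball_open (r : R) : open (@eball R 2 r).
Proof.
rewrite openE => x xr; have := @disk_opn R 0 r (toC x); rewrite -eball_CS /CS /= toCK => /(_ xr)[d d0 hd].
by apply/nbhs_cn; exists d => // y /hd; rewrite /= toCK.
Qed.

Lemma half_ball_CS (r : R) : CS (@half_ball R r) = hdisk r.
Proof.
apply/funext => z; apply/propext; rewrite /CS /half_ball /hdisk /= /eball /half_plane /= -toC_enorm toVK.
by rewrite !mxE.
Qed.

Lemma half_CS z : half_plane (toV z) = (0 < Im z).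
Proof. by rewrite /half_plane /= !mxE. Qed.

(** This is [p + om], the hole in the variable [x / e]. *)
Definition shape p om : set C := [set z | CS om (z - toC p)].

Lemma shape_opn p om : open om -> opn (shape p om).
Proof.
move=> /open_opn oo z /oo[r r0 hr]; exists r => // w wz; apply: hr.
by rewrite opprB addrA subrK.
Qed.

Lemma cl_shape p om z : cl (shape p om) z <-> closure om (toV (z - toC p)).
Proof.
have -> : closure om (toV (z - toC p)) = cl (CS om) (z - toC p) by rewrite CS_cl.
split=> h r r0; have [w hw wr] := h r r0.
  by exists (w - toC p) => //; rewrite (_ : _ - _ = w - z) //; ring.
exists (w + toC p); first by rewrite /shape /= addrK.
by rewrite (_ : _ - _ = w - (z - toC p)) //; ring.
Qed.

Lemma shape_geo (alpha C0 r0 : R) p om z nu : geo_bd alpha (CS om) C0 r0 (z - toC p) nu ->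
  geo_bd alpha (shape p om) C0 r0 z nu.
Proof.
move=> [nu1 h]; split => // x xz; have e : x - toC p - (z - toC p) = x - z by ring.
by have := h (x - toC p); rewrite e => /(_ xz).
Qed.

(** The summand 0 keeps the affine form expected by [cl_affine]. *)
Lemma hole_shape p om e : e != 0 -> CS (hole p om e) = [set z | shape p om (0 + e^-1%:C%C * z)].
Proof.
move=> e0; have en : e%:C%C * e^-1%:C%C = 1 :> C by rewrite -rmorphM /= mulfV.
apply/funext => z; apply/propext; split=> [[y omy hy]|omz].
  rewrite /shape /CS /= -[z]toVK -hy toCD !toCZ.
  rewrite (_ : 0 + e^-1%:C%C * (e%:C%C * toC p + e%:C%C * toC y) - toC p = toC y) ?toCK //.
  transitivity (e%:C%C * e^-1%:C%C * (toC p + toC y) - toC p); first by ring.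
  by rewrite en; ring.
exists (toV (0 + e^-1%:C%C * z - toC p)) => //; apply: (can_inj (@toCK R)).
rewrite toCD !toCZ !toVK; transitivity (e%:C%C * e^-1%:C%C * z); first by ring.
by rewrite en mul1r.
Qed.

Lemma cl_hole p om e : 0 < e -> CS (closure (hole p om e)) = scaled (cl (shape p om)) e.
Proof.
move=> e0; have en : e != 0 by rewrite gt_eqF.
rewrite -CS_cl hole_shape //; apply/funext => z; apply/propext.
have en' : e^-1%:C%C != 0 :> C by rewrite realC_neq0 // invr_neq0.
by rewrite cl_affine // /scaled /= add0r.
Qed.

Lemma perf_CS O p om e : 0 < e -> CS (perforated O p om e) = perf (CS O) (cl (shape p om)) e.
Proof. by move=> e0; rewrite /perf -(cl_hole _ _ e0). Qed.

(** An open shape cannot contain limits of points outside its closure; this transfers the flatness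
    of the hole to its closure. *)
Lemma bd_shape p om X : open om -> bd (~` cl (shape p om)) X -> bd (shape p om) X.
Proof.
move=> oom [cX /contrapT KX]; split => // sX; have [r r0 hr] := shape_opn oom sX.
have [w nw wr] := cX r r0; apply: nw; apply: sub_cl; exact: hr.
Qed.

Lemma bdry_hole p om e X : open om -> 0 < e -> bd (~` cl (shape p om)) X -> bdry (hole p om e) (toV (e%:C%C * X)).
Proof.
move=> oom e0 /(bd_shape oom)[cX nX]; have en : e != 0 by rewrite gt_eqF.
have ee : e^-1%:C%C * (e%:C%C * X) = X by rewrite mulrA -rmorphM /= mulVf // mul1r.
split.
  have : CS (closure (hole p om e)) (e%:C%C * X) by rewrite cl_hole // /scaled /= ee.
  by [].
move=> /interior_subset hX; have : CS (hole p om e) (e%:C%C * X) by [].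
by rewrite hole_shape //= add0r ee.
Qed.

Lemma hole_small p om e (rho : R) : (forall z, shape p om z -> cn z < rho) ->
  forall z, CS (closure (hole p om e)) z -> cn z <= `|e| * rho.
Proof.
move=> hr z; rewrite -CS_cl => cz; apply: eps_le => d d0; have [w [y omy hy] wz] := cz d d0.
have sy : shape p om (toC (p + y)) by rewrite /shape /CS /= toCD addrC addKr toCK.
have wE : w = e%:C%C * toC (p + y) by rewrite -[w]toVK -hy -scalerDr toCZ.
have : cn w <= `|e| * rho by rewrite wE cnM cnR ler_wpM2l // ltW // hr.
by have := cnBD z w; rewrite (cnB z w); lra.
Qed.

(** [ea / 2] keeps the size admissible, [1 / (4 * M)] ensures convergence with room for
    re-expansion, [r1 / 2 / rho] puts the hole in the Taylor disk of [U0], and [s / rho] keeps it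
    away from [Om']. *)
Lemma choose_eps (ea M rho r1 s : R) : 0 < ea -> 0 < M -> 0 < rho -> 0 < r1 -> 0 < s ->
  exists e0, [/\ 0 < e0 < ea, 4 * (e0 * M) <= 1 & forall e, `|e| < e0 ->
    [/\ e < ea, 2 * (e * M) < 1, e * rho < r1 / 2 & `|e| * rho < 2 * s]].
Proof.
move=> ea0 M0 p0 r0 s0.
pose m := Num.min (Num.min (ea / 2) (1 / (4 * M))) (Num.min (r1 / 2 / rho) (s / rho)).
have m0 : 0 < m by rewrite !lt_min !divr_gt0 // mulr_gt0.
have m1 : m <= ea / 2 by rewrite !ge_min lexx.
have m2 : m * (4 * M) <= 1 by rewrite -ler_pdivlMr ?mulr_gt0 // !ge_min lexx orbT.
have m3 : m * rho <= r1 / 2 by rewrite -ler_pdivlMr // !ge_min lexx !orbT.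
have m4 : m * rho <= s by rewrite -ler_pdivlMr // !ge_min lexx !orbT.
exists m; split; [apply/andP; lra | lra | move=> e em].
have he : e < m := le_lt_trans (ler_norm e) em.
have k1 : `|e| * rho < m * rho by rewrite ltr_pM2r.
have k2 : e * rho < m * rho by rewrite ltr_pM2r.
have k3 : e * M < m * M by rewrite ltr_pM2r.
by split; lra.
Qed.

End Geometry.

Theorem theorem1p4 (R : realType) (alpha : R)
  (halpha : 0 < alpha < 1)
  (Om : set 'rV[R]_2) (hOm : admissible_domain alpha Om)
  (om : set 'rV[R]_2) (hom : admissible_hole alpha om)
  (p : 'rV[R]_2) (hp : half_plane p)
  (eps_ad : R) (heps_ad : 0 < eps_ad < 1)
  (hole_sub : forall e : R, 0 < e < eps_ad -> closure (hole p om e) `<=` Om)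
  (go gi : 'rV[R]_2 -> R)
  (hgo : C1a_bdry alpha Om go) (hgi : C1a_bdry alpha om gi)
  (r0 : R) (hr0 : 0 < r0)
  (go_analytic : real_analytic_on
     [set t : R | (eball r0 `&` bdry0 Om) (pt t 0)] (fun t => go (pt t 0)))
  (u : R -> 'rV[R]_2 -> R)
  (hu : forall e : R, 0 < e < eps_ad ->
     [/\ C1a alpha (perforated Om p om e) (u e),
         harmonic_on (perforated Om p om e) (u e),
         forall x : 'rV[R]_2, bdry Om x -> u e x = go x
       & forall x : 'rV[R]_2, bdry (hole p om e) x -> u e x = gi (e^-1 *: (x - e *: p))])
  (u0 : 'rV[R]_2 -> R)
  (hu0 : [/\ C1a alpha Om u0, harmonic_on Om u0
           & forall x : 'rV[R]_2, bdry Om x -> u0 x = go x])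
  (r1 : R) (hr1 : 0 < r1 <= r0) (half_ball_sub : half_ball r1 `<=` Om)
  (U0 : 'rV[R]_2 -> R) (hU0 : harmonic_on (eball r1) U0)
  (U0_ext : forall x : 'rV[R]_2, closure (half_ball r1) x -> U0 x = u0 x)
  (hole_ball : forall e : R, - eps_ad < e < eps_ad ->
     [set e *: p + e *: y | y in closure om] `<=` eball r1)
  (Om' : set 'rV[R]_2) (open_Om' : open Om') (Om'_sub : Om' `<=` Om)
  (Om'_far : ~ closure Om' 0) :
  exists eps' : R,
    [/\ 0 < eps' < eps_ad,
        forall e : R, - eps' < e < eps' ->
          closure (hole p om e) `&` closure Om' = set0
      & exists U : R -> 'rV[R]_2 -> R,
          [/\ real_analytic_C1a alpha Om' [set e : R | - eps' < e < eps'] U,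
              forall e : R, 0 < e < eps' -> forall x : 'rV[R]_2, closure Om' x ->
                u e x = U e x
            & forall x : 'rV[R]_2, closure Om' x -> U 0 x = u0 x]].
Proof.
have /andP[a0 a1] := halpha; have /andP[r10 _] := hr1; have /andP[ea0 _] := heps_ad.
have [[oOm bOm _ OmH] [cOm _ _ _]] := hOm; have [oom bom _ com _] := hom.
have [cu0 hu0' bu0] := hu0.
pose D := CS Om; pose E := shape p om; pose K := cl E.
have oD : opn D := open_opn oOm.
have bD : bdd D := bounded_bdd bOm.
have DH z : D z -> 0 < Im z by move=> /OmH; rewrite half_CS.
have Dr1 : hdisk r1 `<=` D by rewrite -half_ball_CS => z; exact: half_ball_sub.
have [C0 [rg [C00 rg0 geoO]]] := C1a_geo halpha oOm bOm cOm.
have flatO x : bd D x -> flatat D x.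
  by move=> /geoO[nu]; exact: geo_flat.
have [C1 [rh [C10 rh0 geoH]]] := C1a_geo halpha oom bom com.
have flatK x : bd (~` K) x -> flatat (~` K) x.
  move=> /(bd_shape oom) [cx nx].
  have bx : bd (CS om) (x - toC p).
    by split => //; rewrite CS_cl; exact/(cl_shape p om x).1.
  have [nu hnu] := geoH _ bx; apply: (geo_flat_ext a0 C10 rh0) (shape_geo hnu).
  by move=> z nz sz; apply: nz; exact: sub_cl.
have clK : cl K `<=` K by exact: cl_cl.
(* One fixed admissible size suffices to obtain what does not depend on [e]: the positive heights on
   [K] and the continuity of the inner datum. *)
pose e0 := eps_ad / 2; have e00 : 0 < e0 := divr2_gt0 ea0.
have e0a : 0 < e0 < eps_ad by rewrite e00 /e0; clear - ea0; lra.
have inD e X : 0 < e < eps_ad -> K X -> D (e%:C%C * X).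
  move=> he KX; have /andP[ep _] := he; apply: (hole_sub e he).
  have : CS (closure (hole p om e)) (e%:C%C * X).
    by rewrite cl_hole // /scaled /= mulrA -rmorphM /= mulVf ?gt_eqF // mul1r.
  exact: id.
have KH z : K z -> 0 < Im z.
  by move=> /(inD e0 z e0a) /DH; rewrite ImZ pmulr_rgt0.
(* [rho] is enlarged to at least [r1], so that [lam >= 1] in the recursion. *)
have [rho [rr1 Krho]] : exists rho : R, r1 <= rho /\ forall z, K z -> cn z < rho.
  have [B hB] : bdd K.
    have [B hB] := bounded_bdd bom; apply: bdd_cl; exists (B + cn (toC p)) => z /hB h.
    by have := cnBD z (toC p); clear - h; lra.
  exists (Num.max r1 (B + 1)); split; first by rewrite le_max lexx.
  by move=> z /hB zB; apply: le_lt_trans zB _; rewrite lt_max ltrDl ltr01 orbT.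
have rho0 : 0 < rho := lt_le_trans r10 rr1.
have onH e X : 0 < e < eps_ad -> bd (~` K) X -> u e (toV (e%:C%C * X)) = gi (toV X - p).
  move=> he bX; have /andP[ep _] := he; have [_ _ _ hb] := hu e he.
  rewrite hb; last exact: bdry_hole.
  congr gi; apply: (can_inj (@toCK R)); rewrite toCZ !toCB toCZ !toVK.
  by rewrite -mulrBr mulrA -rmorphM /= mulVf ?gt_eqF // mul1r.
have cue e : 0 < e < eps_ad -> cont (cl (perf D K e)) (u e \o toV).
  move=> he; have /andP[ep _] := he; have [[cu _] _ _ _] := hu e he.
  by rewrite -perf_CS // CS_cl; exact/within_cont.
(* By [onH] this is [gi (X - p)] on the boundary, whatever the size. Reading it through the solution
   at [e0] gives its continuity from that of the solution. *)
pose g X := u e0 (toV (e0%:C%C * X)).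
have bdKK X : bd (~` K) X -> K X by move=> [_ /contrapT].
have cg : cont (bd (~` K)) g.
  have h := @cont_affine _ _ _ 0 e0%:C%C (cue e0 e0a).
  apply: (cont_eq (u := fun z => u e0 (toV (0 + e0%:C%C * z)))); first by move=> z _; rewrite add0r.
  apply: cont_sub h => X bX /=; rewrite add0r /perf setDE.
  apply: clU => //; split; first exact: inD e0a (bdKK _ bX).
  have en : e0%:C%C != 0 :> R[i] by rewrite realC_neq0 // gt_eqF.
  rewrite -[_ * X]add0r; apply/(cl_affine _ _ _ en); apply: cl_sub bX.1 => w nw.
  by rewrite /scaled /= add0r mulrA -rmorphM /= mulVf ?gt_eqF // mul1r.
have bK : bdd K by exists rho => z /Krho /ltW.
have [G1 G10 gG1] := evt_bound (@bd_closed _ _ (coK_opn clK)) (bdd_sub bdKK bK) cg.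
pose r := r1 / 2; have rp : 0 < r := divr2_gt0 r10.
have hU : harm (disk 0 r1) (U0 \o toV) by rewrite -eball_CS; apply: harmonic_harm => //; exact: eball_open.
have csub : cdisk 0 r `<=` disk (0 : R[i]) r1.
  by move=> z /= zr; apply: le_lt_trans zr _; rewrite /r; clear - r10; lra.
have cU : cont (cdisk 0 r) (U0 \o toV) := cont_sub csub hU.1.
have [G2 G20 UG] := evt_bound (@cdisk_closed _ 0 r) (@cdisk_bdd _ 0 r) cU.
have [a [aG ha]] := harm_rep rp cU (harm_sub (subset_trans (@disk_cdisk _ 0 r) csub) hU)
  (fun z zr => UG z (circle_cdisk zr)).
(* The coefficient of [e ^ n] in [U0 (e X)]. *)
pose P n (X : R[i]) := complex.Re (a n * (r^-1%:C%C * X) ^+ n).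
pose G := G1 + 2 * G2.
have G2' : 0 <= 2 * G2 by rewrite mulr_ge0.
have G0 : 0 <= G by rewrite addr_ge0.
have gG z : bd (~` K) z -> `|g z| <= G.
  by move=> /gG1 h; apply: le_trans h _; rewrite lerDl.
have cP n : cont (bd (~` K)) (P n).
  have h : harm (bd (~` K)) (P n).
    apply: taylor3_harm => c _; apply: taylor3M; first exact: taylor3_cst.
    by apply/taylor3X/taylor3M; [exact: taylor3_cst | exact: taylor3_id].
  exact: h.1.
have ir0 : 0 < r^-1 by rewrite invr_gt0.
have PG n z : bd (~` K) z -> `|P n z| <= G * (rho / (r1 / 2)) ^+ n.
  move=> /bdKK /Krho zr; apply: le_trans (Re_le _) _; rewrite cnM cnX cnM cnR gtr0_norm //.
  apply: ler_pM; rewrite ?cn_ge0 ?exprn_ge0 ?mulr_ge0 ?cn_ge0 ?(ltW ir0) //.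
    by apply: le_trans (aG n) _; rewrite lerDr.
  rewrite lerXn2r ?nnegrE ?mulr_ge0 ?cn_ge0 ?(ltW ir0) ?(ltW rho0) //.
  by rewrite mulrC ler_pM2r // ltW.
have [h [eta hh]] := correctors oD bD DH r10 Dr1 flatO.
have [A [A0 [hA hs]]] :=
  outer_expansion oD bD DH r10 Dr1 clK KH Krho rr1 flatK G0 cg gG cP PG hh.
have [d [d0 hd]] : exists d : R, 0 < d /\ forall z, CS (closure Om') z -> d <= cn z.
  have : ~ cl (CS Om') 0.
    by rewrite CS_cl /CS /= => h0; apply: Om'_far; rewrite (_ : 0 = toV 0) //; apply: (can_inj (@toCK R)); rewrite toVK; apply: complex_eq; rewrite /= mxE.
  move=> nz; have [d d0 hd] : exists2 d : R, 0 < d & forall w, CS Om' w -> d <= cn w.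
    apply: contrapT => hn; apply: nz => d d0; apply: contrapT => hn'; apply: hn; exists d => // w Ow.
    by rewrite leNgt; apply/negP => wd; apply: hn'; exists w; rewrite ?subr0.
  exists d; split; first exact: d0.
  move=> z; rewrite -CS_cl => cz; apply: eps_le => t t0; have [w /hd dw wz] := cz t t0.
  by apply: le_trans dw _; have := cnBD w z; clear - wz; lra.
(* [Om'] has to stay beyond [2 * s], as the gradient estimate loses a factor 2 in the distance to 0;
   [s <= r1] is asked by the expansion. *)
pose s := Num.min (d / 2) r1; have s0 : 0 < s by rewrite lt_min divr2_gt0.
have sr1 : 0 < s <= r1 by rewrite s0 ge_min lexx orbT.
have s2 : 2 * s <= d by rewrite mulrC -ler_pdivlMr // ge_min lexx.
have [M [B [M0 B0 AB hconv]]] := hs s sr1.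
(* The bound on [A N] holds away from 0; the cut-off by zero makes it global and leaves the
   functions unchanged where they are used. *)
pose A' N z := if pselect (cl D z /\ s <= cn z) then A N z else 0.
have A'E N z : cl D z -> s <= cn z -> A' N z = A N z.
  by move=> cz sz; rewrite /A'; case: pselect => // -[].
have A'B N z : `|A' N z| <= B * M ^+ N.
  rewrite /A'; case: pselect => [[cz sz]|nn] /=; first exact: AB.
  by rewrite normr0 mulr_ge0 // exprn_ge0 // ltW.
have nz z : s < cn z -> z != 0 by move=> sz; rewrite -cn_gt0; exact: lt_trans sz.
have cA' N : cont (cl D `&` [set z | s < cn z]) (A' N).
  have [cA _ _] := hA N; apply: (cont_eq (u := A N)); first by move=> z [cz sz]; rewrite A'E // ltW.
  by apply: cont_sub cA => z [cz sz]; split => //; exact: nz.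
have os : opn [set z : R[i] | s < cn z].
  move=> z sz; exists (cn z - s); first by rewrite subr_gt0.
  by move=> w wz /=; have := cnBD z w; rewrite (cnB z w); clear - wz; lra.
have hA' N : harm (D `&` [set z | s < cn z]) (A' N).
  have [_ hAN _] := hA N; apply: (harm_eq (u := A N)); first exact: opnI.
    by move=> z [/sub_cl cz sz]; rewrite A'E // ltW.
  by apply: harm_sub hAN => z [].
have zA' N z : bd D z -> s < cn z -> A' N z = 0.
  by move=> bz sz; have [_ _ zA] := hA N; rewrite A'E ?zA ?nz ?(ltW sz) //; case: bz.
have subO z : CS Om' z -> D z by exact: Om'_sub.
have subcO z : CS (closure Om') z -> cl D z /\ 2 * s <= cn z.
  move=> cz; split; last exact: le_trans s2 (hd z cz).
  by rewrite /D CS_cl; exact: closure_subset Om'_sub _ cz.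
have ss2 : s <= 2 * s by clear - s0; lra.
have geoO' x0 : bd D x0 -> s < cn x0 -> exists nu, geo_bd alpha D C0 rg x0 nu by move=> /geoO.
have cu0' : C1a alpha Om' u0 := C1a_sub Om'_sub cu0.
have [eps' [epsa epsM heps]] := choose_eps ea0 M0 rho0 r10 s0.
have /andP[eps0 epsea] := epsa.
have inI (e : R) : - eps' < e < eps' -> `|e| < eps' by rewrite ltr_norml.
have epsM2 : eps' * M <= 1 / 2 by clear - epsM eps0 M0; have := mulr_gt0 eps0 M0; lra.
exists eps'; split => //.
  move=> e /inI /heps[_ _ _ er]; apply/seteqP; split => // x [hx ox].
  have zx : x = toV (toC x) by rewrite toCK.
  have sr z : E z -> cn z < rho by move=> /sub_cl; exact: Krho.
  have h1 : cn (toC x) <= `|e| * rho by apply: (hole_small sr); rewrite /CS /= toCK.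
  have [_ h2] : cl D (toC x) /\ 2 * s <= cn (toC x) by apply: subcO; rewrite /CS /= toCK.
  by have := lt_le_trans (le_lt_trans h1 er) h2; rewrite ltxx.
exists (fun t x => u0 x + powser A' (fun j => t ^+ j) (toC x)); split.
- exact: (powser_analytic halpha s0 B0 M0 oD bD cA' hA' zA' A'B subO subcO C00 rg0 geoO' cu0' eps0 epsM).
- move=> e /andP[ep elt] x ox; set z := toC x.
  have eabs : `|e| < eps' by rewrite gtr0_norm.
  have [eea eM er _] := heps e eabs; have he : 0 < e < eps_ad by rewrite ep.
  have [cD sz] : cl D z /\ 2 * s <= cn z by apply: subcO; rewrite /CS /= toCK.
  have sz' : s <= cn z := le_trans ss2 sz.
  (* The difference has zero outer datum, and on the hole its datum is [g] minus the Taylor series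
     of [U0], which equals [u0] on the half ball. *)
  pose v := fun w => u e (toV w) - u0 (toV w).
  have [_ hue be _] := hu e he.
  have oP : open (perforated Om p om e).
    by rewrite /perforated setDE; apply: openI => //; apply: closed_openC; exact: closed_closure.
  have subP : perf D K e `<=` D by move=> w [].
  have cv : cont (cl (perf D K e)) v.
    apply: contB; first exact: cue e he.
    apply: (cont_sub (cl_sub subP)); rewrite /D CS_cl; exact/within_cont/cu0.1.
  have hv : harm (perf D K e) v.
    apply: harmB; first by rewrite -perf_CS //; exact: harmonic_harm.
    by apply: (harm_sub subP); exact: harmonic_harm.
  have v0 w : bd (perf D K e) w -> ~ scaled K e w -> v w = 0.
    move=> bw nw; case: (bd_perf ep bw) => [[_ sw]|[/(CS_bd _ oOm) bw' _]] //.
    by rewrite /v be // bu0 // subrr.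
  have vK X : bd (~` K) X -> bd (perf D K e) (e%:C%C * X) ->
      tends (fun n => \sum_(k < n) e ^+ k * P k X) (g X - v (e%:C%C * X)).
    move=> bX _; have KX := bdKK _ bX; rewrite /v /g !onH // opprB addrC subrK.
    have eXr : cn (e%:C%C * X) < r.
      rewrite cnM cnR gtr0_norm //; apply: le_lt_trans er; rewrite ler_pM2l //.
      exact: ltW (Krho _ KX).
    rewrite -U0_ext; last first.
      apply: subset_closure; have : CS (@half_ball R r1) (e%:C%C * X); last exact: id.
      rewrite half_ball_CS; split; last by rewrite ImZ mulr_gt0 // KH.
      by apply: lt_trans eXr _; rewrite /r; clear - r10; lra.
    pose w := r^-1%:C%C * (e%:C%C * X).
    have w1 : cn w < 1.
      by rewrite cnM cnR gtr0_norm // mulrC ltr_pdivrMr // mul1r.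
    have := ha w w1; rewrite /= add0r.
    have -> : r%:C%C * w = e%:C%C * X by rewrite /w mulrA -rmorphM /= mulfV ?gt_eqF // mul1r.
    apply: tends_eq => n; apply: eq_bigr => k _; rewrite /P -ReZ; congr complex.Re.
    rewrite rmorphXn /= mulrCA -exprMn; congr (_ * _ ^+ _); rewrite /w; ring.
  have h1 := hconv e v ep eM cv hv v0 vK z cD sz'.
  have epow j : `|e ^+ j| <= 1 * e ^+ j by rewrite mul1r normrX gtr0_norm.
  have eMl : e * M <= 1 / 2 by apply: le_trans epsM2; rewrite ler_pM2r // ltW.
  have h2 := powser_tends M0 A'B z ler01 (ltW ep) eMl epow.
  have h3 : tends (fun n => \sum_(j < n) e ^+ j * A' j z) (v z).
    by apply: tends_eq h1 => n; apply: eq_bigr => j _; rewrite A'E.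
  rewrite -(tends_unique h3 h2) /v toCK; by rewrite addrC subrK.
move=> x ox; set z := toC x.
have [cD sz] : cl D z /\ 2 * s <= cn z by apply: subcO; rewrite /CS /= toCK.
suff -> : powser A' (fun j => 0 ^+ j) z = 0 by rewrite addr0.
(* At [e = 0] only the term of order 0 survives, as [0 ^ 0 = 1], and it vanishes because [A 0] is
   0. *)
apply: tends_ser; apply: tends_eq (tends_cst 0) => -[|n]; first by rewrite big_ord0.
rewrite big_ord_recl /= A'E ?(le_trans ss2) // A0 mulr0 big1 ?addr0 // => j _.
by rewrite /= exprS mul0r mul0r.
Qed.
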